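(* There exist constants $\gamma\in(0,1)$, $C_\sharp>0$ and $C_\flat>0$, all independent of $k$ and $\beta$, identified by the properties (a) $|||R_k(p,y)|||_{1,k}\le\gamma\,|||(p,y)|||_{1,k}$ for all $(p,y)\in V_k\times V_k$ whenever $k\ge1$ and $\beta^{1/2}h_k^{-2}<1$, (b) $\|R_k^{m_2}(Id_k-I_{k-1}^kP_k^{k-1})S_k^{m_1}\|\le C_\sharp\gamma^{m_1+m_2}$ for all integers $m_1,m_2\ge0$ whenever $k\ge1$ and $\beta^{1/2}h_k^{-2}<1$, (c) $\|R_k^{m_2}(Id_k-I_{k-1}^kP_k^{k-1})S_k^{m_1}\|\le C_\flat[\max(1,m_1)\max(1,m_2)]^{-1/2}$ for all integers $m_1,m_2\ge0$ whenever $k\ge1$ and $\beta^{1/2}h_k^{-2}\ge1$, for which the following holds. Let $k_*$ be the largest positive integer such that $\beta^{1/2}h_{k_*}^{-2}<1$. Then there exists a positive integer $m_*$, independent of $k$, such that for every integer $m\ge m_*$ the error propagation operators $E_k$ of the symmetric $W$-cycle algorithm (with $m_1=m_2=m$ smoothing steps) satisfy $$\|E_k\|\le 2C_\sharp\gamma^{2m}\qquad\text{for all }1\le k\le k_*,$$ $$\|E_k\|\le 2C_\flat m^{-1}+4^{1-2^{k-k_*}}\big(2C_\sharp\gamma^{2m}\big)\qquad\text{for all }k\ge k_*+1.$$ Here $\|\cdot\|$ is the operator norm with respect to $|||\cdot|||_{1,k}$.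
   Context: Let $d\in\{2,3\}$, let $\Omega\subset\mathbb{R}^d$ be a bounded convex polygonal (polyhedral if $d=3$) domain, let $\beta>0$, and let $(\cdot,\cdot)_{L_2(\Omega)}$ be the inner product of $L_2(\Omega)$ (or $[L_2(\Omega)]^d$). Define $\|v\|_{H^1_\beta(\Omega)}^2=\|v\|_{L_2(\Omega)}^2+\beta^{1/2}|v|_{H^1(\Omega)}^2$, where $|v|_{H^1(\Omega)}=\|\nabla v\|_{L_2(\Omega)}$, and $$\mathcal{B}((p,y),(q,z))=\beta^{1/2}(\nabla p,\nabla q)_{L_2(\Omega)}-(y,q)_{L_2(\Omega)}-(p,z)_{L_2(\Omega)}-\beta^{1/2}(\nabla y,\nabla z)_{L_2(\Omega)}.$$ Meshes. $\mathcal{T}_0$ is a fixed simplicial triangulation of $\Omega$, and $\mathcal{T}_1,\mathcal{T}_2,\dots$ are obtained by successive refinement, with mesh sizes $h_k=h_{k-1}/2$, uniformly shape regular and quasi-uniform. $V_k\subset H^1_0(\Omega)$ is the $P_1$ (continuous piecewise linear) finite element space on $\mathcal{T}_k$, so $V_{k-1}\subset V_k$. $\mathcal{V}_k$ is the set of interior vertices of $\mathcal{T}_k$. Inner products and operators. $(v,w)_k=h_k^d\sum_{x\in\mathcal{V}_k}v(x)w(x)$ for $v,w\in V_k$, and $[(p,y),(q,z)]_k=(p,q)_k+(y,z)_k$ on $V_k\times V_k$. The operator $\mathfrak{B}_k:V_k\times V_k\to V_k\times V_k$ is defined by $[\mathfrak{B}_k(p,y),(q,z)]_k=\mathcal{B}((p,y),(q,z))$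 for all $(p,y),(q,z)\in V_k\times V_k$. $L_k:V_k\to V_k$ is a linear operator, symmetric with respect to $(\cdot,\cdot)_k$, such that $c_1\|v\|_{H^1_\beta(\Omega)}^2\le(L_kv,v)_k\le c_2\|v\|_{H^1_\beta(\Omega)}^2$ for all $v\in V_k$, with $c_1,c_2>0$ independent of $k$ and $\beta$; $\mathfrak{C}_k(p,y)=(L_kp,L_ky)$. The operator $\mathfrak{B}_k\mathfrak{C}_k^{-1}\mathfrak{B}_k$ is symmetric positive definite with respect to $[\cdot,\cdot]_k$. Define $|||(p,y)|||_{s,k}=[(\mathfrak{B}_k\mathfrak{C}_k^{-1}\mathfrak{B}_k)^s(p,y),(p,y)]_k^{1/2}$. $I_{k-1}^k:V_{k-1}\times V_{k-1}\to V_k\times V_k$ is the natural injection; $I_k^{k-1}:V_k\times V_k\to V_{k-1}\times V_{k-1}$ is its transpose: $[I_k^{k-1}(p,y),(q,z)]_{k-1}=[(p,y),I_{k-1}^k(q,z)]_k$; $P_k^{k-1}:V_k\times V_k\to V_{k-1}\times V_{k-1}$ is the Ritz projection: $\mathcal{B}(P_k^{k-1}(p,y),(q,z))=\mathcal{B}((p,y),I_{k-1}^k(q,z))$ for all $(q,z)\in V_{k-1}\times V_{k-1}$. $Id_k$ is the identity on $V_k\times V_k$. Damping factor. $\lambda_k=2/[\lambda_{\min}(\mathfrak{B}_k\mathfrak{C}_k^{-1}\mathfrak{B}_k)+\lambda_{\max}(\mathfrak{B}_k\mathfrak{C}_k^{-1}\mathfrak{B}_k)]$ if $\beta^{1/2}h_k^{-2}<1$,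 and $\lambda_k=[C_\dag(1+\beta^{1/2}h_k^{-2})]^{-1}$ if $\beta^{1/2}h_k^{-2}\ge1$, where $C_\dag$ is a fixed constant, independent of $k$ and $\beta$, such that $\lambda_{\max}(\mathfrak{B}_k\mathfrak{C}_k^{-1}\mathfrak{B}_k)\le C_\dag(1+\beta^{1/2}h_k^{-2})$ for all $k$ and $\beta$. Set $R_k=Id_k-\lambda_k\mathfrak{B}_k\mathfrak{C}_k^{-1}\mathfrak{B}_k$ and $S_k=Id_k-\lambda_k\mathfrak{C}_k^{-1}\mathfrak{B}_k^2$. $W$-cycle algorithm for $\mathfrak{B}_k(p,y)=(f,g)$, with initial guess $(p_0,y_0)$, $m_1$ pre-smoothing and $m_2$ post-smoothing steps; output $MG_W(k,(f,g),(p_0,y_0),m_1,m_2)$. For $k=0$ the output is $\mathfrak{B}_0^{-1}(f,g)$. For $k\ge1$: (1) for $1\le j\le m_1$, $(p_j,y_j)=(p_{j-1},y_{j-1})+\lambda_k\mathfrak{C}_k^{-1}\mathfrak{B}_k((f,g)-\mathfrak{B}_k(p_{j-1},y_{j-1}))$; (2) with $(f',g')=I_k^{k-1}((f,g)-\mathfrak{B}_k(p_{m_1},y_{m_1}))$, compute $(p_1',y_1')=MG_W(k-1,(f',g'),(0,0),m_1,m_2)$ and $(p_2',y_2')=MG_W(k-1,(f',g'),(p_1',y_1'),m_1,m_2)$, and set $(p_{m_1+1},y_{m_1+1})=(p_{m_1},y_{m_1})+I_{k-1}^k(p_2',y_2')$; (3) for $m_1+2\le j\le m_1+m_2+1$,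 $(p_j,y_j)=(p_{j-1},y_{j-1})+\lambda_k\mathfrak{B}_k\mathfrak{C}_k^{-1}((f,g)-\mathfrak{B}_k(p_{j-1},y_{j-1}))$; the output is $(p_{m_1+m_2+1},y_{m_1+m_2+1})$. The error propagation operator $E_k:V_k\times V_k\to V_k\times V_k$ is the linear operator mapping the initial error $(p,y)-(p_0,y_0)$ to the final error $(p,y)-MG_W(k,(f,g),(p_0,y_0),m_1,m_2)$, where $(p,y)=\mathfrak{B}_k^{-1}(f,g)$. The symmetric algorithm has $m_1=m_2=m\ge1$. ''Independent of $k$ and $\beta$'' means that constants may depend only on $\Omega$, the family of triangulations (through shape regularity and quasi-uniformity), $c_1,c_2$ and $C_\dag$. *)

(* Defs.v *)
From HB Require Import structures.
From mathcomp Require Import all_boot all_order all_algebra.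
From mathcomp Require Import all_classical all_reals all_analysis.

Set Implicit Arguments.
Unset Strict Implicit.
Unset Printing Implicit Defensive.

Import Order.TTheory GRing.Theory Num.Theory.
Import numFieldNormedType.Exports.

Local Open Scope classical_set_scope.
Local Open Scope ring_scope.

Section EuclideanSpace.
Variable R : realType.

Definition dotp d (x y : 'rV[R]_d) : R := \sum_i x 0 i * y 0 i.

(* The library norm on 'rV[R]_d is the sup norm; diameters and balls below
   are Euclidean. *)
Definition enorm d (x : 'rV[R]_d) : R := Num.sqrt (dotp x x).

(* The library has no Lebesgue measure on 'rV[R]_d: R^d is first realised as
   the measurable type R * (R * (... * unit)), which carries the product of d
   copies of the Lebesgue measure on R. *)
Fixpoint prodR_display (d : nat) : measure_display :=
  if d is d'.+1 then
    measure_prod_display (R.-ocitv.-measurable.-sigma%mdisp, prodR_display d')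
  else default_measure_display.

Fixpoint prodR (d : nat) : measurableType (prodR_display d) :=
  match d with
  | 0 => unit
  | d'.+1 => (measurableTypeR R * prodR d')%type
  end.

Fixpoint lebesgue_prodR (d : nat) : set (prodR d) -> \bar R :=
  match d with
  | 0 => \d_tt
  | d'.+1 => (@lebesgue_measure R \x @lebesgue_prodR d')%E
  end.

Fixpoint rV_of_prodR (d : nat) : prodR d -> 'rV[R]_d :=
  match d with
  | 0 => fun=> 0
  | d'.+1 => fun x => row_mx (x.1)%:M (rV_of_prodR x.2) : 'rV[R]_(1 + d')
  end.

Definition integral_Rd d (D : set 'rV[R]_d) (f : 'rV[R]_d -> R) : R :=
  fine (\int[@lebesgue_prodR d]_(x in @rV_of_prodR d @^-1` D)
          (f (rV_of_prodR x))%:E)%E.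

(* A bounded nonempty finite intersection of open half-spaces: a bounded convex
   polygonal (d = 2) or polyhedral (d = 3) domain. *)
Definition convex_polytopal_domain d (Omega : set 'rV[R]_d) : Prop :=
  [/\ Omega !=set0, bounded_set Omega &
      exists H : seq ('rV[R]_d * R),
        Omega = [set x | forall h, h \in H -> dotp h.1 x < h.2]].

End EuclideanSpace.

Section Triangulations.
Variables (R : realType) (d : nat).
Implicit Types (Omega : set 'rV[R]_d) (T : 'M[R]_(d.+1, d)).
Implicit Types (M : seq 'M[R]_(d.+1, d)).

(* A simplex is given by the (d+1) x d matrix whose rows are its vertices.
   face T J is the convex hull of the rows with index in J; it is empty when
   J is. *)
Definition face T (J : {set 'I_d.+1}) : set 'rV[R]_d :=
  [set x | exists b : 'rV[R]_d.+1,
    [/\ forall i, 0 <= b 0 i, forall i, i \notin J -> b 0 i = 0,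
        \sum_i b 0 i = 1 & x = b *m T]].

Definition simplex T : set 'rV[R]_d := face T [set: 'I_d.+1].

Definition affinely_independent T : Prop :=
  row_free (row_mx T (const_mx 1 : 'cV[R]_d.+1)).

Definition triangulation Omega M : Prop :=
  [/\ forall T, T \in M -> affinely_independent T,
      forall T T', T \in M -> T' \in M -> simplex T = simplex T' -> T = T',
      [set x | exists2 T, T \in M & simplex T x] = closure Omega &
      forall T T', T \in M -> T' \in M ->
        exists J J', simplex T `&` simplex T' = face T J /\ face T J = face T' J'].

Definition diameter (A : set 'rV[R]_d) : R :=
  sup [set r | exists x y, [/\ A x, A y & r = enorm (x - y)]].

Definition mesh_size M : R := \big[Num.max/0]_(T <- M) diameter (simplex T).

Definition shape_regular (sigma : R) M : Prop :=
  forall T, T \in M -> exists c r,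
    [/\ 0 < r, [set x | enorm (x - c) <= r] `<=` simplex T &
        diameter (simplex T) <= sigma * r].

Definition quasi_uniform (kappa : R) M : Prop :=
  forall T, T \in M -> mesh_size M <= kappa * diameter (simplex T).

Definition refines M' M : Prop :=
  forall T', T' \in M' -> exists2 T, T \in M & simplex T' `<=` simplex T.

(* The shape regularity and quasi-uniformity constants are parameters, so that
   estimates can be uniform over all families sharing them. *)
Record mesh_family Omega (sigma kappa : R) := MeshFamily {
  mesh :> nat -> seq 'M[R]_(d.+1, d);
  mesh_triangulation : forall k, triangulation Omega (mesh k);
  mesh_refines : forall k, refines (mesh k.+1) (mesh k);
  mesh_halving : forall k, mesh_size (mesh k.+1) = mesh_size (mesh k) / 2;
  mesh_shape_regular : forall k, shape_regular sigma (mesh k);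
  mesh_quasi_uniform : forall k, quasi_uniform kappa (mesh k)
}.

(* P1 finite element functions are extended by zero outside Omega, so that
   membership in H^1_0(Omega) amounts to vanishing off Omega. *)
Definition P1_pred Omega M : {pred 'rV[R]_d -> R} := fun v =>
  `[< [/\ continuous v, forall x, ~ Omega x -> v x = 0 &
      forall T, T \in M ->
        exists a c, forall x, simplex T x -> v x = dotp a x + c] >].

Lemma P1_pred_submod Omega M : submod_closed (P1_pred Omega M).
Proof.
split=> [|s u v /asboolP[cu zu au] /asboolP[cv zv av]]; apply/asboolP; split.
- by move=> x; exact: cst_continuous.
- by [].
- move=> T _; exists 0, 0 => x _; rewrite addr0 /dotp big1// => i _.
  by rewrite mxE mul0r.
- move=> x; apply: continuousD; last exact: cv.
  by apply: continuousZl_tmp; exact: cu.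
- move=> x nx; rewrite -[LHS]/(s *: u x + v x) zu// zv//.
  by rewrite scaler0 addr0.
- move=> T TM; have [a [c Hu]] := au _ TM; have [a' [c' Hv]] := av _ TM.
  exists (s *: a + a'), (s * c + c') => x Tx.
  rewrite -[LHS]/(s * u x + v x) Hu// Hv//.
  rewrite mulrDr addrACA; congr (_ + _); rewrite /dotp mulr_sumr -big_split/=.
  by apply: eq_bigr => i _; rewrite !mxE mulrDl mulrA.
Qed.

HB.instance Definition _ Omega M :=
  GRing.isSubmodClosed.Build R ('rV[R]_d -> R) (P1_pred Omega M)
    (P1_pred_submod Omega M).

Record P1 Omega M := MkP1 {
  P1_fun :> 'rV[R]_d -> R;
  P1_funP : P1_fun \in P1_pred Omega M
}.

HB.instance Definition _ Omega M := [isSub for @P1_fun Omega M].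
HB.instance Definition _ Omega M := [Choice of P1 Omega M by <:].
HB.instance Definition _ Omega M :=
  [SubChoice_isSubLmodule of P1 Omega M by <:].

Lemma P1_nested Omega M M' (v : P1 Omega M) :
  refines M' M -> (v : 'rV[R]_d -> R) \in P1_pred Omega M'.
Proof.
move=> ref; have /asboolP[cv zv av] := P1_funP v; apply/asboolP; split=> //.
move=> T' /ref[T TM sub]; have [a [c H]] := av _ TM.
by exists a, c => x /sub /H.
Qed.

Definition interior_vertices Omega M : seq 'rV[R]_d :=
  [seq x <- undup [seq row i T | T <- M, i <- enum 'I_d.+1] | `[< Omega x >]].

End Triangulations.

Section OperatorNotions.
Variable R : realType.

Definition is_eigenvalue (V : lmodType R) (A : V -> V) (l : R) : Prop :=
  exists2 x, x != 0 & A x = l *: x.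

(* Only used for symmetric operators in finite dimension, whose eigenvalues are
   real and finitely many. *)
Definition lambda_min (V : lmodType R) (A : V -> V) : R :=
  inf [set l | is_eigenvalue A l].
Definition lambda_max (V : lmodType R) (A : V -> V) : R :=
  sup [set l | is_eigenvalue A l].

(* Values in \bar R, so that the supremum is never a default value. *)
Definition opnorm (V : lmodType R) (nrm : V -> R) (A : V -> V) : \bar R :=
  ereal_sup [set (nrm (A x))%:E | x in [set x | nrm x <= 1]].

Definition op_inv (V : lmodType R) (A : V -> V) (y : V) : V :=
  xget 0 [set x | A x = y].

End OperatorNotions.

Section Multigrid.
Variables (R : realType) (d : nat) (Omega : set 'rV[R]_d) (sigma kappa : R).
Variable F : mesh_family Omega sigma kappa.

Definition fespace (k : nat) := P1 Omega (F k).
Definition fespace2 (k : nat) : lmodType R := (fespace k * fespace k)%type.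

Definition hmesh (k : nat) : R := mesh_size (F k).

Definition L2ip (v w : 'rV[R]_d -> R) : R :=
  integral_Rd Omega (fun x => v x * w x).

(* For piecewise linear functions the classical partial derivatives exist
   almost everywhere and are the weak ones. *)
Definition gradL2ip (v w : 'rV[R]_d -> R) : R :=
  integral_Rd Omega (fun x => \sum_(i < d)
    'D_(delta_mx 0 i) v x * 'D_(delta_mx 0 i) w x).

Definition ip (k : nat) (v w : fespace k) : R :=
  hmesh k ^+ d * \sum_(x <- interior_vertices Omega (F k)) v x * w x.

Definition ip2 (k : nat) (x y : fespace2 k) : R := ip x.1 y.1 + ip x.2 y.2.

Definition injection (k : nat) (v : fespace k) : fespace k.+1 :=
  MkP1 (P1_nested v (@mesh_refines _ _ _ _ _ F k)).

Definition coarse_to_fine (k : nat) (x : fespace2 k) : fespace2 k.+1 :=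
  (injection x.1, injection x.2).

(* Here and in Bop, ritz and op_inv, the operator is defined by its
   characteristic equation; its solution is unique by nondegeneracy in finite
   dimension, so that the default value 0 of xget is not used. *)
Definition fine_to_coarse (k : nat) (x : fespace2 k.+1) : fespace2 k :=
  xget 0 [set y | forall z, ip2 y z = ip2 x (coarse_to_fine z)].

Variable beta : R.

Definition H1beta_sqr (v : 'rV[R]_d -> R) : R :=
  L2ip v v + Num.sqrt beta * gradL2ip v v.

Definition Bform (k : nat) (x y : fespace2 k) : R :=
  Num.sqrt beta * gradL2ip x.1 y.1 - L2ip x.2 y.1 - L2ip x.1 y.2
  - Num.sqrt beta * gradL2ip x.2 y.2.

Definition Bop (k : nat) (x : fespace2 k) : fespace2 k :=
  xget 0 [set y | forall z, ip2 y z = Bform x z].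

Definition ritz (k : nat) (x : fespace2 k.+1) : fespace2 k :=
  xget 0 [set y | forall z, Bform y z = Bform x (coarse_to_fine z)].

Variable L : forall k, fespace k -> fespace k.

Definition Cop (k : nat) (x : fespace2 k) : fespace2 k := (L x.1, L x.2).

Definition BCB (k : nat) (x : fespace2 k) : fespace2 k :=
  Bop (op_inv (@Cop k) (Bop x)).

Definition tnorm (s k : nat) (x : fespace2 k) : R :=
  Num.sqrt (ip2 (iter s (@BCB k) x) x).

Variable Cdag : R.

Definition damping (k : nat) : R :=
  if Num.sqrt beta * hmesh k ^- 2 < 1
  then 2 / (lambda_min (@BCB k) + lambda_max (@BCB k))
  else (Cdag * (1 + Num.sqrt beta * hmesh k ^- 2))^-1.

Definition Rop (k : nat) (x : fespace2 k) : fespace2 k := x - damping k *: BCB x.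

Definition Sop (k : nat) (x : fespace2 k) : fespace2 k :=
  x - damping k *: op_inv (@Cop k) (Bop (Bop x)).

Definition pre_smooth (k : nat) (f x : fespace2 k) : fespace2 k :=
  x + damping k *: op_inv (@Cop k) (Bop (f - Bop x)).

Definition post_smooth (k : nat) (f x : fespace2 k) : fespace2 k :=
  x + damping k *: Bop (op_inv (@Cop k) (f - Bop x)).

Fixpoint MG_W (m1 m2 k : nat) : fespace2 k -> fespace2 k -> fespace2 k :=
  match k with
  | 0 => fun f _ => op_inv (@Bop 0) f
  | k'.+1 => fun f x0 =>
      let x := iter m1 (pre_smooth f) x0 in
      let f' := fine_to_coarse (f - Bop x) in
      let x' := MG_W m1 m2 f' (MG_W m1 m2 f' 0) in
      iter m2 (post_smooth f) (x + coarse_to_fine x')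
  end.

(* The solution x = Bop^-1 f and the initial guess x0 are arbitrary, so a linear
   E with this property is unique. *)
Definition is_error_propagation (m1 m2 k : nat)
    (E : fespace2 k -> fespace2 k) : Prop :=
  forall f x0, let x := op_inv (@Bop k) f in
    E (x - x0) = x - MG_W m1 m2 f x0.

(* R_k^m2 (Id - I_{k-1}^k P_k^{k-1}) S_k^m1 *)
Definition two_grid (m1 m2 k : nat) (x : fespace2 k.+1) : fespace2 k.+1 :=
  let x' := iter m1 (@Sop k.+1) x in
  iter m2 (@Rop k.+1) (x' - coarse_to_fine (ritz x')).

End Multigrid.

(* Main.v *)
Require Import Defs.
From HB Require Import structures.
From mathcomp Require Import all_boot all_order all_algebra.
From mathcomp Require Import all_classical all_reals all_analysis.
From mathcomp Require Import measurable_realfun.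
From mathcomp Require Import zify ring lra.

Set Implicit Arguments.
Unset Strict Implicit.
Unset Printing Implicit Defensive.

Import Order.TTheory GRing.Theory Num.Theory.
Import numFieldNormedType.Exports.

Local Open Scope classical_set_scope.
Local Open Scope ring_scope.


(** The form pairs x = (p, y) with the flipped pair (p - y, - (p + y)) to the
    energy, the sum of the squared norms of p and y in H^1_beta.  All the
    estimates are therefore made in the energy: the Ritz projection is bounded
    although the form is indefinite, and the first mesh-dependent norm is
    equivalent to the energy norm with constants that depend on c1 and c2 only
    (normal_op_upper and normal_op_lower).  The two smoothers are adjoint with
    respect to the form (pre_post), so a bound for the post-smoother on errors
    without coarse component also gives a bound for the pre-smoother, and
    two_level_bound multiplies the two rates.

    On the levels with beta^(1/2) h^-2 < 1, inverse estimates make the operator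
    well conditioned, uniformly, and each smoothing step contracts by a fixed
    factor gamma (well_conditioned_contraction).  On the finer levels the rate
    of m steps comes from a telescoping sum of energies (smoothing) as soon as
    an error z without coarse component satisfies an approximation property,
    that is, its squared L2 norm is at most a constant times h^2 beta^(-1/2)
    times its energy.  A duality argument (pair_duality) reduces this to the
    Poisson problem: a finite element function e orthogonal in the energy to the
    coarse space satisfies |e|_L2 <= C h |e|_H1 (poisson_ap).

    The property poisson_ap rests on the convexity of the domain, through a
    solution of the Dirichlet problem whose Hessian is bounded in L2 by the
    right-hand side.  Only approximate solutions with arbitrarily small errors
    are needed for this, and they are constructed by elementary means: the usual
    second order difference scheme is solved on a slightly larger polytope, by
    an order-theoretic fixed point (dirichlet_exists); barriers give Lipschitz
    and tangential estimates that are uniform in the step; iterated averages in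
    the coordinate directions, of fixed length, turn an ultrafilter limit of the
    discrete solutions into a smooth function that nearly solves the equation
    (smooth_solution).  The Hessian estimate (regularity) follows from the
    Bochner identity, integrated against a concave smooth approximation of the
    distance to the boundary: the Hessian of a concave weight has the favourable
    sign, and the layer where the cut-off near the boundary spoils the concavity
    is harmless, because near a single face the gradient of the solution is
    almost normal and because neighbourhoods of the edges have a small volume.

    The transition to finite elements uses inscribed cubes and translations
    instead of scaling to a reference simplex: slope_bound controls the gradient
    on a simplex by the values in a cube inside it, and fe_lower, fe_inverse and
    fe_upper follow.  The interpolation error (rest_integral, gradient_error) is
    a discrete Taylor expansion towards the vertices, integrated by means of
    homotheties of the simplex; this is where the dimension has to be at most
    three.

    For the W-cycle, the error operator on a level is the two-grid operator plus
    a correction in which the coarse error operator is applied twice, so that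
    the norms satisfy e_(k+1) <= T_(k+1) + K e_k^2 (wcycle_error_bound).  Since
    the two-grid norms T become small when m grows, twice the two-grid bound is
    preserved (wcycle_recursion); above the level kstar only the bound inherited
    from the coarse levels has to be followed, and its repeated squaring
    produces the factor 4 ^ (1 - 2 ^ (k - kstar)). *)


(** * Integration of test functions on row vectors *)

Section ProductSigmaFinite.
Variables (R : realType) (d1 d2 : measure_display).
Variables (T1 : measurableType d1) (T2 : measurableType d2).
Variable m1 : {sigma_finite_measure set T1 -> \bar R}.
Variable m2 : {sigma_finite_measure set T2 -> \bar R}.
Let p : {measure set (T1 * T2)%type -> \bar R} := product_measure1 m1 m2.

(** Bundling the sigma-finiteness of the product measure lets the product be
    iterated and gives access to the theory of the integral. *)
Lemma product_measure1_sigma_finite : sigma_finite setT p.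
Proof.
have /sigma_finiteP[F [TF ndF Foo]] := sigma_finiteT m1.
have /sigma_finiteP[G [TG ndG Goo]] := sigma_finiteT m2.
exists (fun n => F n `*` G n).
  rewrite -setXTT TF TG predeqE => -[x y]; split.
    move=> [/= [n _ Fnx] [k _ Gky]]; exists (maxn n k) => //; split.
    - by move: x Fnx; exact/subsetPset/ndF/leq_maxl.
    - by move: y Gky; exact/subsetPset/ndG/leq_maxr.
  by move=> [n _ []/= ? ?]; split; exists n.
move=> k; have [? ?] := Foo k; have [? ?] := Goo k.
split; first exact: measurableX.
change ((m1 \x m2) (F k `*` G k) < +oo)%E.
by rewrite product_measure1E// lte_mul_pinfty// ge0_fin_numE.
Qed.

Definition product_sigma_finite :
    {sigma_finite_measure set (T1 * T2)%type -> \bar R} :=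
  HB.pack (product_measure1 m1 m2)
    (Measure_isSigmaFinite.Build _ _ _ p product_measure1_sigma_finite).

End ProductSigmaFinite.

Section LebesgueProduct.
Variable R : realType.

(** The measure lebesgue_prodR as a bundled sigma-finite measure. *)
Fixpoint leb (d : nat) : {sigma_finite_measure set (prodR R d) -> \bar R} :=
  match d return {sigma_finite_measure set (prodR R d) -> \bar R} with
  | 0 => @dirac _ (prodR R 0) tt R : {measure set _ -> \bar R}
  | d'.+1 => product_sigma_finite (@lebesgue_measure R) (leb d')
  end.

Lemma lebE d : @lebesgue_prodR R d = leb d :> (set _ -> _).
Proof. by elim: d => [//|d IH] /=; rewrite IH. Qed.

Local Notation rV := (@rV_of_prodR R _).

Lemma rV_of_prodR0 d (x : prodR R d.+1) : rV x 0 0 = x.1.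
Proof.
transitivity ((row_mx (x.1)%:M (rV x.2) : 'rV[R]_(1 + d)) 0 (lshift d 0)).
  by congr (_ _ _); apply: val_inj.
by rewrite row_mxEl mxE.
Qed.

Lemma rV_of_prodRS d (x : prodR R d.+1) (i : 'I_d) :
  rV x 0 (lift 0 i) = rV x.2 0 i.
Proof.
transitivity ((row_mx (x.1)%:M (rV x.2) : 'rV[R]_(1 + d)) 0 (rshift 1 i)).
  by congr (_ _ _); apply: val_inj.
by rewrite row_mxEr.
Qed.

Fixpoint prodR_of_rV (d : nat) : 'rV[R]_d -> prodR R d :=
  match d with
  | 0 => fun=> tt
  | d'.+1 => fun v => (v 0 0, prodR_of_rV (\row_i v 0 (lift 0 i)))
  end.

Lemma measurable_rV_coord d (i : 'I_d) :
  measurable_fun setT (fun x : prodR R d => rV x 0 i : measurableTypeR R).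
Proof.
elim: d i => [[]//|d IH] i; case: (unliftP 0 i) => [j ->|->].
  under eq_fun do rewrite rV_of_prodRS.
  apply: (measurableT_comp (IH j)); exact: measurable_snd.
under eq_fun do rewrite rV_of_prodR0.
exact: measurable_fst.
Qed.

Fixpoint prodR_affine (d : nat) (c : R) (v : nat -> R) : prodR R d -> prodR R d :=
  match d with
  | 0 => id
  | d'.+1 => fun x => (c * x.1 + v 0%N, prodR_affine c (v \o S) x.2)
  end.

Lemma rV_prodR_affine d (c : R) (v : nat -> R) (x : prodR R d) :
  rV (prodR_affine c v x) = c *: rV x + \row_i v i.
Proof.
elim: d v x => [|d IH] v x; first by apply/rowP => -[].
apply/rowP => i; case: (unliftP 0 i) => [j ->|->].
  rewrite rV_of_prodRS (_ : (prodR_affine c v x).2 = prodR_affine c (v \o S) x.2)//.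
  by rewrite IH [LHS]mxE [X in X + _]mxE [RHS]mxE [X in _ = X + _]mxE rV_of_prodRS !mxE.
by rewrite rV_of_prodR0 [RHS]mxE [X in _ = X + _]mxE rV_of_prodR0 mxE.
Qed.

Lemma measurable_affine1 (c v : R) :
  measurable_fun setT (fun x : measurableTypeR R => c * x + v : measurableTypeR R).
Proof.
by apply: measurable_realfun.measurable_funD => //; apply: measurable_realfun.measurable_funM.
Qed.

Lemma measurable_prodR_affine d (c : R) (v : nat -> R) :
  measurable_fun setT (@prodR_affine d c v).
Proof.
elim: d v => [|d IH] v //=; apply/measurable_fun_pairP; split => /=.
  apply: (measurableT_comp (measurable_affine1 c (v 0%N))); exact: measurable_fst.
apply: (measurableT_comp (IH (v \o S))); exact: measurable_snd.
Qed.

Lemma lebesgue_affine1 (c v : R) (A : set (measurableTypeR R)) : 0 < c ->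
  measurable A ->
  (@lebesgue_measure R A =
   c%:E * lebesgue_measure ((fun x => (c * x + v)%R) @^-1` A))%E.
Proof.
move=> c0 mA.
pose phi (x : measurableTypeR R) : measurableTypeR R := c * x + v.
have mphi : measurable_fun setT phi by exact: measurable_affine1.
pose p : {measure set (measurableTypeR R) -> \bar R} :=
  measure_function_pushforward__canonical__measure_function_Measure
    (@lebesgue_measure R) mphi.
apply: (@lebesgue_measure_unique R (mscale (NngNum (ltW c0)) p)) => // _ [[a b]] _ <-.
transitivity (c%:E * lebesgue_measure (phi @^-1` `]a, b]))%E; last by [].
rewrite (_ : phi @^-1` _ = `](a - v) / c, (b - v) / c]%classic); last first.
  apply/seteqP; split => x /=; rewrite !in_itv/= /phi => /andP[h1 h2]; apply/andP; split.
  - by rewrite ltr_pdivrMr// ltrBlDr mulrC.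
  - by rewrite ler_pdivlMr// lerBrDr mulrC.
  - by move: h1; rewrite ltr_pdivrMr// ltrBlDr mulrC.
  - by move: h2; rewrite ler_pdivlMr// lerBrDr mulrC.
rewrite !lebesgue_measure_itv/= !lte_fin ltr_pM2r ?invr_gt0// ltrD2r.
case: ifPn => ab; last by rewrite mule0.
rewrite !EFinN -!EFinB -EFinM; congr (_%:E); field; exact: lt0r_neq0.
Qed.

(** It suffices to compare the scaled pushforward with the measure itself on
    rectangles, and the induction on the dimension reduces these to the line. *)
Lemma leb_affine d (c : R) (v : nat -> R) (A : set (prodR R d)) : 0 < c ->
  measurable A ->
  (leb d A = (c ^+ d)%:E * leb d (prodR_affine c v @^-1` A))%E.
Proof.
move=> c0; elim: d v A => [|d IH] v A mA; first by rewrite expr0 mul1e.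
pose phi := @prodR_affine d.+1 c v.
have mphi : measurable_fun setT phi by exact: measurable_prodR_affine.
pose p : {measure set (prodR R d.+1) -> \bar R} :=
  measure_function_pushforward__canonical__measure_function_Measure
    (leb d.+1) mphi.
apply: (@product_measure_unique _ _ _ _ _ (@lebesgue_measure R) (leb d)
  (mscale (NngNum (exprn_ge0 d.+1 (ltW c0))) p)) => //.
move=> B C mB mC.
transitivity ((c ^+ d.+1)%:E * leb d.+1 (phi @^-1` (B `*` C)))%E; first by [].
rewrite (_ : phi @^-1` _ = ((fun x => c * x + v 0%N) @^-1` B) `*`
                         (prodR_affine c (v \o S) @^-1` C)) //.
rewrite (_ : leb d.+1 = (@lebesgue_measure R \x leb d)%E :> (set _ -> _))//.
rewrite product_measure1E; last 2 first.
- by rewrite -[X in measurable X]setTI; exact: measurable_affine1.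
- by rewrite -[X in measurable X]setTI; exact: measurable_prodR_affine.
change ((c ^+ d.+1)%:E *
  (@lebesgue_measure R ((fun x : R => (c * x + v 0%N)%R) @^-1` B) *
   leb d (prodR_affine c (v \o S) @^-1` C)) = @lebesgue_measure R B * leb d C)%E.
rewrite (lebesgue_affine1 (v 0%N) c0 mB) (IH (v \o S) _ mC) exprS EFinM.
by rewrite !muleA; congr (_ * _)%E; rewrite -!muleA; congr (_ * _)%E; rewrite muleC.
Qed.


Definition cube d (c : 'rV[R]_d) (r : R) : set 'rV[R]_d :=
  [set x | forall i, `|x 0 i - c 0 i| < r].

Lemma cube_prodR d (c : 'rV[R]_d.+1) (r : R) :
  @rV_of_prodR R d.+1 @^-1` cube c r =
  (`](c 0 0 - r), (c 0 0 + r)[%classic : set (measurableTypeR R))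
    `*` (@rV_of_prodR R d @^-1` cube (\row_i c 0 (lift 0 i)) r).
Proof.
apply/seteqP; split => x /=.
  move=> h; split.
    by move: (h 0); rewrite rV_of_prodR0 in_itv/= ltr_distl.
  by move=> i; move: (h (lift 0 i)); rewrite rV_of_prodRS mxE.
case=> h1 h2 i; case: (unliftP 0 i) => [j ->|->].
  by move: (h2 j); rewrite rV_of_prodRS mxE.
by rewrite rV_of_prodR0; move: h1; rewrite in_itv/= ltr_distl.
Qed.

Lemma measurable_cube d (c : 'rV[R]_d) (r : R) :
  measurable (@rV_of_prodR R d @^-1` cube c r).
Proof.
elim: d c => [|d IH] c.
  by rewrite (_ : _ @^-1` _ = setT)//; apply/seteqP; split => // x _ [].
by rewrite cube_prodR; apply: measurableX.
Qed.

Lemma leb_cube d (c : 'rV[R]_d) (r : R) : 0 < r ->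
  leb d (@rV_of_prodR R d @^-1` cube c r) = ((2 * r) ^+ d)%:E.
Proof.
move=> r0; elim: d c => [|d IH] c.
  rewrite (_ : _ @^-1` _ = setT); last by apply/seteqP; split => // x _ [].
  by rewrite expr0; apply: diracT.
rewrite cube_prodR (_ : leb d.+1 = (@lebesgue_measure R \x leb d)%E :> (set _ -> _))//.
rewrite product_measure1E//; last exact: measurable_cube.
rewrite IH; change (@lebesgue_measure R `](c 0 0 - r)%R, (c 0 0 + r)%R[%classic *
  ((2 * r) ^+ d)%:E = ((2 * r) ^+ d.+1)%:E)%E.
rewrite lebesgue_measure_itv/= lte_fin ifT; last by lra.
by rewrite -EFinD -EFinM exprS; congr (_%:E); ring.
Qed.

(** Functions of row vectors are measured and integrated through their values
    on the iterated product. *)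
Definition mfun_rV d (g : 'rV[R]_d -> R) : Prop :=
  measurable_fun setT (g \o @rV_of_prodR R d : _ -> measurableTypeR R).

(** Test functions are bounded with bounded support, so that every integral
    below is finite and linearity holds without integrability conditions. *)
Definition adm d (g : 'rV[R]_d -> R) : Prop :=
  mfun_rV g /\ exists B, forall x, `|g x| <= B /\ (g x <> 0 -> cube 0 B x).

Definition mset_rV d (A : set 'rV[R]_d) : Prop :=
  measurable (@rV_of_prodR R d @^-1` A).

Definition J d (g : 'rV[R]_d -> R) : R :=
  Rintegral (leb d) setT (g \o @rV_of_prodR R d).

Lemma cube_le d (c : 'rV[R]_d) r s : r <= s -> cube c r `<=` cube c s.
Proof. by move=> rs x h i; exact: lt_le_trans (h i) rs. Qed.

Lemma adm_pos d (g : 'rV[R]_d -> R) : adm g ->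
  exists2 B, 0 < B & forall x, `|g x| <= B /\ (g x <> 0 -> cube 0 B x).
Proof.
case=> _ [B hB]; exists (`|B| + 1); first by rewrite ltr_pwDr.
move=> x; have [h1 h2] := hB x; have BB : B <= `|B| + 1.
  by rewrite (le_trans (ler_norm _))// lerDl.
by split; [exact: le_trans BB | move/h2; exact: cube_le].
Qed.

Lemma adm_integrable d (g : 'rV[R]_d -> R) : adm g ->
  (leb d).-integrable setT (EFin \o (g \o @rV_of_prodR R d)).
Proof.
move=> ag; have [B B0 hB] := adm_pos ag; case: ag => mg _.
pose C := @rV_of_prodR R d @^-1` cube 0 B.
have mC : measurable C by exact: measurable_cube.
apply: (@le_integrable _ _ _ _ _ measurableT _ (fun x => (B * \1_C x)%:E)).
- exact/measurable_EFinP.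
- move=> x _ /=; rewrite lee_fin; have [h1 h2] := hB (rV_of_prodR x).
  rewrite indicE; case: (pselect (C x)) => Cx.
    by rewrite mem_set// mulr1 (le_trans h1)// ler_norm.
  rewrite memNset// mulr0 normr0 normr_le0; apply/eqP; apply: contrapT => h.
  by apply: Cx; exact: h2.
under eq_fun do rewrite EFinM.
apply: integrableZl => //; apply/integrableP; split.
  by apply/measurable_EFinP; exact: measurable_indic.
under eq_integral do rewrite gee0_abs ?lee_fin//.
have CE : leb d C = ((2 * B) ^+ d)%:E by exact: leb_cube.
have iE : (\int[leb d]_x (\1_C x)%:E = leb d C)%E by rewrite integral_indic// setIT.
by rewrite iE CE ltry.
Qed.

Lemma mset_setI d (A B : set 'rV[R]_d) : mset_rV A -> mset_rV B -> mset_rV (A `&` B).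
Proof. by move=> mA mB; rewrite /mset_rV preimage_setI; exact: measurableI. Qed.

Lemma mset_setU d (A B : set 'rV[R]_d) : mset_rV A -> mset_rV B -> mset_rV (A `|` B).
Proof. by move=> mA mB; rewrite /mset_rV preimage_setU; exact: measurableU. Qed.

Lemma mset_setC d (A : set 'rV[R]_d) : mset_rV A -> mset_rV (~` A).
Proof. by move=> mA; rewrite /mset_rV preimage_setC; exact: measurableC. Qed.

Lemma mset_cube d (c : 'rV[R]_d) r : mset_rV (cube c r).
Proof. exact: measurable_cube. Qed.

Lemma mfun_cst d (c : R) : mfun_rV (fun _ : 'rV[R]_d => c).
Proof. exact: measurable_cst. Qed.

Lemma mfun_coord d (i : 'I_d) : mfun_rV (fun x : 'rV[R]_d => x 0 i).
Proof. exact: measurable_rV_coord. Qed.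

Lemma mfunD d (f g : 'rV[R]_d -> R) : mfun_rV f -> mfun_rV g ->
  mfun_rV (fun x => f x + g x).
Proof. by move=> mf mg; exact: (measurable_funD mf mg). Qed.

Lemma mfunM d (f g : 'rV[R]_d -> R) : mfun_rV f -> mfun_rV g ->
  mfun_rV (fun x => f x * g x).
Proof. by move=> mf mg; exact: (measurable_funM mf mg). Qed.

Lemma mfun_indic d (A : set 'rV[R]_d) : mset_rV A -> mfun_rV (\1_A : _ -> R).
Proof. by move=> mA; exact: (@measurable_indic _ _ R setT _ mA). Qed.

Lemma mfun_sum d (I : Type) (s : seq I) (P : pred I) (f : I -> 'rV[R]_d -> R) :
  (forall i, P i -> mfun_rV (f i)) -> mfun_rV (fun x => \sum_(i <- s | P i) f i x).
Proof.
move=> h; elim: s => [|a s IH].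
  by rewrite (_ : (fun _ => _) = fun=> 0); [exact: mfun_cst|apply/funext => x; rewrite big_nil].
rewrite (_ : (fun _ => _) = fun x => (if P a then f a x else 0) +
   \sum_(i <- s | P i) f i x); last first.
  by apply/funext => x; rewrite big_cons; case: ifP => //; rewrite add0r.
apply: mfunD => //; case Pa: (P a); [exact: h|exact: mfun_cst].
Qed.

Lemma mset_le d (f : 'rV[R]_d -> R) c : mfun_rV f -> mset_rV [set x | f x <= c].
Proof.
move=> mf; have := mf measurableT _ (measurable_itv `]-oo, c]); rewrite setTI.
rewrite /mset_rV (_ : (f \o _) @^-1` _ = @rV_of_prodR R d @^-1` [set x | f x <= c]).
  by [].
by apply/seteqP; split => x /=; rewrite in_itv.
Qed.

Lemma mset_lt d (f : 'rV[R]_d -> R) c : mfun_rV f -> mset_rV [set x | f x < c].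
Proof.
move=> mf; have := mf measurableT _ (measurable_itv `]-oo, c[); rewrite setTI.
rewrite /mset_rV (_ : (f \o _) @^-1` _ = @rV_of_prodR R d @^-1` [set x | f x < c]).
  by [].
by apply/seteqP; split => x /=; rewrite in_itv.
Qed.

Lemma mset_forall d (I : finType) (P : pred I) (A : I -> set 'rV[R]_d) :
  (forall i, P i -> mset_rV (A i)) -> mset_rV [set x | forall i, P i -> A i x].
Proof.
move=> h; rewrite /mset_rV (_ : _ @^-1` _ = \bigcap_(i in [set` P])
    (@rV_of_prodR R d @^-1` A i)).
  by apply: fin_bigcap_measurable => // i /= Pi; exact: h.
by apply/seteqP; split.
Qed.

Lemma mset_forall_seq d (I : eqType) (s : seq I) (A : I -> set 'rV[R]_d) :
  (forall i, i \in s -> mset_rV (A i)) -> mset_rV [set x | forall i, i \in s -> A i x].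
Proof.
move=> h; rewrite /mset_rV (_ : _ @^-1` _ = \bigcap_(i in [set` s])
    (@rV_of_prodR R d @^-1` A i)).
  by apply: fin_bigcap_measurable => // i /= Pi; exact: h.
by apply/seteqP; split.
Qed.

(** Continuity gives measurability because a continuous function is the limit of
    its step functions on finer and finer grids. *)
Lemma mfun_continuous d (g : 'rV[R]_d -> R) : continuous g -> mfun_rV g.
Proof.
move=> cg.
pose grid n (y : 'rV[R]_d) : 'rV[int]_d := \row_i Num.floor (n.+1%:R * y 0 i).
pose real n (z : 'rV[int]_d) : 'rV[R]_d := \row_i ((z 0 i)%:~R / n.+1%:R).
apply: (@measurable_fun_cvg _ _ _ setT
  (fun n x => g (real n (grid n (@rV_of_prodR R d x))))) => [n|x _].
  move=> _ Y mY; rewrite setTI.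
  rewrite (_ : _ @^-1` _ = \bigcup_z (if g (real n z) \in Y then
     @rV_of_prodR R d @^-1` [set y | grid n y = z] else set0)); last first.
    apply/seteqP; split => y /=.
      by move=> h; exists (grid n (rV_of_prodR y)) => //; rewrite mem_set.
    by case=> z _; case: ifPn => //; rewrite inE => h /= ->.
  apply: countable_bigcupT_measurable; first exact: countableP.
  move=> z; case: ifPn => // _.
  rewrite (_ : mkset _ = [set y | forall i, true ->
     ([set y : 'rV[R]_d | y 0 i < ((z 0 i) + 1)%:~R / n.+1%:R] `&`
     ~` [set y : 'rV[R]_d | y 0 i < (z 0 i)%:~R / n.+1%:R]) y]).
    apply: mset_forall => i _; apply: mset_setI; last apply: mset_setC.
      by apply: mset_lt; exact: mfun_coord.
    by apply: mset_lt; exact: mfun_coord.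
  apply/seteqP; split => y /=.
    move=> <- i _; rewrite !mxE; split => /=.
      by rewrite ltr_pdivlMr// mulrC floorD1_gt.
    by apply/negP; rewrite -leNgt ler_pdivrMr// mulrC floor_le_tmp.
  move=> h; apply/rowP => i; have [h1 /negP h2] := h i isT; rewrite mxE.
  apply: floor_def; rewrite mulrC.
  by move: h2; rewrite -leNgt ler_pdivrMr// => ->; rewrite -ltr_pdivlMr.
set y := rV_of_prodR x.
apply/cvgrPdist_lt => e e0.
have /nbhs_ballP[r /= r0 hr] : nbhs y [set z | `|g y - g z| < e].
  by move/cvgrPdist_lt : (cg y) => /(_ _ e0).
near=> n; apply: hr; split => // i j; rewrite /ball/= !mxE ord1.
have n0 : 0 < n.+1%:R :> R by [].
rewrite distrC.
have h1 : (Num.floor (n.+1%:R * y 0 j))%:~R / n.+1%:R <= y 0 j.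
  by rewrite ler_pdivrMr// mulrC floor_le_tmp.
have h2 : y 0 j < (Num.floor (n.+1%:R * y 0 j) + 1)%:~R / n.+1%:R.
  by rewrite ltr_pdivlMr// mulrC floorD1_gt.
rewrite ler0_norm ?subr_le0// opprB.
have h3 : n.+1%:R^-1 < r by near: n; exact: (near_infty_natSinv_lt (PosNum r0)).
apply: lt_trans h3; rewrite ltrBlDr (lt_le_trans h2)//.
by rewrite intrD mulrDl mul1r addrC.
Unshelve. all: end_near. Qed.


Section Functional.
Variable d : nat.
Implicit Types (f g : 'rV[R]_d -> R) (A : set 'rV[R]_d).

Lemma adm_intro f M B : mfun_rV f -> (forall x, `|f x| <= M) ->
  (forall x, f x <> 0 -> cube 0 B x) -> adm f.
Proof.
move=> mf h1 h2; split => //; exists (Num.max M B) => x; split.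
  by rewrite le_max h1.
by move/h2; apply: cube_le; rewrite le_max lexx orbT.
Qed.

Lemma adm_dom f g C : mfun_rV f -> adm g -> (forall x, `|f x| <= C * `|g x|) -> adm f.
Proof.
move=> mf ag h; have [B B0 hB] := adm_pos ag.
apply: (@adm_intro _ (`|C| * B) B) => // x.
  rewrite (le_trans (h x))// (le_trans (ler_wpM2r _ (ler_norm C)))//.
  by apply: ler_wpM2l => //; case: (hB x).
case: (hB x) => _ h2 fx; apply: h2 => gx; apply: fx.
by apply/eqP; rewrite -normr_le0 (le_trans (h x))// gx normr0 mulr0.
Qed.

Lemma adm0 : adm (fun _ : 'rV[R]_d => 0).
Proof.
by apply: (@adm_intro _ 0 0) => //; [exact: mfun_cst|move=> x; rewrite normr0].
Qed.

Lemma admD f g : adm f -> adm g -> adm (fun x => f x + g x).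
Proof.
move=> af ag; have [B B0 hB] := adm_pos af; have [C C0 hC] := adm_pos ag.
apply: (@adm_intro _ (B + C) (B + C)).
- by apply: mfunD; [case: af|case: ag].
- by move=> x; rewrite (le_trans (ler_normD _ _))// lerD//; [case: (hB x)|case: (hC x)].
move=> x fg; case: (pselect (f x = 0)) => fx.
  have gx : g x <> 0 by move=> gx; apply: fg; rewrite fx gx addr0.
  by apply: (@cube_le _ _ C); [rewrite lerDr ltW|case: (hC x) => _; apply].
by apply: (@cube_le _ _ B); [rewrite lerDl ltW|case: (hB x) => _; apply].
Qed.

Lemma admZ c f : adm f -> adm (fun x => c * f x).
Proof.
move=> af; apply: (@adm_dom _ f `|c|) => //; last by move=> x; rewrite normrM.
by apply: mfunM; [exact: mfun_cst|case: af].
Qed.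

Lemma admM f g : adm f -> adm g -> adm (fun x => f x * g x).
Proof.
move=> af ag; have [B B0 hB] := adm_pos af.
apply: (@adm_dom _ g B) => //; first by apply: mfunM; [case: af|case: ag].
by move=> x; rewrite normrM ler_wpM2r//; case: (hB x).
Qed.

Lemma adm_restrict f A : adm f -> mset_rV A -> adm (fun x => \1_A x * f x).
Proof.
move=> af mA; apply: (@adm_dom _ f 1) => //.
  by apply: mfunM; [exact: mfun_indic|case: af].
by move=> x; rewrite normrM ler_wpM2r// indicE; case: (_ \in _); rewrite ?normr1 ?normr0.
Qed.

Lemma adm_indic A B : mset_rV A -> A `<=` cube 0 B -> adm (\1_A : _ -> R).
Proof.
move=> mA AB; apply: (@adm_intro _ 1 B); first exact: mfun_indic.
  by move=> x; rewrite indicE; case: (_ \in _); rewrite ?normr1 ?normr0.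
move=> x; rewrite indicE; case: (pselect (A x)) => [/AB//|Ax].
by rewrite memNset.
Qed.

Lemma adm_sum (I : Type) (s : seq I) (P : pred I) (F : I -> 'rV[R]_d -> R) :
  (forall i, P i -> adm (F i)) -> adm (fun x => \sum_(i <- s | P i) F i x).
Proof.
move=> h; elim: s => [|a s IH].
  by rewrite (_ : (fun _ => _) = fun=> 0); [exact: adm0|apply/funext => x; rewrite big_nil].
rewrite (_ : (fun _ => _) = fun x => (if P a then F a x else 0) +
   \sum_(i <- s | P i) F i x); last first.
  by apply/funext => x; rewrite big_cons; case: ifP => //; rewrite add0r.
by apply: admD => //; case Pa: (P a); [exact: h|exact: adm0].
Qed.

Lemma JD f g : adm f -> adm g -> J (fun x => f x + g x) = J f + J g.
Proof. by move=> af ag; rewrite /J -RintegralD//; exact: adm_integrable. Qed.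

Lemma JZ c f : adm f -> J (fun x => c * f x) = c * J f.
Proof. by move=> af; rewrite /J -RintegralZl//; exact: adm_integrable. Qed.

Lemma J_ge0 f : (forall x, 0 <= f x) -> 0 <= J f.
Proof. by move=> h; apply: Rintegral_ge0 => x _; exact: h. Qed.

Lemma J0 : J (fun _ : 'rV[R]_d => 0) = 0.
Proof.
rewrite -[RHS](mul0r (J (fun _ : 'rV[R]_d => 0))) -JZ; last exact: adm0.
by congr J; apply/funext => x; rewrite mul0r.
Qed.

Lemma JN f : adm f -> J (fun x => - f x) = - J f.
Proof. by move=> af; rewrite -mulN1r -JZ//; congr J; apply/funext => x; rewrite mulN1r. Qed.

Lemma admN f : adm f -> adm (fun x => - f x).
Proof.
by move=> af; rewrite (_ : (fun _ => _) = fun x => -1 * f x);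
  [exact: admZ|apply/funext => x; rewrite mulN1r].
Qed.

Lemma admB f g : adm f -> adm g -> adm (fun x => f x - g x).
Proof. by move=> af ag; apply: admD => //; exact: admN. Qed.

Lemma JB f g : adm f -> adm g -> J (fun x => f x - g x) = J f - J g.
Proof. by move=> af ag; rewrite JD ?JN//; exact: admN. Qed.

Lemma J_le f g : adm f -> adm g -> (forall x, f x <= g x) -> J f <= J g.
Proof.
by move=> af ag h; rewrite -subr_ge0 -JB//; apply: J_ge0 => x; rewrite subr_ge0.
Qed.

Lemma J_sum (I : Type) (s : seq I) (P : pred I) (F : I -> 'rV[R]_d -> R) :
  (forall i, P i -> adm (F i)) ->
  J (fun x => \sum_(i <- s | P i) F i x) = \sum_(i <- s | P i) J (F i).
Proof.
move=> h; elim: s => [|a s IH].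
  by rewrite big_nil -[RHS]J0; congr J; apply/funext => x; rewrite big_nil.
rewrite big_cons -IH; case: ifPn => Pa; last first.
  by congr J; apply/funext => x; rewrite big_cons (negbTE Pa).
rewrite -JD//; [|exact: h|exact: adm_sum].
by congr J; apply/funext => x; rewrite big_cons Pa.
Qed.

Lemma adm_norm f : adm f -> adm (fun x => `|f x|).
Proof.
move=> af; apply: (@adm_dom _ f 1) => //; last by move=> x; rewrite normr_id mul1r.
case: af => mf _; exact: (measurableT_comp (@normr_measurable R setT) mf).
Qed.

Lemma J_norm f : adm f -> `|J f| <= J (fun x => `|f x|).
Proof.
move=> af; have an := adm_norm af; rewrite ler_norml -JN//; apply/andP; split.
  by apply: J_le => //; [exact: admN|move=> x; rewrite lerNl -normrN ler_norm].
by apply: J_le => // x; rewrite ler_norm.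
Qed.

Lemma J_cube (c : 'rV[R]_d) r : 0 < r -> J (\1_(cube c r) : _ -> R) = (2 * r) ^+ d.
Proof.
move=> r0; rewrite /J /Rintegral.
rewrite (_ : (fun x => _) = fun x => (\1_(@rV_of_prodR R d @^-1` cube c r) x)%:E).
  have -> : (\int[leb d]_x (\1_(@rV_of_prodR R d @^-1` cube c r) x)%:E =
      leb d (@rV_of_prodR R d @^-1` cube c r))%E.
    by rewrite integral_indic ?setIT//; exact: measurable_cube.
  by rewrite leb_cube.
by apply/funext => x; rewrite !indicE; congr (_%:E); congr (_%:R); rewrite !inE/=.
Qed.

Lemma adm_cube (c : 'rV[R]_d) r : adm (\1_(cube c r) : _ -> R).
Proof.
apply: (@adm_indic _ (\sum_i `|c 0 i| + r)); first exact: mset_cube.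
move=> x h i; rewrite mxE subr0 -(subrK (c 0 i) (x 0 i)) (le_lt_trans (ler_normD _ _))//.
have h1 := h i; suff : `|c 0 i| <= \sum_j `|c 0 j| by lra.
by rewrite (bigD1 i)//= lerDl sumr_ge0.
Qed.

Lemma prodR_affine_row (c : R) (v : 'rV[R]_d) (x : prodR R d) :
  @rV_of_prodR R d (prodR_affine c
     (fun k => if insub k is Some i then v 0 (i : 'I_d) else 0) x) =
  c *: rV_of_prodR x + v.
Proof.
by rewrite rV_prodR_affine; congr (_ + _); apply/rowP => i; rewrite mxE valK.
Qed.

Lemma mfun_affine f c v : mfun_rV f -> mfun_rV (fun x => f (c *: x + v)).
Proof.
move=> mf; rewrite /mfun_rV.
rewrite (_ : _ \o _ = (f \o @rV_of_prodR R d) \o prodR_affine c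
     (fun k => if insub k is Some i then v 0 (i : 'I_d) else 0)).
  exact: (measurableT_comp mf (measurable_prodR_affine c _)).
by apply/funext => x /=; rewrite prodR_affine_row.
Qed.

Lemma adm_affine f c v : 0 < c -> adm f -> adm (fun x => f (c *: x + v)).
Proof.
move=> c0 af; have [B B0 hB] := adm_pos af.
apply: (@adm_intro _ B ((B + \sum_i `|v 0 i|) / c)).
- by apply: mfun_affine; case: af.
- by move=> x; case: (hB (c *: x + v)).
move=> x /(proj2 (hB _)) h i; rewrite mxE subr0 ltr_pdivlMr// -(gtr0_norm c0) -normrM.
have := h i; rewrite !mxE subr0 mulrC => hi.
rewrite -(addrK (v 0 i) (x 0 i * c)) (le_lt_trans (ler_normB _ _))// ltr_leD//.
by rewrite (bigD1 i)//= lerDl sumr_ge0.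
Qed.

(** Change of variables under dilations and translations, the two symmetries
    that carry all the estimates below. *)
Lemma J_affine f c v : 0 < c -> adm f -> J (fun x => f (c *: x + v)) = c ^- d * J f.
Proof.
move=> c0 af; have af' := adm_affine v c0 af.
pose w k := if insub k is Some i then v 0 (i : 'I_d) else 0.
pose phi := @prodR_affine d c w.
have mphi : measurable_fun setT phi by exact: measurable_prodR_affine.
pose p : {measure set (prodR R d) -> \bar R} :=
  measure_function_pushforward__canonical__measure_function_Measure
    (leb d) mphi.
have cd0 : 0 <= c ^+ d by rewrite exprn_ge0// ltW.
pose F := EFin \o (f \o @rV_of_prodR R d).
pose G := EFin \o ((fun x => f (c *: x + v)) \o @rV_of_prodR R d).
have FG : F \o phi = G by apply/funext => x; rewrite /F /G /phi /= prodR_affine_row.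
have iG : (leb d).-integrable setT G by exact: adm_integrable.
have mF : measurable_fun setT F by apply/measurable_EFinP; case: af.
have key (H : prodR R d -> \bar R) : measurable_fun setT H -> (forall x, (0 <= H x)%E) ->
    (\int[leb d]_x H x = (c ^+ d)%:E * \int[leb d]_x (H \o phi) x)%E.
  move=> mH H0; rewrite (eq_measure_integral (mscale (NngNum cd0) p)); last first.
    by move=> A mA _; exact: (leb_affine w c0).
  rewrite ge0_integral_mscale//; congr (_ * _)%E.
  by rewrite [LHS](ge0_integral_pushforward mphi)//.
rewrite /J /Rintegral -/F -/G.
have -> : (\int[leb d]_x F x = (c ^+ d)%:E * \int[leb d]_x G x)%E.
  rewrite (integralE _ _ F) (integralE _ _ G) (key F^\+%E)//; last exact: measurable_funepos.
  rewrite (key F^\-%E)//; last exact: measurable_funeneg.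
  rewrite -funepos_comp -funeneg_comp FG [in RHS]muleBr//.
  apply: fin_num_adde_defl; rewrite fin_numN; apply: integrable_fin_num => //.
  exact: integrable_funeneg.
rewrite fineM//; last exact: integrable_fin_num.
by rewrite mulrA mulVf ?mul1r// expf_neq0// gt_eqF.
Qed.

Lemma J_translate f v : adm f -> J (fun x => f (x + v)) = J f.
Proof.
move=> af; have := J_affine v ltr01 af; rewrite expr1n invr1 mul1r => <-.
by congr J; apply/funext => x; rewrite scale1r.
Qed.

Import HBNNSimple.

Definition null_rV A : Prop := mset_rV A /\ leb d (@rV_of_prodR R d @^-1` A) = 0%E.

Lemma null_setU A B : null_rV A -> null_rV B -> null_rV (A `|` B).
Proof.
move=> [mA A0] [mB B0]; split; first exact: mset_setU.
by rewrite preimage_setU measureU0.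
Qed.

Lemma nullP A : mset_rV A -> adm (\1_A : _ -> R) -> J (\1_A : _ -> R) = 0 -> null_rV A.
Proof.
move=> mA aA JA; split => //.
have iA : (\int[leb d]_x (\1_(@rV_of_prodR R d @^-1` A) x)%:E)%E \is a fin_num.
  by apply: integrable_fin_num => //; exact: (adm_integrable aA).
move: JA; rewrite /J /Rintegral => JA.
have : fine (\int[leb d]_x (\1_(@rV_of_prodR R d @^-1` A) x)%:E)%E = 0 by [].
have iE : (\int[leb d]_x (\1_(@rV_of_prodR R d @^-1` A) x)%:E =
    leb d (@rV_of_prodR R d @^-1` A))%E by rewrite integral_indic ?setIT.
by move/eqP; rewrite fine_eq0// iE => /eqP.
Qed.

(** The integral does not see a null set, whatever the integrand does on it:
    simple functions below the integrand can be cut off there.  The partial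
    derivatives of a piecewise affine function are uncontrolled on the faces. *)
Lemma integral_off_null A (F G : prodR R d -> \bar R) : null_rV A ->
  (forall x, ~ A (rV_of_prodR x) -> F x = G x) ->
  (\int[leb d]_x F x = \int[leb d]_x G x)%E.
Proof.
case=> mA A0 FG; set N := @rV_of_prodR R d @^-1` A in A0.
have mN : measurable (~` N) by apply: measurableC; exact: mA.
have sub (F1 G1 : prodR R d -> \bar R) : (forall x, (0 <= G1 x)%E) ->
    (forall x, ~ A (rV_of_prodR x) -> F1 x = G1 x) ->
    (ereal_sup [set sintegral (leb d) h | h in
       [set h : {nnsfun prodR R d >-> R} | forall x, ((h x)%:E <= F1 x)%E]] <=
     ereal_sup [set sintegral (leb d) h | h in
       [set h : {nnsfun prodR R d >-> R} | forall x, ((h x)%:E <= G1 x)%E]])%E.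
  move=> G0 E; apply: ge_ereal_sup => _ [h hF <-].
  pose h' : {nnsfun prodR R d >-> R} := mul_nnsfun h (indic_nnsfun R mN).
  have -> : sintegral (leb d) h = sintegral (leb d) h'.
    have intE (k : {nnsfun prodR R d >-> R}) :
        sintegral (leb d) k = (\int[leb d]_x (k x)%:E)%E.
      by rewrite (integral_nnsfun _ measurableT) patch_setT.
    rewrite !intE; apply: ge0_ae_eq_integral => //.
    - exact/measurable_EFinP.
    - exact/measurable_EFinP.
    - by move=> x _; rewrite lee_fin.
    - by move=> x _; rewrite lee_fin.
    exists N; split => // x /= /not_implyP[_ nx]; apply: contrapT => Nx; apply: nx.
    by rewrite /= mindicE mem_set// mulr1.
  apply: ereal_sup_ubound; exists h' => // x /=.
  rewrite mindicE; case: (pselect (N x)) => Nx; last first.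
    by rewrite mem_set// mulr1 -E.
  by rewrite memNset// mulr0; exact: G0.
rewrite /integral; congr (_ - _)%E; apply/eqP; rewrite eq_le; apply/andP; split; apply: sub => // x nx;
  by rewrite !(funeposE, funenegE) !patch_setT FG.
Qed.

Lemma integral_Rd_off_null A D f g : null_rV A ->
  (forall x, ~ A x -> D x -> f x = g x) -> (forall x, ~ A x -> ~ D x -> g x = 0) ->
  integral_Rd D f = J g.
Proof.
move=> A0 h1 h2; rewrite /integral_Rd /J /Rintegral lebE; congr fine.
rewrite [LHS]integral_mkcond.
apply: (@integral_off_null A _ (fun x => (g (rV_of_prodR x))%:E) A0) => x nx.
rewrite /patch; case: ifPn; rewrite ?inE ?notin_setE /= => Dx.
  by rewrite h1.
by rewrite h2.
Qed.

Lemma integral_RdE D f g : (forall x, D x -> f x = g x) ->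
  (forall x, ~ D x -> g x = 0) -> integral_Rd D f = J g.
Proof.
move=> h1 h2; apply: (@integral_Rd_off_null set0).
- split; rewrite /mset_rV preimage_set0 ?measure0//.
- by move=> x _; exact: h1.
- by move=> x _; exact: h2.
Qed.

End Functional.

End LebesgueProduct.

(** * Euclidean geometry and a difference scheme for the Laplacian *)

Section Euclid.
Variables (R : realType) (d : nat).
Implicit Types (x y z s v : 'rV[R]_d) (a c : R).

Lemma dotpC x y : dotp x y = dotp y x.
Proof. by apply: eq_bigr => i _; rewrite mulrC. Qed.

Lemma dotpDl x y z : dotp (x + y) z = dotp x z + dotp y z.
Proof. by rewrite /dotp -big_split/=; apply: eq_bigr => i _; rewrite mxE mulrDl. Qed.

Lemma dotpZl a x y : dotp (a *: x) y = a * dotp x y.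
Proof. by rewrite /dotp mulr_sumr; apply: eq_bigr => i _; rewrite mxE mulrA. Qed.

Lemma dotpDr x y z : dotp z (x + y) = dotp z x + dotp z y.
Proof. by rewrite !(dotpC z) dotpDl. Qed.

Lemma dotpZr a x y : dotp y (a *: x) = a * dotp y x.
Proof. by rewrite !(dotpC y) dotpZl. Qed.

Lemma dotpNl x y : dotp (- x) y = - dotp x y.
Proof. by rewrite -scaleN1r dotpZl mulN1r. Qed.

Lemma dotpNr x y : dotp y (- x) = - dotp y x.
Proof. by rewrite !(dotpC y) dotpNl. Qed.

Lemma dotpBl x y z : dotp (x - y) z = dotp x z - dotp y z.
Proof. by rewrite dotpDl dotpNl. Qed.

Lemma dotpBr x y z : dotp z (x - y) = dotp z x - dotp z y.
Proof. by rewrite dotpDr dotpNr. Qed.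

Lemma dotp0l y : dotp 0 y = 0.
Proof. by rewrite -(scale0r 0) dotpZl mul0r. Qed.

Lemma dotp0r y : dotp y 0 = 0.
Proof. by rewrite dotpC dotp0l. Qed.

Lemma dotp_ge0 x : 0 <= dotp x x.
Proof. by apply: sumr_ge0 => i _; rewrite -expr2 sqr_ge0. Qed.

Lemma dotp_delta x i : dotp x (delta_mx 0 i) = x 0 i.
Proof.
rewrite /dotp (bigD1 i)//= big1 ?addr0; first by rewrite mxE !eqxx mulr1.
by move=> j ji; rewrite mxE eqxx/= (negbTE ji) mulr0.
Qed.

Lemma dotp_CS x y : (dotp x y) ^+ 2 <= dotp x x * dotp y y.
Proof.
have [y0|y0] := eqVneq (dotp y y) 0.
  have -> : y = 0.
    apply/rowP => i; rewrite mxE; apply/eqP; rewrite -sqrf_eq0 expr2.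
    move/eqP: y0; rewrite /dotp psumr_eq0 => [/allP/(_ i)/=|j _]; last by rewrite -expr2 sqr_ge0.
    by rewrite mem_index_enum => /(_ isT).
  by rewrite !dotp0r expr0n mulr0.
have yp : 0 < dotp y y by rewrite lt_def y0 dotp_ge0.
have := dotp_ge0 (dotp y y *: x - dotp x y *: y).
rewrite dotpBl !dotpBr !dotpZl !dotpZr (dotpC y x).
rewrite (_ : _ - _ = dotp y y * (dotp x x * dotp y y - dotp x y ^+ 2)); last by ring.
by rewrite pmulr_rge0// subr_ge0.
Qed.

Lemma enorm_ge0 x : 0 <= enorm x.
Proof. exact: sqrtr_ge0. Qed.

Lemma enorm_sqr x : enorm x ^+ 2 = dotp x x.
Proof. by rewrite sqr_sqrtr// dotp_ge0. Qed.

Lemma dotp_le x y : `|dotp x y| <= enorm x * enorm y.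
Proof.
rewrite -(ler_pXn2r (n := 2))// ?nnegrE ?mulr_ge0 ?enorm_ge0//.
by rewrite exprMn !enorm_sqr -normrX ger0_norm ?sqr_ge0// dotp_CS.
Qed.

Lemma enormD x y : enorm (x + y) <= enorm x + enorm y.
Proof.
rewrite -(ler_pXn2r (n := 2))// ?nnegrE ?addr_ge0 ?enorm_ge0//.
rewrite sqrrD !enorm_sqr dotpDl !dotpDr (dotpC y x).
by have := le_trans (ler_norm _) (dotp_le x y); rewrite -mulr_natl; lra.
Qed.

Lemma enormZ a x : enorm (a *: x) = `|a| * enorm x.
Proof.
by rewrite /enorm dotpZl dotpZr mulrA -expr2 sqrtrM ?sqr_ge0// sqrtr_sqr.
Qed.

Lemma enormN x : enorm (- x) = enorm x.
Proof. by rewrite -scaleN1r enormZ normrN1 mul1r. Qed.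

Lemma enorm_delta i : enorm (delta_mx 0 i : 'rV[R]_d) = 1.
Proof. by rewrite /enorm dotp_delta mxE !eqxx sqrtr1. Qed.

Lemma enorm_coord x i : `|x 0 i| <= enorm x.
Proof. by rewrite -dotp_delta (le_trans (dotp_le _ _))// enorm_delta mulr1. Qed.

Lemma enorm_le_sum x : enorm x <= \sum_i `|x 0 i|.
Proof.
rewrite -(ler_pXn2r (n := 2))// ?nnegrE ?enorm_ge0 ?sumr_ge0//.
rewrite enorm_sqr expr2 mulr_suml; apply: ler_sum => i _.
rewrite (le_trans (ler_norm _))// normrM ler_wpM2l//.
by rewrite (bigD1 i)//= lerDl sumr_ge0.
Qed.

Lemma enorm0_eq0 x : enorm x = 0 -> x = 0.
Proof.
move=> x0; apply/rowP => i; rewrite mxE; apply/eqP; rewrite -normr_le0 -x0.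
exact: enorm_coord.
Qed.

End Euclid.

Section DiscreteLaplacian.
Variables (R : realType) (d : nat).
Implicit Types (x y z s v : 'rV[R]_d) (U D : set 'rV[R]_d).
Local Notation e i := (delta_mx 0 i : 'rV[R]_d).

(** Without division by the square of the step, a solution of the scheme has
    second difference of the size of the square of the step. *)
Definition dlap (h : R) (w : 'rV[R]_d -> R) x : R :=
  \sum_i (w (x + h *: e i) + w (x - h *: e i) - 2 * w x).

Lemma dlapD h (v w : 'rV[R]_d -> R) x :
  dlap h (fun x => v x + w x) x = dlap h v x + dlap h w x.
Proof. by rewrite /dlap -big_split/=; apply: eq_bigr => i _; ring. Qed.

Lemma dlapZ h c (w : 'rV[R]_d -> R) x :
  dlap h (fun x => c * w x) x = c * dlap h w x.
Proof. by rewrite /dlap mulr_sumr; apply: eq_bigr => i _; ring. Qed.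

Lemma dlap_cst h c x : dlap h (fun=> c) x = 0.
Proof. by rewrite /dlap big1// => i _; ring. Qed.

Lemma dlapN h (w : 'rV[R]_d -> R) x : dlap h (fun x => - w x) x = - dlap h w x.
Proof. by rewrite /dlap -sumrN; apply: eq_bigr => i _; ring. Qed.

Lemma dlapB h (v w : 'rV[R]_d -> R) x :
  dlap h (fun x => v x - w x) x = dlap h v x - dlap h w x.
Proof. by rewrite dlapD dlapN. Qed.

Lemma dlap_shift h (w : 'rV[R]_d -> R) s x :
  dlap h (fun x => w (x + s)) x = dlap h w (x + s).
Proof. by rewrite /dlap; apply: eq_bigr => i _; rewrite ![_ + s]addrAC. Qed.

Lemma dlap_affine_sqr h (v : 'rV[R]_d) c x :
  dlap h (fun x => (c - dotp v x) ^+ 2) x = 2 * h ^+ 2 * dotp v v.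
Proof.
rewrite /dlap [dotp v v]/dotp mulr_sumr; apply: eq_bigr => i _.
by rewrite dotpBr dotpDr dotpZr dotp_delta; ring.
Qed.

Lemma dlap_affine h (v : 'rV[R]_d) c x : dlap h (fun x => c - dotp v x) x = 0.
Proof. by rewrite /dlap big1// => i _; rewrite dotpBr dotpDr dotpZr dotp_delta; ring. Qed.

Lemma dlap_sqr h (v : 'rV[R]_d) x :
  dlap h (fun x => dotp (x - v) (x - v)) x = 2 * d%:R * h ^+ 2.
Proof.
transitivity (\sum_(i < d) (2 * h ^+ 2)); last first.
  by rewrite sumr_const card_ord -mulr_natl; ring.
apply: eq_bigr => i _; 
rewrite (addrAC x (h *: e i)) (addrAC x (- (h *: e i))); move: (x - v) => z.
rewrite !dotpDl !dotpDr !dotpNl !dotpNr !dotpZl !dotpZr (dotpC (e i) z) !dotp_delta.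
by rewrite !mxE !eqxx /=; ring.
Qed.

(** A strict subsolution that is nonpositive at the neighbours outside the set
    cannot have a positive supremum: near the supremum the average over the
    neighbours would exceed it.  The supremum need not be attained, which is
    why the subsolution has to be strict. *)
Lemma max_principle U h c (y : 'rV[R]_d -> R) M : 0 < c ->
  (forall x, U x -> y x <= M) -> (forall x, U x -> c <= dlap h y x) ->
  (forall x i, U x -> ~ U (x + h *: e i) -> y (x + h *: e i) <= 0) ->
  (forall x i, U x -> ~ U (x - h *: e i) -> y (x - h *: e i) <= 0) ->
  forall x, U x -> y x <= 0.
Proof.
move=> c0 yM yl yp ym x0 Ux0; rewrite leNgt; apply/negP => y0.
pose E := [set y x | x in U].
have hE : has_sup E.
  by split; [exists (y x0), x0|exists M => _ [x Ux <-]; exact: yM].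
have yS x : U x -> y x <= sup E.
  by move=> Ux; apply: ub_le_sup; [case: hE|exists x].
have S0 : 0 <= sup E by rewrite (le_trans (ltW y0))// yS.
have eps0 : 0 < c / (2 * d%:R + 1) by rewrite divr_gt0// ltr_wpDl// mulr_ge0.
have [_ [x Ux <-] hx] := sup_adherent eps0 hE.
have := yl _ Ux; apply/negP; rewrite -ltNge.
apply: (@le_lt_trans _ _ (\sum_(i < d) 2 * (sup E - y x))).
  apply: ler_sum => i _.
  suff : y (x + h *: e i) <= sup E /\ y (x - h *: e i) <= sup E by lra.
  split.
    case: (pselect (U (x + h *: e i))) => [/yS//|/(yp _ _ Ux) h1]; exact: le_trans S0.
  case: (pselect (U (x - h *: e i))) => [/yS//|/(ym _ _ Ux) h1]; exact: le_trans S0.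
rewrite sumr_const card_ord -mulr_natl.
have h1 : sup E - y x < c / (2 * d%:R + 1) by lra.
have d0 : 0 <= d%:R :> R by [].
have : (sup E - y x) * (2 * d%:R + 1) < c by rewrite -ltr_pdivlMr// ltr_wpDl// mulr_ge0.
by have := yS _ Ux; nra.
Qed.

(** Existence for the difference scheme comes from the order structure alone:
    the averaging operator is monotone on the functions lying between the
    barrier and its opposite, so the supremum of its subsolutions is a fixed
    point.  Every point of the space belongs to its own grid, so the solution is
    defined everywhere and may be compared with all of its translates. *)
Lemma dirichlet_exists D h (f bar : 'rV[R]_d -> R) : (0 < d)%N ->
  (forall x, 0 <= bar x) ->
  (forall x, D x -> dlap h bar x + h ^+ 2 * `|f x| <= 0) ->
  exists w : 'rV[R]_d -> R, [/\ forall x, ~ D x -> w x = 0,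
    forall x, `|w x| <= bar x & forall x, D x -> dlap h w x = - (h ^+ 2 * f x)].
Proof.
move=> d0 b0 bs.
have n0 : 0 < 2 * d%:R :> R by rewrite mulr_gt0// ltr0n.
pose A (v : 'rV[R]_d -> R) x := \sum_i (v (x + h *: e i) + v (x - h *: e i)).
have dlapE (v : 'rV[R]_d -> R) x : dlap h v x = A v x - 2 * d%:R * v x.
  rewrite /dlap big_split/= /A; congr (_ + _).
  by rewrite sumr_const card_ord -mulr_natl; ring.
pose T (v : 'rV[R]_d -> R) x :=
  if `[< D x >] then (A v x + h ^+ 2 * f x) / (2 * d%:R) else 0.
have Tmono (v v' : 'rV[R]_d -> R) : (forall x, v x <= v' x) -> forall x, T v x <= T v' x.
  move=> vv x; rewrite /T; case: ifP => // _.
  rewrite ler_pM2r ?invr_gt0// lerD2r; apply: ler_sum => i _; exact: lerD.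
have Tub x : T bar x <= bar x.
  rewrite /T; case: ifPn => [/asboolP Dx|_//].
  rewrite ler_pdivrMr//; have := bs _ Dx; rewrite dlapE.
  have := ler_norm (f x); have : 0 <= h ^+ 2 by exact: sqr_ge0.
  by move=> h1 h2; have := ler_wpM2l h1 h2; lra.
have Tlb x : - bar x <= T (fun x => - bar x) x.
  rewrite /T; case: ifPn => [/asboolP Dx|_]; last by rewrite oppr_le0.
  rewrite ler_pdivlMr//; have := bs _ Dx; rewrite dlapE.
  have -> : A (fun x => - bar x) x = - A bar x.
    by rewrite /A -sumrN; apply: eq_bigr => i _; ring.
  have := ler_norm (- f x); rewrite normrN; have : 0 <= h ^+ 2 by exact: sqr_ge0.
  by move=> h1 h2; have := ler_wpM2l h1 h2; lra.
pose S : set ('rV[R]_d -> R) :=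
  [set v | forall x, - bar x <= v x <= bar x /\ v x <= T v x].
pose w x := sup [set v x | v in S].
have S0 : S (fun x => - bar x) by move=> x; split; rewrite ?Tlb// lexx -subr_ge0 opprK addr_ge0.
have hs x : has_sup [set v x | v in S].
  by split; [exists (- bar x); exists (fun x => - bar x)|
             exists (bar x) => _ [v Sv <-]; case: (Sv x) => /andP[]].
have vw (v : 'rV[R]_d -> R) x : S v -> v x <= w x.
  by move=> Sv; apply: ub_le_sup; [case: (hs x)|exists v].
have wT x : w x <= T w x.
  apply: sup_le_ub; first by case: (hs x).
  move=> _ [v Sv <-]; case: (Sv x) => _ h1; apply: le_trans h1 _.
  by apply: Tmono => z; exact: vw.
have wlb x : - bar x <= w x by exact: (vw _ x S0).
have wub x : w x <= bar x.
  by apply: sup_le_ub; [case: (hs x)|move=> _ [v Sv <-]; case: (Sv x) => /andP[]].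
have STw : S (T w).
  move=> x; split; last by apply: Tmono.
  apply/andP; split; first by apply: le_trans (wT x).
  by apply: le_trans (Tub x); exact: Tmono.
have wE x : w x = T w x by apply/eqP; rewrite eq_le wT/=; exact: vw.
exists w; split.
- by move=> x nD; rewrite wE /T; case: asboolP.
- by move=> x; rewrite ler_norml wlb wub.
move=> x Dx; rewrite dlapE [X in _ - _ * X]wE /T; case: asboolP => // _.
by field; rewrite gt_eqF ?ltr0n.
Qed.

End DiscreteLaplacian.

(** * Estimates for the difference scheme in a polytope *)

Section Polytope.
Variables (R : realType) (d : nat).
Implicit Types (x y z s v : 'rV[R]_d) (f w : 'rV[R]_d -> R).
Local Notation e i := (delta_mx 0 i : 'rV[R]_d).

Variable Hs : seq ('rV[R]_d * R).
Hypothesis d_gt0 : (0 < d)%N.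
Hypothesis unitH : forall p, p \in Hs -> dotp p.1 p.1 = 1.

(** Signed distance to a bounding hyperplane, positive inside. *)
Definition gap (p : 'rV[R]_d * R) x : R := p.2 - dotp p.1 x.

Definition polytope : set 'rV[R]_d := [set x | forall p, p \in Hs -> 0 < gap p x].

Variables (rho bmax : R).
Hypothesis rho_ge0 : 0 <= rho.
Hypothesis polytope_bounded : forall x, polytope x -> enorm x <= rho.
Hypothesis offset_bounded : forall p, p \in Hs -> `|p.2| <= bmax.

Lemma gapD p x s : gap p (x + s) = gap p x - dotp p.1 s.
Proof. by rewrite /gap dotpDr; ring. Qed.

Lemma unit_normal p : p \in Hs -> enorm p.1 = 1.
Proof. by move=> /unitH pp; rewrite /enorm pp sqrtr1. Qed.

Lemma gap_lip p x s : p \in Hs -> `|gap p (x + s) - gap p x| <= enorm s.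
Proof.
move=> pH; rewrite gapD addrAC subrr add0r normrN (le_trans (dotp_le _ _))//.
by rewrite unit_normal// mul1r.
Qed.

Lemma gap_le p x : p \in Hs -> polytope x -> gap p x <= bmax + rho.
Proof.
move=> pH Dx; rewrite /gap lerD//.
  by rewrite (le_trans (ler_norm _))// offset_bounded.
rewrite (le_trans (ler_norm _))// normrN (le_trans (dotp_le _ _))//.
by rewrite unit_normal// mul1r polytope_bounded.
Qed.

Lemma bmax_ge0 p : p \in Hs -> 0 <= bmax.
Proof. by move=> /offset_bounded; apply: le_trans. Qed.

(** A concave paraboloid that is at least one on the whole domain; multiples of it
    turn bounds of the right-hand side into bounds of the solution, and small
    multiples make subsolutions strict. *)
Definition cap x : R := (rho + 1) ^+ 2 - dotp (x - 0) (x - 0).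

Lemma dlap_cap h x : dlap h cap x = - (2 * d%:R * h ^+ 2).
Proof. by rewrite /cap dlapB dlap_cst sub0r dlap_sqr. Qed.

Lemma cap_ge0 x s : polytope x -> enorm s <= 1 -> 0 <= cap (x + s).
Proof.
move=> Dx s1; rewrite /cap subr0 subr_ge0 -enorm_sqr.
rewrite ler_pXn2r// ?nnegrE ?enorm_ge0 ?addr_ge0//.
by rewrite (le_trans (enormD _ _))// lerD// polytope_bounded.
Qed.

Lemma cap_le x : cap x <= (rho + 1) ^+ 2.
Proof. by rewrite /cap gerBl dotp_ge0. Qed.

Lemma enorm_step h i : enorm (h *: e i) = `|h|.
Proof. by rewrite enormZ enorm_delta mulr1. Qed.

Section Scheme.
Variables (h F Lf : R).
Hypotheses (h_gt0 : 0 < h) (h_le1 : h <= 1).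
Hypotheses (F_ge0 : 0 <= F) (Lf_ge0 : 0 <= Lf).

Definition scheme_solution f w := [/\ forall x, ~ polytope x -> w x = 0,
  exists M, forall x, w x <= M &
  forall x, polytope x -> dlap h w x = - (h ^+ 2 * f x)].

(** The parabola in the distance to the hyperplane, shifted to vanish one step
    behind it, is a supersolution of the scheme that is nonnegative at the
    neighbours outside the domain. *)
Lemma scheme_face_ub f w p x : scheme_solution f w -> (forall x, `|f x| <= F) ->
  p \in Hs -> polytope x ->
  w x <= (F + 1) * (bmax + rho + 2) * (gap p x + h).
Proof.
move=> [w0 [M wM] we] fF pH Dx.
pose W := bmax + rho + 2.
have W0 : 0 <= W by rewrite !addr_ge0// (bmax_ge0 pH).
pose be x := (F + 1) * (W * (gap p x + h) - 2^-1 * (gap p x + h) ^+ 2).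
have lapbe z : dlap h be z = - ((F + 1) * h ^+ 2).
  rewrite /be dlapZ dlapB !dlapZ (_ : (fun _ => _) = fun z => (p.2 + h) - dotp p.1 z); last first.
    by apply/funext => t; rewrite /gap; ring.
  rewrite dlap_affine (_ : (fun _ => _) = fun z => ((p.2 + h) - dotp p.1 z) ^+ 2); last first.
    by apply/funext => t; rewrite /gap; congr (_ ^+ 2); ring.
  by rewrite dlap_affine_sqr unitH//; field.
have be0 z s : polytope z -> enorm s <= h -> 0 <= be (z + s).
  move=> Dz sh; have := gap_lip z s pH; have := gap_le pH Dz; have := Dz _ pH.
  move=> g0 gW; rewrite ler_distl => /andP[h1 h2].
  rewrite /be; apply: mulr_ge0; first by rewrite addr_ge0.
  have : 0 <= (gap p (z + s) + h) * (W - 2^-1 * (gap p (z + s) + h)).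
    by apply: mulr_ge0; rewrite /W; [lra|move: h_le1; lra].
  by rewrite expr2; lra.
suff : w x - be x <= 0.
  rewrite subr_le0 => /le_trans; apply; rewrite /be -mulrA ler_wpM2l ?addr_ge0//.
  by rewrite gerBl mulr_ge0 ?invr_ge0 ?sqr_ge0.
have hpos i : enorm (h *: e i) <= h by rewrite enorm_step ger0_norm// ltW.
have hneg i : enorm (- (h *: e i)) <= h by rewrite enormN.
apply: (@max_principle R d polytope h (h ^+ 2) (fun x => w x - be x) M) => //.
- by rewrite exprn_gt0.
- move=> z Dz; rewrite (le_trans _ (wM z))// gerBl.
  by have := be0 z 0 Dz; rewrite addr0; apply; rewrite -(scale0r z) enormZ normr0 mul0r ltW.
- move=> z Dz; rewrite dlapB we// lapbe; have := fF z; rewrite ler_norml => /andP[_ h1].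
  have : 0 <= h ^+ 2 by exact: sqr_ge0.
  by move=> h2; have := ler_wpM2l h2 h1; lra.
- by move=> z i Dz nD; rewrite w0// sub0r oppr_le0 be0.
- by move=> z i Dz nD; rewrite w0// sub0r oppr_le0 be0.
Qed.

Definition face_const := (F + 1) * (bmax + rho + 2).

Variables (f w : 'rV[R]_d -> R).
Hypothesis f_le : forall x, `|f x| <= F.
Hypothesis f_lip : forall x s, `|f (x + s) - f x| <= Lf * enorm s.
Hypothesis w_off : forall x, ~ polytope x -> w x = 0.
Variable M : R.
Hypothesis w_bnd : forall x, `|w x| <= M.
Hypothesis w_eq : forall x, polytope x -> dlap h w x = - (h ^+ 2 * f x).

Lemma scheme_face p x : p \in Hs -> polytope x ->
  `|w x| <= face_const * (gap p x + h).
Proof.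
move=> pH Dx; rewrite ler_norml lerNl; apply/andP; split.
  apply: (@scheme_face_ub (fun x => - f x) (fun x => - w x) p x) => //.
    split => //; first by move=> z nD; rewrite w_off// oppr0.
      by exists M => z; rewrite (le_trans (ler_norm _))// normrN.
    by move=> z Dz; rewrite dlapN w_eq// mulrN.
  by move=> z; rewrite normrN.
apply: (@scheme_face_ub f w p x) => //; split => //.
by exists M => z; rewrite (le_trans (ler_norm _)).
Qed.

Hypothesis Hs_nonempty : Hs != [::].

Lemma face_const_ge0 : 0 <= face_const.
Proof.
case: Hs Hs_nonempty bmax_ge0 => // p s _ /(_ p); rewrite mem_head => /(_ isT) b0.
by rewrite mulr_ge0// !addr_ge0.
Qed.

Definition lip_const := face_const + (Lf + 1) * (rho + 1) ^+ 2.

Lemma lip_const_ge : Lf + 1 <= lip_const.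
Proof.
rewrite /lip_const -[leLHS]add0r lerD ?face_const_ge0// ler_peMr ?addr_ge0//.
by rewrite exprn_ege1// lerDr.
Qed.

(** If a translation moves a point across the boundary, the point is close to a
    face, where the solution is small. *)
Lemma scheme_shift_off x s : ~ (polytope x /\ polytope (x + s)) ->
  `|w (x + s) - w x| <= face_const * (enorm s + h).
Proof.
have K0 := face_const_ge0.
have aux z v : polytope z -> ~ polytope (z + v) ->
    `|w z| <= face_const * (enorm v + h).
  move=> Dz /existsNP[p /not_implyP[pH /negP]]; rewrite -leNgt => g0.
  apply: (le_trans (scheme_face pH Dz)); rewrite ler_wpM2l// lerD2r.
  have := gap_lip z v pH; rewrite ler_distl => /andP[h1 h2]; lra.
move=> nn; case: (pselect (polytope x)) => Dx.
  have nDs : ~ polytope (x + s) by move=> Ds; apply: nn.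
  by rewrite (w_off nDs) sub0r normrN; exact: aux.
rewrite (w_off Dx) subr0; case: (pselect (polytope (x + s))) => Ds; last first.
  by rewrite (w_off Ds) normr0 mulr_ge0// addr_ge0// ?enorm_ge0// ltW.
by rewrite -(enormN s); apply: aux => //; rewrite addrK.
Qed.

(** The translates of the solution by an arbitrary vector solve the same scheme
    on the overlap of the domains, and the comparison with the faces controls
    the difference elsewhere. *)
Lemma scheme_lip x s : `|w (x + s) - w x| <= lip_const * (enorm s + h).
Proof.
have K0 := face_const_ge0; have h0 := ltW h_gt0.
have c2 : 0 <= (rho + 1) ^+ 2 by exact: sqr_ge0.
have s0 := enorm_ge0 s.
pose U := [set x | polytope x /\ polytope (x + s)].
case: (pselect (U x)) => Ux; last first.
  rewrite (le_trans (scheme_shift_off Ux))// ler_wpM2r ?addr_ge0//.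
  by rewrite lerDl mulr_ge0// addr_ge0.
pose c0 := Lf * enorm s + h.
have c00 : 0 <= c0 by rewrite addr_ge0// mulr_ge0.
have dd : 0 < (2 * d%:R : R) by rewrite mulr_gt0// ltr0n.
have key (sg : R) : `|sg| = 1 -> sg * (w (x + s) - w x) - face_const * (enorm s + h)
    - c0 / (2 * d%:R) * cap x <= 0.
  move=> sg1.
  pose y z := sg * (w (z + s) - w z) - face_const * (enorm s + h)
    - c0 / (2 * d%:R) * cap z.
  have yoff z v : polytope z -> enorm v <= 1 -> ~ U (z + v) -> y (z + v) <= 0.
    move=> Dz v1 nU; rewrite /y -addrA -opprD subr_le0.
    rewrite (le_trans (ler_norm _))// normrM sg1 mul1r.
    rewrite (le_trans (scheme_shift_off nU))// lerDl mulr_ge0//.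
      by rewrite divr_ge0// ltW.
    exact: cap_ge0.
  apply: (@max_principle R d U h (h ^+ 2 * h) y
     (M + M + face_const * (enorm s + h) + c0 / (2 * d%:R) * ((rho + 1) ^+ 2))) => //.
  - by rewrite mulr_gt0// exprn_gt0.
  - move=> z [Dz Dzs]; rewrite /y.
    have h1 : sg * (w (z + s) - w z) <= M + M.
      rewrite (le_trans (ler_norm _))// normrM sg1 mul1r (le_trans (ler_normB _ _))//.
      exact: lerD.
    have h2 : 0 <= face_const * (enorm s + h) by rewrite mulr_ge0// addr_ge0.
    have h3 : 0 <= c0 / (2 * d%:R) * cap z.
      rewrite mulr_ge0//; first by rewrite divr_ge0// ltW.
      rewrite -(addr0 z); apply: cap_ge0 => //.
      by rewrite -(scale0r z) enormZ normr0 mul0r.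
    have h4 : 0 <= c0 / (2 * d%:R) * (rho + 1) ^+ 2.
      by rewrite mulr_ge0// divr_ge0// ltW.
    lra.
  - move=> z [Dz Dzs]; rewrite /y !dlapB dlap_cst subr0 dlapZ dlapB dlap_shift.
    rewrite !w_eq// dlapZ dlap_cap.
    have -> : c0 / (2 * d%:R) * - (2 * d%:R * h ^+ 2) = - (c0 * h ^+ 2).
      by field; rewrite gt_eqF// ltr0n.
    have -> : sg * (- (h ^+ 2 * f (z + s)) - - (h ^+ 2 * f z)) =
       - (h ^+ 2 * (sg * (f (z + s) - f z))) by ring.
    have : sg * (f (z + s) - f z) <= Lf * enorm s.
      by rewrite (le_trans (ler_norm _))// normrM sg1 mul1r.
    have hh : 0 <= h ^+ 2 by exact: sqr_ge0.
    by move=> /(ler_wpM2l hh); rewrite /c0; lra.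
  - by move=> z i [Dz _] nU; apply: yoff => //; rewrite enorm_step ger0_norm.
  - by move=> z i [Dz _] nU; apply: yoff => //; rewrite enormN enorm_step ger0_norm.
have fin : face_const * (enorm s + h) + c0 / (2 * d%:R) * cap x <= lip_const * (enorm s + h).
  rewrite /lip_const [leRHS]mulrDl lerD2l.
  apply: (@le_trans _ _ (c0 * (rho + 1) ^+ 2)).
    rewrite -mulrA ler_wpM2l// ler_pdivrMl//.
    rewrite (le_trans (cap_le x))// ler_peMl//.
    by rewrite -natrM ler1n muln_gt0.
  rewrite mulrAC ler_wpM2r// /c0 mulrDr lerD//.
    by rewrite ler_wpM2r// lerDl.
  by rewrite ler_peMl// lerDr.
rewrite ler_norml; apply/andP; split.
  by have := key (-1); rewrite normrN1 => /(_ erefl); lra.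
by have := key 1; rewrite normr1 => /(_ erefl); lra.
Qed.

(** Away from the other faces, the domain is near one of its faces invariant
    under tangential translations, which keep the zero boundary values: the
    tangential differences are small near the face. *)
Lemma scheme_tangential p x0 s r : p \in Hs -> polytope x0 -> dotp p.1 s = 0 ->
  0 < r -> enorm s + h < r ->
  (forall q, q \in Hs -> q != p -> 2 * r <= gap q x0) ->
  `|w (x0 + s) - w x0| <=
    lip_const * (enorm s + h) * ((d%:R / r ^+ 2 + 1) * (bmax + rho + 2)) * (gap p x0 + h).
Proof.
move=> pH Dx0 ps r0 sr other; have h0 := ltW h_gt0.
have K0 : 0 <= lip_const by apply: le_trans lip_const_ge; rewrite addr_ge0.
have s0 := enorm_ge0 s; have b0 := bmax_ge0 pH.
pose B := d%:R / r ^+ 2 + 1.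
have B1 : 1 <= B by rewrite lerDr divr_ge0// sqr_ge0.
pose A := B * (bmax + rho + 2).
pose U := [set x | polytope x /\ enorm (x - x0) < r].
have near z v : enorm (z - x0) < r -> enorm v < r -> 0 < gap p (z + v) ->
    polytope (z + v).
  move=> zr vr gz q qH; have [->//|qp] := eqVneq q p.
  have := other q qH qp; have := gap_lip x0 (z - x0 + v) qH.
  rewrite (_ : x0 + (z - x0 + v) = z + v); last by rewrite addrA (addrC x0) subrK.
  rewrite ler_distl => /andP[h1 _] h2; have := enormD (z - x0) v; lra.
pose c0 := lip_const * (enorm s + h).
have c00 : 0 <= c0 by rewrite mulr_ge0// addr_ge0.
pose be z := (r ^- 2 * dotp (z - x0) (z - x0)) + (A * (gap p z + h) - B * (gap p z + h) ^+ 2).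
have lapbe z : dlap h be z = - (2 * h ^+ 2).
  rewrite /be dlapD dlapZ dlap_sqr dlapB !dlapZ.
  rewrite (_ : (fun _ => _) = fun z => (p.2 + h) - dotp p.1 z); last first.
    by apply/funext => t; rewrite /gap; ring.
  rewrite dlap_affine (_ : (fun _ => _) = fun z => ((p.2 + h) - dotp p.1 z) ^+ 2); last first.
    by apply/funext => t; rewrite /gap; congr (_ ^+ 2); ring.
  by rewrite dlap_affine_sqr unitH// /B; field; rewrite gt_eqF.
have beg z v : polytope z -> enorm v <= h ->
    r ^- 2 * dotp (z + v - x0) (z + v - x0) <= be (z + v).
  move=> Dz vh; rewrite lerDl subr_ge0 expr2 mulrA.
  have := gap_le pH Dz; have := Dz p pH; have := gap_lip z v pH.
  rewrite ler_distl => /andP[h1 h2] h3 h4; rewrite ler_wpM2r//; first by lra.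
  by rewrite /A ler_wpM2l//; clearbody B; [lra|move: h_le1; lra].
have be0 z v : polytope z -> enorm v <= h -> 0 <= be (z + v).
  move=> Dz vh; apply: le_trans (beg _ _ Dz vh).
  by rewrite mulr_ge0 ?dotp_ge0// invr_ge0 sqr_ge0.
have key (sg : R) : `|sg| = 1 -> sg * (w (x0 + s) - w x0) - c0 * be x0 <= 0.
  move=> sg1.
  have zK z : sg * (w (z + s) - w z) <= c0.
    by rewrite (le_trans (ler_norm _))// normrM sg1 mul1r scheme_lip.
  have yoff z v : U z -> enorm v <= h -> ~ U (z + v) ->
      sg * (w (z + v + s) - w (z + v)) - c0 * be (z + v) <= 0.
    move=> [Dz zr] vh nU; rewrite subr_le0.
    case: (ltP (enorm (z + v - x0)) r) => zvr; last first.
      rewrite (le_trans (zK _))// ler_peMr// (le_trans _ (beg _ _ Dz vh))//.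
      rewrite mulrC ler_pdivlMr ?exprn_gt0// mul1r -enorm_sqr.
      by rewrite ler_pXn2r// ?nnegrE ?enorm_ge0// ltW.
    have nD : ~ polytope (z + v) by move=> D; apply: nU.
    have g0 : ~ 0 < gap p (z + v).
      by move=> g0; apply: nD; apply: near => //; lra.
    have nDs : ~ polytope (z + v + s).
      by move=> /(_ p pH); rewrite gapD ps subr0.
    by rewrite !w_off// subrr mulr0 mulr_ge0// be0.
  apply: (@max_principle R d U h (h ^+ 2 * h)
    (fun z => sg * (w (z + s) - w z) - c0 * be z) c0) => //.
  - by rewrite mulr_gt0// exprn_gt0.
  - move=> z [Dz _]; rewrite (le_trans _ (zK z))// gerBl mulr_ge0//.
    by rewrite -(addr0 z) be0// -(scale0r z) enormZ normr0 mul0r.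
  - move=> z [Dz zr].
    have Dzs : polytope (z + s) by apply: near => //; [lra|rewrite gapD ps subr0; exact: Dz].
    rewrite dlapB dlapZ dlapB dlap_shift !w_eq// dlapZ lapbe.
    have -> : sg * (- (h ^+ 2 * f (z + s)) - - (h ^+ 2 * f z)) =
       - (h ^+ 2 * (sg * (f (z + s) - f z))) by ring.
    have h1 : sg * (f (z + s) - f z) <= Lf * enorm s.
      by rewrite (le_trans (ler_norm _))// normrM sg1 mul1r.
    have hh : 0 <= h ^+ 2 by exact: sqr_ge0.
    have := ler_wpM2l hh h1.
    have h2 : Lf * enorm s + h <= c0.
      have := lip_const_ge; rewrite /c0 => h3.
      have h4 : 0 <= (lip_const - (Lf + 1)) * (enorm s + h).
        by rewrite mulr_ge0// ?subr_ge0// addr_ge0.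
      have : 0 <= Lf * h by exact: mulr_ge0.
      by nra.
    by have := ler_wpM2l hh h2; have := mulr_ge0 hh c00; lra.
  - by move=> z i Uz nU; apply: yoff => //; rewrite enorm_step ger0_norm.
  - by move=> z i Uz nU; apply: yoff => //; rewrite enormN enorm_step ger0_norm.
  by split => //; rewrite subrr -(scale0r x0) enormZ normr0 mul0r.
have fin : c0 * be x0 <= c0 * A * (gap p x0 + h).
  rewrite -mulrA ler_wpM2l// /be subrr dotp0l mulr0 add0r gerBl.
  by rewrite mulr_ge0 ?sqr_ge0//; lra.
rewrite -/c0 -/B -/A; move: (c0 * be x0) (c0 * A * (gap p x0 + h)) fin key => q1 q2 fin key.
rewrite ler_norml; apply/andP; split.
  by have := key (-1); rewrite normrN1 => /(_ erefl); lra.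
by have := key 1; rewrite normr1 => /(_ erefl); lra.
Qed.

End Scheme.

(** The paraboloid serves as the barrier. *)
Lemma scheme_exists (h F : R) (f : 'rV[R]_d -> R) : 0 < h -> h <= 1 -> 0 <= F ->
  (forall x, `|f x| <= F) ->
  exists w, [/\ forall x, ~ polytope x -> w x = 0,
    exists M, forall x, `|w x| <= M &
    forall x, polytope x -> dlap h w x = - (h ^+ 2 * f x)].
Proof.
move=> h0 h1 F0 fF.
have dd : 0 < (2 * d%:R : R) by rewrite mulr_gt0// ltr0n.
pose bar x := F / (2 * d%:R) * Num.max 0 (cap x).
have FF : 0 <= F / (2 * d%:R) by rewrite divr_ge0// ltW.
have [||w [w1 w2 w3]] := @dirichlet_exists R d polytope h f bar d_gt0.
- by move=> x; rewrite mulr_ge0// le_max lexx.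
- move=> x Dx.
  have capE s : enorm s <= 1 -> Num.max 0 (cap (x + s)) = cap (x + s).
    by move=> s1; apply/max_idPr; exact: cap_ge0.
  have s0 : enorm (0 : 'rV[R]_d) <= 1 by rewrite -(scale0r 0) enormZ normr0 mul0r.
  have -> : dlap h bar x = F / (2 * d%:R) * dlap h cap x.
    rewrite -dlapZ /dlap; apply: eq_bigr => i _; rewrite /bar.
    have si : enorm (h *: e i) <= 1 by rewrite enorm_step ger0_norm// ltW.
    rewrite !capE// ?enormN//.
    by have := capE _ s0; rewrite addr0 => ->.
  rewrite dlap_cap (_ : _ * - _ = - (h ^+ 2 * F)); last by field; rewrite gt_eqF// ltr0n.
  by rewrite addrC subr_le0 ler_wpM2l// sqr_ge0.
exists w; split => //; exists (F / (2 * d%:R) * (rho + 1) ^+ 2) => x.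
rewrite (le_trans (w2 x))// ler_wpM2l// ge_max sqr_ge0/=; exact: cap_le.
Qed.

End Polytope.

(** * Smoothing by iterated averages *)

Lemma rem_remC (T : eqType) (i j : T) (l : seq T) : rem j (rem i l) = rem i (rem j l).
Proof.
elim: l => //= a l IH; case ai: (a == i); case aj: (a == j); rewrite /= ?ai ?aj ?IH //.
by rewrite -(eqP ai) (eqP aj).
Qed.


Section Triple.
Variable d : nat.

(** Averaging three times in every coordinate direction leaves room for three
    derivatives, each of which consumes one average. *)
Definition triple : seq 'I_d := enum 'I_d ++ enum 'I_d ++ enum 'I_d.

Lemma count_triple i : count_mem i triple = 3%N.
Proof. by rewrite /triple !count_cat !count_uniq_mem ?enum_uniq// mem_enum. Qed.

Lemma size_triple : size triple = (3 * d)%N.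
Proof. by rewrite /triple !size_cat size_enum_ord; lia. Qed.

Lemma mem_triple1 i : i \in triple.
Proof. by rewrite -has_pred1 has_count count_triple. Qed.

Lemma mem_triple2 i j : j \in rem i triple.
Proof.
by rewrite -has_pred1 has_count count_rem count_triple subn_gt0; case: (_ && _).
Qed.

Lemma mem_triple3 i j k : k \in rem j (rem i triple).
Proof.
rewrite -has_pred1 has_count !count_rem count_triple -subnDA subn_gt0.
by case: (_ && _); case: (_ && _).
Qed.

End Triple.

Section UltraLimit.
Variables (R : realType) (U : set_system nat).
Hypothesis UU : UltraFilter U.
Hypothesis sub : \oo `<=` U.
Implicit Types (u v : nat -> R).

(** Bounded sequences converge along an ultrafilter, so that the solutions of
    the difference schemes for finer and finer steps have a pointwise limit at
    once, linearly and compatibly with translations. *)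
Definition ulim u : R := lim (u @ U).

Local Instance U_proper : ProperFilter U.
Proof. exact: ultra_proper. Qed.

Lemma ulim_cvg u (M : R) : (forall n, `|u n| <= M) -> u @ U --> ulim u.
Proof.
move=> uM.
have FA : U (u @^-1` `[- M, M]%classic).
  by apply: filterE => n; rewrite /= in_itv/= -ler_norml.
have [l [_ cl]] := @segment_compact R (- M) M _ (fmap_proper_filter _ _) FA.
suff ul : u @ U --> l by apply: cvgP ul.
move=> B Bl; have [//|nB] := in_ultra_setVsetC (u @^-1` B) UU.
by have [z [Bz nBz]] := cl _ _ (nB : (u @ U) (~` B)) Bl.
Qed.

Lemma ulimD u v (M N : R) : (forall n, `|u n| <= M) -> (forall n, `|v n| <= N) ->
  ulim (fun n => u n + v n) = ulim u + ulim v.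
Proof.
by move=> uM vN; apply: cvg_lim => //; apply: cvgD; [exact: ulim_cvg uM|exact: ulim_cvg vN].
Qed.

Lemma ulimZ c u (M : R) : (forall n, `|u n| <= M) ->
  ulim (fun n => c * u n) = c * ulim u.
Proof. by move=> uM; apply: cvg_lim => //; apply: cvgMr; exact: ulim_cvg uM. Qed.

Lemma ulim_cst c : ulim (fun=> c) = c.
Proof. by apply: cvg_lim => //; exact: cvg_cst. Qed.

(** Inequalities only need to hold up to an error that tends to zero. *)
Lemma ulim_le u v (M N : R) (eps : nat -> R) : (forall n, `|u n| <= M) ->
  (forall n, `|v n| <= N) -> eps @ \oo --> (0 : R) ->
  (forall n, u n <= v n + eps n) -> ulim u <= ulim v.
Proof.
move=> uM vN e0 h; have cu := ulim_cvg uM.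
have ce : eps @ U --> (0 : R) by apply: cvg_trans e0 => B; exact: sub.
have cv : (fun n => v n + eps n) @ U --> ulim v.
  by rewrite -[ulim v]addr0; apply: cvgD ce; exact: ulim_cvg vN.
by apply: (ler_cvg_to cu cv); apply: filterE.
Qed.

Lemma ulim_norm u (M C : R) (eps : nat -> R) : (forall n, `|u n| <= M) ->
  eps @ \oo --> (0 : R) -> (forall n, `|u n| <= C + eps n) -> `|ulim u| <= C.
Proof.
move=> uM e0 h; rewrite ler_norml; apply/andP; split.
  rewrite lerNl -mulN1r -(ulimZ _ uM) -(ulim_cst C).
  apply: (@ulim_le _ _ M `|C| eps) => // n; first by rewrite mulN1r normrN.
  by rewrite mulN1r (le_trans _ (h n))// -normrN ler_norm.
rewrite -(ulim_cst C); apply: (@ulim_le _ _ M `|C| eps) => // n.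
by rewrite (le_trans _ (h n))// ler_norm.
Qed.

End UltraLimit.

Section Averages.
Variables (R : realType) (d : nat) (U : set_system nat).
Hypothesis UU : UltraFilter U.
Hypothesis sub : \oo `<=` U.
Variable s : R.
Hypothesis s_gt0 : 0 < s.
Local Notation e i := (delta_mx 0 i : 'rV[R]_d).
Implicit Types (x y : 'rV[R]_d) (i j : 'I_d) (V W : nat -> 'rV[R]_d -> R).
Implicit Types (l m : seq 'I_d).

Definition mesh_step (n : nat) : R := s / n.+1%:R.

Lemma mesh_step_gt0 n : 0 < mesh_step n.
Proof. by rewrite divr_gt0. Qed.

Lemma mesh_step_le n : mesh_step n <= s.
Proof. by rewrite ler_pdivrMr// ler_peMr// ?ler1n// ltW. Qed.

Lemma mesh_stepN n : n.+1%:R * mesh_step n = s.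
Proof. by rewrite /mesh_step mulrC divfK. Qed.

Lemma mesh_step_cvg (c : R) : (fun n => c * mesh_step n) @ \oo --> (0 : R).
Proof.
rewrite -(mulr0 c); apply: cvgMr; rewrite -(mulr0 s); apply: cvgMr.
exact: cvg_harmonic.
Qed.

(** The forward averages over an interval of fixed length have as discrete
    derivative the difference quotient over this length; in the limit of small
    steps averaging gains one derivative in one direction. *)
Definition avg i V n x : R :=
  n.+1%:R^-1 * \sum_(k < n.+1) V n (x + (k%:R * mesh_step n) *: e i).

Definition dif i V n x : R := (V n (x + s *: e i) - V n x) / s.

Definition avgs l V := foldr avg V l.
Definition difs l V := foldr dif V l.

Definition bounded_seq (M : R) V := forall n x, `|V n x| <= M.

(** Discrete solutions are Lipschitz only up to an error of the order of the
    step, which disappears in the limit. *)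
Definition coarse_lip (K : R) V :=
  forall n x y, `|V n (x + y) - V n x| <= K * (enorm y + mesh_step n).

Lemma avg_bound i V n x (c b : R) :
  (forall k, (k < n.+1)%N -> `|V n (x + (k%:R * mesh_step n) *: e i) - c| <= b) ->
  `|avg i V n x - c| <= b.
Proof.
move=> h; rewrite /avg.
have -> : n.+1%:R^-1 * \sum_(k < n.+1) V n (x + (k%:R * mesh_step n) *: e i) - c =
    n.+1%:R^-1 * \sum_(k < n.+1) (V n (x + (k%:R * mesh_step n) *: e i) - c).
  by rewrite sumrB sumr_const card_ord -[c *+ _]mulr_natl mulrBr mulKf ?pnatr_eq0.
rewrite normrM ger0_norm ?invr_ge0// ler_pdivrMl//.
rewrite (le_trans (ler_norm_sum _ _ _))// (le_trans (ler_sum _ (fun (k : 'I__) _ => h k (ltn_ord k))))//.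
by rewrite sumr_const card_ord -[b *+ _]mulr_natl.
Qed.

Lemma avg_bounded i V M : bounded_seq M V -> bounded_seq M (avg i V).
Proof.
move=> h n x; rewrite -[avg _ _ _ _]subr0; apply: avg_bound => k _.
by rewrite subr0.
Qed.

Lemma avg_lip i V K : coarse_lip K V -> coarse_lip K (avg i V).
Proof.
move=> h n x y.
have -> : avg i V n (x + y) - avg i V n x =
    avg i (fun n z => V n (z + y) - V n z) n x - 0.
  rewrite subr0 /avg -mulrBr -sumrB; congr (_ * _); apply: eq_bigr => k _.
  by rewrite (addrAC x y).
by apply: avg_bound => k _; rewrite subr0.
Qed.

Lemma dif_bounded i V M : bounded_seq M V -> bounded_seq (2 * M / s) (dif i V).
Proof.
move=> h n x; rewrite /dif normrM [`|s^-1|]ger0_norm ?invr_ge0 ?(ltW s_gt0)//.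
rewrite ler_pM2r ?invr_gt0// (le_trans (ler_normB _ _))//.
by have := h n x; have := h n (x + s *: e i); lra.
Qed.

Lemma dif_lip i V K : coarse_lip K V -> coarse_lip (2 * K / s) (dif i V).
Proof.
move=> h n x y; rewrite /dif -mulrBl normrM [`|s^-1|]ger0_norm ?invr_ge0 ?(ltW s_gt0)//.
rewrite (_ : 2 * K / s * _ = (2 * K * (enorm y + mesh_step n)) / s); last by rewrite mulrAC.
rewrite ler_pM2r ?invr_gt0//.
have := h n x y; have := h n (x + s *: e i) y.
rewrite (addrAC x) !ler_norml => /andP[h1 h2] /andP[h3 h4]; apply/andP; split; lra.
Qed.

Lemma avgC i j V : avg i (avg j V) = avg j (avg i V).
Proof.
apply/funext => n; apply/funext => x; rewrite /avg.
under eq_bigr => k _ do rewrite mulr_sumr.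
under [in RHS]eq_bigr => k _ do rewrite mulr_sumr.
rewrite exchange_big/=; congr (_ * _); apply: eq_bigr => k _; apply: eq_bigr => k' _.
by congr (_ * V n _); rewrite addrAC.
Qed.

Lemma dif_avg i j V : dif i (avg j V) = avg j (dif i V).
Proof.
apply/funext => n; apply/funext => x; rewrite /dif /avg -mulrBr -mulrA; congr (_ * _).
rewrite -sumrB mulr_suml; apply: eq_bigr => k _.
by rewrite (addrAC x).
Qed.

Lemma difC i j V : dif i (dif j V) = dif j (dif i V).
Proof.
apply/funext => n; apply/funext => x; rewrite /dif (addrAC x (s *: e i)).
by congr (_ * _); ring.
Qed.

Lemma dif_avgs i l V : dif i (avgs l V) = avgs l (dif i V).
Proof. by elim: l => //= j l IH; rewrite dif_avg IH. Qed.

Lemma avgs_rem i l V : i \in l -> avgs l V = avg i (avgs (rem i l) V).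
Proof.
elim: l => //= j l IH; rewrite inE; have [->//|ij] := eqVneq i j.
by move=> /= il; rewrite (IH il) avgC.
Qed.

Lemma difs_rot i j l V : difs [:: i, j & l] V = difs [:: j, i & l] V.
Proof. by rewrite /= difC. Qed.

Lemma avgs_bounded l V M : bounded_seq M V -> bounded_seq M (avgs l V).
Proof. by move=> h; elim: l => //= i l; exact: avg_bounded. Qed.

Lemma avgs_lip l V K : coarse_lip K V -> coarse_lip K (avgs l V).
Proof. by move=> h; elim: l => //= i l; exact: avg_lip. Qed.

(** Bounds pass to the averages from the points that they sample. *)
Lemma avgs_bound l V n x (c b : R) :
  (forall y, enorm (y - x) <= (size l)%:R * s -> `|V n y - c| <= b) ->
  `|avgs l V n x - c| <= b.
Proof.
elim: l x => [|i l IH] x h /=.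
  by apply: h; rewrite subrr -(scale0r x) enormZ normr0 !mul0r.
apply: avg_bound => k kn; apply: IH => y hy; apply: h.
set z := x + _ in hy.
rewrite -(subrK z y) -addrA (le_trans (enormD _ _))//=.
rewrite -natr1 mulrDl mul1r lerD// /z [x + _]addrC addrK enorm_step.
rewrite ger0_norm; last by rewrite mulr_ge0// ltW// mesh_step_gt0.
by rewrite -[leRHS](mesh_stepN n) ler_wpM2r ?ltW ?mesh_step_gt0// ltr_nat.
Qed.

Definition lims V x : R := ulim U (fun n => V n x).

Lemma lims_bounded V M x : bounded_seq M V -> `|lims V x| <= M.
Proof.
move=> h; apply: (ulim_norm UU sub (M := M) (C := M) (eps := fun n => 0 * mesh_step n)).
- by move=> n; exact: h.
- exact: mesh_step_cvg.
- by move=> n; rewrite mul0r addr0; exact: h.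
Qed.

(** Estimates of differences up to a multiple of the step pass to the limit
    without that error. *)
Lemma lims_diff V M x y (C c : R) : bounded_seq M V ->
  (forall n, `|V n y - V n x| <= C + c * mesh_step n) -> `|lims V y - lims V x| <= C.
Proof.
move=> h hC.
have -> : lims V y - lims V x = ulim U (fun n => V n y + (-1) * V n x).
  rewrite (ulimD UU (M := M) (N := M))//.
    by rewrite (ulimZ UU _ (M := M))// mulN1r.
  by move=> n; rewrite mulN1r normrN.
apply: (ulim_norm UU sub (M := M + M) (C := C) (eps := fun n => c * mesh_step n)).
- by move=> n; rewrite mulN1r (le_trans (ler_normB _ _))// lerD.
- exact: mesh_step_cvg.
- by move=> n; rewrite mulN1r.
Qed.

Lemma lims_lip V M K x y : bounded_seq M V -> coarse_lip K V ->
  `|lims V (x + y) - lims V x| <= K * enorm y.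
Proof.
move=> h hK; apply: (@lims_diff V M _ _ _ K) => // n.
by rewrite -mulrDr; exact: hK.
Qed.

(** Derivatives are understood with a quadratic remainder that is uniform over
    the space, as is natural for functions with Lipschitz derivatives. *)
Definition pder (G G' : 'rV[R]_d -> R) i :=
  exists C, forall x t, `|G (x + t *: e i) - G x - t * G' x| <= C * t ^+ 2.

(** Moving the average by one step exchanges its first sample for the one a full
    length further on. *)
Lemma avg_step i V n x k :
  avg i V n (x + (k%:R * mesh_step n) *: e i) - avg i V n x =
  mesh_step n * \sum_(l < k) dif i V n (x + (l%:R * mesh_step n) *: e i).
Proof.
elim: k => [|k IH]; first by rewrite big_ord0 mul0r scale0r addr0 subrr mulr0.
rewrite big_ord_recr/= mulrDr -IH.
set y := x + (k%:R * mesh_step n) *: e i.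
have -> : x + (k.+1%:R * mesh_step n) *: e i = y + mesh_step n *: e i.
  by rewrite /y -addrA -scalerDl -natr1 mulrDl mul1r.
suff : avg i V n (y + mesh_step n *: e i) - avg i V n y = mesh_step n * dif i V n y.
  by move=> <-; ring.
rewrite /avg -mulrBr /dif big_ord_recr/= [X in _ - X]big_ord_recl/=.
rewrite mul0r scale0r addr0.
have -> : y + mesh_step n *: e i + (n%:R * mesh_step n) *: e i = y + s *: e i.
  by rewrite -addrA -scalerDl -{1}(mul1r (mesh_step n)) -mulrDl nat1r mesh_stepN.
rewrite (_ : \sum_(k0 < n) V n (y + mesh_step n *: e i + _) =
  \sum_(k0 < n) V n (y + ((bump 0 k0)%:R * mesh_step n) *: e i)); last first.
  apply: eq_bigr => j _; congr (V n _); rewrite -addrA -scalerDl; congr (_ + _ *: _).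
  by rewrite /bump leq0n add1n -natr1 mulrDl mul1r addrC.
rewrite /mesh_step; set a := \sum_(_ < n) _; set b := V n (y + s *: e i).
have n1 : n%:R + 1 != 0 :> R by rewrite natr1 pnatr_eq0.
by rewrite -natr1; field; rewrite n1 gt_eqF.
Qed.

Lemma lims_avg_pder i V M K : 0 <= K -> bounded_seq M V -> coarse_lip K V ->
  pder (lims (avg i V)) (lims (dif i V)) i.
Proof.
move=> K0 VM VK; set L := 2 * K / s.
have L0 : 0 <= L by rewrite divr_ge0 ?mulr_ge0// ltW.
have M0 : 0 <= M by apply: le_trans (VM 0%N 0).
have aM := avg_bounded i VM; have aK := avg_lip i VK.
have dM := dif_bounded i VM; have dK := dif_lip i VK; rewrite -/L in dK.
have pos x t : 0 <= t ->
    `|lims (avg i V) (x + t *: e i) - lims (avg i V) x - t * lims (dif i V) x| <= L * t ^+ 2.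
  move=> t0.
  have -> : lims (avg i V) (x + t *: e i) - lims (avg i V) x - t * lims (dif i V) x =
      ulim U (fun n => avg i V n (x + t *: e i) +
        ((-1) * avg i V n x + (- t) * dif i V n x)).
    have b1 n : `|(-1) * avg i V n x| <= M by rewrite mulN1r normrN.
    have b2 n : `|(- t) * dif i V n x| <= t * (2 * M / s).
      by rewrite normrM normrN [`|t|]ger0_norm// ler_wpM2l.
    have b12 n : `|(-1) * avg i V n x + (- t) * dif i V n x| <= M + t * (2 * M / s).
      by rewrite (le_trans (ler_normD _ _))// lerD.
    rewrite (ulimD UU (M := M) (N := M + t * (2 * M / s)))// (ulimD UU (M := M) (N := t * (2 * M / s)))//.
    by rewrite (ulimZ UU _ (M := M))// (ulimZ UU _ (M := 2 * M / s))// mulN1r mulNr addrA.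
  apply: (ulim_norm UU sub (M := M + (M + t * (2 * M / s)))
     (eps := fun n => (2 * K + 2 * M / s) * mesh_step n)).
  - move=> n; rewrite (le_trans (ler_normD _ _))// lerD//.
    rewrite (le_trans (ler_normD _ _))// lerD//; first by rewrite mulN1r normrN.
    by rewrite normrM normrN [`|t|]ger0_norm// ler_wpM2l.
  - exact: mesh_step_cvg.
  move=> n; have h0 := mesh_step_gt0 n; set h := mesh_step n in h0 *.
  pose k := Num.truncn (t / h).
  have kt : k%:R * h <= t by rewrite -ler_pdivlMr// truncn_le// divr_ge0// ltW.
  have tk : t < k%:R * h + h.
    by rewrite -{2}(mul1r h) -mulrDl natr1 -ltr_pdivrMr//; apply: truncnS_gt.
  have e1 : `|avg i V n (x + t *: e i) - avg i V n (x + (k%:R * h) *: e i)| <= 2 * K * h.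
    have := aK n (x + (k%:R * h) *: e i) ((t - k%:R * h) *: e i).
    rewrite -addrA -scalerDl (addrC (k%:R * h)) subrK => /le_trans; apply.
    rewrite enorm_step ger0_norm ?subr_ge0// mulrC -/h [2 * K]mulrC -mulrA mulrC.
    by rewrite ler_wpM2l//; lra.
  have e2 : `|avg i V n (x + (k%:R * h) *: e i) - avg i V n x - (k%:R * h) * dif i V n x|
      <= L * t ^+ 2.
    rewrite avg_step -/h (_ : _ - _ = h * \sum_(l < k)
        (dif i V n (x + (l%:R * h) *: e i) - dif i V n x)); last first.
      by rewrite sumrB sumr_const card_ord -[_ *+ k]mulr_natl; ring.
    rewrite normrM ger0_norm ?(ltW h0)//.
    apply: (@le_trans _ _ (h * \sum_(l < k) (L * (k%:R * h)))).
      rewrite ler_wpM2l ?(ltW h0)// (le_trans (ler_norm_sum _ _ _))//.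
      apply: ler_sum => l _; rewrite (le_trans (dK n _ _))// ler_wpM2l//.
      have lh : (l.+1)%:R * h <= k%:R * h by rewrite ler_pM2r// ler_nat.
      rewrite enorm_step ger0_norm; last by rewrite mulr_ge0// ltW.
      by move: lh; rewrite -natr1 mulrDl mul1r.
    rewrite sumr_const card_ord -[_ *+ k]mulr_natl.
    rewrite (_ : h * _ = L * (k%:R * h) ^+ 2); last by ring.
    by rewrite ler_wpM2l// ler_pXn2r// ?nnegrE// mulr_ge0// ltW.
  have e3 : `|(k%:R * h - t) * dif i V n x| <= h * (2 * M / s).
    rewrite normrM ler_pM// ?dM// distrC ger0_norm ?subr_ge0//; lra.
  rewrite (_ : _ + _ = (avg i V n (x + t *: e i) - avg i V n (x + (k%:R * h) *: e i)) +
     (avg i V n (x + (k%:R * h) *: e i) - avg i V n x - (k%:R * h) * dif i V n x) +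
     (k%:R * h - t) * dif i V n x); last by ring.
  rewrite (le_trans (ler_normD _ _))//.
  have := ler_normD (avg i V n (x + t *: e i) - avg i V n (x + (k%:R * h) *: e i))
     (avg i V n (x + (k%:R * h) *: e i) - avg i V n x - (k%:R * h) * dif i V n x).
  by move: e1 e2 e3; rewrite mulrDl [h * _]mulrC; lra.
exists (2 * L) => x t; case: (leP 0 t) => t0.
  by rewrite (le_trans (pos x t t0))// ler_wpM2r ?sqr_ge0//; lra.
have t1 : 0 <= - t by lra.
have := pos (x + t *: e i) (- t) t1; rewrite scaleNr addrK sqrrN => p1.
have := lims_lip x (t *: e i) dM dK; rewrite enorm_step [`|t|]ltr0_norm// => p2.
have p3 : `|t * (lims (dif i V) (x + t *: e i) - lims (dif i V) x)| <= L * t ^+ 2.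
  rewrite normrM ltr0_norm// (_ : L * _ = - t * (L * - t)); last by ring.
  by rewrite ler_wpM2l.
move: p1 p3; move: (lims (avg i V) x) (lims (avg i V) _) (lims (dif i V) x) (lims (dif i V) _).
move=> a b c f; rewrite !ler_norml => /andP[h1 h2] /andP[h3 h4].
apply/andP; split; lra.
Qed.

(** Two averages in a direction turn the second difference with the small step
    into the one with the fixed step. *)
Lemma avg_second_difference i V n x :
  avg i (avg i (fun n z => V n (z + mesh_step n *: e i) + V n (z - mesh_step n *: e i)
     - 2 * V n z)) n x = mesh_step n ^+ 2 * dif i (dif i V) n (x - mesh_step n *: e i).
Proof.
pose fw (W : nat -> 'rV[R]_d -> R) n z := W n (z + mesh_step n *: e i) - W n z.
have avg_fw W (m : nat) z : avg i (fw W) m z = mesh_step m * dif i W m z.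
  rewrite /fw; have := avg_step i W m z 1; rewrite big_ord1 mul1r mul0r scale0r addr0 => <-.
  rewrite /avg -mulrBr -sumrB; congr (_ * _); apply: eq_bigr => k _.
  by rewrite (addrAC z).
rewrite (_ : avg i (avg i _) n x = avg i (avg i (fw (fw V))) n (x - mesh_step n *: e i)).
  rewrite (_ : avg i (fw (fw V)) = fun (k : nat) z => mesh_step k * dif i (fw V) k z); last first.
    by apply/funext => k; apply/funext => z; exact: avg_fw.
  rewrite (_ : avg i _ n _ = mesh_step n * avg i (dif i (fw V)) n (x - mesh_step n *: e i)).
    rewrite -dif_avg (_ : avg i (fw V) = fun (k : nat) z => mesh_step k * dif i V k z).
      by rewrite /dif; ring.
    by apply/funext => k; apply/funext => z; exact: avg_fw.
  by rewrite /avg mulrCA; congr (_ * _); rewrite mulr_sumr.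
rewrite /avg; congr (_ * _); apply: eq_bigr => k _; congr (_ * _); apply: eq_bigr => k' _.
rewrite /fw; set a := (k%:R * _) *: _; set b := (k'%:R * _) *: _; set t := mesh_step n *: e i.
have -> : x - t + a + b + t = x + a + b.
  by rewrite (addrAC x) (addrAC (x + a)) subrK.
have -> : x - t + a + b = x + a + b - t by rewrite (addrAC x) (addrAC (x + a)).
by ring.
Qed.


Definition second_diff i V n z :=
  V n (z + mesh_step n *: e i) + V n (z - mesh_step n *: e i) - 2 * V n z.

Lemma avgs_second_diff i l V : avgs l (second_diff i V) = second_diff i (avgs l V).
Proof.
elim: l => //= j l ->; apply/funext => n; apply/funext => x.
rewrite /avg /second_diff mulrCA -!mulrDr -mulrBr; congr (_ * _).
rewrite mulr_sumr -big_split/= -sumrB; apply: eq_bigr => k _.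
by rewrite (addrAC x) (addrAC x (- _)).
Qed.

Lemma avgs_sum (I : Type) (r : seq I) l (V : I -> nat -> 'rV[R]_d -> R) :
  avgs l (fun n x => \sum_(k <- r) V k n x) = fun n x => \sum_(k <- r) avgs l (V k) n x.
Proof.
elim: l => //= j l ->; apply/funext => n; apply/funext => x.
rewrite /avg exchange_big/= mulr_sumr; apply: eq_bigr => k _.
by rewrite mulr_sumr.
Qed.

Lemma lims_sum (I : Type) (r : seq I) (V : I -> nat -> 'rV[R]_d -> R) (M : R) :
  (forall k, bounded_seq M (V k)) ->
  lims (fun n x => \sum_(k <- r) V k n x) = fun x => \sum_(k <- r) lims (V k) x.
Proof.
move=> h; apply/funext => x; elim: r => [|a r IH].
  rewrite big_nil -[RHS](ulim_cst UU); congr ulim; apply/funext => n.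
  by rewrite big_nil.
rewrite big_cons -IH -(ulimD UU (M := M) (N := (size r)%:R * M)).
- by congr ulim; apply/funext => n; rewrite big_cons.
- by move=> n; exact: h.
move=> n; elim: r {IH} => [|b r IH] /=; first by rewrite big_nil normr0 mul0r.
rewrite big_cons (le_trans (ler_normD _ _))// -natr1 mulrDl mul1r addrC lerD//.
exact: h.
Qed.

Section Words.
Variables (W : nat -> 'rV[R]_d -> R) (M0 K0 : R).
Hypothesis K0_ge0 : 0 <= K0.
Hypothesis W_bounded : bounded_seq M0 W.
Hypothesis W_lip : coarse_lip K0 W.

Lemma difs_reg m : exists M, exists2 K, 0 <= K &
  bounded_seq M (difs m W) /\ coarse_lip K (difs m W).
Proof.
elim: m => [|i m [M [K K1 [hM hK]]]]; first by exists M0, K0.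
exists (2 * M / s), (2 * K / s); first by rewrite divr_ge0 ?mulr_ge0// ltW.
by split; [exact: dif_bounded|exact: dif_lip].
Qed.

(** Each letter of the first word stands for one averaging, each letter of the
    second for one difference quotient, so that all the derivatives of a
    smoothed function are again of this form. *)
Definition smoothed l m : 'rV[R]_d -> R := lims (avgs l (difs m W)).

Lemma smoothed_reg l m : exists M,
  (forall x, `|smoothed l m x| <= M) /\
  (forall x y, `|smoothed l m (x + y) - smoothed l m x| <= M * enorm y).
Proof.
have [M [K K1 [hM hK]]] := difs_reg m.
have hM' := avgs_bounded l hM; have hK' := avgs_lip l hK.
exists (Num.max M K); split => [x|x y].
  by rewrite (le_trans (lims_bounded _ hM'))// le_max lexx.
rewrite (le_trans (lims_lip _ _ hM' hK'))// ler_wpM2r ?enorm_ge0//.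
by rewrite le_max lexx orbT.
Qed.

Lemma smoothed_pder l m i : i \in l ->
  pder (smoothed l m) (smoothed (rem i l) (i :: m)) i.
Proof.
move=> il; have [M [K K1 [hM hK]]] := difs_reg m.
rewrite /smoothed (avgs_rem _ il) /= -dif_avgs.
exact: (lims_avg_pder _ K1 (avgs_bounded _ hM) (avgs_lip _ hK)).
Qed.

End Words.

End Averages.

(** The second derivatives of the smoothed solutions are limits of averaged
    second differences, hence satisfy the equation up to the oscillation of the
    right-hand side over the range of the averages. *)
Lemma smoothed_equation (R : realType) (d : nat) (U : set_system nat)
  (UU : UltraFilter U) (sub : \oo `<=` U) (s : R) (s_gt0 : 0 < s)
  (W : nat -> 'rV[R]_d -> R) (M K Lf : R) (f : 'rV[R]_d -> R) (x : 'rV[R]_d) :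
  0 <= K -> bounded_seq M W -> coarse_lip s K W ->
  (forall y s, `|f (y + s) - f y| <= Lf * enorm s) -> 0 <= Lf ->
  (forall n y, enorm (y - x) <= (3 * d)%:R * s ->
    dlap (mesh_step s n) (W n) y = - (mesh_step s n ^+ 2 * f y)) ->
  `|\sum_i smoothed U s W (rem i (rem i (triple d))) [:: i; i] x + f x| <=
     Lf * ((3 * d)%:R * s).
Proof.
move=> K0 WM WK fL Lf0 eqn.
pose H i := avgs s (rem i (rem i (triple d))) (difs s [:: i; i] W).
have WM2 i : bounded_seq (2 * (2 * M / s) / s) (H i).
  by apply: avgs_bounded; apply: dif_bounded => //; exact: dif_bounded.
have WK2 i : coarse_lip s (2 * (2 * K / s) / s) (H i).
  by apply: avgs_lip => //; apply: dif_lip => //; exact: dif_lip.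
set K2 := 2 * (2 * K / s) / s in WK2.
have sumE : \sum_i smoothed U s W (rem i (rem i (triple d))) [:: i; i] x =
    lims U (fun n x => \sum_i H i n x) x.
  by rewrite (lims_sum UU _ WM2).
have -> : \sum_i smoothed U s W (rem i (rem i (triple d))) [:: i; i] x + f x =
    lims U (fun n x => \sum_i H i n x + f x) x.
  have bs n : `|\sum_i H i n x| <= \sum_(i < d) (2 * (2 * M / s) / s).
    by rewrite (le_trans (ler_norm_sum _ _ _))// ler_sum// => i _; exact: WM2.
  rewrite sumE /lims (ulimD UU (M := \sum_(i < d) (2 * (2 * M / s) / s)) (N := `|f x|))//.
  by rewrite (ulim_cst UU).
apply: (ulim_norm UU sub (M := \sum_(i < d) (2 * (2 * M / s) / s) + `|f x|)
   (eps := fun n => (d%:R * (K2 * 2)) * mesh_step s n)).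
- move=> n; rewrite (le_trans (ler_normD _ _))// lerD2r.
  by rewrite (le_trans (ler_norm_sum _ _ _))// ler_sum// => i _; exact: WM2.
- exact: mesh_step_cvg.
move=> n; have h0 := mesh_step_gt0 s_gt0 n; set h := mesh_step s n in h0 *.
have key : `|\sum_i H i n (x - h *: delta_mx 0 i) + f x| <= Lf * ((3 * d)%:R * s).
  have E : avgs s (triple d) (fun n z => \sum_i second_diff s i W n z) n x =
      h ^+ 2 * \sum_i H i n (x - h *: delta_mx 0 i).
    rewrite avgs_sum mulr_sumr; apply: eq_bigr => i _.
    rewrite (avgs_rem _ _ (mem_triple1 i)) (avgs_rem _ _ (mem_triple2 i i)).
    rewrite avgs_second_diff (avg_second_difference s_gt0) -/h; congr (_ * _).
    by rewrite /H /= !dif_avgs.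
  have B := @avgs_bound _ _ _ s_gt0 (triple d)
    (fun n z => \sum_i second_diff s i W n z) n x (- (h ^+ 2 * f x))
    (h ^+ 2 * (Lf * ((3 * d)%:R * s))).
  move: B; rewrite size_triple E opprK -mulrDr normrM ger0_norm ?sqr_ge0//.
  rewrite ler_pM2l ?exprn_gt0//; apply => y yx.
  have -> : \sum_i second_diff s i W n y = dlap h (W n) y by [].
  rewrite eqn// -/h addrC -mulrBr normrM ger0_norm ?sqr_ge0// ler_wpM2l ?sqr_ge0//.
  rewrite distrC -{1}(subrK x y) (addrC _ x) (le_trans (fL _ _))//.
  by rewrite ler_wpM2l.
have diff : `|\sum_i H i n x - \sum_i H i n (x - h *: delta_mx 0 i)| <=
    d%:R * (K2 * 2) * h.
  rewrite -sumrB (le_trans (ler_norm_sum _ _ _))//.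
  apply: (@le_trans _ _ (\sum_(i < d) (K2 * (h + h)))).
    apply: ler_sum => i _; rewrite distrC (le_trans (WK2 i n x _))//.
    by rewrite enormN enorm_step ger0_norm// ltW.
  by rewrite sumr_const card_ord -[_ *+ d]mulr_natl le_eqVlt; apply/orP; left; apply/eqP; ring.
rewrite (_ : _ + f x = (\sum_i H i n (x - h *: delta_mx 0 i) + f x) +
   (\sum_i H i n x - \sum_i H i n (x - h *: delta_mx 0 i))); last by ring.
by rewrite (le_trans (ler_normD _ _))// lerD.
Qed.

(** The derivatives are carried along explicitly, as difference quotients give
    them; the third ones only serve to make the second ones regular. *)
Definition C3 (R : realType) d (G0 : 'rV[R]_d -> R) (G1 : 'I_d -> 'rV[R]_d -> R)
    (G2 : 'I_d -> 'I_d -> 'rV[R]_d -> R)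
    (G3 : 'I_d -> 'I_d -> 'I_d -> 'rV[R]_d -> R) : Prop :=
  [/\ forall i, pder G0 (G1 i) i, forall i j, pder (G1 i) (G2 i j) j,
      forall i j k, pder (G2 i j) (G3 i j k) k,
      forall i j k x, [/\ G2 i j x = G2 j i x, G3 i j k x = G3 j i k x &
        G3 i j k x = G3 i k j x] &
      exists M, forall i j k x y, [/\ `|G0 x| <= M, `|G1 i x| <= M, `|G2 i j x| <= M,
        `|G3 i j k x| <= M & [/\ `|G0 (x + y) - G0 x| <= M * enorm y,
        `|G1 i (x + y) - G1 i x| <= M * enorm y,
        `|G2 i j (x + y) - G2 i j x| <= M * enorm y &
        `|G3 i j k (x + y) - G3 i j k x| <= M * enorm y]]].

(** Differentiating in a direction replaces one of its averages by a difference
    quotient; averages and difference quotients commute, hence so do the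
    derivatives. *)
Lemma smoothed_C3 (R : realType) (d : nat) (U : set_system nat)
  (UU : UltraFilter U) (sub : \oo `<=` U) (s : R) (s_gt0 : 0 < s)
  (W : nat -> 'rV[R]_d -> R) (M K : R) : 0 <= K ->
  bounded_seq M W -> coarse_lip s K W ->
  C3 (smoothed U s W (triple d) [::])
     (fun i => smoothed U s W (rem i (triple d)) [:: i])
     (fun i j => smoothed U s W (rem j (rem i (triple d))) [:: j; i])
     (fun i j k => smoothed U s W (rem k (rem j (rem i (triple d)))) [:: k; j; i]).
Proof.
move=> K0 WM WK; split.
- by move=> i; apply: (smoothed_pder UU sub s_gt0 K0 WM WK); exact: mem_triple1.
- by move=> i j; apply: (smoothed_pder UU sub s_gt0 K0 WM WK); exact: mem_triple2.
- by move=> i j k; apply: (smoothed_pder UU sub s_gt0 K0 WM WK); exact: mem_triple3.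
- move=> i j k x; split; first by rewrite rem_remC /smoothed difs_rot.
    by rewrite (rem_remC i j) /smoothed [difs s [:: k; j; i] W]/= (difC s j i).
  by rewrite rem_remC /smoothed difs_rot.
have [N hN] : exists N : seq 'I_d -> seq 'I_d -> R, forall l m,
    (forall x, `|smoothed U s W l m x| <= N l m) /\
    (forall x y, `|smoothed U s W l m (x + y) - smoothed U s W l m x| <= N l m * enorm y).
  have h l m := smoothed_reg UU sub s_gt0 K0 WM WK l m.
  exists (fun l m => projT1 (cid (h l m))) => l m.
  by case: (cid (h l m)).
have N0 l m : 0 <= N l m by have [h _] := hN l m; apply: le_trans (h 0).
pose S0 := N (triple d) [::].
pose S1 := \sum_i N (rem i (triple d)) [:: i].
pose S2 := \sum_i \sum_j N (rem j (rem i (triple d))) [:: j; i].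
pose S3 := \sum_i \sum_j \sum_k N (rem k (rem j (rem i (triple d)))) [:: k; j; i].
exists (S0 + S1 + S2 + S3) => i j k x y.
have b0 : 0 <= S0 by exact: N0.
have b1 : 0 <= S1 by apply: sumr_ge0.
have b2 : 0 <= S2 by apply: sumr_ge0 => a _; apply: sumr_ge0.
have b3 : 0 <= S3.
  by apply: sumr_ge0 => a _; apply: sumr_ge0 => b _; apply: sumr_ge0.
have a1 : N (rem i (triple d)) [:: i] <= S1.
  by rewrite /S1 (bigD1 i)//= lerDl sumr_ge0.
have a2 : N (rem j (rem i (triple d))) [:: j; i] <= S2.
  rewrite /S2 (bigD1 i)//= (bigD1 j)//= -addrA lerDl addr_ge0 ?sumr_ge0// => a _.
  exact: sumr_ge0.
have a3 : N (rem k (rem j (rem i (triple d)))) [:: k; j; i] <= S3.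
  rewrite /S3 (bigD1 i)//= (bigD1 j)//= (bigD1 k)//= -!addrA lerDl.
  rewrite !addr_ge0 ?sumr_ge0// => a _; rewrite ?sumr_ge0// => b _; exact: sumr_ge0.
have [h0 l0] := hN (triple d) [::].
have [h1 l1] := hN (rem i (triple d)) [:: i].
have [h2 l2] := hN (rem j (rem i (triple d))) [:: j; i].
have [h3 l3] := hN (rem k (rem j (rem i (triple d)))) [:: k; j; i].
have y0 := enorm_ge0 y.
split; [| | | |split].
- by apply: le_trans (h0 x) _; rewrite /S0 in b0 *; lra.
- by apply: le_trans (h1 x) _; lra.
- by apply: le_trans (h2 x) _; lra.
- by apply: le_trans (h3 x) _; lra.
- by apply: le_trans (l0 x y) _; rewrite ler_wpM2r// /S0 in b0 *; lra.
- by apply: le_trans (l1 x y) _; rewrite ler_wpM2r//; lra.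
- by apply: le_trans (l2 x y) _; rewrite ler_wpM2r//; lra.
- by apply: le_trans (l3 x y) _; rewrite ler_wpM2r//; lra.
Qed.

Section SmoothSolution.
Variables (R : realType) (d : nat) (Hs : seq ('rV[R]_d * R)) (rho bmax F Lf : R).
Variables (f : 'rV[R]_d -> R).
Hypothesis d_gt0 : (0 < d)%N.
Hypothesis unitH : forall p, p \in Hs -> dotp p.1 p.1 = 1.
Hypothesis Hs_nonempty : Hs != [::].
Hypothesis rho_ge0 : 0 <= rho.
Hypothesis polytope_bounded : forall x, polytope Hs x -> enorm x <= rho.
Hypothesis offset_bounded : forall p, p \in Hs -> `|p.2| <= bmax.
Hypotheses (F_ge0 : 0 <= F) (Lf_ge0 : 0 <= Lf).
Hypothesis f_le : forall x, `|f x| <= F.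
Hypothesis f_lip : forall x s, `|f (x + s) - f x| <= Lf * enorm s.

Let fc := face_const rho bmax F.
Let K := lip_const rho bmax F Lf.

(** All properties hold for the solutions of the scheme up to the step, and the
    averages, which sample points at distance at most 3 d s, pass them on.  What
    matters later is that the Lipschitz constant does not depend on s, and that
    tangential differences near a face carry the distance to it as a factor. *)
Lemma smooth_solution s : 0 < s -> s <= 1 -> exists G0 G1 G2 G3,
  [/\ @C3 R d G0 G1 G2 G3,
   forall x y, `|G0 (x + y) - G0 x| <= K * enorm y,
   forall x, (forall y, enorm (y - x) <= (3 * d)%:R * s -> polytope Hs y) ->
     `|\sum_i G2 i i x + f x| <= Lf * ((3 * d)%:R * s),
   forall p x y r, p \in Hs -> 0 < r -> (3 * d)%:R * s < gap p x ->
     (forall q, q \in Hs -> q != p -> 2 * r + (3 * d)%:R * s <= gap q x) ->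
     dotp p.1 y = 0 -> enorm y < r ->
     `|G0 (x + y) - G0 x| <= K * enorm y * ((d%:R / r ^+ 2 + 1) * (bmax + rho + 2)) *
        (gap p x + (3 * d)%:R * s) &
   forall p x t, p \in Hs -> 0 <= t -> gap p x <= t -> `|G0 x| <= fc * (t + (3 * d)%:R * s)].
Proof.
move=> s0 s1.
have [U [UU sub]] := @ultraFilterLemma nat \oo _.
have h1 n : mesh_step s n <= 1 by rewrite (le_trans (mesh_step_le s0 n)).
have ex n := scheme_exists d_gt0 rho_ge0 polytope_bounded (mesh_step_gt0 s0 n) (h1 n) F_ge0 f_le.
pose W n := projT1 (cid (ex n)).
have Woff n x : ~ polytope Hs x -> W n x = 0.
  by rewrite /W; case: cid => w [] /= h _ _; exact: h.
have Wbnd n : exists M, forall x, `|W n x| <= M.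
  by rewrite /W; case: cid => w [] /= _ h _; exact: h.
have Weq n x : polytope Hs x -> dlap (mesh_step s n) (W n) x = - (mesh_step s n ^+ 2 * f x).
  by rewrite /W; case: cid => w [] /= _ _ h; exact: h.
have fc0 : 0 <= fc by apply: (face_const_ge0 rho_ge0 offset_bounded F_ge0 Hs_nonempty).
have K0 : 0 <= K.
  apply: le_trans (lip_const_ge rho_ge0 offset_bounded F_ge0 Lf_ge0 Hs_nonempty).
  by rewrite addr_ge0.
have Wface n p x : p \in Hs -> polytope Hs x ->
    `|W n x| <= fc * (gap p x + mesh_step s n).
  move=> pH Dx; have [M hM] := Wbnd n.
  exact: (scheme_face unitH rho_ge0 polytope_bounded offset_bounded (mesh_step_gt0 s0 n)
    (h1 n) F_ge0 f_le (Woff n) hM (Weq n) pH Dx).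
have WK : coarse_lip s K W.
  move=> n x y; have [M hM] := Wbnd n.
  exact: (scheme_lip d_gt0 unitH rho_ge0 polytope_bounded offset_bounded (mesh_step_gt0 s0 n)
    (h1 n) F_ge0 Lf_ge0 f_le f_lip (Woff n) hM (Weq n) Hs_nonempty).
have Wtan n p x0 y r : p \in Hs -> polytope Hs x0 -> dotp p.1 y = 0 ->
   0 < r -> enorm y + mesh_step s n < r ->
   (forall q, q \in Hs -> q != p -> 2 * r <= gap q x0) ->
   `|W n (x0 + y) - W n x0| <=
     K * (enorm y + mesh_step s n) * ((d%:R / r ^+ 2 + 1) * (bmax + rho + 2)) *
     (gap p x0 + mesh_step s n).
  move=> *; have [M hM] := Wbnd n.
  exact: (scheme_tangential d_gt0 unitH rho_ge0 polytope_bounded offset_bounded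
    (mesh_step_gt0 s0 n) (h1 n) F_ge0 Lf_ge0 f_le f_lip (Woff n) hM (Weq n) Hs_nonempty).
have [p0 p0H] : exists p, p \in Hs by case: Hs Hs_nonempty => // p l _; exists p; rewrite mem_head.
have b0 := bmax_ge0 offset_bounded p0H.
have [M ME] : exists M, M = fc * (bmax + rho + 1) by eexists.
have WM : bounded_seq M W.
  rewrite ME.
  move=> n x; case: (pselect (polytope Hs x)) => Dx; last first.
    by rewrite Woff// normr0 mulr_ge0// !addr_ge0.
  rewrite (le_trans (Wface n p0 x p0H Dx))// ler_wpM2l// lerD//.
  exact: (gap_le unitH polytope_bounded offset_bounded).
have M0 : 0 <= M by apply: le_trans (WM 0%N 0).
have S0 : 0 <= (3 * d)%:R * s by rewrite mulr_ge0// ltW.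
exists (smoothed U s W (triple d) [::]),
  (fun i => smoothed U s W (rem i (triple d)) [:: i]),
  (fun i j => smoothed U s W (rem j (rem i (triple d))) [:: j; i]),
  (fun i j k => smoothed U s W (rem k (rem j (rem i (triple d)))) [:: k; j; i]).
split.
- exact: (smoothed_C3 UU sub s0 K0 WM WK).
- by move=> x y; exact: (lims_lip UU sub _ _ (avgs_bounded _ _ WM) (avgs_lip _ WK)).
- move=> x xD; apply: (smoothed_equation UU sub s0 K0 WM WK f_lip Lf_ge0).
  by move=> n y yx; apply: Weq; exact: xD.
- move=> p x y r pH r0 gx other py yr.
  have [T TE] : exists T, T = (d%:R / r ^+ 2 + 1) * (bmax + rho + 2) by eexists.
  have T0 : 0 <= T by rewrite TE mulr_ge0 ?addr_ge0// divr_ge0// sqr_ge0.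
  have [g gE] : exists g, g = gap p x + (3 * d)%:R * s by eexists.
  have g0 : 0 <= g by rewrite gE; lra.
  have y0 := enorm_ge0 y.
  have ry : 0 < r - enorm y by rewrite subr_gt0.
  rewrite -TE -gE.
  have [c cE] : exists c, c = K * T * (enorm y + g + 1) + 2 * M / (r - enorm y) by eexists.
  apply: (lims_diff UU sub (s := s) (M := M) (c := c)); first exact: (avgs_bounded _ _ WM).
  move=> n; have h0 := mesh_step_gt0 s0 n; have hh := h1 n.
  set h := mesh_step s n in h0 hh *.
  have -> : avgs s (triple d) (difs s [::] W) n (x + y) - avgs s (triple d) (difs s [::] W) n x =
      avgs s (triple d) (fun n z => W n (z + y) - W n z) n x - 0.
    rewrite subr0 /=; elim: (triple d) x {gx other g gE g0 c cE} => //= i l IH x.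
    rewrite /avg -mulrBr -sumrB; congr (_ * _); apply: eq_bigr => k _.
    by rewrite (addrAC x) IH.
  apply: (avgs_bound s0) => z; rewrite size_triple subr0 => zx.
  have c1 : 0 <= K * T * (enorm y + g + 1) by rewrite !mulr_ge0// !addr_ge0.
  have c2 : 0 <= 2 * M / (r - enorm y) by apply: divr_ge0; [exact: mulr_ge0|exact: ltW].
  have c3 : 0 <= K * enorm y * T * g by rewrite !mulr_ge0.
  have cH : c * h = K * T * (enorm y + g + 1) * h + 2 * M / (r - enorm y) * h.
    by rewrite cE mulrDl.
  have c1h := mulr_ge0 c1 (ltW h0); have c2h := mulr_ge0 c2 (ltW h0).
  case: (ltP (enorm y + h) r) => yh; last first.
    have b1 : `|W n (z + y) - W n z| <= 2 * M / (r - enorm y) * h.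
      rewrite mulrAC ler_pdivlMr//.
      apply: (@le_trans _ _ (2 * M * (r - enorm y))).
        rewrite ler_wpM2r ?(ltW ry)// (le_trans (ler_normB _ _))//.
        by have := WM n (z + y); have := WM n z; lra.
      by rewrite ler_wpM2l ?mulr_ge0//; lra.
    by apply: (le_trans b1); rewrite cH; lra.
  have gz q : q \in Hs -> gap q x - (3 * d)%:R * s <= gap q z.
    move=> qH; have := gap_lip unitH x (z - x) qH.
    by rewrite addrCA subrr addr0 ler_distl => /andP[h2 _]; lra.
  have gpz : gap p z <= g.
    have := gap_lip unitH x (z - x) pH.
    by rewrite addrCA subrr addr0 ler_distl gE => /andP[_ h2]; lra.
  have Dz : polytope Hs z.
    move=> q qH; have [qp|qp] := eqVneq q p; first by have := gz p pH; rewrite qp; lra.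
    by have := gz q qH; have := other q qH qp; lra.
  have := Wtan n p z y r pH Dz py r0 yh.
  have ot q : q \in Hs -> q != p -> 2 * r <= gap q z.
    by move=> qH qp; have := gz q qH; have := other q qH qp; lra.
  move=> /(_ ot) /le_trans; apply; rewrite -/h -TE.
  apply: (@le_trans _ _ (K * (enorm y + h) * T * (g + h))).
    by rewrite ler_wpM2l ?lerD2r// !mulr_ge0// addr_ge0// ltW.
  rewrite (_ : K * (enorm y + h) * T * (g + h) = K * enorm y * T * g +
    K * T * (enorm y + g + h) * h); last by ring.
  rewrite lerD2l cH.
  have : K * T * (enorm y + g + h) * h <= K * T * (enorm y + g + 1) * h.
    by rewrite ler_pM2r// ler_wpM2l ?mulr_ge0// lerD2l.
  by lra.
move=> p x t pH t0 gx.
apply: (ulim_norm UU sub (M := M) (eps := fun n => fc * mesh_step s n)).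
- by move=> n; exact: (avgs_bounded _ _ WM).
- exact: mesh_step_cvg.
move=> n /=; rewrite -[avgs _ _ _ _ _]subr0; apply: (avgs_bound s0) => z.
rewrite size_triple subr0 -mulrDr => zx.
have h0 := mesh_step_gt0 s0 n.
case: (pselect (polytope Hs z)) => Dz; last first.
  by rewrite Woff// normr0 mulr_ge0// !addr_ge0// ltW.
rewrite (le_trans (Wface n p z pH Dz))// ler_wpM2l// lerD2r.
have := gap_lip unitH x (z - x) pH.
by rewrite addrCA subrr addr0 ler_distl => /andP[_ h2]; lra.
Qed.

End SmoothSolution.

(** * Calculus with uniform remainders *)

Section Calculus.
Variables (R : realType) (d : nat).
Implicit Types (F G : 'rV[R]_d -> R) (x y v : 'rV[R]_d).
Local Notation e i := (delta_mx 0 i : 'rV[R]_d).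

Definition blip F := exists M, forall x y, `|F x| <= M /\ `|F (x + y) - F x| <= M * enorm y.

Lemma blip_cst c : blip (fun=> c).
Proof.
exists `|c| => x y; split => //; rewrite subrr normr0.
by rewrite mulr_ge0// enorm_ge0.
Qed.

Lemma blipD F G : blip F -> blip G -> blip (fun x => F x + G x).
Proof.
move=> [M hM] [N hN]; exists (M + N) => x y.
have [h1 h2] := hM x y; have [h3 h4] := hN x y; split.
  by rewrite (le_trans (ler_normD _ _))// lerD.
rewrite (_ : _ - _ = (F (x + y) - F x) + (G (x + y) - G x)); last by ring.
by rewrite (le_trans (ler_normD _ _))// mulrDl lerD.
Qed.

Lemma blipM F G : blip F -> blip G -> blip (fun x => F x * G x).
Proof.
move=> [M hM] [N hN].
have M0 : 0 <= M by have [h _] := hM 0 0; apply: le_trans h.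
have N0 : 0 <= N by have [h _] := hN 0 0; apply: le_trans h.
exists (M * N + M * N) => x y; have [h1 h2] := hM x y; have [h3 h4] := hN x y.
have [h5 _] := hN (x + y) 0; split.
  by rewrite normrM (le_trans (ler_pM _ _ h1 h3))// lerDl mulr_ge0.
rewrite (_ : _ - _ = (F (x + y) - F x) * G (x + y) + F x * (G (x + y) - G x)); last by ring.
rewrite (le_trans (ler_normD _ _))// !normrM mulrDl lerD//.
  by rewrite mulrAC ler_pM.
by rewrite -mulrA ler_pM.
Qed.

Lemma blipZ c F : blip F -> blip (fun x => c * F x).
Proof. by move=> hF; apply: blipM => //; exact: blip_cst. Qed.

Lemma blipN F : blip F -> blip (fun x => - F x).
Proof.
by move=> /(blipZ (-1)); rewrite (_ : (fun x => -1 * F x) = fun x => - F x)//;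
  apply/funext => x; rewrite mulN1r.
Qed.

Lemma blipB F G : blip F -> blip G -> blip (fun x => F x - G x).
Proof. by move=> hF hG; apply: blipD => //; exact: blipN. Qed.

Lemma blip_sum (I : Type) (r : seq I) (P : pred I) (F : I -> 'rV[R]_d -> R) :
  (forall i, blip (F i)) -> blip (fun x => \sum_(i <- r | P i) F i x).
Proof.
move=> h; elim: r => [|a r IH].
  by rewrite (_ : (fun _ => _) = fun=> 0); [exact: blip_cst|apply/funext => x; rewrite big_nil].
case Pa: (P a); last first.
  by rewrite (_ : (fun _ => _) = fun x => \sum_(i <- r | P i) F i x)//; apply/funext => x;
    rewrite big_cons Pa.
rewrite (_ : (fun _ => _) = fun x => F a x + \sum_(i <- r | P i) F i x); last first.
  by apply/funext => x; rewrite big_cons Pa.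
exact: blipD.
Qed.

Lemma lip_continuous F M : (forall x y, `|F (x + y) - F x| <= M * enorm y) -> continuous F.
Proof.
move=> h x A /nbhs_ballP[eps /= eps0 hA].
have M0 : 0 <= `|M| + 1 by rewrite addr_ge0.
have MM : 0 < (`|M| + 1) * (d%:R + 1) by rewrite mulr_gt0// ltr_wpDl.
apply/nbhs_ballP; exists (eps / ((`|M| + 1) * (d%:R + 1))); first by rewrite /= divr_gt0.
move=> y [e0 hy]; apply: hA; rewrite /ball/=.
rewrite distrC (_ : y = x + (y - x)); last by rewrite addrCA subrr addr0.
rewrite (le_lt_trans (h _ _))//.
have yx : enorm (y - x : 'rV[R]_d) <= d%:R * (eps / ((`|M| + 1) * (d%:R + 1))).
  rewrite (le_trans (enorm_le_sum _))//.
  rewrite (_ : d%:R * _ = \sum_(i < d) (eps / ((`|M| + 1) * (d%:R + 1)))); last first.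
    by rewrite sumr_const card_ord -[RHS]mulr_natl.
  apply: ler_sum => i _; rewrite !mxE distrC ltW//; exact: (hy 0 i).
apply: (@le_lt_trans _ _ ((`|M| + 1) * (d%:R * (eps / ((`|M| + 1) * (d%:R + 1)))))).
  apply: (@le_trans _ _ ((`|M| + 1) * enorm (y - x))); last by rewrite ler_wpM2l.
  by rewrite ler_wpM2r ?enorm_ge0// (le_trans (ler_norm _))// lerDl.
rewrite (_ : (`|M| + 1) * _ = eps * (d%:R / (d%:R + 1))); last first.
  have [D DE] : exists D : R, D = d%:R by eexists.
  have [A' AE] : exists A' : R, A' = `|M| by eexists.
  have D0 : 0 <= D by rewrite DE.
  have A0 : 0 <= A' by rewrite AE.
  rewrite -DE -AE; field; rewrite !gt_eqF//; lra.
by rewrite gtr_pMr// ltr_pdivrMr ?ltr_wpDl// mul1r ltrDl.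
Qed.

Lemma blip_mfun F : blip F -> mfun_rV F.
Proof.
move=> [M h]; apply: mfun_continuous; apply: (@lip_continuous _ M) => x y.
by case: (h x y).
Qed.

Lemma blip_adm F B : blip F -> (forall x, F x <> 0 -> cube 0 B x) -> adm F.
Proof.
move=> bF h; have [M hM] := bF; apply: (@adm_intro _ _ _ M B) => //.
  exact: blip_mfun.
by move=> x; case: (hM x 0).
Qed.

Lemma pderD F F' G G' i : pder F F' i -> pder G G' i ->
  pder (fun x => F x + G x) (fun x => F' x + G' x) i.
Proof.
move=> [C hC] [D hD]; exists (C + D) => x t.
rewrite (_ : _ - _ - _ = (F (x + t *: e i) - F x - t * F' x) +
  (G (x + t *: e i) - G x - t * G' x)); last by ring.
by rewrite (le_trans (ler_normD _ _))// mulrDl lerD.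
Qed.

Lemma pder_cst c i : pder (fun _ : 'rV[R]_d => c) (fun=> 0) i.
Proof. by exists 0 => x t; rewrite subrr mulr0 subrr normr0 mul0r. Qed.

Lemma pderM F F' G G' i : blip F -> blip G -> pder F F' i -> pder G G' i ->
  pder (fun x => F x * G x) (fun x => F' x * G x + F x * G' x) i.
Proof.
move=> [M hM] [N hN] [C hC] [D hD].
have M0 : 0 <= M by have [h _] := hM 0 0; apply: le_trans h.
have N0 : 0 <= N by have [h _] := hN 0 0; apply: le_trans h.
exists (C * N + M * D + M * N) => x t.
rewrite (_ : _ - _ - _ = (F (x + t *: e i) - F x - t * F' x) * G x +
  F x * (G (x + t *: e i) - G x - t * G' x) +
  (F (x + t *: e i) - F x) * (G (x + t *: e i) - G x)); last by ring.
have [h1 h2] := hM x (t *: e i); have [h3 h4] := hN x (t *: e i).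
rewrite enorm_step in h2 h4.
rewrite (le_trans (ler_normD _ _))// [leRHS]mulrDl lerD//.
  rewrite (le_trans (ler_normD _ _))// [leRHS]mulrDl !normrM lerD//.
    by rewrite (mulrAC C) ler_pM.
  by rewrite -mulrA ler_pM.
rewrite normrM (_ : M * N * t ^+ 2 = (M * `|t|) * (N * `|t|)); first by rewrite ler_pM.
by rewrite -[t ^+ 2]real_normK ?num_real//; ring.
Qed.

Lemma pderZ c F F' i : pder F F' i -> pder (fun x => c * F x) (fun x => c * F' x) i.
Proof.
move=> [C hC]; exists (`|c| * C) => x t.
rewrite (_ : _ - _ - _ = c * (F (x + t *: e i) - F x - t * F' x)); last by ring.
by rewrite normrM -mulrA ler_wpM2l.
Qed.

Lemma pder_sum (I : Type) (r : seq I) (F F' : I -> 'rV[R]_d -> R) i :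
  (forall k, pder (F k) (F' k) i) ->
  pder (fun x => \sum_(k <- r) F k x) (fun x => \sum_(k <- r) F' k x) i.
Proof.
move=> h; elim: r => [|a r IH].
  have := pder_cst 0 i; congr pder; apply/funext => x; by rewrite big_nil.
have := pderD (h a) IH; congr pder; apply/funext => x; by rewrite big_cons.
Qed.

(** A derivative of a function with bounded support has zero integral: by
    translation invariance the difference quotients do. *)
Lemma J_pder0 F F' i B : pder F F' i -> blip F -> blip F' ->
  (forall x, F x <> 0 -> cube 0 B x) -> (forall x, F' x <> 0 -> cube 0 B x) -> J F' = 0.
Proof.
move=> [C hC] bF bF' sF sF'.
have aF := blip_adm bF sF; have aF' := blip_adm bF' sF'.
have C0 : 0 <= C.
  by have := hC 0 1; rewrite expr1n mulr1; apply: le_trans.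
pose B1 := `|B| + 2.
have key t : 0 < t -> t <= 1 -> t * `|J F'| <= (C * (2 * B1) ^+ d) * t ^+ 2.
  move=> t0 t1.
  have aT : adm (fun x => F (x + t *: e i)).
    have := adm_affine (t *: e i) ltr01 aF; rewrite (_ : (fun x => _) = fun x => F (x + t *: e i))//.
    by apply/funext => x; rewrite scale1r.
  have aR : adm (fun x => F (x + t *: e i) - F x - t * F' x).
    by apply: admB; [exact: admB|exact: admZ].
  have <- : `|J (fun x => F (x + t *: e i) - F x - t * F' x)| = t * `|J F'|.
    rewrite JB; [|exact: admB|exact: admZ].
    by rewrite JB// JZ// J_translate// subrr sub0r normrN normrM gtr0_norm.
  rewrite (le_trans (J_norm aR))//.
  rewrite (_ : C * (2 * B1) ^+ d * t ^+ 2 = J (fun x => (C * t ^+ 2) * \1_(cube 0 B1) x)); last first.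
    by rewrite JZ ?J_cube//; [ring|rewrite ltr_wpDl|exact: adm_cube].
  apply: J_le; [exact: adm_norm|apply: admZ; exact: adm_cube|move=> x].
  rewrite indicE; case: (pselect (cube 0 B1 x)) => xB.
    by rewrite mem_set// mulr1.
  have hB1 : B <= B1 by rewrite /B1 (le_trans (ler_norm B))// lerDl.
  have nF z : ~ cube 0 B z -> F z = 0 by move=> nz; apply: contrapT => /sF.
  have nF' z : ~ cube 0 B z -> F' z = 0 by move=> nz; apply: contrapT => /sF'.
  have nx : ~ cube 0 B x by move=> /(cube_le hB1).
  rewrite memNset// mulr0 nF ?nF// ?nF'// ?mulr0 ?subrr ?normr0// => xt; apply: xB => j.
  have := xt j; rewrite !mxE eqxx/= !subr0 /B1 => h1.
  have := ler_normB (x 0 j + t * (j == i)%:R) (t * (j == i)%:R); rewrite addrK => h2.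
  have h3 : `|t * (j == i)%:R| <= 1.
    by case: (j == i); rewrite ?mulr0 ?normr0 ?mulr1 ?gtr0_norm.
  by have := ler_norm B; lra.
apply/eqP; rewrite -normr_le0 leNgt; apply/negP => JF.
pose A := C * (2 * B1) ^+ d.
have A0 : 0 <= A by rewrite mulr_ge0// exprn_ge0// mulr_ge0// addr_ge0.
pose t := Num.min 1 (`|J F'| / (2 * (A + 1))).
have t0 : 0 < t by rewrite lt_min ltr01 divr_gt0// mulr_gt0// ltr_wpDl.
have t1 : t <= 1 by rewrite ge_min lexx.
have := key t t0 t1; rewrite -/A expr2 mulrA (mulrC t) ler_pM2r// => h1.
have : t <= `|J F'| / (2 * (A + 1)) by rewrite ge_min lexx orbT.
rewrite ler_pdivlMr; last by rewrite mulr_gt0// ltr_wpDl.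
by nra.
Qed.

(** The increments along the coordinate axes are added one after the other. *)
Lemma taylor1 (G0 : 'rV[R]_d -> R) (G1 : 'I_d -> 'rV[R]_d -> R) (M : R) :
  (forall i, pder G0 (G1 i) i) ->
  (forall i x y, `|G1 i (x + y) - G1 i x| <= M * enorm y) ->
  exists2 C, 0 <= C &
    forall x v, `|G0 (x + v) - G0 x - \sum_i v 0 i * G1 i x| <= C * enorm v ^+ 2.
Proof.
move=> hp hM.
have [N hN] : exists N, forall i x t, `|G0 (x + t *: e i) - G0 x - t * G1 i x| <= N * t ^+ 2.
  pose Ni i := projT1 (cid (hp i)).
  have hi i x t : `|G0 (x + t *: e i) - G0 x - t * G1 i x| <= Ni i * t ^+ 2.
    by rewrite /Ni; case: cid => N h /=; exact: h.
  have N0 i : 0 <= Ni i.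
    by have := hi i 0 1; rewrite expr1n mulr1; apply: le_trans.
  exists (\sum_i Ni i) => i x t; rewrite (le_trans (hi i x t))// ler_wpM2r ?sqr_ge0//.
  by rewrite (bigD1 i)//= lerDl sumr_ge0.
pose Q := `|N| + d%:R * `|M|.
have Q0 : 0 <= Q by rewrite addr_ge0// mulr_ge0.
pose part (r : seq 'I_d) (v : 'rV[R]_d) := \sum_(i <- r) v 0 i *: e i.
have partn r v : enorm (part r v) <= (size r)%:R * enorm v.
  elim: r => [|i r IH]; first by rewrite /part big_nil -(scale0r 0) enormZ normr0 !mul0r.
  rewrite /part big_cons (le_trans (enormD _ _))//= -natr1 mulrDl mul1r addrC lerD//.
  by rewrite enorm_step enorm_coord.
have main r x v : uniq r -> (size r <= d)%N ->
    `|G0 (x + part r v) - G0 x - \sum_(i <- r) v 0 i * G1 i x| <=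
      (size r)%:R * Q * enorm v ^+ 2.
  elim: r => [|i r IH] /=.
    by rewrite /part !big_nil addr0 subrr subr0 normr0 !mul0r.
  move=> /andP[_ ur] sr; have := IH ur (ltnW sr) => {}IH.
  rewrite /part !big_cons -/(part r v).
  rewrite (_ : x + (v 0 i *: e i + part r v) = (x + part r v) + v 0 i *: e i); last first.
    by rewrite addrAC addrA.
  have h1 := hN i (x + part r v) (v 0 i).
  have h2 : `|v 0 i * (G1 i (x + part r v) - G1 i x)| <= d%:R * `|M| * enorm v ^+ 2.
    rewrite normrM.
    apply: (@le_trans _ _ (enorm v * (`|M| * (d%:R * enorm v)))); last first.
      by rewrite le_eqVlt; apply/orP; left; apply/eqP; ring.
    rewrite ler_pM// ?enorm_coord// (le_trans (hM _ _ _))//.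
    apply: (@le_trans _ _ (`|M| * enorm (part r v))).
      by rewrite ler_wpM2r ?enorm_ge0// ler_norm.
    rewrite ler_wpM2l// (le_trans (partn _ _))// ler_wpM2r ?enorm_ge0// ler_nat.
    exact: ltnW.
  have h3 : N * v 0 i ^+ 2 <= `|N| * enorm v ^+ 2.
    apply: (@le_trans _ _ (`|N| * v 0 i ^+ 2)); first by rewrite ler_wpM2r ?sqr_ge0// ler_norm.
    rewrite ler_wpM2l// -real_normK ?num_real// ler_pXn2r// ?nnegrE ?enorm_ge0//.
    exact: enorm_coord.
  rewrite (_ : _ - _ - _ = (G0 (x + part r v) - G0 x - \sum_(j <- r) v 0 j * G1 j x) +
    ((G0 (x + part r v + v 0 i *: e i) - G0 (x + part r v) - v 0 i * G1 i (x + part r v)) +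
     (v 0 i * (G1 i (x + part r v) - G1 i x)))); last by ring.
  rewrite (le_trans (ler_normD _ _))// -natr1 mulrDl mulrDl mul1r lerD//.
  rewrite (le_trans (ler_normD _ _))// /Q mulrDl lerD//.
  exact: le_trans h3.
exists (d%:R * Q); first by rewrite mulr_ge0.
move=> x v; have := main (index_enum 'I_d) x v (index_enum_uniq _).
have sz : size (index_enum 'I_d) = d by rewrite -[RHS]size_enum_ord enumT.
rewrite sz => /(_ (leqnn _)); rewrite /part.
by rewrite -row_sum_delta.
Qed.


(** Pointwise Bochner formula in integrated form: the difference between the
    full Hessian and the Laplacian is the double divergence of the positive
    semidefinite matrix Q, so it can be moved onto a weight. *)
Definition bochner (G1 : 'I_d -> 'rV[R]_d -> R) i j x : R :=
  (i == j)%:R * (\sum_k G1 k x ^+ 2) - G1 i x * G1 j x.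

(** Two integrations by parts against the weight, each of them an instance of
    the vanishing of integrated derivatives. *)
Lemma bochner_identity (G0 : 'rV[R]_d -> R) (G1 : 'I_d -> 'rV[R]_d -> R)
    (G2 : 'I_d -> 'I_d -> 'rV[R]_d -> R) (G3 : 'I_d -> 'I_d -> 'I_d -> 'rV[R]_d -> R) (P0 : 'rV[R]_d -> R)
    (P1 : 'I_d -> 'rV[R]_d -> R) (P2 : 'I_d -> 'I_d -> 'rV[R]_d -> R) B :
  C3 G0 G1 G2 G3 -> blip P0 -> (forall i, blip (P1 i)) -> (forall i j, blip (P2 i j)) ->
  (forall i, pder P0 (P1 i) i) -> (forall i j, pder (P1 i) (P2 i j) j) ->
  (forall x, ~ cube 0 B x -> P0 x = 0 /\ (forall i, P1 i x = 0) /\ forall i j, P2 i j x = 0) ->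
  J (fun x => P0 x * (\sum_i \sum_j G2 i j x ^+ 2 - (\sum_i G2 i i x) ^+ 2)) =
  J (fun x => \sum_i \sum_j P2 i j x * bochner G1 i j x).
Proof.
move=> [_ p1 p2 sym [M hM]] bP0 bP1 bP2 dP0 dP1 supp.
have b1 i : blip (G1 i).
  by exists M => x y; have [_ h _ _ [_ h' _ _]] := hM i i i x y.
have b2 i j : blip (G2 i j).
  by exists M => x y; have [_ _ h _ [_ _ h' _]] := hM i j i x y.
have b3 i j k : blip (G3 i j k).
  by exists M => x y; have [_ _ _ h [_ _ _ h']] := hM i j k x y.
have supp0 (H : 'rV[R]_d -> R) : (forall x, ~ cube 0 B x -> H x = 0) ->
    forall x, H x <> 0 -> cube 0 B x.
  by move=> h x Hx; apply: contrapT => nx; apply: Hx; exact: h.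
(* the divergence of the rows of the matrix *)
pose A i x := \sum_j (G1 j x * G2 j i x - G1 i x * G2 j j x).
pose A' i x := \sum_j (G2 j i x * G2 j i x + G1 j x * G3 j i i x -
   (G2 i i x * G2 j j x + G1 i x * G3 j j i x)).
have bA i : blip (A i).
  by apply: blip_sum => j; apply: blipB; apply: blipM.
have bA' i : blip (A' i).
  by apply: blip_sum => j; apply: blipB; apply: blipD; apply: blipM.
have dA i : pder (A i) (A' i) i.
  apply: pder_sum => j.
  have h1 := pderM (b1 j) (b2 j i) (p1 j i) (p2 j i i).
  have h2 := pderZ (-1) (pderM (b1 i) (b2 j j) (p1 i i) (p2 j j i)).
  have := pderD h1 h2; congr pder; apply/funext => x; by ring.
have sA : forall i x, ~ cube 0 B x -> P0 x * A i x = 0.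
  by move=> i x nx; have [-> _] := supp _ nx; rewrite mul0r.
have JA i : J (fun x => P1 i x * A i x + P0 x * A' i x) = 0.
  apply: (@J_pder0 (fun x => P0 x * A i x) _ i B).
  - exact: pderM.
  - exact: blipM.
  - by apply: blipD; exact: blipM.
  - exact/supp0/sA.
  - by apply: supp0 => x nx; have [-> [-> _]] := supp _ nx; rewrite !mul0r addr0.
pose Q i j x := bochner G1 i j x.
pose Q' i j x := (i == j)%:R * (\sum_k (G2 k j x * G1 k x + G1 k x * G2 k j x)) -
  (G2 i j x * G1 j x + G1 i x * G2 j j x).
have bQ i j : blip (Q i j).
  apply: blipB; last exact: blipM.
  by apply: blipZ; apply: blip_sum => k; apply: blipM.
have bQ' i j : blip (Q' i j).
  apply: blipB; last by apply: blipD; exact: blipM.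
  by apply: blipZ; apply: blip_sum => k; apply: blipD; apply: blipM.
have dQ i j : pder (Q i j) (Q' i j) j.
  have h1 := pderM (b1 i) (b1 j) (p1 i j) (p1 j j).
  have h2 : pder (fun x => \sum_k G1 k x * G1 k x)
      (fun x => \sum_k (G2 k j x * G1 k x + G1 k x * G2 k j x)) j.
    by apply: pder_sum => k; apply: pderM.
  have := pderD (pderZ (i == j)%:R h2) (pderZ (-1) h1).
  by congr pder; apply/funext => x; rewrite /Q /Q' /bochner mulN1r.
have JQ i j : J (fun x => P2 i j x * Q i j x + P1 i x * Q' i j x) = 0.
  apply: (@J_pder0 (fun x => P1 i x * Q i j x) _ j B).
  - exact: pderM.
  - exact: blipM.
  - by apply: blipD; exact: blipM.
  - by apply: supp0 => x nx; have [_ [-> _]] := supp _ nx; rewrite !mul0r.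
  - by apply: supp0 => x nx; have [_ [-> ->]] := supp _ nx; rewrite !mul0r addr0.
have admA i : adm (fun x => P1 i x * A i x + P0 x * A' i x).
  apply: blip_adm (supp0 _ _); first by apply: blipD; exact: blipM.
  by move=> x nx; have [-> [-> _]] := supp _ nx; rewrite !mul0r addr0.
have admQ i j : adm (fun x => P2 i j x * Q i j x + P1 i x * Q' i j x).
  apply: blip_adm (supp0 _ _); first by apply: blipD; exact: blipM.
  by move=> x nx; have [_ [-> ->]] := supp _ nx; rewrite !mul0r addr0.
have admL : adm (fun x => P0 x * (\sum_i \sum_j G2 i j x ^+ 2 - (\sum_i G2 i i x) ^+ 2)).
  apply: blip_adm (supp0 _ _).
    apply: blipM => //; apply: blipB; last by apply: blipM; apply: blip_sum.
    by apply: blip_sum => i; apply: blip_sum => j; apply: blipM.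
  by move=> x nx; have [-> _] := supp _ nx; rewrite mul0r.
have admR : adm (fun x => \sum_i \sum_j P2 i j x * Q i j x).
  apply: blip_adm (supp0 _ _).
    by apply: blip_sum => i; apply: blip_sum => j; apply: blipM.
  move=> x nx; have [_ [_ h]] := supp _ nx.
  by rewrite big1// => i _; rewrite big1// => j _; rewrite h mul0r.
apply/eqP; rewrite -subr_eq0 -JB//; apply/eqP.
have sumA : J (fun x => \sum_i (P1 i x * A i x + P0 x * A' i x)) = 0.
  by rewrite J_sum//= big1// => i _; exact: JA.
have sumQ : J (fun x => \sum_i \sum_j (P2 i j x * Q i j x + P1 i x * Q' i j x)) = 0.
  rewrite J_sum/=; last by move=> i _; apply: adm_sum => j _; exact: admQ.
  rewrite big1// => i _; rewrite J_sum//= big1// => j _; exact: JQ.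
transitivity (J (fun x => \sum_i (P1 i x * A i x + P0 x * A' i x)) -
  J (fun x => \sum_i \sum_j (P2 i j x * Q i j x + P1 i x * Q' i j x))); last first.
  by rewrite sumA sumQ subrr.
rewrite -JB; first last.
- by apply: adm_sum => i _; apply: adm_sum => j _; exact: admQ.
- by apply: adm_sum => i _; exact: admA.
congr J; apply/funext => x.
have hQA i : \sum_j Q' i j x = A i x.
  rewrite /Q' /A sumrB (bigD1 i)//= eqxx mul1r [X in _ + X - _]big1; last first.
    by move=> j ji; rewrite eq_sym (negPf ji) mul0r.
  rewrite addr0 -sumrB; apply: eq_bigr => j _.
  by have [-> _ _] := sym i j i x; ring.
have hA' : \sum_i A' i x = \sum_i \sum_j G2 i j x ^+ 2 - (\sum_i G2 i i x) ^+ 2.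
  have -> : \sum_i A' i x = \sum_i \sum_j (G2 j i x * G2 j i x) +
      \sum_i \sum_j G1 j x * G3 j i i x - \sum_i \sum_j G2 i i x * G2 j j x -
      \sum_i \sum_j G1 i x * G3 j j i x.
    rewrite -big_split -!sumrB/=; apply: eq_bigr => i _.
    rewrite -big_split -!sumrB/=; apply: eq_bigr => j _; ring.
  have -> : \sum_i \sum_j G1 j x * G3 j i i x = \sum_i \sum_j G1 i x * G3 j j i x.
    rewrite exchange_big/=; apply: eq_bigr => i _; apply: eq_bigr => j _.
    have [_ h1 h2] := sym i j j x; have [_ h3 h4] := sym j j i x.
    by rewrite h1 h4.
  have -> : \sum_i \sum_j G2 j i x * G2 j i x = \sum_i \sum_j G2 i j x ^+ 2.
    by rewrite exchange_big.
  have -> : \sum_i \sum_j G2 i i x * G2 j j x = (\sum_i G2 i i x) ^+ 2.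
    by rewrite expr2 mulr_suml; apply: eq_bigr => i _; rewrite mulr_sumr.
  by ring.
have -> : \sum_i (P1 i x * A i x + P0 x * A' i x) =
    \sum_i P1 i x * A i x + P0 x * (\sum_i A' i x).
  by rewrite big_split/= mulr_sumr.
have -> : \sum_i \sum_j (P2 i j x * Q i j x + P1 i x * Q' i j x) =
    \sum_i \sum_j P2 i j x * Q i j x + \sum_i P1 i x * A i x.
  rewrite -big_split/=; apply: eq_bigr => i _.
  by rewrite big_split/= -mulr_sumr hQA.
by rewrite hA'; ring.
Qed.

End Calculus.

(** * A smooth ramp and a smooth concave minimum *)

Section Ramp.
Variable R : realType.
Implicit Types u v t : R.

Definition clamp u : R := Num.max 0 (Num.min 1 u).

(** A convex C^2 replacement of the positive part: zero on the negative axis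
    and equal to u - 1/2 beyond 1, with derivatives ramp1 and ramp2. *)
Definition ramp0 u : R := clamp u ^+ 3 - clamp u ^+ 4 / 2 + Num.max 0 (u - 1).
Definition ramp1 u : R := 3 * clamp u ^+ 2 - 2 * clamp u ^+ 3.
Definition ramp2 u : R := 6 * clamp u * (1 - clamp u).

Variant clamp_spec u : R -> R -> Prop :=
| ClampNeg of u <= 0 : clamp_spec u 0 0
| ClampIn of 0 <= u & u <= 1 : clamp_spec u u 0
| ClampBig of 1 <= u : clamp_spec u 1 (u - 1).

Lemma clampP u : clamp_spec u (clamp u) (Num.max 0 (u - 1)).
Proof.
rewrite /clamp; have [u0|u0] := leP u 0.
  rewrite (min_idPr _) ?(le_trans u0)// (max_idPl u0) (max_idPl _) ?subr_le0 ?(le_trans u0)//.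
  exact: ClampNeg.
have [u1|u1] := leP 1 u.
  rewrite (max_idPr _) ?ler01// (max_idPr _) ?subr_ge0//; exact: ClampBig.
rewrite (max_idPr (ltW u0)) (max_idPl _) ?subr_le0 ?ltW//.
by apply: ClampIn; exact: ltW.
Qed.

Lemma clamp_range u : 0 <= clamp u <= 1.
Proof. by case: clampP => *; apply/andP; split; lra. Qed.

Lemma clamp_lip u t : `|clamp (u + t) - clamp u| <= `|t|.
Proof.
rewrite ler_norml; have := ler_norm t; have := ler_norm (- t); rewrite normrN.
by case: (clampP u) => *; case: (clampP (u + t)) => *; apply/andP; split; lra.
Qed.

Lemma ramp1_range u : 0 <= ramp1 u <= 1.
Proof.
rewrite /ramp1; have /andP[a0 a1] := clamp_range u; move: (clamp u) a0 a1 => a a0 a1.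
rewrite (_ : _ - _ = a ^+ 2 * (1 + 2 * (1 - a))); last by ring.
apply/andP; split; first by rewrite mulr_ge0 ?sqr_ge0//; lra.
have : 0 <= (1 - a) ^+ 2 * (1 + 2 * a) by rewrite mulr_ge0 ?sqr_ge0//; lra.
by lra.
Qed.

Lemma ramp2_range u : 0 <= ramp2 u <= 2.
Proof.
rewrite /ramp2; have /andP[a0 a1] := clamp_range u; move: (clamp u) a0 a1 => a a0 a1.
have := sqr_ge0 (a - 2^-1); have : 0 <= a * (1 - a) by rewrite mulr_ge0 ?subr_ge0.
by move=> h1 h2; apply/andP; split; lra.
Qed.

Lemma ramp2_neq0 u : ramp2 u != 0 -> 0 < u < 1.
Proof.
rewrite /ramp2; case: clampP => h; rewrite ?mulr0 ?mul0r ?subrr ?mulr0 ?eqxx// => h'.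
move=> nz; rewrite !lt_neqAle h h' !andbT; apply/andP; split; apply: contra nz => /eqP.
  by move=> <-; rewrite mulr0 mul0r.
by move=> ->; rewrite subrr mulr0.
Qed.

Lemma ramp0_le0 u : u <= 0 -> ramp0 u = 0.
Proof. by rewrite /ramp0; case: clampP => *; rewrite ?expr0n/= ?expr1n; nra. Qed.

Lemma ramp1_le0 u : u <= 0 -> ramp1 u = 0.
Proof. by rewrite /ramp1; case: clampP => *; rewrite ?expr0n/= ?expr1n; nra. Qed.

Lemma ramp1_ge1 u : 1 <= u -> ramp1 u = 1.
Proof.
rewrite /ramp1; case: clampP => *; rewrite ?expr0n/= ?expr1n; try lra.
have -> : u = 1 by lra.
by rewrite !expr1n; lra.
Qed.

Lemma ramp0_ge1 u : 1 <= u -> ramp0 u = u - 2^-1.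
Proof.
rewrite /ramp0; case: clampP => *; rewrite ?expr0n/= ?expr1n; try lra.
have -> : u = 1 by lra.
by rewrite !expr1n; lra.
Qed.

Lemma ramp0_bounds u : [/\ 0 <= ramp0 u, ramp0 u <= Num.max 0 u & u - 2^-1 <= ramp0 u].
Proof.
rewrite /ramp0; case: clampP => h; rewrite ?expr0n ?expr1n/=; first last.
- rewrite (max_idPr _); last lra.
  by split; lra.
- move=> h'; rewrite (max_idPr h).
  have h1 : 0 <= u ^+ 3 * (2 - u) by rewrite mulr_ge0 ?exprn_ge0//; lra.
  have h2 : 0 <= (1 - u) ^+ 3 * (1 + u) by rewrite mulr_ge0 ?exprn_ge0//; lra.
  have h3 : 0 <= u * (1 - u) * (1 + u) by rewrite !mulr_ge0//; lra.
  have h4 : 0 <= u ^+ 4 by rewrite exprn_ge0.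
  by split; lra.
- by rewrite (max_idPl h); split; lra.
Qed.

Lemma ramp1_lip u t : `|ramp1 (u + t) - ramp1 u| <= 6 * `|t|.
Proof.
have h := clamp_lip u t; rewrite /ramp1.
have /andP[] := clamp_range u; have /andP[] := clamp_range (u + t).
move: (clamp (u + t)) (clamp u) h => b a h b0 b1 a0 a1.
rewrite (_ : _ - _ = (b - a) * (3 * (a + b) - 2 * (a ^+ 2 + a * b + b ^+ 2))); last by ring.
rewrite normrM mulrC ler_pM// ler_norml; apply/andP; split; nra.
Qed.

Lemma ramp2_lip u t : `|ramp2 (u + t) - ramp2 u| <= 6 * `|t|.
Proof.
have h := clamp_lip u t; rewrite /ramp2.
have /andP[] := clamp_range u; have /andP[] := clamp_range (u + t).
move: (clamp (u + t)) (clamp u) h => b a h b0 b1 a0 a1.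
rewrite (_ : _ - _ = (b - a) * (6 * (1 - (a + b)))); last by ring.
by rewrite normrM mulrC ler_pM// ler_norml; apply/andP; split; lra.
Qed.

Lemma ramp0_lip u t : `|ramp0 (u + t) - ramp0 u| <= 6 * `|t|.
Proof.
have h := clamp_lip u t; rewrite /ramp0.
have /andP[a0 a1] := clamp_range u; have /andP[b0 b1] := clamp_range (u + t).
rewrite (_ : _ - _ = (clamp (u + t) ^+ 3 - clamp (u + t) ^+ 4 / 2 -
   (clamp u ^+ 3 - clamp u ^+ 4 / 2)) +
   (Num.max 0 (u + t - 1) - Num.max 0 (u - 1))); last by ring.
rewrite (le_trans (ler_normD _ _))// (_ : 6 = 5 + 1 :> R); last by lra.
rewrite [leRHS]mulrDl mul1r lerD//.
  move: (clamp (u + t)) (clamp u) h a0 a1 b0 b1 => b a h a0 a1 b0 b1.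
  rewrite (_ : _ - _ = (b - a) * ((a ^+ 2 + a * b + b ^+ 2) -
    (a + b) * (a ^+ 2 + b ^+ 2) / 2)); last by field.
  rewrite normrM mulrC ler_pM// ler_norml.
  have h1 : 0 <= a ^+ 2 <= 1 by rewrite sqr_ge0 expr_le1.
  have h2 : 0 <= b ^+ 2 <= 1 by rewrite sqr_ge0 expr_le1.
  have h3 : 0 <= a * b <= 1 by rewrite mulr_ge0// mulr_ile1.
  have h4 : 0 <= (a + b) * (a ^+ 2 + b ^+ 2) <= 4.
    have -> : 4 = 2 * 2 :> R by lra.
    by rewrite mulr_ge0 ?ler_pM//; lra.
  by apply/andP; split; lra.
rewrite ler_norml; have := ler_norm t; have := ler_norm (- t); rewrite normrN.
have [] := leP 0 (u - 1); have [] := leP 0 (u + t - 1) => *; apply/andP; split; lra.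
Qed.

Lemma ramp0_rem u t : `|ramp0 (u + t) - ramp0 u - t * ramp1 u| <= 6 * t ^+ 2.
Proof.
have hl := clamp_lip u t.
have s2 : (clamp (u + t) - clamp u) ^+ 2 <= t ^+ 2.
  by rewrite -[leLHS]real_normK ?num_real// -[leRHS]real_normK ?num_real// ler_pXn2r ?nnegrE.
have /andP[a0 a1] := clamp_range u; have /andP[b0 b1] := clamp_range (u + t).
have key : `|(u + t - clamp (u + t)) * (ramp1 (u + t) - ramp1 u)| <= 3 * t ^+ 2.
  have [v0|v0] := leP (u + t) 0.
    have -> : clamp (u + t) = 0 by case: clampP v0 => //; lra.
    have [u0|u0] := leP u 0.
      by rewrite !ramp1_le0// subrr mulr0 normr0 mulr_ge0 ?sqr_ge0.
    rewrite ramp1_le0// sub0r subr0 normrM normrN.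
    have h1 : `|u + t| <= `|t| by rewrite (ler0_norm v0) ler0_norm; lra.
    have h2 : `|ramp1 u| <= 3 * `|t|.
      rewrite ger0_norm; last by case/andP: (ramp1_range u).
      have : clamp u <= - t by case: clampP => *; lra.
      have : - t <= `|t| by rewrite -normrN ler_norm.
      rewrite /ramp1; have := exprn_ge0 3 a0; have : clamp u ^+ 2 <= clamp u.
        by rewrite expr2 ler_piMl.
      lra.
    by rewrite -real_normK ?num_real// expr2 mulrCA ler_pM.
  have [v1|v1] := leP 1 (u + t); last first.
    have -> : clamp (u + t) = u + t by case: clampP; lra.
    by rewrite subrr mul0r normr0 mulr_ge0 ?sqr_ge0.
  have -> : clamp (u + t) = 1 by case: clampP v1 => *; lra.
  rewrite [ramp1 (u + t)]ramp1_ge1//; have [u1|u1] := leP 1 u.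
    by rewrite !ramp1_ge1// subrr mulr0 normr0 mulr_ge0 ?sqr_ge0.
  rewrite normrM; have h1 : `|u + t - 1| <= `|t| by rewrite !ger0_norm; lra.
  have h2 : `|1 - ramp1 u| <= 3 * `|t|.
    rewrite ger0_norm; last by case/andP: (ramp1_range u); lra.
    have h3 : 1 - clamp u <= t by case: clampP => *; lra.
    have h4 := ler_norm t.
    have h5 : 0 <= (1 - clamp u) * ((1 - clamp u) + 2 * clamp u ^+ 2 + 1).
      by apply: mulr_ge0; [lra|have := sqr_ge0 (clamp u); lra].
    apply: (@le_trans _ _ (3 * (1 - clamp u))); last lra.
    by rewrite /ramp1; lra.
  by rewrite -real_normK ?num_real// expr2 mulrCA ler_pM.
have tail z : Num.max 0 (z - 1) = (z - clamp z) * ramp1 z.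
  rewrite /ramp1; case: clampP => *; rewrite ?expr0n ?expr1n/=; nra.
rewrite /ramp0 !tail.
move: key s2 a0 a1 b0 b1; set a := clamp u; set b := clamp (u + t).
move=> key s2 a0 a1 b0 b1.
rewrite (_ : _ - _ - _ = (b - a) ^+ 2 * ((b + 2 * a) - (b ^+ 2 + 2 * a * b + 3 * a ^+ 2) / 2) +
   (u + t - b) * (ramp1 (u + t) - ramp1 u)); last first.
  by rewrite /ramp1 -/a -/b; field.
rewrite (le_trans (ler_normD _ _))// (_ : 6 = 3 + 3 :> R); last by lra.
rewrite [leRHS]mulrDl lerD// normrM (ger0_norm (sqr_ge0 _)) mulrC ler_pM ?sqr_ge0//.
have h1 : 0 <= a ^+ 2 <= 1 by rewrite sqr_ge0 expr_le1.
have h2 : 0 <= b ^+ 2 <= 1 by rewrite sqr_ge0 expr_le1.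
have h3 : 0 <= a * b <= 1 by rewrite mulr_ge0// mulr_ile1.
by rewrite ler_norml; apply/andP; split; lra.
Qed.

Lemma ramp1_rem u t : `|ramp1 (u + t) - ramp1 u - t * ramp2 u| <= 15 * t ^+ 2.
Proof.
have hl := clamp_lip u t.
have s2 : (clamp (u + t) - clamp u) ^+ 2 <= t ^+ 2.
  by rewrite -[leLHS]real_normK ?num_real// -[leRHS]real_normK ?num_real// ler_pXn2r ?nnegrE.
have /andP[a0 a1] := clamp_range u; have /andP[b0 b1] := clamp_range (u + t).
have key : `|(clamp (u + t) - clamp u - t) * ramp2 u| <= 6 * t ^+ 2.
  have [->|nz] := eqVneq (ramp2 u) 0; first by rewrite mulr0 normr0 mulr_ge0 ?sqr_ge0.
  have /andP[u0 u1] := ramp2_neq0 nz.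
  have cu : clamp u = u.
    by rewrite /clamp (min_idPr (ltW u1)) (max_idPr (ltW u0)).
  rewrite /ramp2 cu.
  case: (clampP (u + t)) => v0 *.
  - have w0 : 0 <= - (u + t) by lra.
    have h1 : 0 <= - (u + t) * (u * (1 - u)) by rewrite !mulr_ge0//; lra.
    have h2 : - (u + t) * (u * (1 - u)) <= (- t) * (- t).
      have h3 : 0 <= - (u + t) * u by rewrite mulr_ge0// ltW.
      have h4 : 0 <= - (u + t) * (u * u) by rewrite !mulr_ge0// ltW.
      have h5 : 0 <= u * u by rewrite mulr_ge0// ltW.
      have h6 : 0 <= u * - (u + t) by rewrite mulr_ge0// ltW.
      have h7 : 0 <= (u + t) * (u + t) by rewrite -expr2 sqr_ge0.
      lra.
    by rewrite ler_norml; apply/andP; split; lra.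
  - rewrite (_ : u + t - u - t = 0); last by ring.
    by rewrite mul0r normr0 mulr_ge0 ?sqr_ge0.
  - have w0 : 0 <= u + t - 1 by lra.
    have h1 : 0 <= (u + t - 1) * ((1 - u) * u) by rewrite !mulr_ge0//; lra.
    have h2 : (u + t - 1) * ((1 - u) * u) <= t * t.
      have h3 : 0 <= (u + t - 1) * (1 - u) by rewrite mulr_ge0//; lra.
      have h4 : 0 <= (u + t - 1) * (1 - u) * (1 - u) by rewrite !mulr_ge0//; lra.
      have h5 : 0 <= (1 - u) * (1 - u) by rewrite -expr2 sqr_ge0.
      have h7 : 0 <= (u + t - 1) * (u + t - 1) by rewrite -expr2 sqr_ge0.
      lra.
    by rewrite ler_norml; apply/andP; split; lra.
rewrite /ramp1; move: key; rewrite /ramp2.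
move: s2 a0 a1 b0 b1; set a := clamp u; set b := clamp (u + t).
move=> s2 a0 a1 b0 b1 key.
rewrite (_ : _ - _ - _ = (b - a) ^+ 2 * (3 - 2 * (b + 2 * a)) +
   (b - a - t) * (6 * a * (1 - a))); last by ring.
rewrite (le_trans (ler_normD _ _))// (_ : 15 = 9 + 6 :> R); last by lra.
rewrite [leRHS]mulrDl lerD// normrM (ger0_norm (sqr_ge0 _)) mulrC ler_pM ?sqr_ge0//.
by rewrite ler_norml; apply/andP; split; lra.
Qed.

End Ramp.

Section SoftMin.
Variables (R : realType) (d : nat).
Implicit Types (F G : 'rV[R]_d -> R) (x y v : 'rV[R]_d).
Local Notation e i := (delta_mx 0 i : 'rV[R]_d).

Definition lip F := exists M, forall x y, `|F (x + y) - F x| <= M * enorm y.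

Lemma lip_ge0 F : lip F -> exists2 M, 0 <= M & forall x y, `|F (x + y) - F x| <= M * enorm y.
Proof.
move=> [M hM]; exists `|M| => // x y; rewrite (le_trans (hM x y))//.
by rewrite ler_wpM2r ?enorm_ge0// ler_norm.
Qed.

Lemma blip_lip F : blip F -> lip F.
Proof. by move=> [M hM]; exists M => x y; case: (hM x y). Qed.

Lemma lipD F G : lip F -> lip G -> lip (fun x => F x + G x).
Proof.
move=> [M hM] [N hN]; exists (M + N) => x y.
rewrite (_ : _ - _ = (F (x + y) - F x) + (G (x + y) - G x)); last by ring.
by rewrite (le_trans (ler_normD _ _))// mulrDl lerD.
Qed.

Lemma lipZ c F : lip F -> lip (fun x => c * F x).
Proof.
move=> [M hM]; exists (`|c| * M) => x y.
by rewrite -mulrBr normrM -mulrA ler_wpM2l.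
Qed.

Lemma lipB F G : lip F -> lip G -> lip (fun x => F x - G x).
Proof.
move=> lF /(lipZ (-1)) lG; rewrite (_ : (fun x => _) = fun x => F x + -1 * G x).
  exact: lipD.
by apply/funext => x; rewrite mulN1r.
Qed.

Lemma lip_comp (th : R -> R) C F : (forall u t, `|th (u + t) - th u| <= C * `|t|) ->
  lip F -> lip (fun x => th (F x)).
Proof.
move=> hC /lip_ge0[M M0 hM]; exists (`|C| * M) => x y.
have -> : F (x + y) = F x + (F (x + y) - F x) by rewrite addrCA subrr addr0.
rewrite (le_trans (hC _ _))// -mulrA.
apply: (@le_trans _ _ (`|C| * `|F (x + y) - F x|)); last by rewrite ler_wpM2l.
by rewrite ler_wpM2r// ler_norm.
Qed.

Lemma blip_comp (th : R -> R) C N F : (forall u t, `|th (u + t) - th u| <= C * `|t|) ->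
  (forall u, `|th u| <= N) -> lip F -> blip (fun x => th (F x)).
Proof.
move=> hC hN /(lip_comp hC)[M hM]; exists (Num.max N M) => x y; split.
  by rewrite le_max hN.
by rewrite (le_trans (hM x y))// ler_wpM2r ?enorm_ge0// le_max lexx orbT.
Qed.

Lemma pder_comp (th th' : R -> R) C N F F' i :
  (forall u t, `|th (u + t) - th u - t * th' u| <= C * t ^+ 2) ->
  (forall u, `|th' u| <= N) -> lip F -> pder F F' i ->
  pder (fun x => th (F x)) (fun x => th' (F x) * F' x) i.
Proof.
move=> hC hN /lip_ge0[M M0 hM] [D hD].
have C0 : 0 <= C.
  by have := hC 0 1; rewrite expr1n mulr1; apply: le_trans.
have N0 : 0 <= N by apply: le_trans (hN 0).
exists (C * M ^+ 2 + N * D) => x t.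
have [y yE] : exists y : R, y = F (x + t *: e i) - F x by eexists.
have FE : F (x + t *: e i) = F x + y by rewrite yE addrCA subrr addr0.
rewrite FE (_ : _ - _ - _ = (th (F x + y) - th (F x) - y * th' (F x)) +
   th' (F x) * (y - t * F' x)); last by ring.
rewrite (le_trans (ler_normD _ _))// [leRHS]mulrDl lerD//.
  rewrite (le_trans (hC _ _))// -mulrA ler_wpM2l//.
  rewrite -exprMn -real_normK ?num_real// -[leRHS]real_normK ?num_real//.
  rewrite ler_pXn2r ?nnegrE// normrM (ger0_norm M0) yE.
  by have := hM x (t *: e i); rewrite enorm_step.
by rewrite normrM -mulrA ler_pM// yE.
Qed.

Variables (eps top : R).
Hypothesis eps_gt0 : 0 < eps.

(** A concave C^2 approximation from above of the minimum of top and of the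
    gaps to finitely many hyperplanes, with its first and second derivatives.
    Away from the places where two of the competitors are nearly equal it is
    locally affine, with the same gradient as the minimum. *)
Fixpoint smin (s : seq ('rV[R]_d * R)) x : R :=
  if s is q :: s' then gap q x - eps * ramp0 ((gap q x - smin s' x) / eps) else top.

Fixpoint smin1 (s : seq ('rV[R]_d * R)) i x : R :=
  if s is q :: s' then - q.1 0 i -
    ramp1 ((gap q x - smin s' x) / eps) * (- q.1 0 i - smin1 s' i x) else 0.

Fixpoint smin2 (s : seq ('rV[R]_d * R)) i j x : R :=
  if s is q :: s' then ramp1 ((gap q x - smin s' x) / eps) * smin2 s' i j x -
    eps^-1 * ramp2 ((gap q x - smin s' x) / eps) *
      ((- q.1 0 i - smin1 s' i x) * (- q.1 0 j - smin1 s' j x)) else 0.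

Lemma gap_is_lip (q : 'rV[R]_d * R) : lip (gap q).
Proof.
exists (enorm q.1) => x y; rewrite gapD addrAC subrr add0r normrN; exact: dotp_le.
Qed.

Lemma pder_gap (q : 'rV[R]_d * R) i : pder (gap q) (fun=> - q.1 0 i) i.
Proof.
exists 0 => x t; rewrite gapD dotpZr dotp_delta (_ : _ - _ - _ = 0) ?normr0 ?mul0r//; ring.
Qed.

Lemma smin_calculus s : [/\ lip (smin s), forall i, blip (smin1 s i), forall i j, blip (smin2 s i j),
  forall i, pder (smin s) (smin1 s i) i & forall i j, pder (smin1 s i) (smin2 s i j) j].
Proof.
have ramp1N u : `|@ramp1 R u| <= 1.
  by case/andP: (ramp1_range u) => *; rewrite ger0_norm.
have ramp2N u : `|@ramp2 R u| <= 2.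
  by case/andP: (ramp2_range u) => *; rewrite ger0_norm.
elim: s => [|q s [l0 b1 b2 p1 p2]]/=.
  split=> *; [exact/blip_lip/blip_cst|exact: blip_cst|exact: blip_cst|exact: pder_cst|exact: pder_cst].
have lz : lip (fun x => (gap q x - smin s x) / eps).
  rewrite (_ : (fun x => _) = fun x => eps^-1 * (gap q x - smin s x)); last first.
    by apply/funext => x; rewrite mulrC.
  by apply/lipZ/lipB => //; exact: gap_is_lip.
have pz i : pder (fun x => (gap q x - smin s x) / eps)
    (fun x => (- q.1 0 i - smin1 s i x) / eps) i.
  have := pderZ eps^-1 (pderD (pder_gap q i) (pderZ (-1) (p1 i))).
  by congr pder; apply/funext => x; rewrite mulN1r mulrC.
have bc i : blip (fun x => - q.1 0 i - smin1 s i x).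
  by apply: blipB => //; exact: blip_cst.
have pc i j : pder (fun x => - q.1 0 i - smin1 s i x) (fun x => - smin2 s i j x) j.
  have := pderD (pder_cst (- q.1 0 i) j) (pderZ (-1) (p2 i j)).
  by congr pder; apply/funext => x; ring.
have br1 : blip (fun x => ramp1 ((gap q x - smin s x) / eps)).
  exact: (blip_comp (@ramp1_lip R) ramp1N).
have br2 : blip (fun x => ramp2 ((gap q x - smin s x) / eps)).
  exact: (blip_comp (@ramp2_lip R) ramp2N).
split.
- apply: lipB; first exact: gap_is_lip.
  by apply/lipZ/(lip_comp (@ramp0_lip R)).
- by move=> i; apply: blipB; [exact: blip_cst|exact: blipM].
- move=> i j; apply: blipB; first exact: blipM.
  by apply: blipM; [exact: blipZ|exact: blipM].
- move=> i; have := pderD (pder_gap q i)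
    (pderZ (- eps) (pder_comp (@ramp0_rem R) ramp1N lz (pz i))).
  congr pder; apply/funext => x; first by ring.
  by field; rewrite gt_eqF.
- move=> i j; have := pderD (pder_cst (- q.1 0 i) j) (pderZ (-1) (pderM br1 (bc i)
    (pder_comp (@ramp1_rem R) ramp2N lz (pz j)) (pc i j))).
  congr pder; apply/funext => x; first by ring.
  by field; rewrite gt_eqF.
Qed.

Definition grad_smin s x : 'rV[R]_d := \row_i smin1 s i x.

(** The adjugate form of a gradient is positive semidefinite, so the Hessian of
    a concave function has a nonpositive trace against it; by induction only a
    square with the factor - ramp2 is added at each gap. *)
Lemma smin_concave s x g :
  \sum_i \sum_j smin2 s i j x * ((i == j)%:R * dotp g g - g 0 i * g 0 j) <= 0.
Proof.
elim: s => [|q s IH] /=.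
  by rewrite big1// => i _; rewrite big1// => j _; rewrite mul0r.
set r1 := ramp1 _; set r2 := ramp2 _.
pose c : 'rV[R]_d := - q.1 - grad_smin s x.
have -> : \sum_i \sum_j (r1 * smin2 s i j x - eps^-1 * r2 *
    ((- q.1 0 i - smin1 s i x) * (- q.1 0 j - smin1 s j x))) *
      ((i == j)%:R * dotp g g - g 0 i * g 0 j) =
  r1 * (\sum_i \sum_j smin2 s i j x * ((i == j)%:R * dotp g g - g 0 i * g 0 j)) -
  eps^-1 * r2 * (dotp c c * dotp g g - dotp c g ^+ 2).
  rewrite mulr_sumr.
  have -> : dotp c c * dotp g g = \sum_i \sum_j c 0 i * c 0 j * ((i == j)%:R * dotp g g).
    rewrite {1}/dotp mulr_suml; apply: eq_bigr => i _.
    rewrite (bigD1 i)//= eqxx mul1r big1 ?addr0// => j ji.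
    by rewrite eq_sym (negPf ji) mul0r mulr0.
  have -> : dotp c g ^+ 2 = \sum_i \sum_j c 0 i * c 0 j * (g 0 i * g 0 j).
    rewrite expr2 {1}/dotp mulr_suml; apply: eq_bigr => i _.
    rewrite /dotp mulr_sumr; apply: eq_bigr => j _; ring.
  rewrite -sumrB mulr_sumr -sumrB; apply: eq_bigr => i _.
  rewrite -sumrB !mulr_sumr -sumrB; apply: eq_bigr => j _.
  by rewrite !mxE; ring.
have r10 : 0 <= r1 by case/andP: (ramp1_range ((gap q x - smin s x) / eps)).
have r20 : 0 <= r2 by case/andP: (ramp2_range ((gap q x - smin s x) / eps)).
rewrite subr_le0 (@le_trans _ _ 0)//; first by rewrite mulr_ge0_le0.
apply: mulr_ge0; last by rewrite subr_ge0 dotp_CS.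
by rewrite mulr_ge0// invr_ge0 ltW.
Qed.

Lemma grad_smin_le1 s x : (forall p, p \in s -> enorm p.1 = 1) -> enorm (grad_smin s x) <= 1.
Proof.
elim: s => [|q s IH] us.
  rewrite (_ : grad_smin _ _ = 0) ?/enorm ?dotp0l ?sqrtr0//; apply/rowP => i; by rewrite !mxE.
rewrite (_ : grad_smin _ _ = (1 - ramp1 ((gap q x - smin s x) / eps)) *: (- q.1) +
    ramp1 ((gap q x - smin s x) / eps) *: grad_smin s x); last first.
  by apply/rowP => i; rewrite !mxE /=; ring.
have /andP[r0 r1] := ramp1_range ((gap q x - smin s x) / eps).
rewrite (le_trans (enormD _ _))// !enormZ enormN us ?mem_head// ger0_norm ?subr_ge0//.
rewrite mulr1 ger0_norm//.
have : enorm (grad_smin s x) <= 1 by apply: IH => p ps; apply: us; rewrite inE ps orbT.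
move=> h; have : ramp1 ((gap q x - smin s x) / eps) * enorm (grad_smin s x) <= ramp1 ((gap q x - smin s x) / eps).
  by rewrite ler_piMr.
by lra.
Qed.

Lemma smin_ge s x t : t <= top -> (forall p, p \in s -> t <= gap p x) -> t <= smin s x.
Proof.
move=> tt; elim: s => [|q s IH]//= h.
have tb : t <= smin s x by apply: IH => p ps; apply: h; rewrite inE ps orbT.
have ta : t <= gap q x by apply: h; rewrite mem_head.
have [_ h1 _] := ramp0_bounds ((gap q x - smin s x) / eps).
have : eps * ramp0 ((gap q x - smin s x) / eps) <= Num.max 0 (gap q x - smin s x).
  rewrite (le_trans (ler_wpM2l (ltW eps_gt0) h1))//.
  by rewrite maxr_pMr ?(ltW eps_gt0)// mulr0 mulrC divfK ?gt_eqF.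
by have [] := leP 0 (gap q x - smin s x); lra.
Qed.

Lemma smin_cons_le q s x : smin (q :: s) x <= gap q x /\ smin (q :: s) x <= smin s x + eps.
Proof.
have [h1 _ h2] := ramp0_bounds ((gap q x - smin s x) / eps) => /=; split.
  by rewrite gerBl mulr_ge0// ltW.
have : eps * ((gap q x - smin s x) / eps - 2^-1) <= eps * ramp0 ((gap q x - smin s x) / eps).
  by rewrite ler_wpM2l// ltW.
by rewrite mulrBr mulrCA divff ?gt_eqF// mulr1; have := eps_gt0; lra.
Qed.

Lemma smin_le_top s x : smin s x <= top + (size s)%:R * eps.
Proof.
elim: s => [|q s IH]; first by rewrite mul0r addr0.
have [_ h] := smin_cons_le q s x; rewrite (le_trans h)// -[size _]/((size s).+1) -natr1; lra.
Qed.

Lemma smin_le s x p : p \in s -> smin s x <= gap p x + (size s)%:R * eps.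
Proof.
elim: s => [//|q s IH]; rewrite inE -[size _]/((size s).+1) -natr1 => /predU1P[->|ps].
  have [h _] := smin_cons_le q s x; rewrite (le_trans h)// lerDl mulr_ge0 ?addr_ge0//.
  exact: ltW.
have [_ h] := smin_cons_le q s x; rewrite (le_trans h)//; have := IH ps; lra.
Qed.

(** If one gap is smaller than all its competitors by the total smoothing
    width, each of the nested comparisons is decided, and only this gap is
    seen. *)
Lemma grad_smin_flat s x p : uniq s -> p \in s -> gap p x + (size s)%:R * eps <= top ->
  (forall q, q \in s -> q != p -> gap p x + (size s)%:R * eps <= gap q x) ->
  grad_smin s x = - p.1.
Proof.
elim: s => [//|q s IH]; rewrite cons_uniq => /andP[qs us].
rewrite -[size _]/((size s).+1) -natr1 mulrDl mul1r.
rewrite inE => ps ht ho; apply/rowP => i; rewrite !mxE /=.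
have se : 0 <= (size s)%:R * eps by rewrite mulr_ge0// ltW.
case/predU1P: ps => [pq|ps].
  rewrite pq ramp1_le0 ?mul0r ?subr0// pmulr_lle0 ?invr_gt0// subr_le0.
  apply: smin_ge; first by rewrite -pq; have := eps_gt0; lra.
  move=> r rs; have := ho r; rewrite inE rs orbT => /(_ isT).
  have -> : r != p by rewrite pq; apply: contraNneq qs => <-.
  by rewrite -pq; move=> /(_ isT); have := eps_gt0; lra.
have qp : q != p by apply: contraNneq qs => ->.
have -> : smin1 s i x = - p.1 0 i.
  have /rowP/(_ i) : grad_smin s x = - p.1.
    apply: IH => //; first by have := eps_gt0; lra.
    move=> r rs rp; have := ho r; rewrite inE rs orbT => /(_ isT rp); have := eps_gt0; lra.
  by rewrite !mxE.
rewrite ramp1_ge1; first by ring.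
rewrite ler_pdivlMr// mul1r; have := smin_le x ps; have := ho q (mem_head _ _) qp; lra.
Qed.

End SoftMin.

(** * Volumes of slabs and of their intersections *)

Section Packing.
Variables (R : realType) (d : nat).
Implicit Types (x y v : 'rV[R]_d) (S : set 'rV[R]_d).
Local Notation e i := (delta_mx 0 i : 'rV[R]_d).

(** The indicators of the disjoint translates add up to at most the indicator of
    a cube that contains them. *)
Lemma packing (I : finType) (w : I -> 'rV[R]_d) S B M : 0 < B + M -> mset_rV S ->
  S `<=` cube 0 B -> (forall i j, `|w i 0 j| <= M) ->
  (forall i i' x, S (x + w i) -> S (x + w i') -> i = i') ->
  #|I|%:R * J (\1_S : _ -> R) <= (2 * (B + M)) ^+ d.
Proof.
move=> BM mS SB wM dis.
have aS : adm (\1_S : _ -> R) by exact: (adm_indic mS SB).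
have aT i : adm (fun x => (\1_S (x + w i) : R)).
  have := adm_affine (w i) ltr01 aS; congr adm; apply/funext => x; by rewrite scale1r.
have -> : #|I|%:R * J (\1_S : _ -> R) = J (fun x => \sum_i (\1_S (x + w i) : R)).
  rewrite J_sum; last by move=> i _.
  rewrite (eq_bigr (fun=> J (\1_S : _ -> R))); last by move=> i _; exact: J_translate.
  by rewrite sumr_const mulr_natl.
rewrite -(J_cube 0 BM); apply: J_le; [by apply: adm_sum|exact: adm_cube|move=> x].
case: (pselect (exists i, S (x + w i))) => [[i Si]|no]; last first.
  rewrite big1; first by rewrite indicE.
  by move=> i _; rewrite indicE memNset// => Si; apply: no; exists i.
rewrite (bigD1 i)//= big1 ?addr0; last first.
  move=> i' ii'; rewrite indicE memNset// => Si'; move/eqP: ii'; apply.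
  exact: (dis _ _ _ Si' Si).
rewrite !indicE mem_set// mem_set// => j.
have := SB _ Si j; rewrite !mxE !subr0 => h.
rewrite -(addrK (w i 0 j) (x 0 j)) (le_lt_trans (ler_normB _ _))//.
by rewrite ltr_leD.
Qed.

Lemma multiples_separated (g l : R) (i k : nat) : 0 < l ->
  `|g - 3 * i%:R * l| <= l -> `|g - 3 * k%:R * l| <= l -> i = k.
Proof.
move=> l0.
have aux (a b : nat) : (a < b)%N -> `|g - 3 * a%:R * l| <= l -> `|g - 3 * b%:R * l| <= l -> False.
  move=> ab; have h : a%:R + 1 <= b%:R :> R by rewrite natr1 ler_nat.
  have h' : 0 <= (b%:R - a%:R - 1) * l by rewrite mulr_ge0 ?(ltW l0)//; lra.
  rewrite !ler_norml => /andP[h1 h2] /andP[h3 h4]; lra.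
by case: (ltngtP i k) => [ik|ki|//] h1 h2; [case: (aux _ _ ik)|case: (aux _ _ ki)].
Qed.

Lemma inverse_count (l : R) : 0 < l -> l <= 1 -> exists N : nat,
  [/\ 1 <= 2 * N%:R * l & forall i : 'I_N, i%:R * l <= 1].
Proof.
move=> l0 l1; exists (Num.truncn l^-1).
have l10 : 0 <= l^-1 by rewrite invr_ge0 ltW.
have /andP[h1 h2] := truncn_itv l10.
have N1 : 1 <= (Num.truncn l^-1)%:R :> R by rewrite ler1n truncn_gt0 invf_ge1.
rewrite -natr1 in h2; split.
  rewrite -ler_pdivrMr// mul1r; lra.
move=> i; rewrite -ler_pdivlMr// mul1r (le_trans _ h1)// ler_nat ltnW//.
Qed.

Definition slab (p : 'rV[R]_d * R) l := [set x | `|gap p x| <= l].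

Lemma mset_slab p l : mset_rV (slab p l).
Proof.
have mg : mfun_rV (gap p).
  apply: mfun_continuous; have [M hM] := gap_is_lip p; exact: (lip_continuous hM).
apply: mset_le; exact: (measurableT_comp (@normr_measurable R setT) mg).
Qed.

(** About 1 / l translates of the slab along its normal are disjoint and stay in
    a fixed cube. *)
Lemma slab_vol p B : dotp p.1 p.1 = 1 -> 0 < B -> exists2 C, 0 <= C &
  forall l, 0 < l -> l <= 1 -> J (\1_(cube 0 B `&` slab p l) : _ -> R) <= C * l.
Proof.
move=> pp B0; pose M : R := 3 * enorm p.1.
have M0 : 0 <= M by rewrite mulr_ge0// enorm_ge0.
exists (2 * (2 * (B + M)) ^+ d); first by rewrite mulr_ge0// exprn_ge0// mulr_ge0// addr_ge0// ltW.
move=> l l0 l1; have [N [N1 N2]] := inverse_count l0 l1.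
have := @packing 'I_N (fun i => - (3 * i%:R * l) *: p.1) (cube 0 B `&` slab p l) B M.
rewrite card_ord => h.
have {}h : N%:R * J (\1_(cube 0 B `&` slab p l) : _ -> R) <= (2 * (B + M)) ^+ d.
  apply: h.
  - by rewrite ltr_wpDr.
  - by apply: mset_setI; [exact: mset_cube|exact: mset_slab].
  - by move=> x [].
  - move=> i j; rewrite mxE normrM normrN /M.
    have := N2 i => ?.
    have il : 0 <= i%:R * l by rewrite mulr_ge0 ?ler0n// ltW.
    by rewrite ler_pM// ?enorm_coord// -mulrA ger0_norm ?mulr_ge0//; lra.
  - move=> i i' x [_ h1] [_ h2]; apply/val_inj/(@multiples_separated (- gap p x) l) => //=.
      by move: h1; rewrite /slab/= gapD dotpZr pp -normrN; congr (`|_| <= _); ring.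
    by move: h2; rewrite /slab/= gapD dotpZr pp -normrN; congr (`|_| <= _); ring.
set V := J _ in h *.
have V0 : 0 <= V by apply: J_ge0 => x; rewrite indicE.
apply: (@le_trans _ _ (2 * N%:R * l * V)); first by rewrite ler_peMl.
by rewrite (_ : 2 * N%:R * l * V = 2 * l * (N%:R * V)); [rewrite [leRHS]mulrAC ler_wpM2l// mulr_ge0// ltW|ring].
Qed.

(** The intersection of two transversal slabs is translated along both normals;
    the hyperplanes of two faces of a domain with an interior point are either
    transversal or parallel and apart, and then thin slabs do not meet. *)
Lemma corner_vol p q B (x0 : 'rV[R]_d) : dotp p.1 p.1 = 1 -> dotp q.1 q.1 = 1 -> p != q ->
  0 < gap p x0 -> 0 < gap q x0 -> 0 < B ->
  exists C l0, [/\ 0 <= C, 0 < l0 & forall l l', 0 < l -> l <= l0 -> 0 < l' -> l' <= l0 ->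
    J (\1_(cube 0 B `&` (slab p l `&` slab q l')) : _ -> R) <= C * (l * l')].
Proof.
move=> pp qq pq gp gq B0; pose c := dotp p.1 q.1.
have [c1|c1] := eqVneq (1 - c ^+ 2) 0.
  (* parallel hyperplanes are disjoint *)
  have pq1 : p.1 = c *: q.1.
    apply/eqP; rewrite -subr_eq0; apply/eqP/enorm0_eq0; rewrite /enorm.
    rewrite dotpBl !dotpBr !dotpZl !dotpZr pp qq (dotpC q.1 p.1) -/c.
    by rewrite (_ : _ - _ = 1 - c ^+ 2) ?c1 ?sqrtr0//; ring.
  have cE : c = 1 \/ c = -1.
    have : (c - 1) * (c + 1) == 0 by apply/eqP; rewrite -[RHS]oppr0 -c1; ring.
    by rewrite mulf_eq0 subr_eq0 addr_eq0 => /orP[]/eqP; [left|right].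
  pose k := p.2 - c * q.2.
  have kE x : gap p x - c * gap q x = k by rewrite /gap pq1 dotpZl /k; ring.
  have k0 : k != 0.
    case: cE => cE; last by rewrite -(kE x0) cE mulN1r opprK gt_eqF// addr_gt0.
    apply: contra pq; rewrite /k cE mul1r subr_eq0 => /eqP pq2.
    rewrite cE scale1r in pq1.
    by rewrite [p]surjective_pairing pq1 pq2 -surjective_pairing.
  exists 0, (`|k| / 3); split => //; first by rewrite divr_gt0// normr_gt0.
  move=> l l' l0 h l'0 h'; rewrite (_ : _ `&` _ = set0); last first.
    apply/seteqP; split => // x [_ [/=]]; rewrite /slab/= => h1 h2.
    have : `|k| <= l + l'.
      rewrite -(kE x) (le_trans (ler_normB _ _))// lerD// normrM.
      by case: cE => ->; rewrite ?normrN normr1 mul1r.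
    have : 0 < `|k| by rewrite normr_gt0.
    lra.
  by rewrite mul0r indic0 J0.
pose D := 1 - c ^+ 2.
pose a := D^-1 *: (p.1 - c *: q.1); pose b := D^-1 *: (q.1 - c *: p.1).
have cq : dotp q.1 p.1 = c by rewrite dotpC.
have pa : dotp p.1 a = 1.
  by rewrite /a dotpZr dotpBr dotpZr pp -/c -expr2 mulVf.
have qb : dotp q.1 b = 1.
  by rewrite /b dotpZr dotpBr dotpZr qq cq -expr2 mulVf.
have pb : dotp p.1 b = 0 by rewrite /b dotpZr dotpBr dotpZr pp -/c mulr1 subrr mulr0.
have qa : dotp q.1 a = 0 by rewrite /a dotpZr dotpBr dotpZr qq cq mulr1 subrr mulr0.
clearbody a b; pose M : R := 3 * (enorm a + enorm b).
have M0 : 0 <= M by rewrite mulr_ge0// addr_ge0// enorm_ge0.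
exists (4 * (2 * (B + M)) ^+ d), 1; split=> //.
  by rewrite mulr_ge0// exprn_ge0// mulr_ge0// addr_ge0// ltW.
move=> l l' l0 l1 l'0 l'1.
have [N [N1 N2]] := inverse_count l0 l1; have [N' [N1' N2']] := inverse_count l'0 l'1.
pose S := cube 0 B `&` (slab p l `&` slab q l').
have h : (N * N')%:R * J (\1_S : _ -> R) <= (2 * (B + M)) ^+ d.
  have := @packing ('I_N * 'I_N')%type
    (fun i => - (3 * i.1%:R * l) *: a - (3 * i.2%:R * l') *: b) S B M.
  rewrite card_prod !card_ord; apply.
  - by rewrite ltr_wpDr.
  - apply: mset_setI; first exact: mset_cube.
    by apply: mset_setI; exact: mset_slab.
  - by move=> x [].
  - have bnd (n : nat) (t : R) (u : 'rV[R]_d) k : 0 < t -> n%:R * t <= 1 ->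
        `|((3 * n%:R * t) *: u) 0 k| <= 3 * enorm u.
      move=> t0 nt; rewrite mxE normrM ler_pM ?enorm_coord//.
      by rewrite ger0_norm ?mulr_ge0 ?ler0n ?(ltW t0)//; lra.
    move=> [i j] k /=; rewrite scaleNr mxE [X in `|X + _|]mxE [X in `|_ + X|]mxE.
    rewrite (le_trans (ler_normD _ _))// !normrN /M mulrDr lerD//; apply: bnd => //.
  - move=> [i j] [i' j'] x [_ [h1 h3]] [_ [h2 h4]].
    move: h1 h2 h3 h4; rewrite /slab/= !gapD !dotpBr !dotpZr pa pb qa qb => h1 h2 h3 h4.
    congr pair; apply: val_inj => /=.
      apply: (@multiples_separated (- gap p x) l) => //.
        by rewrite -normrN; move: h1; congr (`|_| <= _); ring.
      by rewrite -normrN; move: h2; congr (`|_| <= _); ring.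
    apply: (@multiples_separated (- gap q x) l') => //.
      by rewrite -normrN; move: h3; congr (`|_| <= _); ring.
    by rewrite -normrN; move: h4; congr (`|_| <= _); ring.
rewrite -/S; have [V VE] : exists V, V = J (\1_S : _ -> R) by eexists.
rewrite -VE in h *.
have V0 : 0 <= V by rewrite VE; apply: J_ge0 => x; rewrite indicE.
have NN : 1 <= (2 * N%:R * l) * (2 * N'%:R * l') by rewrite mulr_ege1.
apply: (@le_trans _ _ ((2 * N%:R * l) * (2 * N'%:R * l') * V)); first by rewrite ler_peMl.
rewrite natrM in h.
rewrite (_ : _ * V = 4 * (l * l') * (N%:R * N'%:R * V)); last by ring.
by rewrite [leRHS]mulrAC ler_wpM2l// !mulr_ge0// ltW.
Qed.

End Packing.

(** * Interior second order estimate on a convex polytope *)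

Section HessianWeight.
Variables (R : realType) (d : nat).
Implicit Types (x y v : 'rV[R]_d).
Local Notation e i := (delta_mx 0 i : 'rV[R]_d).

Lemma directional_bound (G0 : 'rV[R]_d -> R) (G1 : 'I_d -> 'rV[R]_d -> R) M L x w r :
  (forall i, pder G0 (G1 i) i) ->
  (forall i x y, `|G1 i (x + y) - G1 i x| <= M * enorm y) -> 0 < r ->
  (forall t, 0 < t -> t <= r -> `|G0 (x + t *: w) - G0 x| <= L * (t * enorm w)) ->
  `|\sum_i w 0 i * G1 i x| <= L * enorm w.
Proof.
move=> hp hM r0 hL; have [C C0 hC] := taylor1 hp hM.
rewrite leNgt; apply/negP => lt.
pose D := `|\sum_i w 0 i * G1 i x| - L * enorm w.
have D0 : 0 < D by rewrite subr_gt0.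
pose E := C * enorm w ^+ 2.
have E0 : 0 <= E by rewrite mulr_ge0// sqr_ge0.
pose t := Num.min r (D / (2 * (E + 1))).
have t0 : 0 < t by rewrite lt_min r0 divr_gt0// mulr_gt0// ltr_wpDl.
have tr : t <= r by rewrite ge_min lexx.
have h1 := hL t t0 tr; have h2 := hC x (t *: w).
have h3 : t * `|\sum_i w 0 i * G1 i x| <= L * (t * enorm w) + E * t ^+ 2.
  have -> : t * `|\sum_i w 0 i * G1 i x| = `|\sum_i (t *: w) 0 i * G1 i x|.
    rewrite -{1}(gtr0_norm t0) -normrM mulr_sumr; congr `|_|; apply: eq_bigr => i _.
    by rewrite mxE mulrA.
  rewrite enormZ (gtr0_norm t0) exprMn in h2.
  set Z := \sum_i _ in h2 *.
  rewrite (_ : Z = (G0 (x + t *: w) - G0 x) - (G0 (x + t *: w) - G0 x - Z)); last by ring.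
  by rewrite (le_trans (ler_normB _ _))// lerD// (le_trans h2)// /E mulrCA mulrC.
have h4 : t <= D / (2 * (E + 1)) by rewrite ge_min lexx orbT.
have h5 : D <= E * t.
  rewrite /D -(ler_pM2l t0); lra.
have : t * (2 * (E + 1)) <= D by rewrite -ler_pdivlMr// mulr_gt0// ltr_wpDl.
lra.
Qed.

Variables (Ds : seq ('rV[R]_d * R)) (rho : R).
Hypothesis unitD : forall p, p \in Ds -> dotp p.1 p.1 = 1.
Hypothesis bounded_D : forall x, polytope Ds x -> cube 0 rho x.

Variables (tau sig eps : R).
Hypotheses (tau_gt0 : 0 < tau) (sig_gt0 : 0 < sig) (eps_gt0 : 0 < eps).
Hypothesis eps_le : (size Ds)%:R * eps <= sig.

Local Notation m := (smin eps tau Ds).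
Local Notation m1 := (smin1 eps tau Ds).
Local Notation m2 := (smin2 eps tau Ds).
Local Notation z x := ((m x - sig) / sig).

(** Concave functions of the distance to the boundary are admissible weights
    up to the convexity of the ramp, which acts only in the layer where the soft
    minimum lies between sig and 2 sig. *)
Definition weight x : R := sig / tau * ramp0 (z x).

Lemma weight_off x : ~ polytope Ds x -> z x <= 0.
Proof.
move=> /existsNP[p] /not_implyP[pD /negP]; rewrite -leNgt => gp.
rewrite pmulr_lle0 ?invr_gt0// subr_le0.
by have := smin_le tau eps_gt0 x pD; have := eps_le; lra.
Qed.

(** By the Bochner identity the weighted excess of the squared Hessian over the
    squared Laplacian is the Hessian of the weight against the adjugate form of
    the gradient.  The soft minimum contributes a nonpositive term, by
    concavity; the ramp contributes bad, which vanishes if the gradient of the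
    solution is parallel to that of the soft minimum. *)
Lemma hessian_weight G0 G1 G2 G3 : @C3 R d G0 G1 G2 G3 ->
  let g x : 'rV[R]_d := \row_i G1 i x in
  let bad x := dotp (grad_smin eps tau Ds x) (grad_smin eps tau Ds x) * dotp (g x) (g x) -
      dotp (grad_smin eps tau Ds x) (g x) ^+ 2 in
  [/\ blip weight, adm (fun x => ramp2 (z x) * bad x) &
  J (fun x => weight x * (\sum_i \sum_j G2 i j x ^+ 2 - (\sum_i G2 i i x) ^+ 2)) <=
  (tau * sig)^-1 * J (fun x => ramp2 (z x) * bad x)].
Proof.
move=> hC g bad.
have [lm b1 b2 p1 p2] := smin_calculus tau eps_gt0 Ds.
have lz : lip (fun x => z x).
  rewrite (_ : (fun x => _) = fun x => sig^-1 * (m x + - sig)); last first.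
    by apply/funext => x; rewrite mulrC.
  by apply/lipZ/lipD => //; exact/blip_lip/blip_cst.
have pz i : pder (fun x => z x) (fun x => m1 i x / sig) i.
  have := pderZ sig^-1 (pderD (p1 i) (pder_cst (- sig) i)).
  by congr pder; apply/funext => x; rewrite ?addr0 mulrC.
have ramp1N u : `|@ramp1 R u| <= 1.
  by case/andP: (ramp1_range u) => *; rewrite ger0_norm.
have ramp2N u : `|@ramp2 R u| <= 2.
  by case/andP: (ramp2_range u) => *; rewrite ger0_norm.
have br1 : blip (fun x => ramp1 (z x)) by exact: (blip_comp (@ramp1_lip R) ramp1N).
have br2 : blip (fun x => ramp2 (z x)) by exact: (blip_comp (@ramp2_lip R) ramp2N).
have br0 : blip (fun x => ramp0 (z x)).
  have [M hM] := lip_comp (@ramp0_lip R) lz.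
  pose N := Num.max 0 ((tau + sig - sig) / sig).
  exists (Num.max N M) => x y; split.
    have [h1 h2 _] := ramp0_bounds (z x).
    rewrite ger0_norm// (le_trans h2)// le_max; apply/orP; left.
    rewrite /N ge_max le_max lexx/= le_max ler_pM2r ?invr_gt0// lerD2r.
    apply/orP; right; rewrite (le_trans (smin_le_top tau eps_gt0 Ds x))// lerD2l.
    exact: eps_le.
  by rewrite (le_trans (hM x y))// ler_wpM2r ?enorm_ge0// le_max lexx orbT.
pose P1 i x := tau^-1 * (ramp1 (z x) * m1 i x).
pose P2 i j x := tau^-1 * (ramp2 (z x) * (m1 j x / sig) * m1 i x + ramp1 (z x) * m2 i j x).
have bP0 : blip weight by exact: blipZ.
have bP1 i : blip (P1 i) by apply/blipZ/blipM.
have bP2 i j : blip (P2 i j).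
  apply/blipZ/blipD; last exact: blipM.
  apply: blipM => //; apply: blipM => //.
  by rewrite (_ : (fun x => _) = fun x => sig^-1 * m1 j x);
    [exact: blipZ|apply/funext => x; rewrite mulrC].
have dP0 i : pder weight (P1 i) i.
  have := pderZ (sig / tau) (pder_comp (@ramp0_rem R) ramp1N lz (pz i)).
  congr pder; apply/funext => x; rewrite /P1; field; by rewrite !gt_eqF.
have dP1 i j : pder (P1 i) (P2 i j) j.
  exact: pderZ _ (pderM br1 (b1 i) (pder_comp (@ramp1_rem R) ramp2N lz (pz j)) (p2 i j)).
have supp x : ~ cube 0 rho x -> weight x = 0 /\ (forall i, P1 i x = 0) /\ forall i j, P2 i j x = 0.
  move=> nx; have z0 : z x <= 0 by apply: weight_off => /bounded_D.
  have r2 : ramp2 (z x) = 0.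
    apply/eqP/negPn/negP => /ramp2_neq0/andP[]; lra.
  rewrite /weight /P1 /P2 ramp0_le0// ramp1_le0// r2.
  by split; [rewrite mulr0|split => [i|i j]; rewrite !mul0r ?addr0 mulr0].
have [_ p1G _ _ [M hM]] := hC.
have bG1 i : blip (G1 i).
  by exists M => x y; have [_ h _ _ [_ h' _ _]] := hM i i i x y.
have bdot : blip (fun x => dotp (grad_smin eps tau Ds x) (g x)).
  rewrite /dotp; apply: blip_sum => i.
  rewrite (_ : (fun x => _) = fun x => m1 i x * G1 i x); first exact: blipM.
  by apply/funext => x; rewrite !mxE.
have bmm : blip (fun x => dotp (grad_smin eps tau Ds x) (grad_smin eps tau Ds x)).
  rewrite /dotp; apply: blip_sum => i.
  rewrite (_ : (fun x => _) = fun x => m1 i x * m1 i x); first exact: blipM.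
  by apply/funext => x; rewrite !mxE.
have bgg : blip (fun x => dotp (g x) (g x)).
  rewrite /dotp; apply: blip_sum => i.
  rewrite (_ : (fun x => _) = fun x => G1 i x * G1 i x); first exact: blipM.
  by apply/funext => x; rewrite !mxE.
have abad : adm (fun x => ramp2 (z x) * bad x).
  apply: (@blip_adm _ _ _ rho).
    apply: blipM => //; apply: blipB; first exact: blipM.
    by rewrite (_ : (fun x => _) = fun x => dotp (grad_smin eps tau Ds x) (g x) *
      dotp (grad_smin eps tau Ds x) (g x)); [exact: blipM|apply/funext => x; rewrite expr2].
  move=> x h; apply: contrapT => nx; apply: h.
  have z0 : z x <= 0 by apply: weight_off => /bounded_D.
  suff -> : ramp2 (z x) = 0 by rewrite mul0r.
  by apply/eqP/negPn/negP => /ramp2_neq0/andP[]; lra.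
split=> //; rewrite (bochner_identity hC bP0 bP1 bP2 dP0 dP1 supp) -JZ//.
have aP : adm (fun x => \sum_i \sum_j P2 i j x * bochner G1 i j x).
  apply: (@blip_adm _ _ _ rho).
    apply: blip_sum => i; apply: blip_sum => j; apply: blipM => //.
    apply: blipB; last exact: blipM.
    by apply: blipZ; apply: blip_sum => k; apply: blipM.
  move=> x h; apply: contrapT => nx; apply: h.
  have [_ [_ h]] := supp x nx.
  by rewrite big1// => i _; rewrite big1// => j _; rewrite h mul0r.
apply: J_le => //; first exact: admZ.
move=> x.
have bE i j : bochner G1 i j x = (i == j)%:R * dotp (g x) (g x) - g x 0 i * g x 0 j.
  rewrite /bochner !mxE /dotp; congr (_ * _ - _); apply: eq_bigr => k _.
  by rewrite mxE expr2.
have := smin_concave tau eps_gt0 Ds x (g x).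
set con := \sum_i _ => con0.
have -> : \sum_i \sum_j P2 i j x * bochner G1 i j x =
  (tau * sig)^-1 * (ramp2 (z x) * bad x) + tau^-1 * ramp1 (z x) * con.
  have -> : bad x = \sum_i \sum_j m1 i x * m1 j x *
      ((i == j)%:R * dotp (g x) (g x) - g x 0 i * g x 0 j).
    have -> : bad x = \sum_i \sum_j m1 i x * m1 j x * ((i == j)%:R * dotp (g x) (g x)) -
       \sum_i \sum_j m1 i x * m1 j x * (g x 0 i * g x 0 j).
      congr (_ - _).
        rewrite {1}/dotp mulr_suml; apply: eq_bigr => i _.
        rewrite (bigD1 i)//= eqxx mul1r big1 ?addr0 ?mxE// => j ji.
        by rewrite eq_sym (negPf ji) mul0r mulr0.
      rewrite expr2 {1}/dotp mulr_suml; apply: eq_bigr => i _.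
      rewrite /dotp mulr_sumr; apply: eq_bigr => j _; rewrite !mxE; ring.
    rewrite -sumrB; apply: eq_bigr => i _; rewrite -sumrB; apply: eq_bigr => j _; ring.
  rewrite !mulr_sumr -big_split/=; apply: eq_bigr => i _.
  rewrite !mulr_sumr -big_split/=; apply: eq_bigr => j _.
  by rewrite bE /P2; field; rewrite !gt_eqF.
rewrite gerDl mulr_ge0_le0// mulr_ge0 ?invr_ge0 ?(ltW tau_gt0)//.
by case/andP: (ramp1_range (z x)).
Qed.

End HessianWeight.

(** * Regularity of the Dirichlet problem on a convex polytope *)

Section Regularity.
Variables (R : realType) (d : nat).
Implicit Types (x y v : 'rV[R]_d).
Local Notation e i := (delta_mx 0 i : 'rV[R]_d).

(** The face moved outwards by tau. *)
Definition push (tau : R) (p : 'rV[R]_d * R) := (p.1, p.2 + tau).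

Lemma gap_push tau p x : gap (push tau p) x = gap p x + tau.
Proof. by rewrite /gap/=; ring. Qed.

Lemma pos_below (Hs : seq ('rV[R]_d * R)) x0 : polytope Hs x0 ->
  exists2 g, 0 < g & forall p, p \in Hs -> g <= gap p x0.
Proof.
elim: Hs => [|q Hs IH] hx; first by exists 1.
have [g g0 hg] : exists2 g, 0 < g & forall p, p \in Hs -> g <= gap p x0.
  by apply: IH => p pH; apply: hx; rewrite inE pH orbT.
exists (Num.min g (gap q x0)).
  by rewrite lt_min g0 hx// mem_head.
by move=> p; rewrite inE ge_min => /predU1P[->|/hg ->]; rewrite ?lexx ?orbT.
Qed.

(** Homotheties centred at an interior point map the enlarged polytopes into
    the polytope. *)
Lemma enlarged_bounded (Hs : seq ('rV[R]_d * R)) x0 rho0 : polytope Hs x0 ->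
  (forall x, polytope Hs x -> enorm x <= rho0) ->
  exists2 rho, 0 <= rho & forall tau, 0 <= tau -> tau <= 1 ->
    forall x, polytope (map (push tau) Hs) x -> enorm x <= rho.
Proof.
move=> hx0 hrho; have [g g0 hg] := pos_below hx0.
pose t := g / (g + 2).
have t0 : 0 < t by rewrite divr_gt0//; lra.
have tg : t * (g + 2) = g by rewrite /t mulrVK// unitfE gt_eqF//; lra.
have r0 : 0 <= rho0 by apply: le_trans (hrho _ hx0); exact: enorm_ge0.
exists (enorm x0 + t^-1 * (rho0 + enorm x0)).
  by rewrite addr_ge0 ?enorm_ge0// mulr_ge0 ?invr_ge0 ?(ltW t0)// addr_ge0// enorm_ge0.
move=> tau tau0 tau1 x hx.
have hz : polytope Hs (x0 + t *: (x - x0)).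
  move=> p pH; have h1 := hg p pH; have h2 := hx _ (map_f (push tau) pH).
  rewrite gap_push in h2.
  have -> : gap p (x0 + t *: (x - x0)) = (1 - t) * gap p x0 + t * gap p x.
    by rewrite gapD dotpZr dotpBr /gap; ring.
  have t1 : t < 1 by rewrite ltr_pdivrMr ?mul1r; lra.
  have h3 : (1 - t) * g <= (1 - t) * gap p x0 by rewrite ler_wpM2l//; lra.
  have h4 : 0 < t * (gap p x + tau) by rewrite mulr_gt0.
  have h5 : t * tau <= t * 1 by rewrite ler_wpM2l// ltW.
  have h6 : t * g <= g by rewrite ler_piMl ?ltW.
  lra.
have -> : x = x0 + t^-1 *: ((x0 + t *: (x - x0)) - x0).
  by rewrite [X in t^-1 *: X]addrAC subrr add0r scalerA mulVf ?gt_eqF// scale1r addrCA subrr addr0.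
rewrite (le_trans (enormD _ _))// lerD2l enormZ gtr0_norm ?invr_gt0// ler_wpM2l ?invr_ge0 ?(ltW t0)//.
by rewrite (le_trans (enormD _ _))// enormN lerD2r hrho.
Qed.

Lemma small_enough (c k : R) : 0 <= c -> 0 < k -> exists2 r0, 0 < r0 & forall r, 0 <= r -> r <= r0 -> c * r <= k.
Proof.
move=> c0 k0; exists (k / (c + 1)); first by rewrite divr_gt0// ltr_wpDl.
move=> r r0 h; rewrite ler_pdivlMr ?ltr_wpDl// in h; lra.
Qed.

Lemma min_pos (s : seq R) : all (fun a => 0 < a) s -> exists2 r, 0 < r & all (fun a => r <= a) s.
Proof.
elim: s => [|a s IH] /=; first by exists 1.
move=> /andP[a0 /IH[r r0 hr]]; exists (Num.min a r); first by rewrite lt_min a0.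
by rewrite ge_min lexx/=; apply: sub_all hr => b rb; rewrite ge_min rb orbT.
Qed.

(** The constants of slab_vol and corner_vol, made uniform over the finitely
    many faces and pairs of faces. *)
Lemma slab_corner_vol (Ds : seq ('rV[R]_d * R)) x0 B : 0 < B ->
  (forall p, p \in Ds -> dotp p.1 p.1 = 1) -> polytope Ds x0 ->
  exists C l0, [/\ 0 <= C, 0 < l0 & forall p q l l', p \in Ds -> q \in Ds ->
    0 < l -> l <= l0 -> 0 < l' -> l' <= l0 ->
    J (\1_(cube 0 B `&` slab p l) : _ -> R) <= C * l /\
    (p != q -> J (\1_(cube 0 B `&` (slab p l `&` slab q l')) : _ -> R) <= C * (l * l'))].
Proof.
move=> B0 uD hx0.
have pair p q : p \in Ds -> q \in Ds -> exists C l0, [/\ 0 <= C, 0 < l0 & forall l l',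
    0 < l -> l <= l0 -> 0 < l' -> l' <= l0 ->
    J (\1_(cube 0 B `&` slab p l) : _ -> R) <= C * l /\
    (p != q -> J (\1_(cube 0 B `&` (slab p l `&` slab q l')) : _ -> R) <= C * (l * l'))].
  move=> pD qD; have [C C0 hC] := slab_vol (uD p pD) B0.
  have [C' [l0 [C'0 l00 hC']]] : exists C l0, [/\ 0 <= C, 0 < l0 & forall l l',
    0 < l -> l <= l0 -> 0 < l' -> l' <= l0 ->
    p != q -> J (\1_(cube 0 B `&` (slab p l `&` slab q l')) : _ -> R) <= C * (l * l')].
    have [<-|pq] := eqVneq p q; first by exists 0, 1.
    have [C' [l0 [C'0 l00 hC']]] := corner_vol (uD p pD) (uD q qD) pq (hx0 p pD) (hx0 q qD) B0.
    by exists C', l0; split=> // *; exact: hC'.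
  exists (C + C'), (Num.min 1 l0); split; [exact: addr_ge0|by rewrite lt_min ltr01|].
  move=> l l' lp; rewrite le_min => /andP[l1 ll] l'p; rewrite le_min => /andP[_ ll'].
  split => [|pq].
    by rewrite (le_trans (hC l lp l1))// ler_wpM2r ?(ltW lp)// lerDl.
  by rewrite (le_trans (hC' l l' lp ll l'p ll' pq))// ler_wpM2r ?mulr_ge0 ?(ltW lp) ?(ltW l'p)// lerDr.
have [C hC] : exists C : 'rV[R]_d * R -> 'rV[R]_d * R -> R * R, forall p q, p \in Ds -> q \in Ds ->
    [/\ 0 <= (C p q).1, 0 < (C p q).2 & forall l l',
    0 < l -> l <= (C p q).2 -> 0 < l' -> l' <= (C p q).2 ->
    J (\1_(cube 0 B `&` slab p l) : _ -> R) <= (C p q).1 * l /\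
    (p != q -> J (\1_(cube 0 B `&` (slab p l `&` slab q l')) : _ -> R) <= (C p q).1 * (l * l'))].
  have ex p q : exists c : R * R, p \in Ds -> q \in Ds ->
    [/\ 0 <= c.1, 0 < c.2 & forall l l',
    0 < l -> l <= c.2 -> 0 < l' -> l' <= c.2 ->
    J (\1_(cube 0 B `&` slab p l) : _ -> R) <= c.1 * l /\
    (p != q -> J (\1_(cube 0 B `&` (slab p l `&` slab q l')) : _ -> R) <= c.1 * (l * l'))].
    have [pD|pD] := boolP (p \in Ds); last by exists (0, 0).
    have [qD|qD] := boolP (q \in Ds); last by exists (0, 0).
    by have [C [l0 h]] := pair p q pD qD; exists (C, l0).
  by exists (fun p q => projT1 (cid (ex p q))) => p q; case: cid.
have [C0 C00 hC0] : exists2 C0, 0 <= C0 & forall p q, p \in Ds -> q \in Ds -> (C p q).1 <= C0.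
  exists (\sum_(p <- Ds) \sum_(q <- Ds) `|(C p q).1|).
    by apply: sumr_ge0 => p _; apply: sumr_ge0.
  move=> p q pD qD; rewrite (big_rem p)//= (big_rem q)//=.
  rewrite (le_trans (ler_norm _))// -addrA lerDl addr_ge0//; first exact: sumr_ge0.
  by apply: sumr_ge0 => ? _; apply: sumr_ge0.
have [l0 l00 hl0] : exists2 l0, 0 < l0 & forall p q, p \in Ds -> q \in Ds -> l0 <= (C p q).2.
  have [l0 l00 /allP hl0] : exists2 l0, 0 < l0 & all (fun a => l0 <= a)
      [seq (C z.1 z.2).2 | z <- [seq (p, q) | p <- Ds, q <- Ds]].
    apply: min_pos; apply/allP => a /mapP[z /allpairsP[[p' q']/= [pD qD ->]] ->] /=.
    by have [] := hC _ _ pD qD.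
  exists l0 => // p q pD qD; apply: hl0; apply/mapP; exists (p, q) => //.
  exact: allpairs_f.
exists C0, l0; split=> // p q l l' pD qD lp ll l'p ll'.
have [c0 c1 h] := hC p q pD qD.
have [h1 h2] := h l l' lp (le_trans ll (hl0 _ _ pD qD)) l'p (le_trans ll' (hl0 _ _ pD qD)).
split=> [|pq].
  by rewrite (le_trans h1)// ler_wpM2r ?(ltW lp)// hC0.
by rewrite (le_trans (h2 pq))// ler_wpM2r ?mulr_ge0 ?(ltW lp) ?(ltW l'p)// hC0.
Qed.

Lemma le_bigseq (I : eqType) (s : seq I) (P : pred I) (f : I -> R) a :
  (forall i, 0 <= f i) -> a \in s -> P a -> f a <= \sum_(i <- s | P i) f i.
Proof. by move=> f0 as_ Pa; rewrite (big_rem a)//= Pa lerDl sumr_ge0. Qed.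

Lemma sum_le_const (I : eqType) (s : seq I) (P : pred I) (f : I -> R) c : 0 <= c ->
  (forall i, i \in s -> P i -> f i <= c) -> \sum_(i <- s | P i) f i <= (size s)%:R * c.
Proof.
move=> c0; elim: s => [|a s IH] h; first by rewrite big_nil mul0r.
have {}IH : \sum_(i <- s | P i) f i <= (size s)%:R * c.
  by apply: IH => i si; apply: h; rewrite inE si orbT.
rewrite big_cons -[size _]/((size s).+1) -natr1; case: ifP => Pa.
  have := h a (mem_head _ _) Pa; lra.
lra.
Qed.

Lemma mset_polytope (Hs : seq ('rV[R]_d * R)) : mset_rV (polytope Hs).
Proof.
apply: mset_forall_seq => p _.
rewrite (_ : (fun x => _) = ~` [set x | gap p x <= 0]).
  apply: mset_setC; apply: mset_le; apply: mfun_continuous.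
  by have [M hM] := gap_is_lip p; exact: (lip_continuous hM).
by apply/seteqP; split => x /=; [move=> h; apply/negP; rewrite -ltNge|move=> /negP; rewrite -ltNge].
Qed.

Lemma polytope_cube (Hs : seq ('rV[R]_d * R)) rho x : (forall x, polytope Hs x -> enorm x <= rho) ->
  polytope Hs x -> cube 0 (rho + 1) x.
Proof.
move=> h /h hx i; rewrite mxE subr0 (le_lt_trans (enorm_coord x i))//; lra.
Qed.

(** The convexity estimate: up to arbitrarily small errors there is a smooth
    solution of the Dirichlet problem whose Hessian is bounded, with constant
    one, by the right-hand side.  The scheme is solved in the polytope whose
    faces are moved outwards by tau, so that the weight exceeds a constant close
    to one on the original polytope.  The layer where the ramp is convex splits
    into a part near a single face, where the solution has a small tangential
    gradient, and a part near two faces, whose volume is of second order. *)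
Lemma regularity (Hs : seq ('rV[R]_d * R)) x0 rho0 (f : 'rV[R]_d -> R) F Lf kap :
  (0 < d)%N -> (forall p, p \in Hs -> dotp p.1 p.1 = 1) -> uniq Hs -> Hs != [::] ->
  polytope Hs x0 -> (forall x, polytope Hs x -> enorm x <= rho0) ->
  0 <= F -> 0 <= Lf -> (forall x, `|f x| <= F) ->
  (forall x y, `|f (x + y) - f x| <= Lf * enorm y) ->
  (forall x, ~ polytope Hs x -> f x = 0) -> 0 < kap ->
  exists G0 G1 G2 G3, [/\ @C3 R d G0 G1 G2 G3,
    forall x, polytope Hs x -> `|\sum_i G2 i i x + f x| <= kap,
    J (fun x => \1_(polytope Hs) x * \sum_i \sum_j G2 i j x ^+ 2) <= J (fun x => f x ^+ 2) + kap &
    forall x, ~ polytope Hs x -> `|G0 x| <= kap].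
Proof.
move=> d0 uH unH Hn hx0 hrho0 F0 Lf0 fF fL f0 kap0.
have [rho rho_ge0 hrho] := enlarged_bounded hx0 hrho0.
have [bmax bmaxE] : exists b : R, b = \sum_(p <- Hs) `|p.2| + 1 by eexists.
have [K KE] : exists K, K = lip_const rho bmax F Lf by eexists.
have [fc fcE] : exists c, c = face_const rho bmax F by eexists.
have bm0 : 0 <= bmax by rewrite bmaxE addr_ge0// sumr_ge0.
have fc0 : 0 <= fc by rewrite fcE /face_const mulr_ge0// !addr_ge0.
have K0 : 0 <= K by rewrite KE /lip_const addr_ge0 -?fcE// mulr_ge0 ?sqr_ge0// addr_ge0.
have [tau0 tau00 htau0] := small_enough (mulr_ge0 (ler0n _ 2) fc0) kap0.
have [tau tau_gt0 /= /and3P[tau1 taule _]] : exists2 t, 0 < t & all (fun a => t <= a) [:: 1; tau0].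
  by apply: min_pos; rewrite /= ltr01 tau00.
have {htau0} htau : 2 * fc * tau <= kap by apply: htau0 => //; exact: ltW.
have [Ds DsE] : exists Ds, Ds = map (push tau) Hs by eexists.
have DsP p : p \in Ds -> exists2 q, q \in Hs & p = push tau q by rewrite DsE => /mapP.
have uD p : p \in Ds -> dotp p.1 p.1 = 1 by move=> /DsP[q qH ->]; apply: (uH q qH).
have unD : uniq Ds.
  rewrite DsE map_inj_uniq// => -[a b] [a' b'] [-> /addIr ->]//.
have bD p : p \in Ds -> `|p.2| <= bmax.
  move=> /DsP[q qH ->] /=; rewrite (le_trans (ler_normD _ _))// bmaxE lerD//.
    by apply: (le_bigseq (f := fun p => `|p.2|)).
  by rewrite ger0_norm// ltW.
have Dsn : Ds != [::] by rewrite DsE; case: (Hs) Hn.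
have hD x : polytope Ds x -> enorm x <= rho by rewrite DsE; apply: hrho; rewrite ?(ltW tau_gt0).
have gapD0 x : polytope Hs x -> forall p, p \in Ds -> tau <= gap p x.
  by move=> hx p /DsP[q qH ->]; rewrite gap_push lerDr ltW// hx.
have HD x : polytope Hs x -> polytope Ds x.
  by move=> hx p pD; apply: lt_le_trans tau_gt0 (gapD0 _ hx _ pD).
have [B BE] : exists B, B = rho + 1 by eexists.
have B0 : 0 < B by rewrite BE ltr_wpDl.
have DB x : polytope Ds x -> cube 0 B x by rewrite BE; exact: polytope_cube.
have [C [l0 [C0 l00 hvol]]] := slab_corner_vol B0 uD (HD _ hx0).
have [n nE] : exists n : R, n = (size Ds)%:R by eexists.
have n1 : 1 <= n by rewrite nE ler1n; case: (Ds) Dsn.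
have n0 : 0 < n by exact: lt_le_trans n1.
have [E EE] : exists E, E = J (fun x => f x ^+ 2) by eexists.
have E0 : 0 <= E by rewrite EE; apply: J_ge0 => x; exact: sqr_ge0.
have kap8 : 0 < kap / 8 by rewrite divr_gt0.
(* the corner contribution fixes r, the flat one then fixes sig *)
have c10 : 0 <= 12 * n ^+ 2 * K ^+ 2 * C / tau.
  by rewrite !mulr_ge0 ?exprn_ge0 ?invr_ge0 ?(ltW n0) ?(ltW tau_gt0).
have [r1 r10 hr1] := small_enough c10 kap8.
have [r r0 /= /and3P[rle rl _]] : exists2 t, 0 < t & all (fun a => t <= a) [:: r1; l0 / 3].
  by apply: min_pos; rewrite /= r10 divr_gt0.
have {hr1} hr : 12 * n ^+ 2 * K ^+ 2 * C / tau * r <= kap / 8 by apply: hr1 => //; exact: ltW.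
have [Ar ArE] : exists A, A = (d%:R / r ^+ 2 + 1) * (bmax + rho + 2) by eexists.
have Ar0 : 0 <= Ar by rewrite ArE mulr_ge0// ?addr_ge0// divr_ge0 ?sqr_ge0.
have c20 : 0 <= 36 * n * K ^+ 2 * Ar ^+ 2 * C / tau.
  by rewrite !mulr_ge0 ?exprn_ge0 ?invr_ge0 ?(ltW n0) ?(ltW tau_gt0).
have [s1 s10 hs1] := small_enough c20 kap8.
have c30 : 0 <= 3 / 2 * (E + kap) / tau.
  by rewrite !mulr_ge0 ?addr_ge0 ?invr_ge0 ?(ltW kap0) ?(ltW tau_gt0).
have kap2 : 0 < kap / 2 by rewrite divr_gt0.
have [s2 s20 hs2] := small_enough c30 kap2.
have [sig sig_gt0 /= /and5P[sg1 sgs1 sgs2 sgt /and3P[sgl sgr _]]] : exists2 t, 0 < t &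
    all (fun a => t <= a) [:: 1; s1; s2; tau / 3; l0 / 2; r].
  by apply: min_pos; rewrite /= ltr01 s10 s20 r0 !divr_gt0.
have {hs1} hs1 := hs1 _ (ltW sig_gt0) sgs1; have {hs2} hs2 := hs2 _ (ltW sig_gt0) sgs2.
have [eps epsE] : exists e, e = sig / (2 * n) by eexists.
have eps0 : 0 < eps by rewrite epsE divr_gt0// mulr_gt0.
have neps : n * eps = sig / 2 by rewrite epsE; field; rewrite gt_eqF.
have neps' : (size Ds)%:R * eps <= sig.
  by rewrite -nE neps ler_pdivrMr// ler_peMr ?(ltW sig_gt0)// ler1n.
(* the mesh of the scheme is chosen last *)
have kap4 : 0 < kap / 4 by rewrite divr_gt0.
have c40 : 0 <= (2 * F * Lf + Lf ^+ 2) * (2 * B) ^+ d.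
  by rewrite mulr_ge0 ?exprn_ge0 ?addr_ge0 ?mulr_ge0 ?sqr_ge0 ?(ltW B0).
have [e1 e10 he1] := small_enough c40 kap4.
have [e2 e20 he2] := small_enough Lf0 kap0.
have [eta eta0 /= /and5P[et1 ete1 ete2 ets /andP[etr _]]] : exists2 t, 0 < t &
    all (fun a => t <= a) [:: 1; e1; e2; sig / 4; r].
  by apply: min_pos; rewrite /= ltr01 e10 e20 r0 divr_gt0.
have {he1} he1 := he1 _ (ltW eta0) ete1; have {he2} he2 := he2 _ (ltW eta0) ete2.
have d30 : 0 < (3 * d)%:R :> R by rewrite ltr0n muln_gt0.
have [s sE] : exists s, s = eta / (3 * d)%:R by eexists.
have s0 : 0 < s by rewrite sE divr_gt0.
have s_le1 : s <= 1.
  by rewrite sE ler_pdivrMr// mul1r (le_trans et1)// ler1n muln_gt0.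
have ds : (3 * d)%:R * s = eta by rewrite sE mulrC mulfVK// gt_eqF.
have := smooth_solution d0 uD Dsn rho_ge0 hD bD F0 Lf0 fF fL s0 s_le1.
rewrite -KE -fcE ds => -[G0 [G1 [G2 [G3 [hC GK Geq Gtan Gface]]]]].
exists G0, G1, G2, G3; split => //.
- move=> x hx; rewrite (le_trans (Geq x _))// => y hy p pD.
  have := gap_lip uD x (y - x) pD; rewrite (_ : x + (y - x) = y); last by rewrite addrCA subrr addr0.
  rewrite ler_norml => /andP[h _]; have h2 := gapD0 _ hx _ pD.
  clear -h h2 hy ets sgt sig_gt0; lra.
-   have [bw abad hw] := hessian_weight DB tau_gt0 sig_gt0 eps0 neps' hC.
  pose H x := \sum_i \sum_j G2 i j x ^+ 2; pose T x := \sum_i G2 i i x.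
  have [p1G p2G _ _ [M hM]] := hC.
  have G1M i x y : `|G1 i (x + y) - G1 i x| <= M * enorm y.
    by have [_ _ _ _ [_ h _ _]] := hM i i i x y.
  have b2 i j : blip (G2 i j).
    by exists M => x y; have [_ _ h _ [_ _ h' _]] := hM i j i x y.
  have bH : blip H.
    by apply: blip_sum => i; apply: blip_sum => j; apply: blipM.
  have bT : blip T by apply: blip_sum => i.
  have woff x : ~ polytope Ds x -> weight Ds tau sig eps x = 0.
    by move=> nx; rewrite /weight ramp0_le0 ?mulr0//; exact: weight_off.
  have aw g : blip g -> adm (fun x => weight Ds tau sig eps x * g x).
    move=> bg; apply: (@blip_adm _ _ _ B); first exact: blipM.
    move=> x h; apply: contrapT => nx; apply: h; rewrite woff ?mul0r// => /DB //.
  have w0 x : 0 <= weight Ds tau sig eps x.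
    rewrite /weight mulr_ge0 ?divr_ge0 ?(ltW sig_gt0) ?(ltW tau_gt0)//.
    by have [] := ramp0_bounds ((smin eps tau Ds x - sig) / sig).
  have w1 x : weight Ds tau sig eps x <= 1.
    have := smin_le_top tau eps0 Ds x; rewrite -nE neps => hm.
    rewrite /weight mulrAC ler_pdivrMr// mul1r.
    have [z1|z1] := leP 1 ((smin eps tau Ds x - sig) / sig).
      rewrite ramp0_ge1// mulrBr mulrCA mulfV ?gt_eqF// mulr1.
      clear -hm sig_gt0; lra.
    have [_ h _] := ramp0_bounds ((smin eps tau Ds x - sig) / sig).
    have h1 : ramp0 ((smin eps tau Ds x - sig) / sig) <= 1.
      by rewrite (le_trans h)// ge_max ler01 ltW.
    apply: (@le_trans _ _ (sig * 1)); first by rewrite ler_wpM2l ?(ltW sig_gt0).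
    clear -sgt sig_gt0 tau_gt0; lra.
  have wOm x : polytope Hs x -> 1 - 3 / 2 * sig / tau <= weight Ds tau sig eps x.
    move=> hx; have hm : tau <= smin eps tau Ds x by apply: smin_ge => //; exact: gapD0.
    have [_ _ h] := ramp0_bounds ((smin eps tau Ds x - sig) / sig).
    apply: (@le_trans _ _ (sig / tau * ((smin eps tau Ds x - sig) / sig - 2^-1))); last first.
      by rewrite ler_wpM2l// divr_ge0 ?ltW.
    rewrite (_ : sig / tau * _ = (smin eps tau Ds x - 3 / 2 * sig) / tau); last first.
      by field; rewrite !gt_eqF.
    rewrite ler_pdivlMr// mulrBl divfK ?gt_eqF//; clear -hm sig_gt0; lra.
  have wT : J (fun x => weight Ds tau sig eps x * T x ^+ 2) <= E + kap / 4.
    have af : adm (fun x => f x ^+ 2).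
      rewrite (_ : (fun x => _) = fun x => f x * f x); last by apply/funext => x; rewrite expr2.
      apply: admM; apply: (@blip_adm _ _ _ B).
      + exists (Num.max F Lf) => x y; rewrite le_max fF/=; split=> //.
        by rewrite (le_trans (fL _ _))// ler_wpM2r ?enorm_ge0// le_max lexx orbT.
      + by move=> x h; apply: contrapT => nx; apply: h; apply: f0 => /HD/DB.
      + exists (Num.max F Lf) => x y; rewrite le_max fF/=; split=> //.
        by rewrite (le_trans (fL _ _))// ler_wpM2r ?enorm_ge0// le_max lexx orbT.
      + by move=> x h; apply: contrapT => nx; apply: h; apply: f0 => /HD/DB.
    have [c cE] : exists c, c = 2 * F * (Lf * eta) + (Lf * eta) ^+ 2 by eexists.
    have Le0 : 0 <= Lf * eta by rewrite mulr_ge0// ltW.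
    have c0 : 0 <= c by rewrite cE addr_ge0 ?sqr_ge0// !mulr_ge0// ltW.
    have hc : c * (2 * B) ^+ d <= kap / 4.
      apply: le_trans he1; rewrite [leRHS]mulrAC ler_wpM2r ?exprn_ge0 ?mulr_ge0 ?(ltW B0)//.
      rewrite cE mulrDl; have : Lf ^+ 2 * eta ^+ 2 <= Lf ^+ 2 * eta.
        by rewrite ler_wpM2l ?sqr_ge0// expr2 ler_piMl// ltW.
      rewrite exprMn => h; clear -h; lra.
    have aT2 : adm (fun x => weight Ds tau sig eps x * T x ^+ 2).
      by apply: (aw (fun x => T x ^+ 2)); exact: blipM.
    apply: (@le_trans _ _ (J (fun x => f x ^+ 2 + c * \1_(cube 0 B) x))).
      apply: J_le => //; first by apply: admD => //; apply: admZ; exact: adm_cube.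
      move=> x; have [hz|hz] := leP ((smin eps tau Ds x - sig) / sig) 0.
        by rewrite /weight ramp0_le0// mulr0 mul0r addr_ge0 ?sqr_ge0// mulr_ge0// indicE ler0n.
      have hm : sig < smin eps tau Ds x by move: hz; rewrite pmulr_lgt0 ?invr_gt0// subr_gt0.
      have hg p : p \in Ds -> sig / 2 < gap p x.
        by move=> pD; have h := smin_le tau eps0 x pD; rewrite -nE neps in h; clear -h hm; lra.
      have hT : `|T x + f x| <= Lf * eta.
        apply: Geq => y hy p pD; have := gap_lip uD x (y - x) pD.
        rewrite (_ : x + (y - x) = y); last by rewrite addrCA subrr addr0.
        rewrite ler_norml => /andP[h _]; have h2 := hg p pD; clear -h h2 hy ets sig_gt0; lra.
      have xB : cube 0 B x by apply: DB => p pD; apply: lt_trans (hg p pD); rewrite divr_gt0.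
      rewrite indicE mem_set// mulr1.
      apply: (@le_trans _ _ (1 * T x ^+ 2)); first by rewrite ler_wpM2r ?sqr_ge0.
      rewrite mul1r (_ : T x = (T x + f x) - f x); last by rewrite addrK.
      have hf := fF x; move: (T x + f x) hT => A hA.
      have h1 : A ^+ 2 <= (Lf * eta) ^+ 2.
        by rewrite -real_normK ?num_real// ler_pXn2r ?nnegrE.
      have h2 : `|A * f x| <= (Lf * eta) * F by rewrite normrM ler_pM.
      move: h2; rewrite ler_norml => /andP[h2 h3]; rewrite cE sqrrB; clear -h1 h2 h3; lra.
    rewrite JD//; last by apply: admZ; exact: adm_cube.
    by rewrite JZ ?J_cube -?EE ?lerD2l//; exact: adm_cube.
    have [L LE] : exists L, L = K * Ar * (3 * sig) by eexists.
  have L0 : 0 <= L by rewrite LE !mulr_ge0// ltW.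
  pose g x : 'rV[R]_d := \row_i G1 i x.
  pose bad x := dotp (grad_smin eps tau Ds x) (grad_smin eps tau Ds x) * dotp (g x) (g x) -
      dotp (grad_smin eps tau Ds x) (g x) ^+ 2.
  have unitD p : p \in Ds -> enorm p.1 = 1 by move=> pD; exact: (unit_normal uD).
  have gK x : dotp (g x) (g x) <= K ^+ 2.
    have h : dotp (g x) (g x) <= K * enorm (g x).
      have -> : dotp (g x) (g x) = `|\sum_i (g x) 0 i * G1 i x|.
        rewrite -[LHS]ger0_norm ?dotp_ge0//; congr `|_|; apply: eq_bigr => i _.
        by rewrite [X in _ * X]mxE.
      apply: (directional_bound p1G G1M ltr01) => t t0 t1.
      by rewrite (le_trans (GK _ _))// enormZ gtr0_norm.
    have h2 := enorm_ge0 (g x); rewrite -enorm_sqr in h *; clear -h h2 K0; nra.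
  have badK x : bad x <= K ^+ 2.
    have h2 := grad_smin_le1 eps tau x unitD; have h1 := enorm_ge0 (grad_smin eps tau Ds x).
    rewrite /bad -enorm_sqr; have h6 := gK x; have h5 := dotp_ge0 (g x).
    have h4 := sqr_ge0 (dotp (grad_smin eps tau Ds x) (g x)).
    have h3 : enorm (grad_smin eps tau Ds x) ^+ 2 <= 1 by rewrite expr_le1.
    have h7 : enorm (grad_smin eps tau Ds x) ^+ 2 * dotp (g x) (g x) <= dotp (g x) (g x) by rewrite ler_piMl.
    clear -h7 h6 h4; lra.
  have badL x p : p \in Ds -> sig / 2 < gap p x -> gap p x < 2 * sig ->
      (forall q, q \in Ds -> q != p -> 3 * r < gap q x) -> bad x <= L ^+ 2.
    move=> pD g1 g2 go.
    have gm : grad_smin eps tau Ds x = - p.1.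
      apply: grad_smin_flat => //; rewrite -nE neps; first by clear -g2 sgt sig_gt0; lra.
      by move=> q qD qp; have h := go q qD qp; clear -h g2 sgr sig_gt0; lra.
    pose w := g x - dotp p.1 (g x) *: p.1.
    have pw : dotp p.1 w = 0 by rewrite /w dotpBr dotpZr uD// mulr1 subrr.
    have wg : dotp w (g x) = dotp w w.
      by rewrite /w dotpBr dotpZr -/w (dotpC w p.1) pw mulr0 subr0.
    have badE : bad x = dotp w w.
      rewrite /bad gm dotpNl !dotpNr dotpNl opprK uD// mul1r sqrrN -wg /w dotpBl dotpZl expr2//.
    have h : dotp w w <= L * enorm w.
      have -> : dotp w w = `|\sum_i w 0 i * G1 i x|.
        rewrite -[LHS]ger0_norm ?dotp_ge0// -wg; congr `|_|; apply: eq_bigr => i _.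
        by rewrite [X in _ * X]mxE.
      have rw : 0 < r / (enorm w + 1) / 2 by rewrite !divr_gt0// ltr_wpDl// enorm_ge0.
      apply: (directional_bound p1G G1M rw) => t t0 t1.
      have tw : enorm (t *: w) = t * enorm w by rewrite enormZ gtr0_norm.
      have := Gtan p x (t *: w) r pD r0; rewrite -ArE => /(_ _ _ _ _)/le_trans; apply.
      + clear -ets g1 sig_gt0; lra.
      + by move=> q qD qp; have h := go q qD qp; clear -h etr; lra.
      + by rewrite dotpZr pw mulr0.
      + rewrite tw; apply: (@le_lt_trans _ _ (r / 2)); last by clear -r0; lra.
        apply: (@le_trans _ _ (r / (enorm w + 1) / 2 * enorm w)); first by rewrite ler_wpM2r ?enorm_ge0.
        rewrite mulrAC ler_pM2r// mulrAC ler_pdivrMr; last by rewrite ltr_wpDl// enorm_ge0.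
        by rewrite ler_wpM2l// ?(ltW r0)// lerDl.
      + have kt : 0 <= K * Ar * (t * enorm w).
          by rewrite !mulr_ge0 ?(ltW t0)// enorm_ge0.
        have gs : gap p x + eta <= 3 * sig by clear -g2 ets sig_gt0; lra.
        rewrite tw LE (_ : K * Ar * (3 * sig) * _ = K * Ar * (t * enorm w) * (3 * sig)); last by ring.
        by rewrite (mulrAC K) ler_wpM2l.
    have h2 := enorm_ge0 w; rewrite badE -enorm_sqr in h *; clear -h h2 L0; nra.
  have hbad : J (fun x => ramp2 ((smin eps tau Ds x - sig) / sig) * bad x) <=
      n * (n * (2 * K ^+ 2 * (C * (2 * sig * (3 * r))))) + n * (2 * L ^+ 2 * (C * (2 * sig))).
    pose S (p q : 'rV[R]_d * R) := cube 0 B `&` (slab p (2 * sig) `&` slab q (3 * r)).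
    pose Tp (p : 'rV[R]_d * R) := cube 0 B `&` slab p (2 * sig).
    have mS p q : adm (\1_(S p q) : _ -> R).
      apply: (@adm_indic _ _ _ B); last by move=> x [].
      by apply: mset_setI; [exact: mset_cube|apply: mset_setI; exact: mset_slab].
    have mT p : adm (\1_(Tp p) : _ -> R).
      apply: (@adm_indic _ _ _ B); last by move=> x [].
      by apply: mset_setI; [exact: mset_cube|exact: mset_slab].
    pose b1 x : R := \sum_(p <- Ds) \sum_(q <- Ds | p != q) 2 * K ^+ 2 * \1_(S p q) x.
    pose b2' x : R := \sum_(p <- Ds) 2 * L ^+ 2 * \1_(Tp p) x.
    have ab1 : adm b1 by apply: adm_sum => p _; apply: adm_sum => q _; exact: admZ.
    have ab2 : adm b2' by apply: adm_sum => p _; exact: admZ.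
    have b10 x : 0 <= b1 x.
      by apply: sumr_ge0 => p _; apply: sumr_ge0 => q _; rewrite !mulr_ge0 ?sqr_ge0// indicE ler0n.
    have b20 x : 0 <= b2' x.
      by apply: sumr_ge0 => p _; rewrite !mulr_ge0 ?sqr_ge0// indicE ler0n.
    have pt x : ramp2 ((smin eps tau Ds x - sig) / sig) * bad x <= b1 x + b2' x.
      have [->|nz] := eqVneq (ramp2 ((smin eps tau Ds x - sig) / sig)) 0.
        by rewrite mul0r addr_ge0.
      have /andP[] := ramp2_neq0 nz; rewrite pmulr_lgt0 ?invr_gt0// subr_gt0 => m1.
      rewrite ltr_pdivrMr// mul1r => m2.
      have hg p : p \in Ds -> sig / 2 < gap p x.
        by move=> pD; have h := smin_le tau eps0 x pD; rewrite -nE neps in h; clear -h m1; lra.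
      have xB : cube 0 B x by apply: DB => p pD; apply: lt_trans (hg p pD); rewrite divr_gt0.
      have [p pD gp] : exists2 p, p \in Ds & gap p x < 2 * sig.
        apply: contrapT => no; have : 2 * sig <= smin eps tau Ds x; last by clear -m2; lra.
        apply: smin_ge => //; first by clear -sgt sig_gt0; lra.
        by move=> p pD; rewrite leNgt; apply/negP => h; apply: no; exists p.
      have gp1 := hg p pD.
      have /andP[q0 q2] := ramp2_range ((smin eps tau Ds x - sig) / sig).
      case: (pselect (exists q, [/\ q \in Ds, p != q & gap q x <= 3 * r])) => [[q [qD pq gq]]|no].
        apply: (@le_trans _ _ (2 * K ^+ 2)).
          apply: (@le_trans _ _ (ramp2 ((smin eps tau Ds x - sig) / sig) * K ^+ 2)).
            by rewrite ler_wpM2l.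
          by rewrite ler_wpM2r ?sqr_ge0.
        apply: (@le_trans _ _ (b1 x)); last by rewrite lerDl.
        have nn p' q' : 0 <= 2 * K ^+ 2 * \1_(S p' q') x.
          by rewrite !mulr_ge0 ?sqr_ge0// indicE ler0n.
        apply: (@le_trans _ _ (\sum_(q <- Ds | p != q) 2 * K ^+ 2 * \1_(S p q) x)); last first.
          apply: (le_bigseq (f := fun p => \sum_(q <- Ds | p != q) 2 * K ^+ 2 * \1_(S p q) x)) => // p'.
          exact: sumr_ge0.
        apply: (@le_trans _ _ (2 * K ^+ 2 * \1_(S p q) x)); last first.
          exact: (le_bigseq (f := fun q => 2 * K ^+ 2 * \1_(S p q) x)).
        rewrite indicE mem_set ?mulr1//; have := hg q qD => gq1.
        by split => //; split; rewrite /slab/= gtr0_norm//; clear -gp gp1 gq gq1 sig_gt0; lra.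
      apply: (@le_trans _ _ (2 * L ^+ 2)).
        apply: (@le_trans _ _ (ramp2 ((smin eps tau Ds x - sig) / sig) * L ^+ 2)).
          rewrite ler_wpM2l//; apply: (badL x p) => // q qD qp.
          by rewrite ltNge; apply/negP => h; apply: no; exists q; split => //; rewrite eq_sym.
        by rewrite ler_wpM2r ?sqr_ge0.
      apply: (@le_trans _ _ (b2' x)); last by rewrite lerDr.
      apply: (@le_trans _ _ (2 * L ^+ 2 * \1_(Tp p) x)); last first.
        apply: (le_bigseq (f := fun p => 2 * L ^+ 2 * \1_(Tp p) x)) => // p'.
        by rewrite !mulr_ge0 ?sqr_ge0// indicE ler0n.
      rewrite indicE mem_set ?mulr1//.
      by split => //; rewrite /slab/= gtr0_norm//; clear -gp gp1 sig_gt0; lra.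
    rewrite (le_trans (J_le abad (admD ab1 ab2) pt))// JD// lerD//.
      rewrite /b1 J_sum; last by move=> p _; apply: adm_sum => q _; exact: admZ.
      rewrite nE; apply: sum_le_const; first by rewrite !mulr_ge0 ?sqr_ge0// ltW.
      move=> p pD _; rewrite J_sum; last by move=> q _; exact: admZ.
      apply: sum_le_const; first by rewrite !mulr_ge0 ?sqr_ge0// ltW.
      move=> q qD pq; rewrite JZ// ler_wpM2l ?mulr_ge0 ?sqr_ge0//.
      by have [||||_ h] := hvol p q (2 * sig) (3 * r) pD qD; [clear -sig_gt0; lra|clear -sgl; lra|clear -r0; lra|clear -rl; lra|exact: h].
    rewrite /b2' J_sum; last by move=> p _; exact: admZ.
    rewrite nE; apply: sum_le_const; first by rewrite !mulr_ge0 ?sqr_ge0// ltW.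
    move=> p pD _; rewrite JZ// ler_wpM2l ?mulr_ge0 ?sqr_ge0//.
    by have [||||h _] := hvol p p (2 * sig) (2 * sig) pD pD; [clear -sig_gt0; lra|clear -sgl; lra|clear -sig_gt0; lra|clear -sgl; lra|exact: h].
  have hbad2 : (tau * sig)^-1 * J (fun x => ramp2 ((smin eps tau Ds x - sig) / sig) * bad x) <= kap / 4.
    have ts0 : 0 < (tau * sig)^-1 by rewrite invr_gt0 mulr_gt0.
    rewrite (le_trans (ler_wpM2l (ltW ts0) hbad))//.
    have -> : (tau * sig)^-1 * (n * (n * (2 * K ^+ 2 * (C * (2 * sig * (3 * r))))) +
        n * (2 * L ^+ 2 * (C * (2 * sig)))) =
      12 * n ^+ 2 * K ^+ 2 * C / tau * r + 36 * n * K ^+ 2 * Ar ^+ 2 * C / tau * sig ^+ 2.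
      by rewrite LE; field; rewrite !gt_eqF.
    have h : 36 * n * K ^+ 2 * Ar ^+ 2 * C / tau * sig ^+ 2 <= 36 * n * K ^+ 2 * Ar ^+ 2 * C / tau * sig.
      by rewrite ler_wpM2l// expr2 ler_piMl// ltW.
    clear -h hs1 hr; lra.
  have XE : (1 - 3 / 2 * sig / tau) * J (fun x => \1_(polytope Hs) x * H x) <= E + kap / 2.
    have aH : adm (fun x => \1_(polytope Hs) x * H x).
      apply: (@adm_dom _ _ _ (fun x => \1_(cube 0 B) x * H x) 1).
      - apply: mfunM; [apply: mfun_indic; exact: mset_polytope|exact: blip_mfun].
      - have [N hN] := bH; apply: (@adm_intro _ _ _ N B).
        + apply: mfunM; [apply: mfun_indic; exact: mset_cube|exact: blip_mfun].
        + move=> x; have [h _] := hN x 0; rewrite normrM (le_trans _ h)// ler_piMl// indicE.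
          by rewrite normr_nat lern1 leq_b1.
        + move=> x; rewrite indicE; case: (pselect (cube 0 B x)) => // nx.
          by rewrite memNset// mul0r.
      - move=> x; rewrite mul1r !normrM ler_wpM2r// !indicE.
        case: (pselect (polytope Hs x)) => hx; last by rewrite memNset// normr0.
        by rewrite !mem_set//; apply/DB/HD.
    rewrite -JZ//.
    have H0 x : 0 <= H x by apply: sumr_ge0 => i _; apply: sumr_ge0 => j _; exact: sqr_ge0.
    apply: (@le_trans _ _ (J (fun x => weight Ds tau sig eps x * H x))).
      apply: J_le; [exact: admZ|exact: aw|move=> x].
      rewrite mulrA; case: (pselect (polytope Hs x)) => hx.
        by rewrite indicE mem_set// mulr1 ler_wpM2r// wOm.
      by rewrite indicE memNset// mulr0 mul0r mulr_ge0.
    have -> : J (fun x => weight Ds tau sig eps x * H x) =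
        J (fun x => weight Ds tau sig eps x * (H x - T x ^+ 2)) +
        J (fun x => weight Ds tau sig eps x * T x ^+ 2).
      rewrite -JD; first by congr J; apply/funext => x; ring.
        by apply: (aw (fun x => H x - T x ^+ 2)); apply: blipB => //; exact: blipM.
      by apply: (aw (fun x => T x ^+ 2)); exact: blipM.
    have := le_trans hw hbad2; rewrite -/(bad) => hw'.
    have {}hw' : J (fun x => weight Ds tau sig eps x * (H x - T x ^+ 2)) <= kap / 4 by [].
    clear -hw' wT; lra.
  rewrite -EE; set X := J _ in XE *.
  have X0 : 0 <= X.
    apply: J_ge0 => x; apply: mulr_ge0; first by rewrite indicE ler0n.
    by apply: sumr_ge0 => i _; apply: sumr_ge0 => j _; exact: sqr_ge0.
  have [th thE] : exists th, th = 3 / 2 * sig / tau by eexists.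
  have hth : th * (E + kap) <= kap / 2.
    by apply: le_trans hs2; rewrite thE le_eqVlt; apply/orP; left; apply/eqP; field; rewrite gt_eqF.
  have th1 : th <= 2^-1 by rewrite thE ler_pdivrMr//; clear -sgt; lra.
  rewrite -thE in XE.
  rewrite leNgt; apply/negP => lt.
  have : (1 - th) * (E + kap) < (1 - th) * X by rewrite ltr_pM2l//; clear -th1; lra.
  move=> h; clear -h XE hth; lra.
- move=> x /existsNP[p] /not_implyP[pH /negP]; rewrite -leNgt => gp.
  have pD : push tau p \in Ds by rewrite DsE map_f.
  have := Gface (push tau p) x tau pD (ltW tau_gt0); rewrite gap_push => /(_ _)/le_trans; apply.
    by clear -gp; lra.
  apply: le_trans htau; rewrite (_ : 2 * fc * tau = fc * (tau + tau)); last by ring.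
  by rewrite ler_wpM2l// lerD2l; clear -ets sgt sig_gt0 tau_gt0; lra.
Qed.

End Regularity.

(** * Barycentric coordinates *)

Section Simplex.
Variables (R : realType) (d : nat).
Implicit Types (T : 'M[R]_(d.+1, d)) (x y : 'rV[R]_d).

Definition vertex_mx T : 'M[R]_(d.+1, d + 1) := row_mx T (const_mx 1).

(** Barycentric coordinates as the coefficients of the point, extended by a
    last coordinate one, on the similarly extended vertices. *)
Definition bary T i x : R := (row_mx x (1%:M : 'M[R]_1) *m pinvmx (vertex_mx T)) 0 i.

Definition bgrad T i : 'rV[R]_d := \row_k pinvmx (vertex_mx T) (lshift 1 k) i.

Definition inner T : set 'rV[R]_d := [set x | forall i, 0 < bary T i x].

Lemma baryE T i x : bary T i x = dotp (bgrad T i) x + pinvmx (vertex_mx T) (rshift d 0) i.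
Proof.
rewrite /bary mxE big_split_ord/= big_ord1 row_mxEr mxE eqxx mul1r; congr (_ + _).
by rewrite /dotp; apply: eq_bigr => k _; rewrite row_mxEl [bgrad T i 0 k]mxE mulrC.
Qed.

Lemma baryD T i x y : bary T i (x + y) = bary T i x + dotp (bgrad T i) y.
Proof. by rewrite !baryE dotpDr; ring. Qed.

Lemma bary_segment T i x y t : bary T i (x + t *: (y - x)) = (1 - t) * bary T i x + t * bary T i y.
Proof. by rewrite baryD dotpZr dotpBr !baryE; ring. Qed.

Variable T : 'M[R]_(d.+1, d).
Hypothesis aiT : affinely_independent T.

Lemma vertex_mxK : vertex_mx T *m pinvmx (vertex_mx T) = 1%:M.
Proof. exact: mulmxVp. Qed.

Lemma vertex_mxVK : pinvmx (vertex_mx T) *m vertex_mx T = 1%:M.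
Proof.
apply: mulVpmx; rewrite /row_full.
have := aiT; rewrite /affinely_independent /row_free -/(vertex_mx T) => /eqP ->.
by rewrite addn1.
Qed.

Lemma bary_mx x : (\row_i bary T i x) *m vertex_mx T = row_mx x (1%:M : 'M[R]_1).
Proof.
rewrite (_ : (\row_i _) = row_mx x (1%:M : 'M[R]_1) *m pinvmx (vertex_mx T)).
  by rewrite -mulmxA vertex_mxVK mulmx1.
by apply/rowP => i; rewrite mxE.
Qed.

Lemma bary_sum x : \sum_i bary T i x = 1.
Proof.
have /matrixP/(_ 0 (rshift d 0)) := bary_mx x.
rewrite row_mxEr !mxE eqxx mulr1n => <-; apply: eq_bigr => i _.
by rewrite [X in X * _]mxE /vertex_mx row_mxEr mxE mulr1.
Qed.

Lemma bary_comb x : (\row_i bary T i x) *m T = x.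
Proof.
apply/rowP => k; have /matrixP/(_ 0 (lshift 1 k)) := bary_mx x.
rewrite row_mxEl => <-; rewrite !mxE; apply: eq_bigr => i _.
by rewrite /vertex_mx row_mxEl.
Qed.

Lemma bary_uniq (b : 'rV[R]_d.+1) i : \sum_j b 0 j = 1 -> bary T i (b *m T) = b 0 i.
Proof.
move=> b1; rewrite /bary (_ : row_mx _ _ = b *m vertex_mx T).
  by rewrite -mulmxA vertex_mxK mulmx1.
rewrite /vertex_mx mul_mx_row; congr row_mx.
apply/matrixP => p q; rewrite !ord1 !mxE eqxx.
transitivity (\sum_j b 0 j); first by rewrite b1.
by apply: eq_bigr => j _; rewrite mxE mulr1.
Qed.

Lemma bary_vertex i j : bary T i (row j T) = (i == j)%:R.
Proof.
rewrite rowE bary_uniq; first by rewrite mxE eqxx.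
rewrite (bigD1 j)//= big1 => [|k kj]; first by rewrite mxE !eqxx addr0.
by rewrite mxE eqxx (negPf kj).
Qed.

Lemma bary_inj x y : (forall i, bary T i x = bary T i y) -> x = y.
Proof.
by move=> h; rewrite -(bary_comb x) -(bary_comb y); congr (_ *m _); apply/rowP => i; rewrite !mxE.
Qed.

Lemma faceP J x : face T J x <-> (forall i, 0 <= bary T i x) /\ forall i, i \notin J -> bary T i x = 0.
Proof.
split=> [[b [b0 bJ b1 ->]]|[h0 hJ]].
  by split=> [i|i iJ]; rewrite bary_uniq//; exact: bJ.
exists (\row_i bary T i x); split; first by move=> i; rewrite mxE.
- by move=> i iJ; rewrite mxE hJ.
- by rewrite -[RHS](bary_sum x); apply: eq_bigr => i _; rewrite mxE.
- by rewrite bary_comb.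
Qed.

Lemma simplexP x : simplex T x <-> forall i, 0 <= bary T i x.
Proof.
by split=> [/faceP[]//|h]; apply/faceP; split => // i; rewrite inE.
Qed.

Lemma vertex_simplex j : simplex T (row j T).
Proof. by apply/simplexP => i; rewrite bary_vertex. Qed.

Lemma bary_le1 x i : simplex T x -> bary T i x <= 1.
Proof.
by move=> /simplexP h; rewrite -(bary_sum x) (bigD1 i)//= lerDl sumr_ge0.
Qed.

Lemma inner_simplex x : inner T x -> simplex T x.
Proof. by move=> h; apply/simplexP => i; apply: ltW. Qed.

(** The gradient of the affine function that interpolates g at the vertices. *)
Definition slope (S : 'M[R]_(d.+1, d)) (g : 'rV[R]_d -> R) : 'rV[R]_d :=
  \sum_j g (row j S) *: bgrad S j.

Lemma slopeE g x y : \sum_j g (row j T) * bary T j (x + y) =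
  \sum_j g (row j T) * bary T j x + dotp (slope T g) y.
Proof.
have -> : dotp (slope T g) y = \sum_j g (row j T) * dotp (bgrad T j) y.
  rewrite /slope; elim/big_rec2: _ => [|j a b _ <-]; first by rewrite dotp0l.
  by rewrite dotpDl dotpZl.
by rewrite -big_split/=; apply: eq_bigr => j _; rewrite baryD mulrDr.
Qed.

Lemma affine_bary (a : 'rV[R]_d) c x : \sum_j (dotp a (row j T) + c) * bary T j x = dotp a x + c.
Proof.
under eq_bigr do rewrite mulrDl.
rewrite big_split/= -mulr_sumr bary_sum mulr1; congr (_ + _).
rewrite -[in RHS](bary_comb x) mulmx_sum_row.
elim/big_rec2: _ => [|j u v _ ->]; first by rewrite dotp0r.
by rewrite dotpDr dotpZr mxE mulrC.
Qed.

Lemma slope_affine (a : 'rV[R]_d) c : slope T (fun x => dotp a x + c) = a.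
Proof.
apply/eqP; rewrite -subr_eq0; apply/eqP/enorm0_eq0.
have h y : dotp (slope T (fun x => dotp a x + c) - a) y = 0.
  have := slopeE (fun x => dotp a x + c) 0 y; rewrite !affine_bary add0r dotp0r add0r dotpBl.
  by move=> h; apply/eqP; rewrite subr_eq0; apply/eqP; apply: (addrI c); rewrite -h addrC.
by rewrite /enorm h sqrtr0.
Qed.

Hypothesis d_gt0 : (0 < d)%N.

Lemma bgrad_neq0 i : enorm (bgrad T i) != 0.
Proof.
apply/eqP => /enorm0_eq0 g0.
have [j ji] : exists j : 'I_d.+1, j != i.
  have [->|i0] := eqVneq i 0; last by exists 0; rewrite eq_sym.
  exists ord_max; rewrite -val_eqE/= -lt0n//.
have := bary_vertex i i; rewrite (_ : row i T = row j T + (row i T - row j T)); last first.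
  by rewrite addrCA subrr addr0.
rewrite baryD bary_vertex g0 dotp0l addr0 eqxx eq_sym (negPf ji) => /eqP.
by rewrite eq_sym oner_eq0.
Qed.

Lemma bgrad_gt0 i : 0 < enorm (bgrad T i).
Proof. by rewrite lt_neqAle eq_sym bgrad_neq0 enorm_ge0. Qed.

(** The hyperplane of a facet in the normal form of the faces of a polytope, so
    that the volume estimate for slabs applies to it. *)
Definition facet i : 'rV[R]_d * R :=
  (- (enorm (bgrad T i))^-1 *: bgrad T i, (enorm (bgrad T i))^-1 * bary T i 0).

Lemma facet_gap i x : gap (facet i) x = (enorm (bgrad T i))^-1 * bary T i x.
Proof.
rewrite /gap/= dotpZl -[in RHS](add0r x) baryD; ring.
Qed.

Lemma facet_unit i : dotp (facet i).1 (facet i).1 = 1.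
Proof.
rewrite /= dotpZl dotpZr -enorm_sqr !mulNr !mulrN opprK mulrA -expr2 exprVn mulVf//.
by rewrite expf_neq0// bgrad_neq0.
Qed.

(** A nonnegative nonconstant affine function is positive in the interior:
    otherwise a step against its gradient would make it negative. *)
Lemma bary_pos_interior i (A : set 'rV[R]_d) x r : 0 < r ->
  (forall y, enorm y < r -> A (x + y)) -> (forall y, A y -> 0 <= bary T i y) -> 0 < bary T i x.
Proof.
move=> r0 hA h; have g0 := bgrad_gt0 i; set g := bgrad T i in g0 *.
have hy : enorm (- (r / 2 / enorm g) *: g) < r.
  rewrite enormZ normrN ger0_norm; last by rewrite !divr_ge0 ?(ltW r0) ?(ltW g0).
  rewrite mulfVK ?gt_eqF//; lra.
have := h _ (hA _ hy); rewrite baryD dotpZr -/g -enorm_sqr.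
rewrite (_ : _ * enorm g ^+ 2 = - (r / 2 * enorm g)); last by field; rewrite gt_eqF.
have : 0 < r / 2 * enorm g by rewrite mulr_gt0// divr_gt0.
lra.
Qed.

Variables (c : 'rV[R]_d) (r : R).
Hypothesis r_gt0 : 0 < r.
Hypothesis ball_in : [set x | enorm (x - c) <= r] `<=` simplex T.

Lemma bgrad_le i : enorm (bgrad T i) <= r^-1.
Proof.
have g0 := bgrad_gt0 i; set g := bgrad T i in g0 *.
have xs : simplex T (c + - (r / enorm g) *: g).
  apply: ball_in => /=; rewrite addrAC subrr add0r enormZ normrN ger0_norm ?divr_ge0 ?(ltW r_gt0) ?(ltW g0)//.
  by rewrite mulfVK ?gt_eqF.
have cs : simplex T c by apply: ball_in; rewrite /= subrr /enorm dotp0l sqrtr0 ltW.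
move/simplexP/(_ i): xs; rewrite baryD dotpZr -/g -enorm_sqr.
rewrite (_ : _ * enorm g ^+ 2 = - (r * enorm g)); last by field; rewrite gt_eqF.
have := bary_le1 i cs => h1 h2; rewrite -[leRHS]mul1r ler_pdivlMr// mulrC; lra.
Qed.

Lemma cube_inner : cube c (r / d%:R) `<=` inner T.
Proof.
have dR : 0 < d%:R :> R by rewrite ltr0n.
move=> x hx i.
have xc : enorm (x - c) < r.
  rewrite (le_lt_trans (enorm_le_sum _))//.
  have -> : r = \sum_(i < d) (r / d%:R) by rewrite sumr_const card_ord -[RHS]mulr_natl mulrC divfK ?gt_eqF.
  apply: ltr_sum => [|j _]; last by have := hx j; rewrite !mxE.
  by apply/hasP; exists (Ordinal d_gt0); rewrite ?mem_index_enum.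
apply: (@bary_pos_interior i (simplex T) x (r - enorm (x - c))); first by rewrite subr_gt0.
  move=> y hy; apply: ball_in => /=; rewrite addrAC (le_trans (enormD _ _))//; lra.
by move=> y /simplexP.
Qed.

End Simplex.

Section Triangulation.
Variables (R : realType) (d : nat).
Hypothesis d_gt0 : (0 < d)%N.
Implicit Types (T : 'M[R]_(d.+1, d)) (x y : 'rV[R]_d) (M : seq 'M[R]_(d.+1, d)).
Local Notation e i := (delta_mx 0 i : 'rV[R]_d).

Lemma inner_open T x : inner T x -> exists2 r, 0 < r & forall y, enorm y < r -> inner T (x + y).
Proof.
move=> hx.
have [r0 r00 /allP hr0] : exists2 r, 0 < r & all (fun a => r <= a)
    [seq bary T i x / (enorm (bgrad T i) + 1) | i <- enum 'I_d.+1].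
  apply: min_pos; apply/allP => a /mapP[i _ ->]; rewrite divr_gt0 ?hx// ltr_wpDl ?enorm_ge0//.
exists r0 => // y hy i; rewrite baryD.
have h : r0 <= bary T i x / (enorm (bgrad T i) + 1).
  by apply: hr0; apply/mapP; exists i => //; rewrite mem_enum.
have g0 : 0 < enorm (bgrad T i) + 1 by rewrite ltr_wpDl// enorm_ge0.
rewrite ler_pdivlMr// in h.
have := dotp_le (bgrad T i) y; rewrite ler_norml => /andP[h1 _].
have h2 : enorm (bgrad T i) * enorm y <= enorm (bgrad T i) * r0.
  by rewrite ler_wpM2l ?enorm_ge0// ltW.
lra.
Qed.

Lemma simplex_closed T x : affinely_independent T -> ~ simplex T x ->
  exists2 r, 0 < r & forall y, enorm y < r -> ~ simplex T (x + y).
Proof.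
move=> ai nx; have [i hi] : exists i, bary T i x < 0.
  apply: contrapT => no; apply: nx; apply/(simplexP ai) => i.
  by rewrite leNgt; apply/negP => h; apply: no; exists i.
have g0 : 0 < enorm (bgrad T i) + 1 by rewrite ltr_wpDl// enorm_ge0.
exists (- bary T i x / (enorm (bgrad T i) + 1)); first by rewrite divr_gt0// oppr_gt0.
move=> y hy /(simplexP ai)/(_ i); rewrite baryD => h.
rewrite ltr_pdivlMr// in hy.
have := dotp_le (bgrad T i) y; rewrite ler_norml => /andP[_ h1].
have := enorm_ge0 y; lra.
Qed.

(** Continuous induction along the segment: the set of parameters up to which
    the estimate holds is closed and open in the unit interval. *)
Lemma local_lipschitz (f : 'rV[R]_d -> R) L : 0 <= L ->
  (forall x, exists2 r, 0 < r & forall y, enorm y < r -> `|f (x + y) - f x| <= L * enorm y) ->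
  forall x y, `|f (x + y) - f x| <= L * enorm y.
Proof.
move=> L0 loc x y.
pose ok t := forall s, 0 <= s -> s <= t -> `|f (x + s *: y) - f x| <= L * (s * enorm y).
pose S := [set t | 0 <= t /\ t <= 1 /\ ok t].
have S0 : S 0.
  split=> //; split=> // s s0 s1; have -> : s = 0 by apply/eqP; rewrite eq_le s0 s1.
  by rewrite scale0r addr0 subrr normr0 mul0r mulr0.
have hS : has_sup S by split; [exists 0|exists 1 => t [_ []]].
pose m := sup S.
have m0 : 0 <= m by apply: (ub_le_sup hS.2).
have m1 : m <= 1 by apply: ge_sup; [exists 0|move=> t [_ []]].
have ltm s : 0 <= s -> s < m -> `|f (x + s *: y) - f x| <= L * (s * enorm y).
  move=> s0 sm; have [t [_ [_ ht]] st] := sup_adherent (eps := m - s) ltac:(by rewrite subr_gt0) hS.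
  apply: ht => //; rewrite -/m in st; lra.
have [r r0 hr] := loc (x + m *: y).
pose del := r / (enorm y + 1).
have yy : 0 < enorm y + 1 by rewrite ltr_wpDl// enorm_ge0.
have del0 : 0 < del by rewrite divr_gt0.
have near s : `|s - m| < del -> `|f (x + s *: y) - f (x + m *: y)| <= L * (`|s - m| * enorm y).
  move=> hs; have := hr ((s - m) *: y); rewrite enormZ.
  rewrite (_ : x + m *: y + _ = x + s *: y); last first.
    by rewrite -addrA -scalerDl addrCA subrr addr0.
  apply; apply: (@le_lt_trans _ _ (`|s - m| * (enorm y + 1))); first by rewrite ler_wpM2l// lerDl.
  by rewrite -ltr_pdivlMr.
have okm : `|f (x + m *: y) - f x| <= L * (m * enorm y).
  have [m00|mp] := leP m 0.
    have -> : m = 0 by apply/eqP; rewrite eq_le m0 m00.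
    by rewrite scale0r addr0 subrr normr0 mul0r mulr0.
  pose s := m - Num.min m (del / 2).
  have p0 : 0 < Num.min m (del / 2) by rewrite lt_min mp divr_gt0.
  have p1 : Num.min m (del / 2) <= m by rewrite ge_min lexx.
  have p2 : Num.min m (del / 2) <= del / 2 by rewrite ge_min lexx orbT.
  have s0 : 0 <= s by rewrite subr_ge0.
  have sm : s < m by rewrite /s gtrBl.
  have ds : `|s - m| = m - s by rewrite distrC gtr0_norm ?subr_gt0.
  have h1 := ltm s s0 sm; have := near s; rewrite ds => /(_ _) h2.
  rewrite (_ : f (x + m *: y) - f x = (f (x + s *: y) - f x) - (f (x + s *: y) - f (x + m *: y))); last by ring.
  rewrite (le_trans (ler_normB _ _))//.
  have {}h2 := h2 ltac:(rewrite /s; lra).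
  rewrite (_ : L * (m * enorm y) = L * (s * enorm y) + L * ((m - s) * enorm y)); last by ring.
  by rewrite lerD.
have mE : m = 1.
  apply/eqP; rewrite eq_le m1 leNgt; apply/negP => lt1.
  pose m' := Num.min 1 (m + del / 2).
  have mm' : m < m' by rewrite lt_min lt1 ltrDl divr_gt0.
  suff /(ub_le_sup hS.2) : S m' by rewrite -/m leNgt mm'.
  have m'd : m' <= m + del / 2 by rewrite ge_min lexx orbT.
  split; first exact: le_trans m0 (ltW mm').
  split; first by rewrite ge_min lexx.
  move=> s s0 sm'; have [sm|sm] := ltP s m; first exact: ltm.
  have ds : `|s - m| = s - m by rewrite ger0_norm// subr_ge0.
  have := near s; rewrite ds => h; have {}h := h ltac:(lra).
  rewrite (_ : f (x + s *: y) - f x = (f (x + s *: y) - f (x + m *: y)) + (f (x + m *: y) - f x)); last by ring.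
  rewrite (le_trans (ler_normD _ _))//.
  rewrite (_ : L * (s * enorm y) = L * ((s - m) * enorm y) + L * (m * enorm y)); last by ring.
  by rewrite lerD.
by move: okm; rewrite mE scale1r mul1r.
Qed.


Lemma polytope_open (Hs : seq ('rV[R]_d * R)) x : (forall p, p \in Hs -> dotp p.1 p.1 = 1) ->
  polytope Hs x -> exists2 r, 0 < r & forall y, enorm y < r -> polytope Hs (x + y).
Proof.
move=> uH hx; have [g g0 hg] := pos_below hx; exists g => // y hy p pH.
have := gap_lip uH x y pH; rewrite ler_norml => /andP[h _]; have := hg p pH; lra.
Qed.

Variables (Hs : seq ('rV[R]_d * R)).
Hypothesis unitH : forall p, p \in Hs -> dotp p.1 p.1 = 1.

Lemma closure_gap x p : closure (polytope Hs) x -> p \in Hs -> 0 <= gap p x.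
Proof.
move=> cx pH; rewrite leNgt; apply/negP => g0.
have [M hM] := gap_is_lip p.
have : nbhs x (gap p @^-1` [set t | t < 0]).
  apply: (lip_continuous hM); apply/nbhs_ballP; exists (- gap p x); first by rewrite /= oppr_gt0.
  move=> t; rewrite /ball/= => ht; have := ler_norm (t - gap p x); rewrite distrC; lra.
by move=> /cx[y [/(_ _ pH) h1 /= h2]]; lra.
Qed.

Section OneMesh.
Variable M : seq 'M[R]_(d.+1, d).
Hypothesis triM : triangulation (polytope Hs) M.

Lemma mesh_ai T : T \in M -> affinely_independent T.
Proof. by case: triM => h _ _ _; exact: h. Qed.

Lemma simplex_gap T x p : T \in M -> simplex T x -> p \in Hs -> 0 <= gap p x.
Proof.
move=> TM Tx; apply: closure_gap; case: triM => _ _ <- _; by exists T.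
Qed.

Lemma mesh_cover x : polytope Hs x -> exists2 T, T \in M & simplex T x.
Proof. by case: triM => _ _ h _ /subset_closure; rewrite -h. Qed.

Lemma inner_polytope T x : T \in M -> inner T x -> polytope Hs x.
Proof.
move=> TM Tx p pH; have [r r0 hr] := inner_open Tx.
have h : simplex T (x + (r / 2) *: p.1).
  apply: inner_simplex; first exact: mesh_ai.
  apply: hr; rewrite enormZ (unit_normal unitH pH) mulr1 gtr0_norm ?divr_gt0//; lra.
have := simplex_gap TM h pH; rewrite gapD dotpZr unitH// mulr1.
have : 0 < r / 2 by rewrite divr_gt0.
lra.
Qed.

(** By conformity the intersection is a common face; a face that meets the
    interior of a simplex is the whole simplex. *)
Lemma mesh_disjoint T T' x : T \in M -> T' \in M -> inner T x -> simplex T' x -> T = T'.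
Proof.
move=> TM T'M Tx T'x; have [_ inj _ conf] := triM; apply: inj => //.
have [I [I' [h1 h2]]] := conf _ _ TM T'M.
have aT := mesh_ai TM; have aT' := mesh_ai T'M.
have IT i : i \in I.
  apply/negPn/negP => iI.
  have : face T I x by rewrite -h1; split => //; exact: inner_simplex.
  by move=> /(faceP aT)[_ /(_ _ iI)]; have := Tx i; lra.
have TE : simplex T = face T' I'.
  rewrite -h2; apply/seteqP; split => y.
    by move=> /(simplexP aT) h; apply/(faceP aT); split => // i; rewrite IT.
  by move=> /(faceP aT)[h _]; apply/(simplexP aT).
have IT' i : i \in I'.
  apply/negPn/negP => iI.
  have [r r0 hr] := inner_open Tx.
  have : 0 < bary T' i x.
    apply: (bary_pos_interior aT' d_gt0 (A := simplex T) r0).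
      by move=> y /hr h; exact: inner_simplex.
    by move=> y; rewrite TE => /(faceP aT')[].
  have : face T' I' x by rewrite -TE; exact: inner_simplex.
  by move=> /(faceP aT')[_ /(_ _ iI)]; lra.
rewrite TE; apply/seteqP; split => y.
  by move=> /(faceP aT')[h _]; apply/(simplexP aT').
by move=> /(simplexP aT') h; apply/(faceP aT'); split => // i; rewrite IT'.
Qed.

(** The sum over the simplices has at most one nonzero term, as their interiors
    are disjoint; duplicates in the list of simplices are removed for that. *)
Definition pgrad (v : 'rV[R]_d -> R) i x : R :=
  \sum_(T <- undup M) \1_(inner T) x * slope T v 0 i.

Lemma pgrad_in v i T x : T \in M -> inner T x -> pgrad v i x = slope T v 0 i.
Proof.
move=> TM Tx; rewrite /pgrad (bigD1_seq T) ?mem_undup ?undup_uniq//=.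
rewrite indicE mem_set// mul1r big_seq_cond big1 ?addr0// => T'.
rewrite mem_undup => /andP[T'M T'T]; rewrite indicE memNset ?mul0r// => T'x.
by move/eqP: T'T; apply; apply/esym/(mesh_disjoint (x := x)) => //; apply: inner_simplex => //; exact: mesh_ai.
Qed.

Lemma pgrad_out v i x : (forall T, T \in M -> ~ inner T x) -> pgrad v i x = 0.
Proof.
move=> h; rewrite /pgrad big_seq big1// => T; rewrite mem_undup => TM.
by rewrite indicE memNset ?mul0r//; exact: h.
Qed.

Definition paffine (v : 'rV[R]_d -> R) := (forall x, ~ polytope Hs x -> v x = 0) /\
  forall T x, T \in M -> simplex T x -> v x = \sum_j v (row j T) * bary T j x.

Lemma P1_paffine v : v \in P1_pred (polytope Hs) M -> paffine v.
Proof.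
move=> /asboolP[_ z a]; split => // T x TM Tx; have [b [c h]] := a _ TM.
rewrite h// -(affine_bary (mesh_ai TM)); apply: eq_bigr => j _; rewrite h//.
by apply: vertex_simplex; exact: mesh_ai.
Qed.

Lemma paffine_diff v T x y : paffine v -> T \in M -> simplex T x -> simplex T (x + y) ->
  v (x + y) - v x = dotp (slope T v) y.
Proof.
move=> [_ a] TM Tx Txy; rewrite (a T x)// (a T (x + y))// slopeE; ring.
Qed.

Lemma avoid_simplices x : exists2 r, 0 < r & forall y T, enorm y < r -> T \in M ->
  simplex T (x + y) -> simplex T x.
Proof.
have : forall T, T \in M -> affinely_independent T by exact: mesh_ai.
elim: (M) => [|T s IH] ai; first by exists 1.
have [r r0 hr] : exists2 r, 0 < r & forall y T, enorm y < r -> T \in s ->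
    simplex T (x + y) -> simplex T x.
  by apply: IH => S Ss; apply: ai; rewrite inE Ss orbT.
case: (pselect (simplex T x)) => Tx.
  exists r => // y S hy; rewrite inE => /predU1P[->|Ss]//; exact: hr.
have [r' r'0 hr'] := simplex_closed (ai T (mem_head _ _)) Tx.
exists (Num.min r r'); first by rewrite lt_min r0.
move=> y S; rewrite lt_min => /andP[h1 h2]; rewrite inE => /predU1P[->|Ss].
  by move=> /(hr' _ h2).
exact: hr.
Qed.

(** Near every point only simplices containing it matter, and on each of them
    the function is affine. *)
Lemma paffine_lip v : paffine v -> exists2 L, 0 <= L & forall x y, `|v (x + y) - v x| <= L * enorm y.
Proof.
move=> pv; pose L := \sum_(T <- M) enorm (slope T v).
have L0 : 0 <= L by apply: sumr_ge0 => T _; exact: enorm_ge0.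
exists L => //; apply: local_lipschitz => // x.
have inT T y : T \in M -> simplex T x -> simplex T (x + y) -> `|v (x + y) - v x| <= L * enorm y.
  move=> TM Tx Txy; rewrite (paffine_diff pv TM Tx Txy) (le_trans (dotp_le _ _))//.
  rewrite ler_wpM2r ?enorm_ge0//.
  by apply: (le_bigseq (f := fun T => enorm (slope T v))) => // ?; exact: enorm_ge0.
have [r r0 hr] := avoid_simplices x; have [z _] := pv.
case: (pselect (polytope Hs x)) => hx.
  have [r' r'0 hr'] := polytope_open unitH hx.
  exists (Num.min r r'); first by rewrite lt_min r0.
  move=> y; rewrite lt_min => /andP[h1 h2].
  have [T TM Txy] := mesh_cover (hr' _ h2); apply: (inT T) => //; exact: hr Txy.
exists r => // y hy; case: (pselect (polytope Hs (x + y))) => hxy.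
  have [T TM Txy] := mesh_cover hxy; apply: (inT T) => //; exact: hr Txy.
by rewrite !z// subrr normr0 mulr_ge0// enorm_ge0.
Qed.

Lemma derive_inner v T x i : paffine v -> T \in M -> inner T x ->
  'D_(e i) v x = slope T v 0 i.
Proof.
move=> pv TM Tx; rewrite /derive; apply: cvg_lim => //.
have [r r0 hr] := inner_open Tx.
apply: cvg_near_cst; apply/nbhs_ballP; exists r => //= t ht t0.
rewrite /ball/= sub0r normrN in ht.
rewrite (addrC (t *: _)) (paffine_diff pv TM).
- by rewrite dotpZr dotp_delta /GRing.scale/= mulKf.
- by apply: inner_simplex => //; exact: mesh_ai.
- by apply: inner_simplex; [exact: mesh_ai|apply: hr; rewrite enorm_step].
Qed.

Definition facets := [seq facet T i | T <- M, i <- enum 'I_d.+1].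

Lemma facetsP T i : T \in M -> facet T i \in facets.
Proof. by move=> TM; apply: allpairs_f => //; rewrite mem_enum. Qed.

Lemma facets_unit p : p \in facets -> dotp p.1 p.1 = 1.
Proof. by move=> /allpairsP[[T i] [TM _ ->]]; apply: facet_unit => //; exact: mesh_ai. Qed.

Lemma off_facets x : polytope Hs x -> (forall p, p \in facets -> gap p x != 0) ->
  exists2 T, T \in M & inner T x.
Proof.
move=> hx hp; have [T TM Tx] := mesh_cover hx; exists T => // i.
have ai := mesh_ai TM.
have := hp _ (facetsP i TM); rewrite facet_gap mulf_eq0 negb_or => /andP[_ h].
by rewrite lt_neqAle eq_sym h /=; move/(simplexP ai): Tx; apply.
Qed.

End OneMesh.

(** Slabs of vanishing width have vanishing volume. *)
Lemma null_facets (s : seq ('rV[R]_d * R)) B : 0 < B -> (forall p, p \in s -> dotp p.1 p.1 = 1) ->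
  null_rV [set x | cube 0 B x /\ exists2 p, p \in s & gap p x = 0].
Proof.
move=> B0; elim: s => [|p s IH] us.
  rewrite (_ : mkset _ = set0); last by apply/seteqP; split => // x [_ [p]].
  by split; rewrite /mset_rV preimage_set0 ?measure0.
rewrite (_ : mkset _ = (cube 0 B `&` slab p 0) `|` [set x | cube 0 B x /\ exists2 p, p \in s & gap p x = 0]).
  apply: null_setU; last by apply: IH => q qs; apply: us; rewrite inE qs orbT.
  have mA : mset_rV (cube 0 B `&` slab p 0) by apply: mset_setI; [exact: mset_cube|exact: mset_slab].
  have aA : adm (\1_(cube 0 B `&` slab p 0) : _ -> R) by apply: (@adm_indic _ _ _ B) => // x [].
  apply: nullP => //; have [C C0 hC] := slab_vol (us p (mem_head _ _)) B0.
  apply/eqP; rewrite eq_le; apply/andP; split; last by apply: J_ge0 => x; rewrite indicE ler0n.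
  rewrite leNgt; apply/negP => JA; set V := J _ in JA.
  have [l l0 hl] := small_enough C0 (divr_gt0 JA (ltr0n R 2)).
  pose l' := Num.min 1 l; have l'0 : 0 < l' by rewrite lt_min ltr01.
  have h1 : C * l' <= V / 2 by apply: hl; [exact: ltW|rewrite ge_min lexx orbT].
  have h2 : V <= C * l'.
    apply: le_trans (hC l' l'0 _); last by rewrite ge_min lexx.
    apply: J_le => //.
      apply: (@adm_indic _ _ _ B); last by move=> x [].
      by apply: mset_setI; [exact: mset_cube|exact: mset_slab].
    move=> x; rewrite !indicE ler_nat.
    case: (pselect ((cube 0 B `&` slab p 0) x)) => hx; last by rewrite memNset.
    rewrite !mem_set//; case: hx => h3 h4; split => //; rewrite /slab/=.
    by apply: le_trans (ltW l'0).
  by move: h1 h2 JA; clear; lra.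
apply/seteqP; split => x /=.
  move=> [xB [q]]; rewrite inE => /predU1P[->|qs] h; [left|right]; split=> //.
    by rewrite /slab/= h normr0.
  by exists q.
move=> [[xB]|[xB [q qs h]]].
  rewrite /slab/= normr_le0 => /eqP h; split => //; exists p => //; exact: mem_head.
by split => //; exists q => //; rewrite inE qs orbT.
Qed.

Variable B : R.
Hypothesis B_gt0 : 0 < B.
Hypothesis HB : forall x, polytope Hs x -> cube 0 B x.

(** The classical partial derivatives agree with the slopes except on the
    facets, which form a null set.  Two meshes are allowed, since coarse and
    fine functions are paired. *)
Lemma gradL2ipE M M' v w : triangulation (polytope Hs) M -> triangulation (polytope Hs) M' ->
  paffine M v -> paffine M' w ->
  gradL2ip (polytope Hs) v w = J (fun x => \sum_i pgrad M v i x * pgrad M' w i x).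
Proof.
move=> tM tM' pv pw.
have us p : p \in facets M ++ facets M' -> dotp p.1 p.1 = 1.
  rewrite mem_cat => /orP[]; exact: facets_unit.
apply: (integral_Rd_off_null (null_facets B_gt0 us)).
- move=> x nx hx; have [T TM Tx] : exists2 T, T \in M & inner T x.
    apply: off_facets => // p pF; apply/eqP => g0; apply: nx; split; first exact: HB.
    by exists p => //; rewrite mem_cat pF.
  have [T' T'M T'x] : exists2 T, T \in M' & inner T x.
    apply: (off_facets tM') => // p pF; apply/eqP => g0; apply: nx; split; first exact: HB.
    by exists p => //; rewrite mem_cat pF orbT.
  apply: eq_bigr => i _; rewrite (derive_inner tM i pv TM Tx) (derive_inner tM' i pw T'M T'x).
  by rewrite (pgrad_in tM _ _ TM Tx) (pgrad_in tM' _ _ T'M T'x).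
- move=> x _ nx; rewrite big1// => i _.
  by rewrite (pgrad_out (M := M)) ?mul0r// => T TM /(inner_polytope tM TM).
Qed.

Lemma L2ipE v w : (forall x, ~ polytope Hs x -> v x = 0) -> L2ip (polytope Hs) v w = J (fun x => v x * w x).
Proof. by move=> z; apply: integral_RdE => // x /z ->; rewrite mul0r. Qed.

End Triangulation.

(** * Norm equivalences for piecewise linear functions *)

Section FiniteElement.
Variables (R : realType) (d : nat).
Hypothesis d_gt0 : (0 < d)%N.
Implicit Types (T : 'M[R]_(d.+1, d)) (x y : 'rV[R]_d).

Lemma mfun_bary T i : mfun_rV (bary T i).
Proof.
apply: mfun_continuous; apply: (@lip_continuous _ _ _ (enorm (bgrad T i))) => x y.
by rewrite baryD addrAC subrr add0r dotp_le.
Qed.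

Lemma mset_inner T : mset_rV (inner T).
Proof.
rewrite (_ : inner T = [set x | forall i, true -> (~` [set x | bary T i x <= 0]) x]).
  by apply: mset_forall => i _; apply: mset_setC; apply: mset_le; exact: mfun_bary.
apply/seteqP; split => x h i; first by move=> _ /=; apply/negP; rewrite -ltNge.
by have := h i isT => /negP; rewrite -ltNge.
Qed.

Lemma enorm_sum (I : Type) (s : seq I) (P : pred I) (F : I -> 'rV[R]_d) :
  enorm (\sum_(i <- s | P i) F i) <= \sum_(i <- s | P i) enorm (F i).
Proof.
apply: (big_ind2 (fun a b => enorm a <= b)) => //.
  by rewrite /enorm dotp0l sqrtr0.
by move=> a b a' b' h1 h2; rewrite (le_trans (enormD _ _))// lerD.
Qed.

Lemma simplex_diam T x y : affinely_independent T -> simplex T x -> simplex T y ->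
  enorm (x - y) <= diameter (simplex T).
Proof.
move=> ai Tx Ty; apply: ub_le_sup; last by exists x, y.
pose S := \sum_i enorm (row i T).
have bnd z : simplex T z -> enorm z <= S.
  move=> Tz; rewrite -(bary_comb ai z) mulmx_sum_row.
  rewrite (le_trans (enorm_sum _ _ _))//; apply: ler_sum => i _.
  rewrite enormZ mxE ger0_norm; last by move/(simplexP ai): Tz.
  by rewrite ler_piMl ?enorm_ge0// bary_le1.
exists (S + S) => _ [z [w [Tz Tw ->]]].
by rewrite (le_trans (enormD _ _))// enormN lerD// bnd.
Qed.

Variables (Hs : seq ('rV[R]_d * R)).
Hypothesis unitH : forall p, p \in Hs -> dotp p.1 p.1 = 1.
Variable B : R.
Hypothesis B_gt0 : 0 < B.
Hypothesis HB : forall x, polytope Hs x -> cube 0 B x.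
Hypothesis polytope_ne : polytope Hs !=set0.
Variable M : seq 'M[R]_(d.+1, d).
Hypothesis triM : triangulation (polytope Hs) M.
Variables (sigma kappa : R).
Hypothesis shM : shape_regular sigma M.
Hypothesis quM : quasi_uniform kappa M.
Local Notation h := (mesh_size M).

Let aiM := mesh_ai triM.

Lemma diam_le T : T \in M -> diameter (simplex T) <= h.
Proof. by move=> TM; exact: (le_bigmax_seq 0 T xpredT (fun T => diameter (simplex T)) TM isT). Qed.

Lemma simplex_size T x y : T \in M -> simplex T x -> simplex T y -> enorm (x - y) <= h.
Proof. by move=> TM Tx Ty; apply: le_trans (diam_le TM); apply: simplex_diam => //; exact: aiM. Qed.

(** The ratio of the mesh size to all inradii is at most this number. *)
Definition shape := kappa * sigma.

Lemma inscribed T : T \in M -> exists c r, [/\ 0 < r, [set x | enorm (x - c) <= r] `<=` simplex T,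
  r <= h & h <= shape * r].
Proof.
move=> TM; have [c [r [r0 ball dr]]] := shM TM; exists c, r.
have rd : r <= diameter (simplex T).
  have [i _] : exists i : 'I_d, true by exists (Ordinal d_gt0).
  have h1 : simplex T (c + r *: delta_mx 0 i).
    by apply: ball; rewrite /= addrAC subrr add0r enormZ enorm_delta mulr1 gtr0_norm.
  have h2 : simplex T c by apply: ball; rewrite /= subrr /enorm dotp0l sqrtr0 ltW.
  have := simplex_diam (aiM TM) h1 h2.
  by rewrite addrAC subrr add0r enormZ enorm_delta mulr1 gtr0_norm.
have hq := quM TM; have hd := diam_le TM.
have k0 : 0 < kappa.
  by rewrite -(pmulr_lgt0 _ (lt_le_trans r0 rd)); lra.
split=> //; first lra.
by rewrite (le_trans hq)// /shape -mulrA ler_wpM2l// ltW.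
Qed.

Lemma mesh_size_gt0 : 0 < h.
Proof.
have [x hx] := polytope_ne; have [T TM _] := mesh_cover triM hx.
by have [c [r [r0 _ rh _]]] := inscribed TM; exact: lt_le_trans rh.
Qed.

Lemma shape_gt0 : 0 < shape.
Proof.
have [x hx] := polytope_ne; have [T TM _] := mesh_cover triM hx.
have [c [r [r0 _ rh hr]]] := inscribed TM.
by rewrite -(pmulr_lgt0 _ r0); exact: lt_le_trans mesh_size_gt0 hr.
Qed.

(** Half the side of a cube inside each simplex.  Comparing a function with its
    translates within that cube replaces the scaling to a reference simplex. *)
Definition cubesize := h / (shape * d%:R).

Lemma cubesize_gt0 : 0 < cubesize.
Proof. by rewrite divr_gt0 ?mesh_size_gt0// mulr_gt0 ?shape_gt0// ltr0n. Qed.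

Lemma cubesizeE : h = shape * d%:R * cubesize.
Proof. by rewrite /cubesize mulrC divfK// gt_eqF// mulr_gt0 ?shape_gt0// ltr0n. Qed.

Lemma inner_cube T : T \in M -> exists c, cube c cubesize `<=` inner T.
Proof.
move=> TM; have [c [r [r0 ball rh hr]]] := inscribed TM; exists c.
move=> x hx; apply: (cube_inner (aiM TM) d_gt0 ball); apply: cube_le hx.
rewrite /cubesize ler_pdivrMr; last by rewrite mulr_gt0 ?shape_gt0// ltr0n.
rewrite (_ : r / d%:R * _ = shape * r)//; field; rewrite pnatr_eq0; lia.
Qed.

Lemma bgrad_bound T i : T \in M -> enorm (bgrad T i) <= shape / h.
Proof.
move=> TM; have [c [r [r0 ball rh hr]]] := inscribed TM.
rewrite (le_trans (bgrad_le (aiM TM) d_gt0 r0 ball i))//.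
by rewrite ler_pdivlMr ?mesh_size_gt0// mulrC ler_pdivrMr.
Qed.

Lemma inner_vol T : T \in M -> adm (\1_(inner T) : _ -> R) /\
  J (\1_(inner T) : _ -> R) <= (4 * h) ^+ d.
Proof.
move=> TM; have h0 := mesh_size_gt0.
have sub : inner T `<=` cube (row ord0 T) (2 * h).
  move=> x Tx i; have := simplex_size TM (inner_simplex (aiM TM) Tx) (vertex_simplex (aiM TM) ord0).
  move=> hx; have := enorm_coord (x - row ord0 T) i; rewrite 2!mxE; rewrite !mxE; lra.
have a1 : adm (\1_(inner T) : _ -> R).
  apply: (@adm_dom _ _ _ _ 1 (mfun_indic (mset_inner T)) (adm_cube (row ord0 T) (2 * h))).
  move=> x; rewrite mul1r !indicE !normr_nat ler_nat.
  by case: (pselect (inner T x)) => Tx; [rewrite !mem_set//; exact: sub|rewrite memNset].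
split=> //; rewrite (_ : 4 * h = 2 * (2 * h)); last by ring.
rewrite -(J_cube (row ord0 T)); last by rewrite mulr_gt0.
apply: J_le => //; first exact: adm_cube.
move=> x; rewrite !indicE ler_nat.
by case: (pselect (inner T x)) => Tx; [rewrite !mem_set//; exact: sub|rewrite memNset].
Qed.

Lemma adm_inner T f : T \in M -> blip f -> adm (fun x => \1_(inner T) x * f x).
Proof.
move=> TM bf; have [a1 _] := inner_vol TM; have [N hN] := bf.
apply: (@adm_dom _ _ _ (\1_(inner T)) N _ a1).
  by apply: mfunM; [exact: mfun_indic (mset_inner T)|exact: blip_mfun].
by move=> x; rewrite normrM mulrC ler_wpM2r//; case: (hN x 0).
Qed.

Lemma sum_inner (f : 'M[R]_(d.+1, d) -> R) x : (forall T, 0 <= f T) ->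
  forall c, 0 <= c -> (forall T, T \in M -> inner T x -> f T <= c) ->
  \sum_(T <- undup M) \1_(inner T) x * f T <= c.
Proof.
move=> f0 c c0 hc; case: (pselect (exists2 T, T \in M & inner T x)) => [[T TM Tx]|no].
  rewrite (bigD1_seq T) ?mem_undup ?undup_uniq//= indicE mem_set// mul1r.
  rewrite big_seq_cond big1 ?addr0; first exact: hc.
  move=> T' /andP[]; rewrite mem_undup => T'M T'T; rewrite indicE memNset ?mul0r// => T'x.
  move/eqP: T'T; apply; apply/esym/(mesh_disjoint d_gt0 triM TM T'M Tx).
  by apply: inner_simplex => //; exact: aiM.
rewrite big_seq big1// => T; rewrite mem_undup => TM; rewrite indicE memNset ?mul0r// => Tx.
by apply: no; exists T.
Qed.

Section OneFunction.
Variable v : 'rV[R]_d -> R.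
Hypothesis pv : paffine Hs M v.

Lemma paffine_blip : blip v.
Proof.
have [L L0 hL] := paffine_lip unitH triM pv; have [z _] := pv.
have B2 : 0 <= L * (d%:R * (2 * B)) + `|v 0|.
  apply: addr_ge0 => //; apply: mulr_ge0 => //; apply: mulr_ge0 => //.
  by rewrite mulr_ge0// ltW.
exists (L + (L * (d%:R * (2 * B)) + `|v 0|)) => x y; split.
  case: (pselect (polytope Hs x)) => hx; last by rewrite z// normr0 addr_ge0.
  have xB : enorm x <= d%:R * (2 * B).
    rewrite (le_trans (enorm_le_sum x))//.
    rewrite (_ : d%:R * _ = \sum_(i < d) (2 * B)); last by rewrite sumr_const card_ord -[RHS]mulr_natl.
    apply: ler_sum => i _; have := HB hx i; rewrite mxE subr0; have := B_gt0; lra.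
  have := hL 0 x; rewrite add0r => h1.
  rewrite -(subrK (v 0) (v x)) (le_trans (ler_normD _ _))//.
  have : L * enorm x <= L * (d%:R * (2 * B)) by rewrite ler_wpM2l.
  lra.
by rewrite (le_trans (hL x y))// ler_wpM2r ?enorm_ge0// lerDl.
Qed.

Lemma paffine_adm : adm v.
Proof.
apply: (blip_adm (B := B) paffine_blip) => x vx; apply: HB; apply: contrapT => nx.
by apply: vx; have [z _] := pv; exact: z.
Qed.

Definition JT T := J (fun x => \1_(inner T) x * v x ^+ 2).

Lemma blip_sqr : blip (fun x => v x ^+ 2).
Proof.
rewrite (_ : (fun x => _) = fun x => v x * v x); last by apply/funext => x; rewrite expr2.
by apply: blipM; exact: paffine_blip.
Qed.

Lemma adm_sqr : adm (fun x => v x ^+ 2).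
Proof.
rewrite (_ : (fun x => _) = fun x => v x * v x); last by apply/funext => x; rewrite expr2.
by apply: admM; exact: paffine_adm.
Qed.

Lemma JT_ge0 T : 0 <= JT T.
Proof. by apply: J_ge0 => x; rewrite mulr_ge0 ?sqr_ge0// indicE ler0n. Qed.

Lemma JT_sum : \sum_(T <- undup M) JT T <= J (fun x => v x ^+ 2).
Proof.
rewrite big_seq /JT -J_sum => [|T]; last by rewrite mem_undup => TM; apply: adm_inner => //; exact: blip_sqr.
apply: J_le; [|exact: adm_sqr|move=> x].
  by apply: adm_sum => T; rewrite mem_undup => TM; apply: adm_inner => //; exact: blip_sqr.
rewrite -big_seq; apply: (sum_inner (f := fun=> v x ^+ 2)) => *; by rewrite ?sqr_ge0.
Qed.

(** If y is short, both x and x + y lie in the inscribed cube for x in the cube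
    of half the size, and the product of the slope with y is the difference of
    the values there. *)
Lemma slope_bound T : T \in M ->
  dotp (slope T v) (slope T v) * cubesize ^+ d.+2 <= 16 * JT T.
Proof.
move=> TM; have [c sub] := inner_cube TM; have q0 := cubesize_gt0.
set q := cubesize in sub q0 *; set a := slope T v.
have key y : enorm y <= q / 2 -> dotp a y ^+ 2 * q ^+ d <= 4 * JT T.
  move=> hy; pose Q := cube c (q / 2).
  have QT : Q `<=` inner T.
    by apply: classical_sets.subset_trans sub; apply: cube_le; rewrite ler_pdivrMr// ler_peMr ?(ltW q0)// ler1n.
  have QyT x : Q x -> inner T (x + y).
    move=> Qx; apply: sub => i; have := Qx i; have := enorm_coord y i; rewrite !mxE => h1 h2.
    rewrite addrAC (le_lt_trans (ler_normD _ _))//; lra.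
  have aQ : adm (\1_Q : _ -> R) by exact: adm_cube.
  have aT : adm (fun x => \1_(inner T) x * v x ^+ 2) by apply: adm_inner => //; exact: blip_sqr.
  have aTy : adm (fun x => \1_(inner T) (x + y) * v (x + y) ^+ 2).
    have := adm_affine y ltr01 aT; congr adm; apply/funext => x; by rewrite scale1r.
  have qE : q ^+ d = J (\1_Q : _ -> R).
    have -> : q = 2 * (q / 2) by field.
    have q2 : 0 < q / 2 by rewrite divr_gt0.
    by rewrite -(J_cube c q2) /Q; congr J; apply/funext => x; congr (\1_(cube c _) x); field.
  have -> : dotp a y ^+ 2 * q ^+ d = J (fun x => dotp a y ^+ 2 * \1_Q x) by rewrite JZ// qE.
  apply: (@le_trans _ _ (J (fun x => 2 * (\1_(inner T) (x + y) * v (x + y) ^+ 2) +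
     2 * (\1_(inner T) x * v x ^+ 2)))); last first.
    rewrite JD; [|exact: admZ|exact: admZ].
    rewrite !JZ// (J_translate y aT) -/(JT T); lra.
  apply: J_le; [exact: admZ|by apply: admD; exact: admZ|move=> x].
  case: (pselect (Q x)) => Qx; last first.
    by rewrite indicE memNset// mulr0 addr_ge0// mulr_ge0// mulr_ge0 ?sqr_ge0// indicE ler0n.
  rewrite !indicE !mem_set//; [|exact: QT|exact: QyT].
  rewrite !(mulr1, mul1r).
  rewrite -(paffine_diff pv TM (inner_simplex (aiM TM) (QT _ Qx)) (inner_simplex (aiM TM) (QyT _ Qx))).
  have := sqr_ge0 (v (x + y) + v x); lra.
have [a0|a0] := eqVneq (enorm a) 0.
  by rewrite (enorm0_eq0 a0) dotp0l mul0r mulr_ge0 ?JT_ge0.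
have ap : 0 < enorm a by rewrite lt_neqAle eq_sym a0 enorm_ge0.
have := key ((q / 2 / enorm a) *: a).
have qa : 0 <= q / 2 / enorm a.
  by apply: divr_ge0; [apply: divr_ge0 => //; exact: ltW|exact: enorm_ge0].
rewrite enormZ ger0_norm//.
rewrite divfK// => /(_ (lexx _)); rewrite dotpZr -enorm_sqr.
rewrite (_ : _ * q ^+ d = enorm a ^+ 2 * q ^+ d.+2 / 4); first lra.
by rewrite !exprS; field.
Qed.

Definition nodal_const := (shape * d%:R) ^+ d * (2 + 2 ^+ d.+1 * 16 * (shape * d%:R) ^+ 2).

(** The value at a vertex is the value at a point of the cube plus a multiple
    of the slope, both of which are controlled in the mean. *)
Lemma vertex_bound T j : T \in M -> h ^+ d * v (row j T) ^+ 2 <= nodal_const * JT T.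
Proof.
move=> TM; have [c sub] := inner_cube TM; have q0 := cubesize_gt0.
have hq := cubesizeE; have sb := slope_bound TM.
have h0 := mesh_size_gt0.
set q := cubesize in sub q0 hq sb *; set a := slope T v in sb.
have ai := aiM TM.
have aT : adm (fun x => \1_(inner T) x * v x ^+ 2) by apply: adm_inner => //; exact: blip_sqr.
have k1 : v (row j T) ^+ 2 * (2 * q) ^+ d <= 2 * JT T + 2 * dotp a a * h ^+ 2 * (2 * q) ^+ d.
  rewrite -(J_cube c q0).
  have -> : v (row j T) ^+ 2 * J (\1_(cube c q) : _ -> R) = J (fun x => v (row j T) ^+ 2 * \1_(cube c q) x).
    by rewrite JZ//; exact: adm_cube.
  have -> : 2 * JT T + 2 * dotp a a * h ^+ 2 * J (\1_(cube c q) : _ -> R) =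
      J (fun x => 2 * (\1_(inner T) x * v x ^+ 2) + 2 * dotp a a * h ^+ 2 * \1_(cube c q) x).
    by rewrite JD ?JZ//; [exact: adm_cube|exact: admZ|apply: admZ; exact: adm_cube].
  apply: J_le; [by apply: admZ; exact: adm_cube| |move=> x].
    by apply: admD; apply: admZ => //; exact: adm_cube.
  case: (pselect (cube c q x)) => Qx; last first.
    rewrite !indicE (memNset Qx) !mulr0 addr0 mulr_ge0// mulr_ge0 ?sqr_ge0// ler0n//.
  rewrite !indicE !mem_set//; last exact: sub.
  rewrite !(mulr1, mul1r).
  have Tx := inner_simplex ai (sub _ Qx).
  have Tj := vertex_simplex ai j.
  have := paffine_diff pv TM (x := x) (y := row j T - x) Tx.
  rewrite (_ : x + (row j T - x) = row j T); last by rewrite addrCA subrr addr0.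
  move=> /(_ Tj) hd; rewrite -/a in hd.
  have h1 : dotp a (row j T - x) ^+ 2 <= dotp a a * h ^+ 2.
    rewrite (le_trans (dotp_CS _ _))// ler_wpM2l ?dotp_ge0// -enorm_sqr.
    by rewrite ler_pXn2r ?nnegrE ?enorm_ge0 ?(ltW h0)//; exact: simplex_size TM Tj Tx.
  have := sqr_ge0 (v x - dotp a (row j T - x)).
  have -> : v (row j T) = v x + dotp a (row j T - x) by rewrite -hd; ring.
  lra.
have qd : 0 < q ^+ d by rewrite exprn_gt0.
have two : 1 <= (2 : R) ^+ d by rewrite exprn_ege1// ler1n.
have J0 := JT_ge0 T.
have S0 : 0 < shape * d%:R by rewrite mulr_gt0 ?shape_gt0// ltr0n.
set S := shape * d%:R in hq S0 *.
rewrite exprMn in k1.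
have k2 : v (row j T) ^+ 2 * q ^+ d <= (2 + 2 ^+ d.+1 * 16 * S ^+ 2) * JT T.
  apply: (@le_trans _ _ (v (row j T) ^+ 2 * (2 ^+ d * q ^+ d))).
    by rewrite ler_wpM2l ?sqr_ge0// ler_peMl// ltW.
  rewrite (le_trans k1)// [leRHS](mulrDl 2) lerD2l hq.
  have -> : 2 * dotp a a * (S * q) ^+ 2 * (2 ^+ d * q ^+ d) =
     2 ^+ d.+1 * S ^+ 2 * (dotp a a * q ^+ d.+2) by rewrite !exprS !exprMn; ring.
  have -> : 2 ^+ d.+1 * 16 * S ^+ 2 * JT T = 2 ^+ d.+1 * S ^+ 2 * (16 * JT T) by ring.
  by rewrite ler_wpM2l// mulr_ge0 ?exprn_ge0// ltW.
have -> : h ^+ d * v (row j T) ^+ 2 = S ^+ d * (v (row j T) ^+ 2 * q ^+ d) by rewrite hq exprMn; ring.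
have -> : nodal_const * JT T = S ^+ d * ((2 + 2 ^+ d.+1 * 16 * S ^+ 2) * JT T) by rewrite /nodal_const -/S; ring.
by rewrite ler_wpM2l// exprn_ge0// ltW.
Qed.

Lemma interior_verticesP x : x \in interior_vertices (polytope Hs) M ->
  polytope Hs x /\ exists T j, T \in M /\ x = row j T.
Proof.
rewrite mem_filter mem_undup => /andP[/asboolP hx /allpairsP[[T j] [TM _ xE]]].
by split => //; exists T, j; split.
Qed.

Lemma nodal_const_gt0 : 0 < nodal_const.
Proof.
have S0 : 0 < shape * d%:R by rewrite mulr_gt0 ?shape_gt0// ltr0n.
apply: mulr_gt0; first exact: exprn_gt0.
apply: ltr_pwDl => //; apply: mulr_ge0; last exact: sqr_ge0.
by apply: mulr_ge0 => //; exact: exprn_ge0.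
Qed.

(** The nodal values at each vertex are charged to one simplex containing it. *)
Lemma fe_lower : h ^+ d * \sum_(x <- interior_vertices (polytope Hs) M) v x * v x <=
  (d.+1%:R * nodal_const) * J (fun x => v x ^+ 2).
Proof.
have nc0 := nodal_const_gt0.
apply: (@le_trans _ _ (d.+1%:R * nodal_const * \sum_(T <- undup M) JT T)); last first.
  by rewrite ler_wpM2l ?JT_sum// mulr_ge0// ltW.
set IV := interior_vertices _ _.
apply: (@le_trans _ _ (\sum_(x <- IV) \sum_(T <- undup M) \sum_j (row j T == x)%:R * (nodal_const * JT T))).
  rewrite mulr_sumr big_seq [leRHS]big_seq; apply: ler_sum => x /interior_verticesP[_ [T [j [TM ->]]]].
  have nn T' j' : 0 <= (row j' T' == row j T)%:R * (nodal_const * JT T').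
    by rewrite mulr_ge0 ?ler0n// mulr_ge0 ?JT_ge0// ltW.
  rewrite -expr2; apply: (@le_trans _ _ (\sum_j' (row j' T == row j T)%:R * (nodal_const * JT T))).
    rewrite (bigD1 j)//= eqxx mul1r ler_wpDr ?vertex_bound//; exact: sumr_ge0.
  apply: (le_bigseq (f := fun T' => \sum_j' (row j' T' == row j T)%:R * (nodal_const * JT T'))); rewrite ?mem_undup//.
  by move=> T'; exact: sumr_ge0.
rewrite exchange_big/= mulr_sumr; apply: ler_sum => T _.
rewrite exchange_big/= (_ : d.+1%:R * nodal_const * JT T = \sum_(j < d.+1) nodal_const * JT T); last first.
  by rewrite sumr_const card_ord -[RHS]mulr_natl mulrA.
have nJ : 0 <= nodal_const * JT T by rewrite mulr_ge0 ?JT_ge0 ?(ltW nc0).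
apply: ler_sum => j _; rewrite -mulr_suml ler_piMl//.
rewrite -natr_sum (_ : 1 = 1%:R)// ler_nat.
rewrite (eq_bigr (fun x => nat_of_bool (x == row j T))); last by move=> x _; rewrite eq_sym.
rewrite -big_mkcond/= sum1_count.
have -> : count (fun x => x == row j T) IV = count_mem (row j T) IV by [].
by rewrite count_uniq_mem ?leq_b1// filter_uniq// undup_uniq.
Qed.

Lemma pgrad_sqr x : \sum_i pgrad M v i x * pgrad M v i x =
  \sum_(T <- undup M) \1_(inner T) x * dotp (slope T v) (slope T v).
Proof.
case: (pselect (exists2 T, T \in M & inner T x)) => [[T TM Tx]|no].
  rewrite [RHS](bigD1_seq T) ?mem_undup ?undup_uniq//= indicE mem_set// mul1r.
  rewrite [X in _ = _ + X]big_seq_cond [X in _ = _ + X]big1 ?addr0.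
    by rewrite /dotp; apply: eq_bigr => i _; rewrite (pgrad_in d_gt0 triM _ _ TM Tx).
  move=> T' /andP[]; rewrite mem_undup => T'M T'T; rewrite indicE memNset ?mul0r// => T'x.
  move/eqP: T'T; apply; apply/esym/(mesh_disjoint d_gt0 triM TM T'M Tx).
  by apply: inner_simplex => //; exact: aiM.
rewrite big1; last first.
  by move=> i _; rewrite pgrad_out ?mul0r// => T TM Tx; apply: no; exists T.
rewrite big_seq big1// => T; rewrite mem_undup => TM; rewrite indicE memNset ?mul0r// => Tx.
by apply: no; exists T.
Qed.

Definition inverse_const := (16 * 4 ^+ d * (shape * d%:R) ^+ d.+2).

(** On a simplex the gradient is constant, so slope_bound and the bound of the
    volume give the estimate. *)
Lemma fe_inverse : J (fun x => \sum_i pgrad M v i x * pgrad M v i x) <=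
  inverse_const * h ^- 2 * J (fun x => v x ^+ 2).
Proof.
have q0 := cubesize_gt0; have hq := cubesizeE; have h0 := mesh_size_gt0.
have S0 : 0 < shape * d%:R by rewrite mulr_gt0 ?shape_gt0// ltr0n.
have ic0 : 0 <= inverse_const * h ^- 2.
  apply: mulr_ge0; last by rewrite invr_ge0 sqr_ge0.
  apply: mulr_ge0; last by apply/exprn_ge0/ltW.
  by apply: mulr_ge0 => //; exact: exprn_ge0.
apply: le_trans (ler_wpM2l ic0 JT_sum).
rewrite (_ : (fun x => _) = fun x => \sum_(T <- undup M) \1_(inner T) x * dotp (slope T v) (slope T v)); last first.
  by apply/funext => x; exact: pgrad_sqr.
have aT T : T \in undup M -> adm (fun x => \1_(inner T) x * dotp (slope T v) (slope T v)).
  by rewrite mem_undup => TM; apply: (adm_inner (f := fun=> _)) => //; exact: blip_cst.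
rewrite (_ : (fun x => _) = fun x => \sum_(T <- undup M | T \in undup M) \1_(inner T) x * dotp (slope T v) (slope T v)); last first.
  by apply/funext => x; rewrite big_seq.
rewrite J_sum// mulr_sumr [leRHS]big_seq; apply: ler_sum => T; rewrite mem_undup => TM.
have [a1 vol] := inner_vol TM.
rewrite (_ : (fun x => _) = fun x => dotp (slope T v) (slope T v) * \1_(inner T) x); last first.
  by apply/funext => x; rewrite mulrC.
rewrite JZ//; have sb := slope_bound TM.
apply: (@le_trans _ _ (dotp (slope T v) (slope T v) * (4 * h) ^+ d)).
  by rewrite ler_wpM2l ?dotp_ge0.
rewrite /inverse_const; set S := shape * d%:R in hq S0 *; set q := cubesize in q0 hq sb *.
have -> : 16 * 4 ^+ d * S ^+ d.+2 * h ^- 2 * JT T = 4 ^+ d * S ^+ d * q ^- 2 * (16 * JT T).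
  by rewrite hq !exprS; field; rewrite !gt_eqF.
have -> : dotp (slope T v) (slope T v) * (4 * h) ^+ d =
  4 ^+ d * S ^+ d * q ^- 2 * (dotp (slope T v) (slope T v) * q ^+ d.+2).
  clear aT ic0; clearbody q; rewrite hq !exprMn !exprS; field.
  exact: lt0r_neq0.
by rewrite ler_wpM2l// !mulr_ge0 ?invr_ge0 ?exprn_ge0// ltW.
Qed.

(** Few simplices meet at a vertex, since their inscribed cubes are disjoint. *)
Lemma vertex_multiplicity x :
  \sum_(T <- undup M) \sum_j (row j T == x)%:R <= d.+1%:R * (3 * (shape * d%:R)) ^+ d.
Proof.
have q0 := cubesize_gt0; have hq := cubesizeE; have h0 := mesh_size_gt0.
set S := shape * d%:R in hq *; set q := cubesize in q0 hq *.
have ex T : exists c, T \in M -> cube c q `<=` inner T.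
  by have [TM|_] := boolP (T \in M); [have [c hc] := inner_cube TM; exists c|exists 0].
pose c T := projT1 (cid (ex T)).
have cT T : T \in M -> cube (c T) q `<=` inner T by rewrite /c; case: cid.
have qd : 0 < (2 * q) ^+ d by rewrite exprn_gt0// mulr_gt0.
rewrite -(ler_pM2r qd) mulr_suml.
have aQ T : adm (fun y => (\sum_j (row j T == x)%:R) * \1_(cube (c T) q) y).
  by apply: admZ; exact: adm_cube.
rewrite (eq_bigr (fun T => J (fun y => (\sum_j (row j T == x)%:R) * \1_(cube (c T) q) y))); last first.
  by move=> T _; rewrite JZ ?J_cube//; exact: adm_cube.
rewrite -J_sum//.
have -> : d.+1%:R * (3 * S) ^+ d * (2 * q) ^+ d = J (fun y => d.+1%:R * \1_(cube x (3 * h)) y).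
  rewrite JZ ?J_cube ?mulr_gt0//; last exact: adm_cube.
  by rewrite -mulrA -exprMn hq; congr (_ * _ ^+ _); ring.
apply: J_le; [exact: adm_sum|by apply: admZ; exact: adm_cube|move=> y].
apply: (@le_trans _ _ (\sum_(T <- undup M) \1_(inner T) y * ((\sum_j (row j T == x)%:R) * \1_(cube (c T) q) y))).
  rewrite big_seq [leRHS]big_seq; apply: ler_sum => T; rewrite mem_undup => TM.
  case: (pselect (cube (c T) q y)) => cy.
    by rewrite (_ : \1_(inner T) y = 1) ?mul1r// indicE mem_set//; exact: cT cy.
  by rewrite (_ : \1_(cube (c T) q) y = 0 :> R) ?mulr0// indicE memNset.
have s0 T : 0 <= \sum_j (row j T == x)%:R :> R by apply: sumr_ge0 => j _; rewrite ler0n.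
apply: sum_inner.
- by move=> T; rewrite mulr_ge0// indicE ler0n.
- by rewrite mulr_ge0// indicE ler0n.
move=> T TM Ty; case: (pselect (exists j, row j T = x)) => [[j jx]|no].
  have -> : \1_(cube x (3 * h)) y = 1 :> R.
    rewrite indicE mem_set// => i.
    have := simplex_size TM (inner_simplex (aiM TM) Ty) (vertex_simplex (aiM TM) j).
    rewrite jx => hx; have := enorm_coord (y - x) i; rewrite !mxE; lra.
  rewrite mulr1; apply: (@le_trans _ _ ((\sum_j (row j T == x)%:R) * 1)).
    by rewrite ler_wpM2l// indicE; case: (_ \in _).
  rewrite mulr1 (_ : d.+1%:R = \sum_(j < d.+1) 1); last by rewrite sumr_const card_ord.
  by apply: ler_sum => k _; case: (_ == _).
rewrite big1 ?mul0r ?mulr_ge0 ?indicE ?ler0n// => j _.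
by case: eqP => // jx; case: no; exists j.
Qed.

Definition upper_const := 4 ^+ d * d.+1%:R * (d.+1%:R * (3 * (shape * d%:R)) ^+ d).

(** A value in a simplex is a convex combination of the values at its vertices,
    and each vertex is used by boundedly many simplices. *)
Lemma fe_upper : J (fun x => v x ^+ 2) <=
  upper_const * (h ^+ d * \sum_(x <- interior_vertices (polytope Hs) M) v x * v x).
Proof.
have h0 := mesh_size_gt0; have [z av] := pv.
have -> : J (fun x => v x ^+ 2) = \sum_(T <- undup M) JT T.
  rewrite big_seq /JT -J_sum => [|T]; last by rewrite mem_undup => TM; apply: adm_inner => //; exact: blip_sqr.
  rewrite -(integral_RdE (D := setT) (f := fun x => v x ^+ 2))//; last by move=> x nT; case: nT.
  apply: (integral_Rd_off_null (null_facets B_gt0 (facets_unit d_gt0 triM))) => [x nx _|x _ nT]; last by case: nT.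
  rewrite -big_seq; case: (pselect (polytope Hs x)) => hx; last first.
    have vx : v x = 0 by exact: z.
    by rewrite vx expr0n/= big1// => T _; rewrite mulr0.
  have [T TM Tx] : exists2 T, T \in M & inner T x.
    apply: (off_facets triM hx) => // p pF; apply/eqP => g0; apply: nx; split; first exact: HB.
    by exists p.
  rewrite (bigD1_seq T) ?mem_undup ?undup_uniq//= indicE mem_set// mul1r.
  rewrite big_seq_cond big1 ?addr0// => T' /andP[]; rewrite mem_undup => T'M T'T.
  rewrite indicE memNset ?mul0r// => T'x.
  move/eqP: T'T; apply; apply/esym/(mesh_disjoint d_gt0 triM TM T'M Tx).
  by apply: inner_simplex => //; exact: aiM.
set IV := interior_vertices _ _.
apply: (@le_trans _ _ ((4 * h) ^+ d * d.+1%:R * \sum_(T <- undup M) \sum_j v (row j T) ^+ 2)).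
  rewrite mulr_sumr big_seq [leRHS]big_seq; apply: ler_sum => T; rewrite mem_undup => TM.
  have [a1 vol] := inner_vol TM; have ai := aiM TM.
  have s0 : 0 <= d.+1%:R * \sum_j v (row j T) ^+ 2.
    by rewrite mulr_ge0//; apply: sumr_ge0 => j _; exact: sqr_ge0.
  apply: (@le_trans _ _ (J (fun x => (d.+1%:R * \sum_j v (row j T) ^+ 2) * \1_(inner T) x))).
    apply: J_le; [by apply: adm_inner => //; exact: blip_sqr|exact: admZ|move=> x].
    case: (pselect (inner T x)) => Tx; last by rewrite !indicE memNset// mul0r mulr0.
    rewrite !indicE mem_set// mul1r mulr1 (av T x TM (inner_simplex ai Tx)).
    have CS : forall (s : seq 'I_d.+1), (\sum_(j <- s) v (row j T) * bary T j x) ^+ 2 <=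
        (size s)%:R * \sum_(j <- s) v (row j T) ^+ 2.
      elim=> [|j s IH]; first by rewrite !big_nil expr0n mul0r.
      rewrite !big_cons -[size _]/((size s).+1) -natr1.
      have b0 : 0 <= bary T j x by exact: ltW.
      have b1 := bary_le1 ai j (inner_simplex ai Tx).
      have sq : (v (row j T) * bary T j x) ^+ 2 <= v (row j T) ^+ 2.
        by rewrite exprMn ler_piMr ?sqr_ge0// expr_le1.
      set X := v (row j T) * bary T j x in sq *; set Y := \sum_(j <- s) _ in IH *.
      set Z := \sum_(j <- s) _ in IH *; set n := (size s)%:R in IH *.
      have Z0 : 0 <= Z by apply: sumr_ge0 => k _; exact: sqr_ge0.
      have [s0'|sn] := eqVneq n 0.
        rewrite s0' in IH *; have Y0 : Y = 0 by apply/eqP; rewrite -sqrf_eq0 eq_le sqr_ge0 andbT; lra.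
        rewrite Y0; lra.
      have n0 : 0 < n by rewrite lt_neqAle eq_sym sn ler0n.
      have k := sqr_ge0 (n * X - Y).
      have k2 : 0 <= n * (X ^+ 2 * n + Y ^+ 2 / n - 2 * X * Y).
        by rewrite (_ : _ * _ = (n * X - Y) ^+ 2)//; field; rewrite gt_eqF.
      rewrite pmulr_rge0// in k2.
      have k3 : Y ^+ 2 / n <= Z by rewrite ler_pdivrMr// mulrC.
      have k4 : X ^+ 2 * n <= v (row j T) ^+ 2 * n by rewrite ler_wpM2r// ltW.
      rewrite sqrrD; lra.
    have := CS (index_enum 'I_d.+1).
    by rewrite (_ : size _ = d.+1)// -[RHS]size_enum_ord enumT.
  rewrite JZ// mulrC -mulrA; exact: ler_wpM2r.
have -> : \sum_(T <- undup M) \sum_j v (row j T) ^+ 2 =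
    \sum_(x <- IV) (v x * v x) * \sum_(T <- undup M) \sum_j (row j T == x)%:R.
  under [RHS]eq_bigr => x _ do rewrite mulr_sumr.
  rewrite [RHS]exchange_big/= big_seq [RHS]big_seq; apply: eq_bigr => T; rewrite mem_undup => TM.
  under [RHS]eq_bigr => x _ do rewrite mulr_sumr.
  rewrite [RHS]exchange_big/=; apply: eq_bigr => j _.
  case: (pselect (polytope Hs (row j T))) => hx.
    have jIV : row j T \in IV.
      by rewrite mem_filter mem_undup; apply/andP; split; [exact/asboolP|apply: allpairs_f => //; rewrite mem_enum].
    rewrite (bigD1_seq (row j T)) ?filter_uniq ?undup_uniq//= eqxx mulr1 expr2 big1 ?addr0//.
    by move=> x xj; rewrite eq_sym (negPf xj) mulr0.
  rewrite z// expr0n/= big1_seq// => x /andP[_ /interior_verticesP[hx' _]].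
  by case: eqP => [jx|_]; [rewrite jx in hx|rewrite mulr0].
rewrite /upper_const exprMn.
apply: (@le_trans _ _ (4 ^+ d * h ^+ d * d.+1%:R * \sum_(x <- IV) (v x * v x) * (d.+1%:R * (3 * (shape * d%:R)) ^+ d))).
  rewrite ler_wpM2l//; first by rewrite !mulr_ge0 ?exprn_ge0// ltW.
  by apply: ler_sum => x _; rewrite ler_wpM2l ?vertex_multiplicity// -expr2 sqr_ge0.
rewrite -mulr_suml le_eqVlt; apply/orP; left; apply/eqP; ring.
Qed.

End OneFunction.

(** * Nodal interpolation *)

(** A point common to two simplices lies in a common face, so that its
    barycentric coordinates are supported by shared vertices and agree. *)
Lemma shared_vertices T T' x (g : 'rV[R]_d -> R) : T \in M -> T' \in M -> simplex T x -> simplex T' x ->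
  \sum_j g (row j T) * bary T j x = \sum_j g (row j T') * bary T' j x.
Proof.
move=> TM T'M Tx T'x; have [_ _ _ conf] := triM.
have [I [I' [h1 h2]]] := conf _ _ TM T'M.
have aT := aiM TM; have aT' := aiM T'M.
have /(faceP aT)[b0 bI] : face T I x by rewrite -h1.
have same j : j \in I -> exists i, row i T' = row j T.
  move=> jI; have : face T I (row j T).
    by apply/(faceP aT); split => [i|i iI]; rewrite bary_vertex// (negPf (_ : i != j))//; apply: contraNneq iI => ->.
  rewrite h2 => fj; have /(faceP aT')[c0 cI] := fj.
  have [i ci] : exists i, 0 < bary T' i (row j T).
    apply: contrapT => no; have := bary_sum aT' (row j T); rewrite big1 => [/eqP|i _].
      by rewrite eq_sym oner_eq0.
    by apply/eqP; rewrite eq_le c0 andbT leNgt; apply/negP => h; apply: no; exists i.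
  have iI' : i \in I' by apply: contraT => /cI h; rewrite h ltxx in ci.
  have fi k : k \in I' -> face T I (row k T').
    move=> kI; rewrite h2; apply/(faceP aT'); split => [l|l lI]; rewrite bary_vertex//.
    by rewrite (negPf (_ : l != k))//; apply: contraNneq lI => ->.
  exists i; apply: (bary_inj aT) => k; rewrite bary_vertex//.
  (* the j-th coordinate is a convex combination of numbers at most one *)
  have e1 : bary T j (row i T') = 1.
    have le1 l : l \in I' -> bary T j (row l T') <= 1.
      by move=> lI; apply: bary_le1 => //; have /(faceP aT)[? _] := fi l lI; apply/(simplexP aT).
    have bz : \sum_l bary T' l (row j T) * (1 - bary T j (row l T')) = 0.
      under eq_bigr do rewrite mulrBr mulr1.
      rewrite sumrB bary_sum//.
      have -> : \sum_l bary T' l (row j T) * bary T j (row l T') = bary T j (row j T).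
        rewrite -[in RHS](bary_comb aT' (row j T)) mulmx_sum_row.
        have aff : forall (s : seq 'I_d.+1), bary T j (\sum_(l <- s) (\row_i0 bary T' i0 (row j T)) 0 l *: row l T') =
          bary T j 0 + \sum_(l <- s) bary T' l (row j T) * (bary T j (row l T') - bary T j 0).
          elim=> [|l s IH]; first by rewrite !big_nil addr0.
          rewrite !big_cons addrC baryD IH dotpZr mxE (baryE T j (row l T')) (baryE T j 0) dotp0r; ring.
        rewrite aff; under [in RHS]eq_bigr do rewrite mulrBr.
        by rewrite sumrB -mulr_suml bary_sum//; ring.
      by rewrite bary_vertex// eqxx subrr.
    have nn l : 0 <= bary T' l (row j T) * (1 - bary T j (row l T')).
      have [lI|lI] := boolP (l \in I'); last by rewrite cI// mul0r.
      by rewrite mulr_ge0// subr_ge0 le1.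
    have : bary T' i (row j T) * (1 - bary T j (row i T')) = 0.
      apply/eqP; rewrite eq_le nn andbT -bz (bigD1 i)//= lerDl; exact: sumr_ge0.
    move/eqP; rewrite mulf_eq0 gt_eqF//= subr_eq0 => /eqP //.
  have /(faceP aT)[p0 _] := fi i iI'.
  have [->|kj] := eqVneq k j; first by rewrite e1.
  apply/eqP; rewrite eq_le p0 andbT.
  have := bary_sum aT (row i T'); rewrite (bigD1 j)//= e1 (bigD1 k)//= => h.
  set Z := \sum_(l | _) _ in h; have Z0 : 0 <= Z by exact: sumr_ge0.
  by move/eqP: h; rewrite -subr_eq0 addrAC subrr add0r addr_eq0 => /eqP ->; rewrite oppr_le0.
pose pi j := xget j [set i | row i T' = row j T].
have piP j : j \in I -> row (pi j) T' = row j T.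
  by move=> /same[i hi]; rewrite /pi; exact: (xgetPex j (P := [set i | row i T' = row j T])) (ex_intro _ i hi).
pose b : 'rV[R]_d.+1 := \row_i \sum_(j in I | pi j == i) bary T j x.
have b1 : \sum_i b 0 i = 1.
  rewrite -[RHS](bary_sum aT x) [RHS](bigID (mem I))/= [X in _ + X]big1 ?addr0; last exact: bI.
  rewrite [RHS](partition_big pi xpredT)//=; apply: eq_bigr => i _; by rewrite mxE.
have xb : x = b *m T'.
  rewrite -[LHS](bary_comb aT x) !mulmx_sum_row (bigID (mem I))/= [X in _ + X]big1 ?addr0; last first.
    by move=> j jI; rewrite mxE bI// scale0r.
  rewrite [LHS](partition_big pi xpredT)//=; apply: eq_bigr => i _; rewrite mxE scaler_suml.
  by apply: eq_bigr => j /andP[jI /eqP <-]; rewrite mxE piP.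
have bE i : bary T' i x = b 0 i by rewrite xb bary_uniq.
rewrite [LHS](bigID (mem I))/= [X in _ + X]big1 ?addr0; last by move=> j jI; rewrite bI// mulr0.
rewrite [LHS](partition_big pi xpredT)//=; apply: eq_bigr => i _; rewrite bE mxE mulr_sumr.
by apply: eq_bigr => j /andP[jI /eqP <-]; rewrite piP.
Qed.

(** The interpolants on the single simplices are glued together; the result
    vanishes off the domain, as a point of a simplex on a face of the polytope
    is a combination of vertices on that face. *)
Lemma nodal_interpolant (g : 'rV[R]_d -> R) : exists v, v \in P1_pred (polytope Hs) M /\
  forall T j, T \in M -> polytope Hs (row j T) -> v (row j T) = g (row j T).
Proof.
pose g' x := if `[< polytope Hs x >] then g x else 0.
pose pick x := nth 0 M (find (fun T => `[< simplex T x >]) M).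
pose v x := if has (fun T => `[< simplex T x >]) M
  then \sum_j g' (row j (pick x)) * bary (pick x) j x else 0.
have vT T x : T \in M -> simplex T x -> v x = \sum_j g' (row j T) * bary T j x.
  move=> TM Tx; have hs : has (fun T => `[< simplex T x >]) M.
    by apply/hasP; exists T => //; exact/asboolP.
  rewrite /v hs; apply: shared_vertices => //.
    by apply: mem_nth; rewrite -has_find.
  by have /asboolP := nth_find (0 : 'M[R]_(d.+1, d)) hs.
have vj T j : T \in M -> v (row j T) = g' (row j T).
  move=> TM; have ai := aiM TM; rewrite (vT T)//; last exact: vertex_simplex.
  rewrite (bigD1 j)//= bary_vertex// eqxx mulr1 big1 ?addr0// => i ij.
  by rewrite bary_vertex// (negPf ij) mulr0.
have z x : ~ polytope Hs x -> v x = 0.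
  move=> nx; rewrite /v; case: ifP => // /hasP[T TM /asboolP Tx].
  rewrite -/(v x) -[LHS]/(\sum_j g' (row j (pick x)) * bary (pick x) j x).
  have -> : \sum_j g' (row j (pick x)) * bary (pick x) j x = v x.
    by rewrite /v ifT//; apply/hasP; exists T => //; exact/asboolP.
  rewrite (vT T)//; have ai := aiM TM.
  move/existsNP: nx => [p /not_implyP[pH /negP]]; rewrite -leNgt => gp.
  have gj j : 0 <= gap p (row j T) by apply: (simplex_gap triM TM) => //; exact: vertex_simplex.
  have bj : forall j, 0 <= bary T j x by apply/(simplexP ai).
  have gx : gap p x = \sum_j gap p (row j T) * bary T j x.
    have := affine_bary ai (- p.1) p.2 x; rewrite dotpNl addrC -/(gap p x) => <-.
    by apply: eq_bigr => j _; rewrite dotpNl /gap addrC.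
  apply: big1 => j _; rewrite /g'; case: asboolP => [hj|]; last by rewrite mul0r.
  have s0 : gap p (row j T) * bary T j x <= 0.
    apply: le_trans gp; rewrite gx (bigD1 j)//= lerDl; apply: sumr_ge0 => k _; exact: mulr_ge0.
  have : bary T j x = 0.
    by apply/eqP; rewrite eq_le bj andbT -(pmulr_rle0 _ (hj p pH)).
  by move=> ->; rewrite mulr0.
have pv : paffine Hs M v.
  by split => // T x TM Tx; rewrite (vT T)//; apply: eq_bigr => j _; rewrite vj.
exists v; split; last by move=> T j TM hj; rewrite vj// /g' asboolT.
apply/asboolP; split => //.
  by have [L _ hL] := paffine_lip unitH triM pv; exact: lip_continuous hL.
move=> T TM; exists (slope T v), (\sum_j v (row j T) * bary T j 0) => x Tx.
by have [_ av] := pv; rewrite (av T)// -[x in LHS]add0r slopeE addrC.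
Qed.

End FiniteElement.

(** * Integration by parts *)

Section Parts.
Variables (R : realType) (d : nat).
Hypothesis d_gt0 : (0 < d)%N.
Implicit Types (T : 'M[R]_(d.+1, d)) (x y : 'rV[R]_d).
Local Notation e i := (delta_mx 0 i : 'rV[R]_d).

Lemma adm_blip (f g : 'rV[R]_d -> R) : adm f -> blip g -> adm (fun x => f x * g x).
Proof.
move=> af bg; have [N hN] := bg.
apply: (@adm_dom _ _ _ f N _ af).
  by apply: mfunM; [case: af|exact: blip_mfun].
by move=> x; rewrite normrM mulrC ler_wpM2r//; case: (hN x 0).
Qed.

Lemma J_le_off_null A (f g : 'rV[R]_d -> R) : null_rV A -> adm f -> adm g ->
  (forall x, ~ A x -> f x <= g x) -> J f <= J g.
Proof.
move=> nA af ag h; have mA : mset_rV A by case: nA.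
have -> : J f = J (fun x => \1_(~` A) x * f x + \1_A x * g x).
  rewrite -(integral_RdE (D := setT) (f := f)) => [|//|x nT]; last by case: nT.
  apply: (integral_Rd_off_null nA) => [x nx _|x _ nT]; last by case: nT.
  by rewrite !indicE (memNset nx) (mem_set (nx : (~` A) x)) mul1r mul0r addr0.
apply: J_le => //; first by apply: admD; apply: adm_restrict => //; exact: mset_setC.
move=> x; case: (pselect (A x)) => Ax.
  by rewrite !indicE (mem_set Ax) memNset ?mul0r ?add0r ?mul1r// => nA'.
by rewrite !indicE (memNset Ax) (mem_set (Ax : (~` A) x)) mul0r addr0 mul1r h.
Qed.

Lemma eq0_of_quadratic_bound (A C : R) : 0 <= C -> (forall t, 0 < t -> t <= 1 -> t * `|A| <= C * t ^+ 2) -> A = 0.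
Proof.
move=> C0 h; apply/eqP; rewrite -normr_le0 leNgt; apply/negP => A0.
have [t t0 ht] := small_enough C0 (divr_gt0 A0 (ltr0n R 2)).
pose s := Num.min 1 t; have s0 : 0 < s by rewrite lt_min ltr01.
have s1 : s <= 1 by rewrite ge_min lexx.
have h1 : C * s <= `|A| / 2 by apply: ht; [exact: ltW|rewrite ge_min lexx orbT].
have := h s s0 s1; rewrite expr2 mulrA [leRHS]mulrC ler_pM2l// => h2; lra.
Qed.

Variables (Hs : seq ('rV[R]_d * R)).
Hypothesis unitH : forall p, p \in Hs -> dotp p.1 p.1 = 1.
Variable B : R.
Hypothesis B_gt0 : 0 < B.
Hypothesis HB : forall x, polytope Hs x -> cube 0 B x.
Variable M : seq 'M[R]_(d.+1, d).
Hypothesis triM : triangulation (polytope Hs) M.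

Lemma adm_pgrad v i : adm (pgrad M v i).
Proof.
rewrite (_ : pgrad M v i = fun x => \sum_(T <- undup M | T \in undup M) \1_(inner T) x * slope T v 0 i); last first.
  by apply/funext => x; rewrite /pgrad big_seq.
apply: adm_sum => T; rewrite mem_undup => TM.
rewrite (_ : (fun x => _) = fun x => slope T v 0 i * \1_(inner T) x); last first.
  by apply/funext => x; rewrite mulrC.
apply/admZ/(@adm_indic _ _ _ B); first exact: mset_inner.
by move=> x /(inner_polytope unitH triM TM)/HB.
Qed.

Lemma pgrad_bounded v i : exists2 P, 0 <= P & forall x, `|pgrad M v i x| <= P.
Proof.
exists (\sum_(T <- undup M) `|slope T v 0 i|); first exact: sumr_ge0.
move=> x; rewrite /pgrad (le_trans (ler_norm_sum _ _ _))//; apply: ler_sum => T _.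
by rewrite normrM ler_piMl// indicE normr_nat lern1 leq_b1.
Qed.

(** Off slabs of width t around the facets, the segment of length t stays in
    one simplex.  These slabs have a volume of order t, which is why difference
    quotients may replace the gradient under the integral. *)
Lemma quotient_off_facets v i x t : paffine Hs M v -> 0 < t ->
  (forall p, p \in facets M -> ~ slab p t x) ->
  v (x + t *: e i) - v x = t * pgrad M v i x.
Proof.
move=> pv t0 off; have [z _] := pv.
have us : forall p, p \in facets M -> dotp p.1 p.1 = 1 by move=> p; exact: (facets_unit d_gt0 triM).
have close p : p \in facets M -> `|gap p (x + t *: e i) - gap p x| <= t.
  by move=> pF; rewrite (le_trans (gap_lip us x (t *: e i) pF))// enorm_step gtr0_norm.
have far T j : T \in M -> gap (facet T j) x < - t \/ t < gap (facet T j) x.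
  move=> TM; have := off _ (facetsP j TM); rewrite /slab/= => /negP.
  by rewrite -ltNge lter_normr => /orP[]; [right|left; lra].
have pos T j y : T \in M -> (0 < gap (facet T j) y) = (0 < bary T j y).
  move=> TM; rewrite facet_gap pmulr_rgt0// invr_gt0 bgrad_gt0//; exact: (mesh_ai triM TM).
have nn T j y : T \in M -> (0 <= gap (facet T j) y) = (0 <= bary T j y).
  move=> TM; rewrite facet_gap pmulr_rge0// invr_gt0 bgrad_gt0//; exact: (mesh_ai triM TM).
case: (pselect (exists2 T, T \in M & simplex T x)) => [[T TM Tx]|no].
  have ai := mesh_ai triM TM.
  have gx j : t < gap (facet T j) x.
    have : 0 <= gap (facet T j) x by rewrite nn//; move/(simplexP ai): Tx; apply.
    by case: (far T j TM) => //; lra.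
  have ix : inner T x by move=> j; rewrite -pos//; have := gx j; lra.
  have ixt : inner T (x + t *: e i).
    move=> j; rewrite -pos//; have := close _ (facetsP j TM); rewrite ler_norml => /andP[h _].
    have := gx j; lra.
  rewrite (paffine_diff pv TM) ?(pgrad_in d_gt0 triM _ _ TM ix)//.
  - by rewrite dotpZr dotp_delta.
  - exact: (inner_simplex ai).
rewrite pgrad_out ?mulr0; last first.
  by move=> T TM Tx; apply: no; exists T => //; apply: inner_simplex => //; exact: (mesh_ai triM TM).
have vx : v x = 0 by apply: z => hx; apply: no; exact: (mesh_cover triM).
rewrite vx subr0; apply: z => hx; apply: no.
have [T TM Tx] := mesh_cover triM hx; exists T => //.
have ai := mesh_ai triM TM; apply/(simplexP ai) => j.
have : 0 <= gap (facet T j) (x + t *: e i) by rewrite nn//; move/(simplexP ai): Tx; apply.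
rewrite -nn//; have := close _ (facetsP j TM); rewrite ler_norml => /andP[_ h].
by case: (far T j TM); lra.
Qed.

(** The integral of the difference quotient of the product vanishes by
    translation invariance; the terms that do not converge to the claim are
    confined to the slabs around the facets. *)
Lemma integration_by_parts v g g' i : paffine Hs M v -> blip g -> blip g' -> pder g g' i ->
  J (fun x => v x * g' x) = - J (fun x => pgrad M v i x * g x).
Proof.
move=> pv bg bg' [Cg hCg]; have av := paffine_adm unitH B_gt0 HB triM pv.
have bv := paffine_blip unitH B_gt0 HB triM pv; have ap := adm_pgrad v i.
have [P P0 hP] := pgrad_bounded v i.
have [V hV] := bv; have [N hN] := bg.
have V0 : 0 <= V by have [h _] := hV 0 0; apply: le_trans h.
have N0 : 0 <= N by have [h _] := hN 0 0; apply: le_trans h.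
have Cg0 : 0 <= Cg by have := hCg 0 1; rewrite expr1n mulr1; apply: le_trans.
have B1 : 0 < B + 1 by rewrite ltr_wpDr.
have us : forall p, p \in facets M -> dotp p.1 p.1 = 1 by move=> p; exact: (facets_unit d_gt0 triM).
have [S S0 hS] : exists2 S, 0 <= S & forall t, 0 < t -> t <= 1 ->
    \sum_(p <- facets M) J (\1_(cube 0 (B + 1) `&` slab p t) : _ -> R) <= S * t.
  elim: (facets M) us => [|p s IH] us.
    by exists 0 => // t t0 t1; rewrite big_nil mul0r.
  have [S S0 hS] : exists2 S, 0 <= S & forall t, 0 < t -> t <= 1 ->
      \sum_(p <- s) J (\1_(cube 0 (B + 1) `&` slab p t) : _ -> R) <= S * t.
    by apply: IH => q qs; apply: us; rewrite inE qs orbT.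
  have [C C0 hC] := slab_vol (us p (mem_head _ _)) B1.
  exists (C + S); first exact: addr_ge0.
  by move=> t t0 t1; rewrite big_cons mulrDl lerD ?hC ?hS.
have a1 : adm (fun x => v x * g' x) by exact: adm_blip.
have a2 : adm (fun x => pgrad M v i x * g x) by exact: adm_blip.
apply/eqP; rewrite -addr_eq0; apply/eqP.
pose K := (V * Cg + P * N) * (2 * (B + 1)) ^+ d + (V + P) * N * S.
have K0 : 0 <= K.
  rewrite addr_ge0 ?mulr_ge0 ?exprn_ge0 ?addr_ge0 ?mulr_ge0 ?(ltW B1)//.
apply: (eq0_of_quadratic_bound K0) => t t0 t1.
have avg : adm (fun x => v x * g x) by exact: adm_blip.
have avgt : adm (fun x => v (x + t *: e i) * g (x + t *: e i)).
  have := adm_affine (t *: e i) ltr01 avg; congr adm; apply/funext => x; by rewrite scale1r.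
pose D x := v (x + t *: e i) * g (x + t *: e i) - v x * g x - t * (v x * g' x) - t * (pgrad M v i x * g x).
have aD : adm D by apply: admB; [apply: admB; [exact: admB|exact: admZ]|exact: admZ].
have JDE : J D = - (t * (J (fun x => v x * g' x) + J (fun x => pgrad M v i x * g x))).
  rewrite /D JB; [|by apply: admB; [exact: admB|exact: admZ]|exact: admZ].
  rewrite JB; [|exact: admB|exact: admZ].
  rewrite JB// !JZ// (J_translate (t *: e i) avg); ring.
have -> : t * `|J (fun x => v x * g' x) + J (fun x => pgrad M v i x * g x)| = `|J D|.
  by rewrite JDE normrN normrM (gtr0_norm t0).
rewrite (le_trans (J_norm aD))//.
pose bad x : R := \sum_(p <- facets M) \1_(cube 0 (B + 1) `&` slab p t) x.
have abad p : adm (\1_(cube 0 (B + 1) `&` slab p t) : _ -> R).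
  apply: (@adm_indic _ _ _ (B + 1)); last by move=> x [].
  by apply: mset_setI; [exact: mset_cube|exact: mset_slab].
apply: (@le_trans _ _ (J (fun x => ((V * Cg + P * N) * t ^+ 2) * \1_(cube 0 (B + 1)) x +
   ((V + P) * N * t) * bad x))); last first.
  rewrite JD; [|by apply: admZ; exact: adm_cube|by apply: admZ; exact: adm_sum].
  rewrite !JZ; [|exact: adm_sum|exact: adm_cube].
  rewrite J_cube// /bad J_sum// /K [leRHS]mulrDl lerD//.
    by rewrite le_eqVlt; apply/orP; left; apply/eqP; ring.
  apply: (@le_trans _ _ ((V + P) * N * t * (S * t))).
    by rewrite ler_wpM2l ?hS// !mulr_ge0 ?addr_ge0// ltW.
  by rewrite le_eqVlt; apply/orP; left; apply/eqP; ring.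
apply: J_le; first exact: adm_norm.
  by apply: admD; apply: admZ; [exact: adm_cube|exact: adm_sum].
move=> x.
have bad0 : 0 <= bad x by apply: sumr_ge0 => p _; rewrite indicE ler0n.
have [z _] := pv.
case: (pselect (cube 0 (B + 1) x)) => xB; last first.
  have nx : ~ polytope Hs x by move=> /HB; apply: contra_not xB; apply: cube_le; lra.
  have nxt : ~ polytope Hs (x + t *: e i).
    move=> /HB h; apply: xB => j; have := h j; rewrite !mxE eqxx/= !subr0 => h1.
    have := ler_normB (x 0 j + t * (j == i)%:R) (t * (j == i)%:R); rewrite addrK => h2.
    have h3 : `|t * (j == i)%:R| <= 1.
      by case: (j == i); rewrite ?mulr0 ?normr0 ?mulr1 ?gtr0_norm.
    lra.
  have -> : D x = 0.
    rewrite /D (z _ nx) (z _ nxt) pgrad_out; first by ring.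
    by move=> T TM /(inner_polytope unitH triM TM).
  by rewrite normr0 addr_ge0// !mulr_ge0 ?addr_ge0 ?mulr_ge0 ?indicE ?ler0n ?sqr_ge0// ltW.
have -> : \1_(cube 0 (B + 1)) x = 1 :> R by rewrite indicE mem_set.
rewrite mulr1.
rewrite (_ : D x = v x * (g (x + t *: e i) - g x - t * g' x) +
   (v (x + t *: e i) - v x - t * pgrad M v i x) * g (x + t *: e i) +
   t * pgrad M v i x * (g (x + t *: e i) - g x)); last by rewrite /D; ring.
have [hv1 hv2] := hV x (t *: e i); have [hn1 hn2] := hN x (t *: e i).
have [hn3 _] := hN (x + t *: e i) 0.
rewrite enorm_step (gtr0_norm t0) in hv2 hn2.
have e1 : `|v x * (g (x + t *: e i) - g x - t * g' x)| <= V * (Cg * t ^+ 2).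
  by rewrite normrM ler_pM.
have e3 : `|t * pgrad M v i x * (g (x + t *: e i) - g x)| <= (t * P) * (N * t).
  by rewrite normrM ler_pM// normrM (gtr0_norm t0) ler_wpM2l// ltW.
have e2 : `|(v (x + t *: e i) - v x - t * pgrad M v i x) * g (x + t *: e i)| <= (V + P) * N * t * bad x.
  case: (pselect (exists2 p, p \in facets M & slab p t x)) => [[p pF sp]|no].
    have b1 : 1 <= bad x.
      apply: le_trans (le_bigseq (f := fun p => \1_(cube 0 (B + 1) `&` slab p t) x) _ pF isT).
        by rewrite indicE mem_set.
      by move=> q; rewrite indicE ler0n.
    apply: (@le_trans _ _ ((V + P) * N * t * 1)); last first.
      by rewrite ler_wpM2l// !mulr_ge0 ?addr_ge0// ltW.
    rewrite normrM mulr1 (_ : (V + P) * N * t = (V * t + t * P) * N); last by ring.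
    rewrite ler_pM// (le_trans (ler_normB _ _))// lerD// normrM (gtr0_norm t0) ler_wpM2l// ltW//.
  rewrite (@quotient_off_facets v i x t pv t0); last by move=> p pF sp; apply: no; exists p.
  by rewrite subrr mul0r normr0 !mulr_ge0 ?addr_ge0// ltW.
rewrite (le_trans (ler_normD _ _))// (le_trans (lerD (ler_normD _ _) (lexx _)))//.
rewrite (_ : (V * Cg + P * N) * t ^+ 2 + _ = V * (Cg * t ^+ 2) + (V + P) * N * t * bad x + t * P * (N * t)); last by ring.
by rewrite !lerD.
Qed.

End Parts.

(** * Interpolation error *)

Section Taylor.
Variables (R : realType) (d : nat).
Implicit Types (T : 'M[R]_(d.+1, d)) (x y w : 'rV[R]_d).
Variables (G0 : 'rV[R]_d -> R) (G1 : 'I_d -> 'rV[R]_d -> R) (G2 : 'I_d -> 'I_d -> 'rV[R]_d -> R)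
  (G3 : 'I_d -> 'I_d -> 'I_d -> 'rV[R]_d -> R).
Hypothesis hC : C3 G0 G1 G2 G3.

Definition hess x : R := \sum_i \sum_j G2 i j x ^+ 2.
Definition quad w x : R := \sum_i \sum_j w 0 i * w 0 j * G2 i j x.

Lemma quad_le w x : quad w x ^+ 2 <= enorm w ^+ 4 * hess x.
Proof.
(* Cauchy-Schwarz over pairs of indices, by completing a square *)
have e4 : enorm w ^+ 4 = \sum_i \sum_j (w 0 i * w 0 j) ^+ 2.
  rewrite (_ : enorm w ^+ 4 = (enorm w ^+ 2) * (enorm w ^+ 2)); last by ring.
  rewrite enorm_sqr /dotp mulr_suml; apply: eq_bigr => i _.
  by rewrite mulr_sumr; apply: eq_bigr => j _; ring.
have key t : 0 <= enorm w ^+ 4 * t ^+ 2 - 2 * quad w x * t + hess x.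
  rewrite e4 /quad /hess !mulr_suml mulr_sumr mulr_suml -sumrB -big_split/=.
  apply: sumr_ge0 => i _; rewrite !mulr_suml mulr_sumr mulr_suml -sumrB -big_split/=.
  apply: sumr_ge0 => j _; have := sqr_ge0 (w 0 i * w 0 j * t - G2 i j x); lra.
have [e0|e0] := eqVneq (enorm w ^+ 4) 0.
  have q0 : quad w x = 0.
    apply/eqP/negPn/negP => qn.
    have := key ((hess x + 1) / (2 * quad w x)); rewrite e0 mul0r sub0r.
    rewrite (_ : 2 * quad w x * _ = hess x + 1); first lra.
    by rewrite mulrC divfK// mulf_neq0.
  by rewrite q0 e0 mul0r expr0n.
have ep : 0 < enorm w ^+ 4 by rewrite lt_neqAle eq_sym e0 exprn_ge0// enorm_ge0.
have := key (quad w x / enorm w ^+ 4).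
move: (enorm w ^+ 4) e0 ep => E e0 ep.
rewrite (_ : _ - _ = - (quad w x ^+ 2 / E)); last by field.
by rewrite addrC subr_ge0 ler_pdivrMr// mulrC.
Qed.

(** Taylor expansion to second order as a Riemann sum over N points of the
    segment: the increments of the first derivatives are expanded on each of the
    N pieces and summed twice. *)
Lemma taylor_mean h : 0 <= h -> exists2 K, 0 <= K & forall x w N, enorm w <= h -> (0 < N)%N ->
  `|G0 (x + w) - G0 x - \sum_i w 0 i * G1 i x -
    N%:R ^- 2 * \sum_(m < N) (N - m.+1)%:R * quad w (x + (m%:R / N%:R) *: w)| <= K / N%:R.
Proof.
move=> h0; have [p1 p2 p3 _ [M hM]] := hC.
have G1M i x y : `|G1 i (x + y) - G1 i x| <= M * enorm y by have [_ _ _ _ [_ ? _ _]] := hM i i i x y.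
have G2M i j x y : `|G2 i j (x + y) - G2 i j x| <= M * enorm y by have [_ _ _ _ [_ _ ? _]] := hM i j i x y.
have [C C0 hC0] := taylor1 p1 G1M.
have [C' C'0 hC1] : exists2 C, 0 <= C & forall i x v,
    `|G1 i (x + v) - G1 i x - \sum_j v 0 j * G2 i j x| <= C * enorm v ^+ 2.
  pose c i := projT1 (cid2 (taylor1 (p2 i) (G2M i))).
  have hc i : 0 <= c i /\ forall x v, `|G1 i (x + v) - G1 i x - \sum_j v 0 j * G2 i j x| <= c i * enorm v ^+ 2.
    by rewrite /c; case: cid2.
  exists (\sum_i c i); first by apply: sumr_ge0 => i _; case: (hc i).
  move=> i x v; have [_ hh] := hc i; rewrite (le_trans (hh x v))// ler_wpM2r ?sqr_ge0//.
  by rewrite (bigD1 i)//= lerDl; apply: sumr_ge0 => k _; case: (hc k).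
exists (C * h ^+ 2 + d%:R * h * (C' * h ^+ 2)).
  by rewrite addr_ge0 ?mulr_ge0 ?sqr_ge0.
move=> x w N wh N0; have NR : 0 < N%:R :> R by rewrite ltr0n.
have [del delE] : exists del : R, del = N%:R^-1 by eexists.
have del0 : 0 < del by rewrite delE invr_gt0.
pose X (l : nat) := x + (l%:R * del) *: w.
have XS l : X l.+1 = X l + del *: w by rewrite /X -addrA -scalerDl -natr1 mulrDl mul1r.
pose q l := quad w (X l).
pose D l := \sum_i w 0 i * G1 i (X l).
have wn : enorm (del *: w) ^+ 2 <= del ^+ 2 * h ^+ 2.
  rewrite enormZ exprMn (gtr0_norm del0) ler_wpM2l ?sqr_ge0// ler_pXn2r ?nnegrE ?enorm_ge0//.
have s1 l : `|G0 (X l.+1) - G0 (X l) - del * D l| <= C * h ^+ 2 * del ^+ 2.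
  have := hC0 (X l) (del *: w); rewrite -XS.
  have -> : \sum_i (del *: w) 0 i * G1 i (X l) = del * D l.
    by rewrite mulr_sumr; apply: eq_bigr => i _; rewrite mxE mulrA.
  move=> /le_trans; apply; rewrite -mulrA ler_wpM2l// mulrC; lra.
have s2 l : `|D l.+1 - D l - del * q l| <= d%:R * h * (C' * h ^+ 2) * del ^+ 2.
  have -> : D l.+1 - D l - del * q l = \sum_i w 0 i *
      (G1 i (X l + del *: w) - G1 i (X l) - \sum_j (del *: w) 0 j * G2 i j (X l)).
    rewrite /D /q /quad mulr_sumr -!sumrB; apply: eq_bigr => i _.
    rewrite XS !mulrBr; congr (_ - _); rewrite !mulr_sumr; apply: eq_bigr => j _.
    by rewrite mxE; ring.
  rewrite (le_trans (ler_norm_sum _ _ _))//.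
  rewrite (_ : d%:R * h * (C' * h ^+ 2) * del ^+ 2 = \sum_(i < d) h * (C' * (del ^+ 2 * h ^+ 2))); last first.
    by rewrite sumr_const card_ord -[RHS]mulr_natl; ring.
  apply: ler_sum => i _; rewrite normrM ler_pM//; first by rewrite (le_trans (enorm_coord _ _)).
  by rewrite (le_trans (hC1 _ _ _))// ler_wpM2l.
have [A AE] : exists A, A = d%:R * h * (C' * h ^+ 2) by eexists.
have A0 : 0 <= A by rewrite AE !mulr_ge0 ?sqr_ge0.
rewrite -AE in s2 *.
have s3 l : `|D l - D 0 - del * \sum_(m < l) q m| <= A * del ^+ 2 * l%:R.
  elim: l => [|l IH]; first by rewrite big_ord0 mulr0 subrr subr0 normr0 mulr0.
  rewrite big_ord_recr/= (_ : _ - _ - _ = (D l - D 0 - del * \sum_(m < l) q m) + (D l.+1 - D l - del * q l)); last by ring.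
  by rewrite (le_trans (ler_normD _ _))// -natr1 mulrDr mulr1 lerD.
have s4 l : (l <= N)%N -> `|G0 (X l) - G0 x - (l%:R * del) * D 0 - del ^+ 2 * \sum_(m < l) (l - m.+1)%:R * q m| <=
    (C * h ^+ 2 + A) * del ^+ 2 * l%:R.
  elim: l => [_|l IH lN]; first by rewrite big_ord0 mulr0 !mul0r /X mul0r scale0r addr0 subrr !subr0 normr0 mulr0.
  have {}IH := IH (ltnW lN).
  have rec : \sum_(m < l.+1) (l.+1 - m.+1)%:R * q m = \sum_(m < l) (l - m.+1)%:R * q m + \sum_(m < l) q m.
    rewrite big_ord_recr/= subnn mul0r addr0 -big_split/=; apply: eq_bigr => m _.
    by rewrite subSn ?ltn_ord// -natr1 mulrDl mul1r.
  rewrite rec (_ : _ - _ - _ - _ = (G0 (X l) - G0 x - (l%:R * del) * D 0 - del ^+ 2 * \sum_(m < l) (l - m.+1)%:R * q m)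
    + (G0 (X l.+1) - G0 (X l) - del * D l) + del * (D l - D 0 - del * \sum_(m < l) q m)); last first.
    by rewrite -natr1; ring.
  rewrite (le_trans (ler_normD _ _))//.
  have h3 : `|del * (D l - D 0 - del * \sum_(m < l) q m)| <= A * del ^+ 2.
    rewrite normrM (gtr0_norm del0) (le_trans (ler_wpM2l (ltW del0) (s3 l)))//.
    rewrite (_ : del * (A * del ^+ 2 * l%:R) = A * del ^+ 2 * (del * l%:R)); last by ring.
    have dl : del * l%:R <= 1 by rewrite delE mulrC ler_pdivrMr// mul1r ler_nat ltnW.
    have Ad : 0 <= A * del ^+ 2 by rewrite mulr_ge0// sqr_ge0.
    by rewrite ler_piMr.
  rewrite (_ : (C * h ^+ 2 + A) * del ^+ 2 * l.+1%:R = (C * h ^+ 2 + A) * del ^+ 2 * l%:R + C * h ^+ 2 * del ^+ 2 + A * del ^+ 2); last first.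
    by rewrite -natr1; ring.
  by rewrite lerD// (le_trans (ler_normD _ _))// lerD.
have Nd : N%:R * del = 1 by rewrite delE mulfV// gt_eqF.
have := s4 N (leqnn _); rewrite /X Nd scale1r mul1r -/(D 0).
have -> : D 0 = \sum_i w 0 i * G1 i x by rewrite /D /X mul0r scale0r addr0.
have -> : (C * h ^+ 2 + A) * del ^+ 2 * N%:R = (C * h ^+ 2 + A) / N%:R by rewrite delE; field; rewrite gt_eqF.
by rewrite /q /X delE exprVn.
Qed.

Lemma weighted_CS (I : Type) (s : seq I) (c z : I -> R) : (forall i, 0 <= c i) ->
  0 < \sum_(i <- s) c i ->
  (\sum_(i <- s) c i * z i) ^+ 2 <= (\sum_(i <- s) c i) * (\sum_(i <- s) c i * z i ^+ 2).
Proof.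
move=> c0; set S := \sum_(i <- s) c i; set m := \sum_(i <- s) c i * z i.
set Q := \sum_(i <- s) _ => S0.
have expand a b : \sum_(i <- s) c i * (a * z i - b) ^+ 2 =
    a ^+ 2 * (\sum_(i <- s) c i * z i ^+ 2) - 2 * a * b * (\sum_(i <- s) c i * z i) +
    b ^+ 2 * \sum_(i <- s) c i.
  rewrite !mulr_sumr -sumrB -big_split/=; apply: eq_bigr => i _; ring.
have : 0 <= \sum_(i <- s) c i * (S * z i - m) ^+ 2.
  by apply: sumr_ge0 => i _; rewrite mulr_ge0 ?sqr_ge0.
rewrite expand -/S -/m -/Q (_ : _ + _ = S * (S * Q - m ^+ 2)); last by ring.
by rewrite pmulr_rge0// subr_ge0.
Qed.

(** The Riemann sum of an inverse square root telescopes after comparison with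
    differences of square roots. *)
Lemma sum_inv_sqrt (N n : nat) : (0 < N)%N ->
  \sum_(k < n) N%:R^-1 / Num.sqrt (k.+1%:R / N%:R) <= 2 * Num.sqrt (n%:R / N%:R) :> R.
Proof.
move=> N0; have NR : 0 < N%:R :> R by rewrite ltr0n.
elim: n => [|n IH]; first by rewrite big_ord0 mulr_ge0// sqrtr_ge0.
rewrite big_ord_recr/=; set s := Num.sqrt (n%:R / N%:R) in IH *.
set t := Num.sqrt (n.+1%:R / N%:R).
have t0 : 0 < t by rewrite sqrtr_gt0 divr_gt0// ltr0n.
have s0 : 0 <= s by exact: sqrtr_ge0.
have st : s <= t by rewrite ler_wsqrtr// ler_pM2r ?invr_gt0// ler_nat.
have tt : N%:R^-1 = (t - s) * (t + s).
  rewrite -subr_sqr !sqr_sqrtr ?divr_ge0//; rewrite -natr1; field; rewrite gt_eqF//.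
have h1 : N%:R^-1 / t <= 2 * (t - s).
  rewrite ler_pdivrMr// tt -subr_ge0 (_ : _ - _ = (t - s) * (t - s)); last by ring.
  by rewrite mulr_ge0 ?subr_ge0.
by clear tt; lra.
Qed.

Hypothesis d_gt0 : (0 < d)%N.
Variable T : 'M[R]_(d.+1, d).
Variables (h : R) (j : 'I_d.+1).
Hypothesis aiT : affinely_independent T.
Hypothesis admT : adm (\1_(inner T) : _ -> R).
Hypothesis h_ge0 : 0 <= h.
Hypothesis sizeT : forall x, inner T x -> enorm (row j T - x) <= h.
Hypothesis d_le3 : (d <= 3)%N.

Definition taylor_rest x := G0 (row j T) - G0 x - \sum_i (row j T - x) 0 i * G1 i x.

Lemma blip_hess : blip hess.
Proof.
have [_ _ _ _ [M hM]] := hC.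
have b2 i k : blip (G2 i k).
  by exists M => x y; have [_ _ ? _ [_ _ ? _]] := hM i k i x y.
rewrite /hess; apply: blip_sum => i; apply: blip_sum => k.
rewrite (_ : (fun x => _) = fun x => G2 i k x * G2 i k x); first exact: blipM.
by apply/funext => x; rewrite expr2.
Qed.

Lemma mfun_taylor_rest : mfun_rV taylor_rest.
Proof.
have [_ _ _ _ [M hM]] := hC.
have b0 : blip G0.
  by exists M => x y; have [? _ _ _ [? _ _ _]] := hM (Ordinal d_gt0) (Ordinal d_gt0) (Ordinal d_gt0) x y.
have b1 i : blip (G1 i).
  by exists M => x y; have [_ ? _ _ [_ ? _ _]] := hM i i i x y.
rewrite /taylor_rest.
rewrite (_ : (fun x => _) = fun x => (G0 (row j T) + -1 * G0 x) + \sum_i (-1 * (row j T 0 i + -1 * x 0 i)) * G1 i x); last first.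
  apply/funext => x; rewrite mulN1r -sumrN; congr (_ + _).
  by apply: eq_bigr => i _; rewrite !mxE; ring.
apply: mfunD.
  apply: mfunD; first exact: mfun_cst.
  by apply: mfunM; [exact: mfun_cst|exact: blip_mfun].
apply: mfun_sum => i _; apply: mfunM; last exact: blip_mfun.
apply: mfunM; first exact: mfun_cst.
apply: mfunD; first exact: mfun_cst.
by apply: mfunM; [exact: mfun_cst|exact: mfun_coord].
Qed.

(** Cauchy-Schwarz with the weights u ^ (-1/2) and u ^ (5/2), where u is the
    remaining fraction of the segment towards the vertex, and the homothety that
    contracts the simplex to this vertex by the factor u.  The dilation costs
    u ^ (-d), and u ^ (5/2 - d) is integrable because d is at most three. *)
Lemma rest_integral ep : 0 < ep ->
  adm (fun x => \1_(inner T) x * taylor_rest x ^+ 2) /\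
  J (fun x => \1_(inner T) x * taylor_rest x ^+ 2) <=
    8 * h ^+ 4 * J (fun x => \1_(inner T) x * hess x) + ep.
Proof.
move=> ep0; have [K K0 hK] := taylor_mean h_ge0.
have [V VE] : exists V, V = J (\1_(inner T) : _ -> R) by eexists.
have V0 : 0 <= V by rewrite VE; apply: J_ge0 => x; rewrite indicE ler0n.
have [N [N0 hN]] : exists N : nat, (0 < N)%N /\ 2 * (K / N%:R) ^+ 2 * V <= ep.
  exists (Num.truncn (2 * K ^+ 2 * V / ep)).+1; split => //.
  set n := Num.truncn _; have nR : 1 <= n.+1%:R :> R by rewrite ler1n.
  have n0 : 0 < n.+1%:R :> R by lra.
  have := truncnS_gt (2 * K ^+ 2 * V / ep); rewrite -/n ltr_pdivrMr// => h1.
  apply: (@le_trans _ _ (2 * K ^+ 2 * V / n.+1%:R)); last by rewrite ler_pdivrMr// [leRHS]mulrC ltW.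
  rewrite exprMn exprVn (_ : 2 * (K ^+ 2 / n.+1%:R ^+ 2) * V = 2 * K ^+ 2 * V * n.+1%:R ^- 2); last by ring.
  rewrite ler_wpM2l ?mulr_ge0 ?sqr_ge0// lef_pV2 ?posrE ?exprn_gt0//.
  by rewrite expr2 ler_peMr// ltW.
have NR : 0 < N%:R :> R by rewrite ltr0n.
set a := row j T.
pose u (k : nat) : R := k.+1%:R / N%:R.
pose s (k : nat) : R := Num.sqrt (u k).
have u0 k : 0 < u k by rewrite divr_gt0// ltr0n.
have s0 k : 0 < s k by rewrite sqrtr_gt0.
have ss k : s k ^+ 2 = u k by rewrite sqr_sqrtr// ltW.
have u1 (k : 'I_N) : u k <= 1 by rewrite ler_pdivrMr// mul1r ler_nat.
have s1 (k : 'I_N) : s k <= 1.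
  by rewrite -(@expr_le1 _ 2)// ?ss ?u1// ltW.
pose c (k : 'I_N) : R := N%:R^-1 / s k.
have c0 k : 0 <= c k by rewrite divr_ge0 ?invr_ge0 ?ltW.
have cs : \sum_k c k <= 2.
  have := sum_inv_sqrt N N0; rewrite divff ?gt_eqF// sqrtr1 mulr1; exact.
have cp : 0 < \sum_k c k.
  rewrite (bigD1 (Ordinal N0))//= ltr_wpDr ?sumr_ge0//.
  by rewrite divr_gt0 ?invr_gt0.
pose P (k : nat) x := u k *: x + (1 - u k) *: a.
have Tin k x : inner T x -> inner T (P k x) \/ (1 < u k).
  move=> Tx; have [uk|] := leP (u k) 1; last by right.
  left => i; have -> : P k x = a + u k *: (x - a).
    by apply/rowP => l; rewrite !mxE; ring.
  rewrite bary_segment bary_vertex//.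
  have h1 := mulr_gt0 (u0 k) (Tx i).
  have : 0 <= (1 - u k) * (i == j)%:R by rewrite mulr_ge0 ?ler0n// subr_ge0.
  lra.
have hess0 x : 0 <= hess x by apply: sumr_ge0 => i _; apply: sumr_ge0 => l _; exact: sqr_ge0.
have pt x : inner T x -> taylor_rest x ^+ 2 <=
    4 * h ^+ 4 * (\sum_(k < N) N%:R^-1 * s k ^+ 5 * hess (P k x)) + 2 * (K / N%:R) ^+ 2.
  move=> Tx; pose w := a - x.
  have wh : enorm w <= h by exact: sizeT.
  have := hK x w N wh N0.
  rewrite (_ : x + w = a); last by rewrite /w addrCA subrr addr0.
  rewrite -/(taylor_rest x) (reindex_inj rev_ord_inj)/=.
  pose q (k : nat) := quad w (P k x).
  rewrite (eq_bigr (fun k : 'I_N => k%:R * q k)); last first.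
    move=> k _; congr (_ * _).
      by congr _%:R; have := ltn_ord k; lia.
    rewrite /q; congr quad; apply/rowP => l; rewrite !mxE /u /w natrB//.
    by field; rewrite gt_eqF.
  set main := N%:R ^- 2 * _ => herr.
  have m2 : main ^+ 2 <= 2 * h ^+ 4 * (\sum_(k < N) N%:R^-1 * s k ^+ 5 * hess (P k x)).
    have mle : `|main| <= \sum_k c k * (s k ^+ 3 * `|q k|).
      rewrite /main mulr_sumr (le_trans (ler_norm_sum _ _ _))//; apply: ler_sum => k _.
      rewrite normrM normrM !mulrA ler_wpM2r//.
      rewrite (ger0_norm (ler0n _ _)) ger0_norm ?invr_ge0 ?sqr_ge0//.
      rewrite /c (_ : N%:R^-1 / s k * s k * s k * s k = N%:R^-1 * s k ^+ 2); last by field; rewrite !gt_eqF.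
      rewrite ss /u -exprVn expr2 -mulrA ler_wpM2l ?invr_ge0 ?(ltW NR)//.
      by rewrite mulrC ler_wpM2r ?invr_ge0 ?(ltW NR)// ler_nat.
    rewrite -real_normK ?num_real//.
    apply: (@le_trans _ _ ((\sum_k c k * (s k ^+ 3 * `|q k|)) ^+ 2)).
      by rewrite ler_pXn2r ?nnegrE// (le_trans _ mle).
    rewrite (le_trans (weighted_CS (fun k : 'I_N => s k ^+ 3 * `|q k|) c0 cp))//.
    have cz0 : 0 <= \sum_k c k * (s k ^+ 3 * `|q k|) ^+ 2.
      by apply: sumr_ge0 => k _; rewrite mulr_ge0 ?sqr_ge0.
    apply: (@le_trans _ _ (2 * \sum_k c k * (s k ^+ 3 * `|q k|) ^+ 2)); first by rewrite ler_wpM2r.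
    rewrite -mulrA ler_wpM2l// mulr_sumr; apply: ler_sum => k _.
    have -> : c k * (s k ^+ 3 * `|q k|) ^+ 2 = N%:R^-1 * s k ^+ 5 * q k ^+ 2.
      rewrite exprMn real_normK ?num_real// /c; field; by rewrite !gt_eqF.
    rewrite [leRHS]mulrCA ler_wpM2l ?mulr_ge0 ?invr_ge0 ?exprn_ge0 ?(ltW NR) ?(ltW (s0 k))//.
    rewrite (le_trans (quad_le _ _))// ler_wpM2r// ler_pXn2r ?nnegrE ?enorm_ge0//.
  have err2 : (taylor_rest x - main) ^+ 2 <= (K / N%:R) ^+ 2.
    by rewrite -real_normK ?num_real// ler_pXn2r ?nnegrE ?divr_ge0 ?(ltW NR).
  have := sqr_ge0 (taylor_rest x - 2 * main).
  have -> : (taylor_rest x - 2 * main) ^+ 2 = 2 * main ^+ 2 + 2 * (taylor_rest x - main) ^+ 2 - taylor_rest x ^+ 2 by ring.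
  move: (\sum_(k < N) _) m2 err2 => Z m2 err2 h3; clear -m2 err2 h3; lra.
have aH : adm (fun x => \1_(inner T) x * hess x) by apply: adm_blip => //; exact: blip_hess.
have aHk k : adm (fun x => \1_(inner T) (P k x) * hess (P k x)) by exact: (adm_affine _ (u0 k) aH).
have aR : adm (fun x => \1_(inner T) x * taylor_rest x ^+ 2).
  have [H hH] := blip_hess.
  have H0 : 0 <= H by have [hh _] := hH 0 0; apply: le_trans hh.
  apply: (@adm_dom _ _ _ _ (4 * h ^+ 4 * (\sum_(k < N) N%:R^-1 * s k ^+ 5 * H) + 2 * (K / N%:R) ^+ 2) _ admT).
    apply: mfunM; first by apply: mfun_indic; exact: mset_inner.
    rewrite (_ : (fun x => _) = fun x => taylor_rest x * taylor_rest x).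
      by apply: mfunM; exact: mfun_taylor_rest.
    by apply/funext => x; rewrite expr2.
  move=> x; case: (pselect (inner T x)) => Tx; last first.
    by rewrite indicE memNset// mul0r normr0 mulr0.
  rewrite indicE mem_set// mul1r normr1 mulr1 ger0_norm ?sqr_ge0// (le_trans (pt _ Tx))//.
  rewrite lerD2r ler_wpM2l ?mulr_ge0 ?exprn_ge0//; apply: ler_sum => k _.
  rewrite ler_wpM2l ?mulr_ge0 ?invr_ge0 ?exprn_ge0 ?(ltW NR) ?(ltW (s0 k))//.
  by have [hh _] := hH (P k x) 0; rewrite (le_trans (ler_norm _)).
split=> //.
apply: (@le_trans _ _ (J (fun x => (\sum_(k < N) (4 * h ^+ 4 * (N%:R^-1 * s k ^+ 5)) *
    (\1_(inner T) (P k x) * hess (P k x))) + 2 * (K / N%:R) ^+ 2 * \1_(inner T) x))).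
  have aS : adm (fun x => \sum_(k < N) (4 * h ^+ 4 * (N%:R^-1 * s k ^+ 5)) *
    (\1_(inner T) (P k x) * hess (P k x))) by apply: adm_sum => k _; exact: admZ.
  apply: J_le => //; first by apply: admD => //; exact: admZ.
  move=> x; case: (pselect (inner T x)) => Tx; last first.
    rewrite !indicE (memNset Tx) mul0r mulr0 addr0; apply: sumr_ge0 => k _.
    by rewrite !mulr_ge0 ?ler0n ?invr_ge0 ?exprn_ge0 ?(ltW NR) ?(ltW (s0 k)).
  rewrite [X in X * _]indicE mem_set// mul1r (le_trans (pt _ Tx))//.
  rewrite indicE (mem_set Tx) mulr1 lerD2r mulr_sumr; apply: ler_sum => k _.
  have Pk : inner T (P k x) by case: (Tin k x Tx) => //; have := u1 k; lra.
  by rewrite indicE (mem_set Pk) mul1r mulrA.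
rewrite JD; [|by apply: adm_sum => k _; exact: admZ|exact: admZ].
rewrite JZ// -VE lerD// J_sum; last by move=> k _; exact: admZ.
set X := J (fun x => _ * hess x).
have X0 : 0 <= X by apply: J_ge0 => x; rewrite mulr_ge0// indicE ler0n.
apply: (@le_trans _ _ (4 * h ^+ 4 * X * \sum_k c k)); last first.
  have hX : 0 <= 4 * h ^+ 4 * X by rewrite !mulr_ge0 ?exprn_ge0.
  apply: (@le_trans _ _ (4 * h ^+ 4 * X * 2)); first by rewrite ler_wpM2l.
  rewrite le_eqVlt; apply/orP; left; apply/eqP; ring.
rewrite mulr_sumr; apply: ler_sum => k _; rewrite JZ//.
rewrite (J_affine ((1 - u k) *: a) (u0 k) aH) -/X.
have key : s k ^+ 5 * u k ^- d <= (s k)^-1.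
  rewrite -ss -exprM ler_pdivrMr ?exprn_gt0// -ler_pdivrMl ?invr_gt0// invrK -exprS.
  by apply: ler_wiXn2l; rewrite ?(ltW (s0 k)) ?s1//; lia.
have h4 : 0 <= 4 * h ^+ 4 * N%:R^-1 * X by rewrite !mulr_ge0 ?exprn_ge0 ?invr_ge0 ?(ltW NR).
rewrite (_ : _ * (u k ^- d * X) = 4 * h ^+ 4 * N%:R^-1 * X * (s k ^+ 5 * u k ^- d)); last by ring.
rewrite (_ : _ * c k = 4 * h ^+ 4 * N%:R^-1 * X * (s k)^-1); last by rewrite /c; ring.
exact: ler_wpM2l.
Qed.

End Taylor.

(** * The approximation property for the Poisson problem *)

Section Approximation.
Variables (R : realType) (d : nat).
Hypothesis d_gt0 : (0 < d)%N.
Hypothesis d_le3 : (d <= 3)%N.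
Implicit Types (T : 'M[R]_(d.+1, d)) (x y : 'rV[R]_d).
Variables (Hs : seq ('rV[R]_d * R)).
Hypothesis unitH : forall p, p \in Hs -> dotp p.1 p.1 = 1.
Hypothesis uniqH : uniq Hs.
Hypothesis Hs_ne : Hs != [::].
Variable x0 : 'rV[R]_d.
Hypothesis hx0 : polytope Hs x0.
Variable rho : R.
Hypothesis hrho : forall x, polytope Hs x -> enorm x <= rho.
Variable M : seq 'M[R]_(d.+1, d).
Hypothesis triM : triangulation (polytope Hs) M.
Variables (sigma kappa : R).
Hypothesis shM : shape_regular sigma M.
Hypothesis quM : quasi_uniform kappa M.
Local Notation h := (mesh_size M).
Local Notation sh := (shape sigma kappa).

Let B := rho + 1.

Let B_gt0 : 0 < B.
Proof. by rewrite ltr_wpDl// (le_trans (enorm_ge0 x0))// hrho. Qed.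

Let HB x : polytope Hs x -> cube 0 B x.
Proof. exact: polytope_cube. Qed.

Let neH : polytope Hs !=set0.
Proof. by exists x0. Qed.

Let h_gt0 : 0 < h.
Proof. exact: (mesh_size_gt0 d_gt0 neH triM shM quM). Qed.

Definition interp_const : R := 16 * d.+1%:R ^+ 2 * sh ^+ 2.

(** Factor of the error that stems from interpolating a function whose values
    at the vertices are only known approximately. *)
Definition interp_slack : R := 2 * d.+1%:R ^+ 2 * (sh / h) ^+ 2 * ((4 * h) ^+ d + 1).

Lemma interp_slack_ge0 : 0 <= interp_slack.
Proof.
apply: mulr_ge0; last by rewrite addr_ge0// exprn_ge0// mulr_ge0// ltW.
by apply: mulr_ge0; last exact: sqr_ge0; apply: mulr_ge0 => //; exact: sqr_ge0.
Qed.

(** As the barycentric coordinates sum to one and reproduce affine functions,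
    the difference of the gradients is the combination of the Taylor remainders
    at the vertices with the gradients of the coordinates. *)
Lemma gradient_error G0 G1 G2 G3 T v kap : @C3 R d G0 G1 G2 G3 -> T \in M ->
  0 < kap -> kap <= 1 -> (forall j, `|G0 (row j T) - v (row j T)| <= kap) ->
    adm (fun x => \1_(inner T) x * \sum_i (G1 i x - slope T v 0 i) ^+ 2) /\
    J (fun x => \1_(inner T) x * \sum_i (G1 i x - slope T v 0 i) ^+ 2) <=
    interp_const * h ^+ 2 * J (fun x => \1_(inner T) x * hess G2 x) + interp_slack * kap.
Proof.
move=> hC TM kap0 kap1 hv; have ai := mesh_ai triM TM.
have [aT vol] := inner_vol d_gt0 neH triM shM quM TM.
have sz j x : inner T x -> enorm (row j T - x) <= h.
  move=> Tx; apply: (simplex_size triM TM); [exact: vertex_simplex|exact: inner_simplex].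
have [V VE] : exists V, V = J (\1_(inner T) : _ -> R) by eexists.
have V0 : 0 <= V by rewrite VE; apply: J_ge0 => x; rewrite indicE ler0n.
rewrite -VE in vol.
have [n nE] : exists n : R, n = d.+1%:R by eexists.
have n0 : 0 < n by rewrite nE ltr0n.
have [Q QE] : exists Q, Q = (sh / h) ^+ 2 by eexists.
have Q0 : 0 <= Q by rewrite QE sqr_ge0.
have pt x : inner T x -> \sum_i (G1 i x - slope T v 0 i) ^+ 2 <=
    2 * n * Q * \sum_j (kap ^+ 2 + taylor_rest G0 G1 T j x ^+ 2).
  move=> Tx; pose g : 'rV[R]_d := \row_i G1 i x.
  have -> : \sum_i (G1 i x - slope T v 0 i) ^+ 2 = enorm (g - slope T v) ^+ 2.
    by rewrite enorm_sqr; apply: eq_bigr => i _; rewrite !mxE expr2.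
  have gE : g - slope T v = \sum_j ((G0 (row j T) - v (row j T)) - taylor_rest G0 G1 T j x) *: bgrad T j.
    rewrite -{1}(slope_affine ai g (G0 x - dotp g x)) /slope -sumrB; apply: eq_bigr => j _.
    rewrite -scalerBl; congr (_ *: _); rewrite /taylor_rest.
    have -> : \sum_i (row j T - x) 0 i * G1 i x = dotp g (row j T) - dotp g x.
      by rewrite -dotpBr /dotp; apply: eq_bigr => i _; rewrite mulrC [in RHS]mxE.
    by ring.
  have en : enorm (g - slope T v) <= \sum_j (kap + `|taylor_rest G0 G1 T j x|) * (sh / h).
    rewrite gE (le_trans (enorm_sum _ _ _))//; apply: ler_sum => j _.
    rewrite enormZ ler_pM ?enorm_ge0//; last exact: (bgrad_bound d_gt0 neH triM shM quM).
    by rewrite (le_trans (ler_normB _ _))// lerD2r.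
  apply: (@le_trans _ _ ((\sum_j (kap + `|taylor_rest G0 G1 T j x|) * (sh / h)) ^+ 2)).
    by rewrite ler_pXn2r ?nnegrE ?enorm_ge0// (le_trans (enorm_ge0 _) en).
  rewrite -mulr_suml exprMn -QE.
  have CS := weighted_CS (s := index_enum 'I_d.+1) (c := fun=> 1 : R)
     (fun j => kap + `|taylor_rest G0 G1 T j x|) (fun=> ler01).
  have s1 : \sum_(i < d.+1) (1 : R) = n by rewrite sumr_const card_ord nE.
  rewrite s1 in CS; have {}CS := CS n0.
  have {}CS : (\sum_j (kap + `|taylor_rest G0 G1 T j x|)) ^+ 2 <=
      n * \sum_j (kap + `|taylor_rest G0 G1 T j x|) ^+ 2.
    move: CS; congr (_ ^+ 2 <= _ * _); apply: eq_bigr => j _; exact: mul1r.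
  rewrite (_ : 2 * n * Q * _ = (n * (2 * \sum_j (kap ^+ 2 + taylor_rest G0 G1 T j x ^+ 2))) * Q); last by ring.
  rewrite ler_wpM2r// (le_trans CS)// ler_wpM2l ?(ltW n0)// mulr_sumr; apply: ler_sum => j _.
  have := sqr_ge0 (kap - `|taylor_rest G0 G1 T j x|).
  rewrite sqrrB sqrrD real_normK ?num_real//; lra.
have rI j := rest_integral hC d_gt0 ai aT (ltW h_gt0) (sz j) d_le3 kap0.
have ak j : adm (fun x => kap ^+ 2 * \1_(inner T) x + \1_(inner T) x * taylor_rest G0 G1 T j x ^+ 2).
  by apply: admD; [exact: admZ|case: (rI j)].
have a2 : adm (fun x => 2 * n * Q * \sum_j (kap ^+ 2 * \1_(inner T) x + \1_(inner T) x * taylor_rest G0 G1 T j x ^+ 2)).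
  by apply: admZ; apply: adm_sum => j _.
have [_ _ _ _ [N hN]] := hC.
have b1 i : blip (G1 i).
  by exists N => x y; have [_ ? _ _ [_ ? _ _]] := hN i i i x y.
have a1 : adm (fun x => \1_(inner T) x * \sum_i (G1 i x - slope T v 0 i) ^+ 2).
  apply: adm_blip => //; apply: blip_sum => i.
  rewrite (_ : (fun x => _) = fun x => (G1 i x - slope T v 0 i) * (G1 i x - slope T v 0 i)).
    by apply: blipM; apply: blipB => //; exact: blip_cst.
  by apply/funext => x; rewrite expr2.
split=> //.
apply: (@le_trans _ _ (J (fun x => 2 * n * Q * \sum_j (kap ^+ 2 * \1_(inner T) x + \1_(inner T) x * taylor_rest G0 G1 T j x ^+ 2)))).
  apply: J_le => // x; case: (pselect (inner T x)) => Tx; last first.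
    have z0 : \1_(inner T) x = 0 :> R by rewrite indicE memNset.
    by rewrite z0 mul0r big1 ?mulr0// => j _; rewrite ?mulr0 mul0r addr0.
  have z1 : \1_(inner T) x = 1 :> R by rewrite indicE mem_set.
  rewrite z1 mul1r (le_trans (pt x Tx))// le_eqVlt; apply/orP; left; apply/eqP.
  by congr (_ * _); apply: eq_bigr => j _; rewrite mulr1 mul1r.
rewrite JZ; last by apply: adm_sum => j _.
rewrite J_sum//; set X := J (fun x => _ * hess G2 x).
have X0 : 0 <= X.
  apply: J_ge0 => x; rewrite mulr_ge0 ?indicE ?ler0n//.
  by apply: sumr_ge0 => i _; apply: sumr_ge0 => l _; exact: sqr_ge0.
apply: (@le_trans _ _ (2 * n * Q * \sum_(j < d.+1) (kap * V + (8 * h ^+ 4 * X + kap)))).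
  rewrite ler_wpM2l ?mulr_ge0 ?(ltW n0)//; apply: ler_sum => j _.
  have [aj rj] := rI j; rewrite JD//; last exact: admZ.
  by rewrite JZ// -VE lerD// ler_wpM2r// expr2 ler_piMl// (ltW kap0).
rewrite sumr_const card_ord -[X in _ * X]mulr_natl -nE.
have hh : Q * h ^+ 4 = sh ^+ 2 * h ^+ 2 by rewrite QE; field; rewrite gt_eqF.
rewrite (_ : 2 * n * Q * _ = 16 * n ^+ 2 * (Q * h ^+ 4) * X + 2 * n ^+ 2 * Q * (V + 1) * kap); last by ring.
rewrite hh lerD//; first by rewrite /interp_const -nE le_eqVlt; apply/orP; left; apply/eqP; ring.
have nQ : 0 <= 2 * n ^+ 2 * Q by apply: mulr_ge0 => //; apply: mulr_ge0 => //; exact: sqr_ge0.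
by rewrite ler_wpM2r ?(ltW kap0)// /interp_slack -nE -QE ler_wpM2l// lerD2r.
Qed.

Let absorb (E E1 k A S Y c : R) : E <= k * E1 + A -> A <= Y + S ->
  S <= (E + k) / 2 + c * k -> E <= Y + E / 2 + (E1 + 2^-1 + c) * k.
Proof. by lra. Qed.

(** The Aubin-Nitsche duality argument: solve the Poisson problem with the
    error as right-hand side, integrate by parts, subtract the nodal
    interpolant, to which the error is orthogonal, and use the regularity
    estimate.  The solution is known up to the parameter kap only, which tends
    to zero at the end. *)
Lemma poisson_ap M' e : triangulation (polytope Hs) M' -> paffine Hs M' e ->
  (forall v, v \in P1_pred (polytope Hs) M -> gradL2ip (polytope Hs) e v = 0) ->
  J (fun x => e x ^+ 2) <= interp_const * h ^+ 2 * gradL2ip (polytope Hs) e e.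
Proof.
move=> triM' pe orth; have [z _] := pe.
have ae := paffine_adm unitH B_gt0 HB triM' pe.
have be := paffine_blip unitH B_gt0 HB triM' pe.
have [L hL] := be.
have L0 : 0 <= L by have [hh _] := hL 0 0; apply: le_trans hh.
have [eta etaE] : exists eta, eta = interp_const * h ^+ 2 by eexists.
have sh0 : 0 < sh by exact: (shape_gt0 d_gt0 neH triM shM quM).
have eta0 : 0 < eta.
  rewrite etaE; apply: mulr_gt0; last exact: exprn_gt0.
  apply: mulr_gt0; last exact: exprn_gt0.
  by apply: mulr_gt0 => //; apply: exprn_gt0; rewrite ltr0n.
rewrite -etaE; set Ga := gradL2ip _ e e.
have GaE : Ga = J (fun x => \sum_i pgrad M' e i x * pgrad M' e i x).
  exact: (gradL2ipE d_gt0 unitH B_gt0 HB triM' triM' pe pe).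
have [E EE] : exists E, E = J (fun x => e x ^+ 2) by eexists.
have [E1 E1E] : exists E, E = J (fun x => `|e x|) by eexists.
have E10 : 0 <= E1 by rewrite E1E; exact: J_ge0.
rewrite -EE; apply/ler_addgt0Pr => ep ep0.
suff [A A0 hA] : exists2 A, 0 <= A & forall kap, 0 < kap -> kap <= 1 ->
    E <= eta / 2 * Ga + E / 2 + A * kap.
  have [k0 k00 hk] := small_enough A0 (divr_gt0 ep0 (ltr0n R 2)).
  pose k := Num.min 1 k0; have kp : 0 < k by rewrite lt_min ltr01.
  have := hA k kp; rewrite ge_min lexx => /(_ isT).
  have := hk k (ltW kp); rewrite ge_min lexx orbT => /(_ isT); lra.
have [b bE] : exists b, b = interp_slack by eexists.
have b0 : 0 <= b by rewrite bE; exact: interp_slack_ge0.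
pose nT : R := (size (undup M))%:R.
exists (E1 + 2^-1 + (2 * eta)^-1 * (nT * b)).
  by rewrite !addr_ge0// mulr_ge0 ?invr_ge0 ?mulr_ge0 ?(ltW eta0).
move=> kap kap0 kap1.
have [G0 [G1 [G2 [G3 [hC Geq Ghess Goff]]]]] :=
  regularity d_gt0 unitH uniqH Hs_ne hx0 hrho L0 L0 (fun x => (hL x 0).1) (fun x y => (hL x y).2) z kap0.
rewrite -EE in Ghess.
have [v [vP vnod]] := nodal_interpolant unitH triM G0.
have pv := P1_paffine triM vP.
have vG T j : T \in M -> `|G0 (row j T) - v (row j T)| <= kap.
  move=> TM; case: (pselect (polytope Hs (row j T))) => hj.
    by rewrite vnod// subrr normr0 ltW.
  by have [zv _] := pv; rewrite (zv _ hj) subr0; exact: Goff.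
have [_ p1 _ _ [N hN]] := hC.
have b1 i : blip (G1 i).
  by exists N => x y; have [_ ? _ _ [_ ? _ _]] := hN i i i x y.
have b2 i k : blip (G2 i k).
  by exists N => x y; have [_ _ ? _ [_ _ ? _]] := hN i k i x y.
have ap i : adm (pgrad M' e i) by exact: (adm_pgrad unitH HB triM').
have aeG i k : adm (fun x => e x * G2 i k x) by exact: adm_blip.
have step1 : E <= kap * E1 + J (fun x => \sum_i pgrad M' e i x * G1 i x).
  have -> : J (fun x => \sum_i pgrad M' e i x * G1 i x) = - J (fun x => \sum_i e x * G2 i i x).
    rewrite J_sum; last by move=> i _; exact: adm_blip.
    rewrite J_sum; last by move=> i _; exact: aeG.
    rewrite -sumrN; apply: eq_bigr => i _.
    by rewrite (integration_by_parts d_gt0 unitH B_gt0 HB triM' pe (b1 i) (b2 i i) (p1 i i)) opprK.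
  have aS : adm (fun x => \sum_i e x * G2 i i x) by apply: adm_sum => i _; exact: aeG.
  rewrite E1E -JZ; last exact: adm_norm.
  rewrite -JB//; last by apply: admZ; exact: adm_norm.
  rewrite EE; apply: J_le.
  - rewrite (_ : (fun x => _) = fun x => e x * e x); first exact: admM.
    by apply/funext => x; rewrite expr2.
  - by apply: admB => //; apply: admZ; exact: adm_norm.
  - move=> x; rewrite -mulr_sumr; case: (pselect (polytope Hs x)) => hx; last first.
      by rewrite z// normr0 mul0r mulr0 subr0 expr0n.
    have := Geq x hx => hg; have : `|e x * (\sum_i G2 i i x + e x)| <= `|e x| * kap.
      by rewrite normrM ler_wpM2l.
    move=> /(le_trans (ler_norm _)); lra.
have step2 : J (fun x => \sum_i pgrad M' e i x * pgrad M v i x) = 0.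
  by rewrite -(gradL2ipE d_gt0 unitH B_gt0 HB triM' triM pe pv) orth.
pose D T x := \sum_i (G1 i x - slope T v 0 i) ^+ 2.
have hD T : T \in undup M -> adm (fun x => \1_(inner T) x * D T x) /\
    J (fun x => \1_(inner T) x * D T x) <= eta * J (fun x => \1_(inner T) x * hess G2 x) + b * kap.
  rewrite mem_undup etaE bE => TM; apply: (gradient_error hC TM kap0 kap1) => j; exact: vG.
have aPP : adm (fun x => \sum_i pgrad M' e i x * pgrad M' e i x).
  by apply: adm_sum => i _; exact: admM.
have aPG : adm (fun x => \sum_i pgrad M' e i x * G1 i x).
  by apply: adm_sum => i _; exact: adm_blip.
have aPv : adm (fun x => \sum_i pgrad M' e i x * pgrad M v i x).
  by apply: adm_sum => i _; apply: admM => //; exact: (adm_pgrad unitH HB triM).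
have aD : adm (fun x => \sum_(T <- undup M | T \in undup M) \1_(inner T) x * D T x).
  by apply: adm_sum => T /hD[].
have D0 T x : 0 <= D T x by apply: sumr_ge0 => i _; exact: sqr_ge0.
have step3 : J (fun x => \sum_i pgrad M' e i x * G1 i x) <=
    eta / 2 * Ga + (2 * eta)^-1 * J (fun x => \sum_(T <- undup M | T \in undup M) \1_(inner T) x * D T x).
  have -> : J (fun x => \sum_i pgrad M' e i x * G1 i x) =
      J (fun x => \sum_i pgrad M' e i x * G1 i x - \sum_i pgrad M' e i x * pgrad M v i x).
    by rewrite JB// step2 subr0.
  rewrite GaE -JZ// -JZ// -JD; [|exact: admZ|exact: admZ].
  apply: (J_le_off_null (null_facets B_gt0 (facets_unit d_gt0 triM))).
  - exact: admB.
  - by apply: admD; exact: admZ.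
  - move=> x nx; rewrite -sumrB.
    case: (pselect (polytope Hs x)) => hx; last first.
      have p0 i : pgrad M' e i x = 0.
        by apply: pgrad_out => T TM /(inner_polytope unitH triM' TM).
      rewrite big1 => [|i _]; last by rewrite p0 !mul0r subrr.
      rewrite addr_ge0// mulr_ge0 ?divr_ge0 ?invr_ge0 ?mulr_ge0 ?(ltW eta0)//.
        by apply: sumr_ge0 => i _; rewrite p0 mul0r.
      by apply: sumr_ge0 => T _; rewrite mulr_ge0// indicE ler0n.
    have [T TM Tx] : exists2 T, T \in M & inner T x.
      apply: (off_facets triM hx) => // p pF; apply/eqP => g0; apply: nx; split; first exact: HB.
      by exists p.
    apply: (@le_trans _ _ (eta / 2 * (\sum_i pgrad M' e i x * pgrad M' e i x) + (2 * eta)^-1 * D T x)).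
      rewrite /D !mulr_sumr -big_split/=; apply: ler_sum => i _.
      rewrite (pgrad_in d_gt0 triM _ _ TM Tx) -mulrBr.
      move: (pgrad M' e i x) (G1 i x - slope T v 0 i) => p q.
      rewrite -subr_ge0 (_ : _ - _ = (2 * eta)^-1 * (eta * p - q) ^+ 2); last by field; rewrite gt_eqF.
      by rewrite mulr_ge0 ?sqr_ge0// invr_ge0 mulr_ge0// ltW.
    rewrite lerD2l ler_wpM2l ?invr_ge0 ?mulr_ge0 ?(ltW eta0)//.
    apply: (@le_trans _ _ (\1_(inner T) x * D T x)); first by rewrite indicE mem_set// mul1r.
    apply: (le_bigseq (f := fun T => \1_(inner T) x * D T x)); rewrite ?mem_undup//.
    by move=> S; rewrite mulr_ge0// indicE ler0n.
have step4 : J (fun x => \sum_(T <- undup M | T \in undup M) \1_(inner T) x * D T x) <=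
    eta * (E + kap) + nT * b * kap.
  have h0 x : 0 <= hess G2 x by apply: sumr_ge0 => i _; apply: sumr_ge0 => j _; exact: sqr_ge0.
  have bh : blip (hess G2) := blip_hess hC.
  have aTh T : T \in undup M -> adm (fun x => \1_(inner T) x * hess G2 x).
    rewrite mem_undup => TM; apply: adm_blip => //.
    by have [] := inner_vol d_gt0 neH triM shM quM TM.
  rewrite J_sum; last by move=> T /hD[].
  apply: (@le_trans _ _ (\sum_(T <- undup M | T \in undup M) (eta * J (fun x => \1_(inner T) x * hess G2 x) + b * kap))).
    by apply: ler_sum => T /hD[].
  rewrite big_split/= -mulr_sumr lerD//; last first.
    rewrite -mulrA; apply: sum_le_const; rewrite ?mulr_ge0 ?(ltW kap0)//.
  rewrite ler_wpM2l ?(ltW eta0)// (le_trans _ Ghess)// -J_sum//.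
  apply: J_le; [exact: adm_sum| |move=> x].
    apply: (@adm_dom _ _ _ (fun x => \1_(cube 0 B) x * hess G2 x) 1).
    - by apply: mfunM; [apply: mfun_indic; exact: mset_polytope|exact: blip_mfun].
    - by apply: adm_blip => //; exact: adm_cube.
    - move=> x; rewrite mul1r !normrM ler_wpM2r// !indicE.
      case: (pselect (polytope Hs x)) => hx; last by rewrite memNset// normr0.
      by rewrite !mem_set//; exact: HB.
  rewrite -big_seq; case: (pselect (polytope Hs x)) => hx.
    rewrite [X in _ <= X * _]indicE mem_set// mul1r.
    by apply: (sum_inner d_gt0 triM (f := fun=> hess G2 x)) => // *; exact: h0.
  rewrite big_seq big1; first by apply: mulr_ge0; [rewrite indicE ler0n|exact: (h0 x)].
  move=> T; rewrite mem_undup => TM; rewrite indicE memNset ?mul0r// => Tx.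
  by apply: hx; exact: (inner_polytope unitH triM TM).
have e2 : 0 <= (2 * eta)^-1 by rewrite invr_ge0 mulr_ge0// ltW.
have := ler_wpM2l e2 step4.
have -> : (2 * eta)^-1 * (eta * (E + kap) + nT * b * kap) = (E + kap) / 2 + (2 * eta)^-1 * (nT * b) * kap.
  by field; rewrite gt_eqF.
exact: absorb step1 step3.
Qed.

End Approximation.

(** * Symmetric operators on finite-dimensional Euclidean spaces *)

Section Linear.
Variables (R : realType) (V W : lmodType R).

Definition lin (f : V -> W) := forall a x y, f (a *: x + y) = a *: f x + f y.

Lemma lin0 f : lin f -> f 0 = 0.
Proof.
move=> lf; have := lf (-1) 0 0; rewrite scaler0 addr0 scaleN1r => ->.
by rewrite addNr.
Qed.

Lemma linD f x y : lin f -> f (x + y) = f x + f y.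
Proof. by move=> lf; rewrite -[x in LHS]scale1r lf scale1r. Qed.

Lemma linZ f a x : lin f -> f (a *: x) = a *: f x.
Proof. by move=> lf; rewrite -[a *: x in LHS]addr0 lf lin0// addr0. Qed.

Lemma linB f x y : lin f -> f (x - y) = f x - f y.
Proof. by move=> lf; rewrite linD// -scaleN1r linZ// scaleN1r. Qed.

Lemma lin_inj f : lin f -> (forall x, f x = 0 -> x = 0) -> injective f.
Proof.
move=> lf h x y fxy; apply/eqP; rewrite -subr_eq0; apply/eqP/h.
by rewrite linB// fxy subrr.
Qed.

Lemma lin_sum (I : Type) (s : seq I) (P : pred I) (F : I -> V) f : lin f ->
  f (\sum_(i <- s | P i) F i) = \sum_(i <- s | P i) f (F i).
Proof. by move=> lf; apply: big_morph => [x y|]; [exact: linD|exact: lin0]. Qed.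

End Linear.

Lemma quad_CS (R : realType) (u f v : R) : 0 <= v ->
  (forall t, 0 <= u - 2 * t * f + t ^+ 2 * v) -> f ^+ 2 <= u * v.
Proof.
move=> v0 key; have [vz|vn] := eqVneq v 0.
  have [->|n0] := eqVneq f 0; first by rewrite expr0n vz mulr0.
  have := key ((u + 1) / (2 * f)); rewrite vz mulr0 addr0.
  have -> : 2 * ((u + 1) / (2 * f)) * f = u + 1 by field.
  lra.
have vp : 0 < v by rewrite lt_neqAle eq_sym vn.
have := key (f / v).
have -> : u - 2 * (f / v) * f + (f / v) ^+ 2 * v = u - f ^+ 2 / v by field.
by rewrite subr_ge0 ler_pdivrMr.
Qed.

Section Euclidean.
Variables (R : realType) (V : lmodType R).
Implicit Types (x y z : V).

(** Finite dimension is recorded by coordinates that are orthogonal up to a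
    common factor; for finite elements these are the nodal values. *)
Definition euclidean (sp : V -> V -> R) := exists N (c : V -> 'rV[R]_N) (c' : 'rV[R]_N -> V) (a : R),
  [/\ lin c, cancel c c', cancel c' c, 0 < a & forall x y, sp x y = a * dotp (c x) (c y)].

Variable sp : V -> V -> R.
Hypothesis eu : euclidean sp.

Lemma spC x y : sp x y = sp y x.
Proof. by have [N [c [c' [a [_ _ _ _ h]]]]] := eu; rewrite !h dotpC. Qed.

Lemma spDl x y z : sp (x + y) z = sp x z + sp y z.
Proof. by have [N [c [c' [a [lc _ _ _ h]]]]] := eu; rewrite !h linD// dotpDl mulrDr. Qed.

Lemma spZl k x z : sp (k *: x) z = k * sp x z.
Proof. by have [N [c [c' [a [lc _ _ _ h]]]]] := eu; rewrite !h linZ// dotpZl mulrCA. Qed.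

Lemma spDr x y z : sp z (x + y) = sp z x + sp z y.
Proof. by rewrite !(spC z) spDl. Qed.

Lemma spZr k x z : sp z (k *: x) = k * sp z x.
Proof. by rewrite !(spC z) spZl. Qed.

Lemma spNl x z : sp (- x) z = - sp x z.
Proof. by rewrite -scaleN1r spZl mulN1r. Qed.

Lemma spNr x z : sp z (- x) = - sp z x.
Proof. by rewrite !(spC z) spNl. Qed.

Lemma sp_ge0 x : 0 <= sp x x.
Proof. by have [N [c [c' [a [_ _ _ a0 h]]]]] := eu; rewrite h mulr_ge0 ?dotp_ge0// ltW. Qed.

Lemma sp_eq0 x : sp x x = 0 -> x = 0.
Proof.
have [N [c [c' [a [lc cK cK' a0 h]]]]] := eu.
rewrite h => /eqP; rewrite mulf_eq0 gt_eqF//= => /eqP d0.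
have c0 : c x = 0 by apply: enorm0_eq0; rewrite /enorm d0 sqrtr0.
by apply: (can_inj cK); rewrite c0 lin0.
Qed.

Lemma sp_gt0 x : x != 0 -> 0 < sp x x.
Proof.
by move=> x0; rewrite lt_neqAle sp_ge0 andbT eq_sym; apply: contra x0 => /eqP /sp_eq0 ->.
Qed.

Lemma sp_ext x y : (forall z, sp x z = sp y z) -> x = y.
Proof.
move=> h; apply/eqP; rewrite -subr_eq0; apply/eqP/sp_eq0.
by rewrite spDl spNl h subrr.
Qed.

Lemma riesz (l : V -> R) : (forall a x y, l (a *: x + y) = a * l x + l y) ->
  exists y, forall z, sp y z = l z.
Proof.
move=> ll; have [N [c [c' [a [lc cK cK' a0 h]]]]] := eu.
have lc' : lin c'.
  by move=> k u v; apply: (can_inj cK); rewrite cK' lc !cK'.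
have l0 : l 0 = 0.
  by have := ll 1 0 0; rewrite scaler0 addr0 mul1r => e; apply: (addrI (l 0)); rewrite addr0 -e.
exists (c' (\row_i (a^-1 * l (c' (delta_mx 0 i))))) => z.
have -> : l z = \sum_i c z 0 i * l (c' (delta_mx 0 i)).
  have {1}-> : z = c' (\sum_i c z 0 i *: delta_mx 0 i) by rewrite -row_sum_delta cK.
  rewrite (lin_sum _ _ _ lc').
  elim: (index_enum _) => [|i s IH]; first by rewrite !big_nil.
  by rewrite !big_cons (linZ _ _ lc') ll IH.
rewrite h cK' /dotp mulr_sumr; apply: eq_bigr => i _; rewrite mxE; field.
exact: lt0r_neq0.
Qed.

Lemma lin_surj f : lin f -> (forall x, f x = 0 -> x = 0) -> forall y, exists x, f x = y.
Proof.
move=> lf inj; have [N [c [c' [a [lc cK cK' a0 h]]]]] := eu.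
have lc' : lin c'.
  by move=> k u v; apply: (can_inj cK); rewrite cK' lc !cK'.
pose M : 'M[R]_N := \matrix_i c (f (c' (delta_mx 0 i))).
have ME u : u *m M = c (f (c' u)).
  rewrite mulmx_sum_row [in RHS](row_sum_delta u) (lin_sum _ _ _ lc') (lin_sum _ _ _ lf) (lin_sum _ _ _ lc).
  by apply: eq_bigr => i _; rewrite rowK !linZ.
have Mu : M \in unitmx.
  rewrite -row_free_unit -kermx_eq0; apply/eqP/row_matrixP => i; rewrite row0.
  have : row i (kermx M) *m M = 0 by rewrite -row_mul mulmx_ker row0.
  rewrite ME => e; have : f (c' (row i (kermx M))) = 0 by apply: (can_inj cK); rewrite e lin0.
  by move=> /inj e'; apply: (can_inj cK'); rewrite e' (lin0 lc').
move=> y; exists (c' (c y *m invmx M)); apply: (can_inj cK).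
by rewrite -ME -mulmxA mulVmx// mulmx1.
Qed.

(** In finite dimension uniqueness gives existence. *)
Lemma form_solve (f : V -> V -> R) (l : V -> R) :
  (forall z k x y, f (k *: x + y) z = k * f x z + f y z) ->
  (forall z k x y, f z (k *: x + y) = k * f z x + f z y) ->
  (forall x, (forall z, f x z = 0) -> x = 0) ->
  (forall a x y, l (a *: x + y) = a * l x + l y) ->
  exists x, forall z, f x z = l z.
Proof.
move=> fl fr fi ll.
pose T x := projT1 (cid (riesz (fr x))).
have TE x z : sp (T x) z = f x z by rewrite /T; case: cid.
have lT : lin T by move=> a x y; apply: sp_ext => z; rewrite spDl spZl !TE fl.
have iT x : T x = 0 -> x = 0.
  by move=> Tx; apply: fi => z; rewrite -TE Tx -(scale0r 0) spZl mul0r.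
have [y hy] := riesz ll; have [x xE] := lin_surj lT iT y.
by exists x => z; rewrite -TE xE.
Qed.

Lemma lin_bounded f : lin f -> exists2 C, 0 <= C & forall x, sp (f x) (f x) <= C * sp x x.
Proof.
move=> lf; have [N [c [c' [a [lc cK cK' a0 h]]]]] := eu.
have lc' : lin c'.
  by move=> k u v; apply: (can_inj cK); rewrite cK' lc !cK'.
pose S := \sum_i enorm (c (f (c' (delta_mx 0 i)))).
have S0 : 0 <= S by apply: sumr_ge0 => i _; exact: enorm_ge0.
exists (S ^+ 2); first exact: sqr_ge0.
move=> x; rewrite !h mulrCA ler_wpM2l ?(ltW a0)// -!enorm_sqr -exprMn.
rewrite ler_pXn2r ?nnegrE ?mulr_ge0 ?enorm_ge0//.
have {1}-> : x = c' (\sum_i c x 0 i *: delta_mx 0 i) by rewrite -row_sum_delta cK.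
rewrite (lin_sum _ _ _ lc') (lin_sum _ _ _ lf) (lin_sum _ _ _ lc).
rewrite (le_trans (enorm_sum _ _ _))// /S mulr_suml; apply: ler_sum => i _.
rewrite (linZ _ _ lc') (linZ _ _ lf) (linZ _ _ lc) enormZ mulrC ler_wpM2l ?enorm_ge0//.
exact: enorm_coord.
Qed.

Definition symmetric f := forall x y, sp (f x) y = sp x (f y).

Lemma psd_CS f x y : lin f -> symmetric f -> (forall x, 0 <= sp (f x) x) ->
  sp (f x) y ^+ 2 <= sp (f x) x * sp (f y) y.
Proof.
move=> lf sf pf.
rewrite mulrC; apply: quad_CS => // t.
have := pf (y - t *: x); rewrite (linB _ _ lf) (linZ _ _ lf) !(spDl, spNl, spZl, spDr, spNr, spZr).
by rewrite (sf y x) (spC y (f x)); lra.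
Qed.

(** The supremum b of the Rayleigh quotient is an eigenvalue of f: otherwise
    b - f is injective, hence has a bounded inverse, and by Cauchy-Schwarz for
    the form of b - f the supremum could be lowered. *)
Lemma top_eigen f M : lin f -> symmetric f -> (exists x, x != 0) ->
  (forall x, sp (f x) x <= M * sp x x) ->
  exists b, is_eigenvalue f b /\ forall x, sp (f x) x <= b * sp x x.
Proof.
move=> lf sf [x1 x1n] hM.
pose Q := [set t | exists2 x, x != 0 & t = sp (f x) x / sp x x].
have hQ : has_sup Q.
  split; first by exists (sp (f x1) x1 / sp x1 x1), x1.
  by exists M => _ [x x0 ->]; rewrite ler_pdivrMr ?sp_gt0.
pose b := sup Q.
have fb x : sp (f x) x <= b * sp x x.
  have [->|x0] := eqVneq x 0; first by rewrite (lin0 lf) -(scale0r 0) !spZl mul0r mulr0.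
  by rewrite -ler_pdivrMr ?sp_gt0//; apply: (ub_le_sup hQ.2); exists x.
exists b; split => //.
apply: contrapT => ne.
pose P x := b *: x - f x.
have lP : lin P by move=> k x y; rewrite /P lf scalerDr opprD !scalerBr scalerA mulrC -scalerA addrACA.
have sP : symmetric P by move=> x y; rewrite /P spDl spNl spZl spDr spNr spZr sf.
have pP x : 0 <= sp (P x) x by rewrite /P spDl spNl spZl subr_ge0.
have iP x : P x = 0 -> x = 0.
  move=> Px; apply/eqP/negPn/negP => x0; apply: ne; exists x => //.
  by apply/eqP; rewrite eq_sym -subr_eq0; apply/eqP.
pose g x := projT1 (cid (lin_surj lP iP x)).
have gK x : P (g x) = x by rewrite /g; case: cid.
have lg : lin g.
  by move=> k x y; apply: (lin_inj lP iP); rewrite gK lP !gK.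
have [C C0 hC] := lin_bounded lg.
have gap x : sp x x <= (1 + C) * sp (P x) x.
  have := psd_CS (g x) x lP sP pP; rewrite gK.
  have h1 : sp x (g x) <= (1 + C) * sp x x.
    have := sp_ge0 (x - g x); rewrite spDl spNl !spDr !spNr (spC (g x) x).
    have := hC x; have := sp_ge0 x; have := mulr_ge0 C0 (sp_ge0 x); lra.
  have [->|x0] := eqVneq x 0; first by rewrite (lin0 lP) -(scale0r 0) !spZl !mul0r mulr0.
  have xp := sp_gt0 x0; have h2 := pP x.
  move=> h3; rewrite -(ler_pM2l xp) -expr2 (le_trans h3)//.
  by rewrite mulrCA mulrA ler_wpM2r// mulrC.
have : b <= b - (1 + C)^-1.
  apply: ge_sup; first by case: hQ.
  move=> _ [x x0 ->]; have xp := sp_gt0 x0; have := gap x; rewrite /P spDl spNl spZl => h.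
  rewrite ler_pdivrMr// mulrBl; have C1 : 0 < 1 + C by lra.
  by rewrite lerBrDr -lerBrDl ler_pdivrMl.
have : 0 < (1 + C)^-1 by rewrite invr_gt0; lra.
lra.
Qed.

Lemma eigenvalue_rayleigh f l : is_eigenvalue f l -> exists2 x, x != 0 & sp (f x) x = l * sp x x.
Proof. by move=> [x x0 fx]; exists x; rewrite // fx spZl. Qed.

(** The supremum of the eigenvalues is meaningful because there are some and
    they are bounded by the Rayleigh quotients. *)
Lemma lambda_maxP f M : lin f -> symmetric f -> (exists x, x != 0) ->
  (forall x, sp (f x) x <= M * sp x x) ->
  (forall x, sp (f x) x <= lambda_max f * sp x x) /\ lambda_max f <= M.
Proof.
move=> lf sf ne hM; have [b [eb hb]] := top_eigen lf sf ne hM.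
have ub l : is_eigenvalue f l -> l <= M.
  by move=> /eigenvalue_rayleigh[x x0 e]; rewrite -(ler_pM2r (sp_gt0 x0)) -e.
have bl : b <= lambda_max f by apply: ub_le_sup => //; exists M.
split; last by apply: ge_sup; [exists b|].
by move=> x; rewrite (le_trans (hb x))// ler_wpM2r// sp_ge0.
Qed.

Lemma lambda_minP f m M : lin f -> symmetric f -> (exists x, x != 0) ->
  (forall x, sp (f x) x <= M * sp x x) ->
  (forall x, m * sp x x <= sp (f x) x) ->
  (forall x, lambda_min f * sp x x <= sp (f x) x) /\ m <= lambda_min f.
Proof.
move=> lf sf ne hM hm.
pose g x := - f x.
have lg : lin g by move=> k x y; rewrite /g lf opprD scalerN.
have sg : symmetric g by move=> x y; rewrite /g spNl spNr sf.
have [b [[x x0 gx] hb]] : exists b, is_eigenvalue g b /\ forall x, sp (g x) x <= b * sp x x.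
  by apply: (top_eigen (M := - m)) => // x; rewrite /g spNl mulNr lerN2.
have eb : is_eigenvalue f (- b).
  by exists x => //; rewrite scaleNr -gx opprK.
have lb l : is_eigenvalue f l -> m <= l.
  by move=> /eigenvalue_rayleigh[y y0 e]; rewrite -(ler_pM2r (sp_gt0 y0)) -e.
have bl : lambda_min f <= - b by apply: ge_inf => //; exists m.
split; last by apply: lb_le_inf; [exists (- b)|].
move=> y; have := hb y; rewrite /g spNl => h.
have : lambda_min f * sp y y <= - b * sp y y by rewrite ler_wpM2r// sp_ge0.
lra.
Qed.

End Euclidean.

(** * Richardson smoothing *)

Section Smoother.
Variables (R : realType) (V : lmodType R) (sp : V -> V -> R).
Hypothesis eu : euclidean sp.
Variable A : V -> V.
Hypotheses (lA : lin A) (sA : symmetric sp A).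
Variable l : R.
Local Notation Rl := (fun x : V => x - l *: A x).

Lemma relax_lin : lin Rl.
Proof.
move=> k x y; rewrite lA !scalerDr scalerN !scalerA (mulrC l k) opprD addrACA.
by rewrite -scalerA.
Qed.

Lemma relax_sym : symmetric sp Rl.
Proof. by move=> x y; rewrite (spDl eu) (spDr eu) (spNl eu) (spNr eu) (spZl eu) (spZr eu) sA. Qed.

Lemma relax_comm x : A (Rl x) = Rl (A x).
Proof. by rewrite (linB _ _ lA) (linZ _ _ lA). Qed.

Section Bounds.
Variables a b : R.
Hypotheses (a0 : 0 <= a) (hA : forall x, a * sp x x <= sp (A x) x).
Hypothesis (hB : forall x, sp (A x) x <= b * sp x x).

Let pA x : 0 <= sp (A x) x.
Proof. by rewrite (le_trans _ (hA x))// mulr_ge0// (sp_ge0 eu). Qed.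

(** The bounds a <= A <= b imply a A <= A^2 <= b A: this is the Cauchy-Schwarz
    inequality, in the inner product and in the energy form. *)
Lemma square_le x : sp (A x) (A x) <= b * sp (A x) x.
Proof.
have [->|Ax0] := eqVneq (A x) 0; first by rewrite -(scale0r 0) !(spZl eu) !mul0r mulr0.
have p := sp_gt0 eu Ax0.
have := psd_CS eu (A x) x lA sA pA; rewrite (sA (A x) x) => h.
by rewrite -(ler_pM2r p) -expr2 (le_trans h)// mulrC -mulrA mulrCA ler_wpM2l.
Qed.

Lemma square_ge x : a * sp (A x) x <= sp (A x) (A x).
Proof.
have [Ax0|Ax0] := eqVneq (A x) 0; first by rewrite Ax0 -(scale0r 0) !(spZl eu) !mul0r mulr0.
have p := sp_gt0 eu Ax0.
have idl : lin (fun x : V => x) by [].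
have h := @psd_CS _ _ _ eu _ (A x) x idl (fun _ _ => erefl) (sp_ge0 eu).
have [q0|q0] := eqVneq (sp (A x) x) 0; first by rewrite q0 mulr0 ltW.
have q : 0 < sp (A x) x by rewrite lt_neqAle eq_sym q0 pA.
rewrite -(ler_pM2r q) -mulrA -expr2 (le_trans (ler_wpM2l a0 h))// mulrCA ler_wpM2l//.
exact: ltW.
Qed.

End Bounds.

(** The relaxed operator is symmetric for the energy inner product, so its norm
    is read off its quadratic form by polarization. *)
Lemma relax_energy (a b : R) : 0 < a -> a <= b -> l = 2 / (a + b) ->
  (forall x, a * sp x x <= sp (A x) x) -> (forall x, sp (A x) x <= b * sp x x) ->
  forall x, sp (A (Rl x)) (Rl x) <= ((b - a) / (a + b)) ^+ 2 * sp (A x) x.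
Proof.
move=> a0 ab lE hA hB x.
have ab0 : 0 < a + b by lra.
have abn := lt0r_neq0 ab0.
have [r rE] : exists r, r = (b - a) / (a + b) by eexists.
have r0 : 0 <= r by rewrite rE divr_ge0//; lra.
have la : l * a = 1 - r by rewrite lE rE; field.
have lb : l * b = 1 + r by rewrite lE rE; field.
have l0 : 0 <= l by rewrite lE divr_ge0// ltW.
rewrite -rE.
have hlo v : (1 - r) * sp (A v) v <= l * sp (A v) (A v).
  by rewrite -la -mulrA ler_wpM2l// (square_ge (ltW a0)).
have hhi v : l * sp (A v) (A v) <= (1 + r) * sp (A v) v.
  by rewrite -lb -mulrA ler_wpM2l// (square_le (ltW a0) hA hB).
have [N NE] : exists N, N = sp (A (Rl x)) (Rl x) by eexists.
have key t : 2 * t * N <= r * (sp (A x) x + t ^+ 2 * N).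
  pose y := t *: Rl x.
  have h1 := hlo (x + y); have h2 := hhi (x - y).
  have cross : sp (A x) y - l * sp (A x) (A y) = t * N.
    rewrite -(spZr eu) -(spNr eu) -(spDr eu) -relax_sym -relax_comm.
    by rewrite /y (spZr eu) NE relax_comm.
  have qy : sp (A y) y = t ^+ 2 * N.
    by rewrite /y (linZ _ _ lA) (spZl eu) (spZr eu) NE; ring.
  have sy : sp (A y) x = sp (A x) y by rewrite sA (spC eu).
  have ey : sp (A y) (A x) = sp (A x) (A y) by rewrite (spC eu).
  move: h1 h2; rewrite (linD _ _ lA) (linB _ _ lA).
  rewrite !(spDl eu, spDr eu, spNl eu, spNr eu) sy ey qy.
  move: cross; move: (sp (A x) x) (sp (A x) y) (sp (A x) (A x)) (sp (A x) (A y)) (sp (A y) (A y)).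
  clear; move=> p q u v w cross h1 h2; lra.
rewrite -NE.
have [rz|rn] := eqVneq r 0.
  by have := key 1; rewrite rz expr0n/= !mul0r; lra.
have rp : 0 < r by rewrite lt_neqAle eq_sym rn.
have := key r^-1.
rewrite -(ler_pM2l rp) => h.
have e1 : r * (2 * r^-1 * N) = 2 * N by field.
have e2 : r * (r * (sp (A x) x + r^-1 ^+ 2 * N)) = r ^+ 2 * sp (A x) x + N by field.
by move: h; rewrite e1 e2; lra.
Qed.

Section Damped.
Hypothesis l0 : 0 < l.
Hypothesis pA : forall x, 0 <= sp (A x) x.
Hypothesis lA1 : forall x, l * sp (A x) x <= sp x x.

Let sq x : l * sp (A x) (A x) <= sp (A x) x.
Proof.
rewrite -ler_pdivlMl//; apply: (square_le (a := 0)) => // y; rewrite ?mul0r//.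
by rewrite ler_pdivlMl.
Qed.

Lemma damped_energy x : sp (A (Rl x)) (Rl x) <= sp (A x) x.
Proof.
have -> : sp (A (Rl x)) (Rl x) = sp (A x) x - 2 * l * sp (A x) (A x) + l ^+ 2 * sp (A (A x)) (A x).
  rewrite (linB _ _ lA) (linZ _ _ lA) !(spDl eu, spDr eu, spNl eu, spNr eu, spZl eu, spZr eu).
  by rewrite (sA (A x) x); ring.
have h := ler_wpM2l (ltW l0) (lA1 (A x)).
have h2 : 0 <= l * sp (A x) (A x) by rewrite mulr_ge0 ?(sp_ge0 eu)// ltW.
move: h h2; rewrite expr2; lra.
Qed.

Lemma damped_norm x : l * sp (A x) x <= sp x x - sp (Rl x) (Rl x).
Proof.
have -> : sp (Rl x) (Rl x) = sp x x - 2 * (l * sp (A x) x) + l * (l * sp (A x) (A x)).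
  by rewrite !(spDl eu, spDr eu, spNl eu, spNr eu, spZl eu, spZr eu) (spC eu x (A x)); ring.
have := ler_wpM2l (ltW l0) (sq x); lra.
Qed.

(** The energies of the iterates decrease and their sum telescopes. *)
Lemma smoothing n z :
  l * n.+1%:R * sp (A (iter n Rl z)) (iter n Rl z) <= sp z z.
Proof.
suff h : l * n.+1%:R * sp (A (iter n Rl z)) (iter n Rl z) <= sp z z - sp (iter n.+1 Rl z) (iter n.+1 Rl z).
  by rewrite (le_trans h)// lerBlDr lerDl (sp_ge0 eu).
elim: n => [|n IH]; first by rewrite mulr1; exact: damped_norm.
have h1 := damped_norm (iter n.+1 Rl z).
have h2 := damped_energy (iter n Rl z).
have h3 := ler_wpM2l (mulr_ge0 (ltW l0) (ler0n R n.+1)) h2.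
rewrite -[n.+2%:R]natr1 mulrDr mulrDl mulr1.
rewrite -[iter n.+2 Rl z]/(Rl (iter n.+1 Rl z)) -[iter n.+1 Rl z]/(Rl (iter n Rl z)) in h1 IH *.
lra.
Qed.

End Damped.

End Smoother.

(** * One level of the multigrid method *)

(** The form is indefinite, but pairing x with star x gives its energy, which
    replaces coercivity.  This, and the equivalence of the preconditioner with
    the energy, is all that the analysis uses of the saddle point problem. *)
Record level (R : realType) (V : lmodType R) (sp Bf : V -> V -> R) (En : V -> R)
    (star : V -> V) (C : V -> V) (c1 c2 : R) : Prop := Level {
  lv_eu : euclidean sp;
  lv_lin : forall y a x x', Bf (a *: x + x') y = a * Bf x y + Bf x' y;
  lv_sym : forall x y, Bf x y = Bf y x;
  lv_star : forall x, Bf x (star x) = En x;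
  lv_En_star : forall x, En (star x) = 2 * En x;
  lv_CS : forall x y, Bf x y ^+ 2 <= En x * En y;
  lv_ge0 : forall x, 0 <= En x;
  lv_En0 : forall x, En x = 0 -> x = 0;
  lv_EnB : forall x y, En (x - y) <= 2 * En x + 2 * En y;
  lv_linC : lin C;
  lv_symC : symmetric sp C;
  lv_c1 : 0 < c1;
  lv_c2 : 0 < c2;
  lv_C1 : forall x, c1 * En x <= sp (C x) x;
  lv_C2 : forall x, sp (C x) x <= c2 * En x }.

Definition form_op (R : realType) (V : lmodType R) (sp Bf : V -> V -> R) x :=
  xget 0 [set y | forall z, sp y z = Bf x z].

Section Level.
Variables (R : realType) (V : lmodType R) (sp Bf : V -> V -> R) (En : V -> R)
  (star : V -> V) (C : V -> V) (c1 c2 : R).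
Hypothesis lv : level sp Bf En star C c1 c2.
Let eu := lv_eu lv.
Local Notation B := (form_op sp Bf).

Lemma op_invK (f : V -> V) y : lin f -> (forall x, f x = 0 -> x = 0) -> f (op_inv f y) = y.
Proof.
move=> lf injf; rewrite /op_inv.
have [x fx] := lin_surj eu lf injf y.
exact: (@xgetPex _ 0 [set x | f x = y] (ex_intro _ x fx)).
Qed.

Lemma form_opE x z : sp (B x) z = Bf x z.
Proof.
have [|y hy] := @riesz _ _ _ eu (Bf x).
  by move=> a u v; rewrite !(lv_sym lv x) (lv_lin lv).
exact: (@xgetPex _ 0 [set y | forall z, sp y z = Bf x z] (ex_intro _ y hy)).
Qed.

Lemma form_op_lin : lin B.
Proof.
move=> a x y; apply: (sp_ext eu) => z.
by rewrite (spDl eu) (spZl eu) !form_opE (lv_lin lv).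
Qed.

Lemma form_op_sym : symmetric sp B.
Proof. by move=> x y; rewrite form_opE (spC eu) form_opE (lv_sym lv). Qed.

Lemma form_op_inj x : B x = 0 -> x = 0.
Proof.
move=> Bx; apply: (lv_En0 lv); rewrite -(lv_star lv) -form_opE Bx.
by rewrite -(scale0r 0) (spZl eu) mul0r.
Qed.

Let C_inj x : C x = 0 -> x = 0.
Proof.
move=> Cx; apply: (lv_En0 lv); apply/eqP; rewrite eq_le (lv_ge0 lv) andbT.
have := lv_C1 lv x; rewrite Cx -[X in sp X](scale0r 0) (spZl eu) mul0r pmulr_rle0//.
exact: (lv_c1 lv).
Qed.

Let CK y : C (op_inv C y) = y.
Proof. exact: op_invK (lv_linC lv) C_inj. Qed.

Lemma form_opK y : B (op_inv B y) = y.
Proof. exact: op_invK form_op_lin form_op_inj. Qed.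

Lemma op_invC_lin : lin (op_inv C).
Proof.
by move=> a x y; apply: (lin_inj (lv_linC lv) C_inj); rewrite CK (lv_linC lv) !CK.
Qed.

Lemma op_invC_sym : symmetric sp (op_inv C).
Proof. by move=> x y; rewrite -{2}(CK x) (lv_symC lv) CK. Qed.

Definition normal_op x := B (op_inv C (B x)).
Local Notation A := normal_op.

Lemma normal_op_lin : lin A.
Proof. by move=> a x y; rewrite /A form_op_lin op_invC_lin form_op_lin. Qed.

Lemma normal_op_sym : symmetric sp A.
Proof. by move=> x y; rewrite /A form_op_sym op_invC_sym form_op_sym. Qed.

(** With u = C^-1 B x, the energy of x for the normal operator is both Bf x u and
    the C-norm of u. *)
Lemma normal_op_upper x : c1 * sp (A x) x <= En x.
Proof.
pose u := op_inv C (B x).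
have qE : sp (A x) x = sp (C u) u by rewrite /A form_op_sym -/u CK (spC eu).
have q2 : sp (A x) x = Bf x u by rewrite qE CK form_opE.
have cs := lv_CS lv x u; have h1 := lv_C1 lv u; have hx := lv_ge0 lv x; have hu := lv_ge0 lv u.
have c10 := lv_c1 lv.
rewrite -q2 in cs; rewrite -qE in h1; clear q2 qE.
have [q0|q0] := ltP 0 (sp (A x) x); last first.
  by rewrite (le_trans _ hx)// pmulr_rle0.
rewrite -(ler_pM2r q0) -mulrA -expr2 (le_trans (ler_wpM2l (ltW c10) cs))//.
by rewrite mulrCA ler_wpM2l.
Qed.

(** The energy Bf x (star x) is the pairing of u = C^-1 B x with star x for the
    form of C, to which the Cauchy-Schwarz inequality applies. *)
Lemma normal_op_lower x : En x <= 2 * c2 * sp (A x) x.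
Proof.
pose u := op_inv C (B x).
have qE : sp (A x) x = sp (C u) u by rewrite /A form_op_sym -/u CK (spC eu).
have pC y : 0 <= sp (C y) y.
  by rewrite (le_trans _ (lv_C1 lv y))// mulr_ge0 ?(lv_ge0 lv)// ltW// (lv_c1 lv).
have cs := psd_CS eu u (star x) (lv_linC lv) (lv_symC lv) pC.
have := lv_C2 lv (star x); rewrite (lv_En_star lv) => h.
rewrite -qE {1}/u CK form_opE (lv_star lv) in cs.
have [e0|e0] := ltP 0 (En x); last first.
  by rewrite (le_trans e0)// qE mulr_ge0// mulr_ge0// ltW// (lv_c2 lv).
rewrite -(ler_pM2r e0) -expr2 (le_trans cs)//.
have q0 : 0 <= sp (A x) x by rewrite qE.
by rewrite (le_trans (ler_wpM2l q0 h))// le_eqVlt; apply/orP; left; apply/eqP; ring.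
Qed.

Lemma normal_op_ge0 x : 0 <= sp (A x) x.
Proof.
have := normal_op_lower x; have := lv_ge0 lv x => h0 h; have c20 := lv_c2 lv.
by have := le_trans h0 h; rewrite pmulr_rge0// mulr_gt0.
Qed.

Variable l : R.
Definition post x := x - l *: A x.
Definition pre x := x - l *: op_inv C (B (B x)).

Lemma pre_lin : lin pre.
Proof.
move=> a x y; rewrite /pre form_op_lin form_op_lin op_invC_lin.
by rewrite !scalerDr scalerN !scalerA (mulrC l a) opprD addrACA -scalerA.
Qed.

Lemma post_lin : lin post. Proof. exact: relax_lin normal_op_lin _. Qed.

Lemma pre_post n x y : Bf (iter n pre x) y = Bf x (iter n post y).
Proof.
suff h u v : Bf (pre u) v = Bf u (post v).
  by elim: n x y => //= n IH x y; rewrite h IH -iterSr.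
rewrite -!form_opE /pre /post (linB _ _ form_op_lin) (linZ _ _ form_op_lin).
rewrite (spDl eu) (spDr eu) (spNl eu) (spNr eu) (spZl eu) (spZr eu).
by rewrite -[B (op_inv C _)]/(A (B u)) normal_op_sym.
Qed.

End Level.

Section TwoLevel.
Variables (R : realType) (V W : lmodType R).
Variables (sp Bf : V -> V -> R) (En : V -> R) (star C : V -> V).
Variables (spw Bw : W -> W -> R) (Ew : W -> R) (starw Cw : W -> W) (c1 c2 : R).
Hypothesis lv : level sp Bf En star C c1 c2.
Hypothesis lw : level spw Bw Ew starw Cw c1 c2.
Variable I : W -> V.
Hypotheses (lI : lin I) (BI : forall y z, Bw y z = Bf (I y) (I z)).
Hypothesis (EI : forall y, Ew y = En (I y)).
Let eu := lv_eu lv.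
Let euw := lv_eu lw.
Local Notation A := (normal_op sp Bf C).
Local Notation Aw := (normal_op spw Bw Cw).

Definition coarse_form_proj x := xget 0 [set y | forall z, Bw y z = Bf x (I z)].
Definition coarse_sp_proj x := xget 0 [set y | forall z, spw y z = sp x (I z)].
Local Notation P := coarse_form_proj.
Local Notation Q := coarse_sp_proj.

Lemma coarse_sp_projE x z : spw (Q x) z = sp x (I z).
Proof.
have [|y hy] := @riesz _ _ _ euw (fun z => sp x (I z)).
  by move=> a u v; rewrite lI (spDr eu) (spZr eu).
exact: (@xgetPex _ 0 [set y | forall z, spw y z = sp x (I z)] (ex_intro _ y hy)).
Qed.

Lemma coarse_form_projE x z : Bw (P x) z = Bf x (I z).
Proof.
have [|y hy] := @riesz _ _ _ euw (fun z => Bf x (I z)).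
  by move=> a u v; rewrite lI !(lv_sym lv x) (lv_lin lv).
have [y' hy'] := lin_surj euw (form_op_lin lw) (@form_op_inj _ _ _ _ _ _ _ _ _ lw) y.
apply: (@xgetPex _ 0 [set y | forall z, Bw y z = Bf x (I z)]); exists y' => z' /=.
by rewrite -(form_opE lw) hy'.
Qed.

Lemma coarse_form_proj_lin : lin P.
Proof.
move=> a x y; apply: (lin_inj (form_op_lin lw) (@form_op_inj _ _ _ _ _ _ _ _ _ lw)).
apply: (sp_ext euw) => z.
by rewrite (form_op_lin lw) (spDl euw) (spZl euw) !(form_opE lw) !coarse_form_projE (lv_lin lv).
Qed.

(** Solving the coarse problem for the restricted residual of an error e gives
    the Ritz projection of e. *)
Lemma coarse_residual e : op_inv (form_op spw Bw) (Q (form_op sp Bf e)) = P e.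
Proof.
apply: (lin_inj (form_op_lin lw) (@form_op_inj _ _ _ _ _ _ _ _ _ lw)).
rewrite (form_opK lw); apply: (sp_ext euw) => z.
by rewrite coarse_sp_projE (form_opE lv) (form_opE lw) coarse_form_projE.
Qed.

Definition coarse_res x := x - I (P x).
Local Notation D := coarse_res.

Lemma coarse_res_orth x w : Bf (D x) (I w) = 0.
Proof.
rewrite /D addrC -scaleN1r (lv_lin lv) -BI coarse_form_projE.
by rewrite mulN1r addNr.
Qed.

(** The flip of the projection is a coarse test function, so stability holds for
    the indefinite form. *)
Lemma coarse_form_proj_le x : Ew (P x) <= 2 * En x.
Proof.
have := lv_CS lv x (I (starw (P x))).
rewrite -coarse_form_projE (lv_star lw) -EI (lv_En_star lw) => h.
have [e0|e0] := ltP 0 (Ew (P x)); last by rewrite (le_trans e0)// mulr_ge0// (lv_ge0 lv).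
by rewrite -(ler_pM2r e0) -expr2 (le_trans h)// mulrCA mulrA.
Qed.

Lemma coarse_res_le x : En (D x) <= 6 * En x.
Proof.
have := lv_EnB lv x (I (P x)); rewrite -EI -/(D x).
have := coarse_form_proj_le x; lra.
Qed.

Lemma coarse_res_sym x y : Bf (D x) y = Bf x (D y).
Proof.
have h : Bf x (I (P y)) = Bf (I (P x)) y.
  by rewrite -coarse_form_projE (lv_sym lw) coarse_form_projE (lv_sym lv).
rewrite /D addrC -scaleN1r (lv_lin lv) mulN1r -h (lv_sym lv x (y - _)).
by rewrite (addrC y) -scaleN1r (lv_lin lv) mulN1r !(lv_sym lv x).
Qed.

Variable l : R.
Local Notation post := (post sp Bf C l).
Local Notation pre := (pre sp Bf C l).

Definition two_level m1 m2 x := iter m2 post (D (iter m1 pre x)).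

(** Both smoothing steps only see errors without coarse component, on which the
    smoother is effective: directly for the post-smoother, and by duality for
    the pre-smoother. *)
Lemma two_level_bound (r : nat -> R) m1 m2 :
  (forall m, 0 <= r m) ->
  (forall m z, (forall w, Bf z (I w) = 0) ->
     sp (A (iter m post z)) (iter m post z) <= r m * En z) ->
  forall x, sp (A (two_level m1 m2 x)) (two_level m1 m2 x) <=
    48 * c2 ^+ 2 * (r m1 * r m2) * sp (A x) x.
Proof.
move=> r0 hr x; rewrite /two_level.
pose z := D (iter m1 pre x); rewrite -/z.
have h1 := hr m2 z (coarse_res_orth _).
have c20 := lv_c2 lv.
suff h2 : En z <= 24 * c2 * r m1 * En x.
  have h3 := normal_op_lower lv x.
  have k1 : 0 <= 24 * c2 * r m1 by apply: mulr_ge0 => //; apply: mulr_ge0 => //; exact: ltW.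
  have := ler_wpM2l (r0 m2) (le_trans h2 (ler_wpM2l k1 h3)) => h4.
  rewrite (le_trans h1)// (le_trans h4)// le_eqVlt; apply/orP; left; apply/eqP.
  by rewrite expr2; ring.
pose w := D (star z).
have e1 : En z = Bf x (iter m1 post w).
  by rewrite -(lv_star lv) {1}/z coarse_res_sym (pre_post lv).
have h2 := lv_CS lv x (iter m1 post w); rewrite -e1 in h2.
have h3 := normal_op_lower lv (iter m1 post w).
have h4 := hr m1 w (coarse_res_orth _).
have h5 := coarse_res_le (star z); rewrite -/w (lv_En_star lv) in h5.
have h6 : En (iter m1 post w) <= 24 * c2 * r m1 * En z.
  have k1 : 0 <= 2 * c2 by apply: mulr_ge0 => //; exact: ltW.
  rewrite (le_trans h3)// (le_trans (ler_wpM2l k1 (le_trans h4 (ler_wpM2l (r0 m1) h5))))//.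
  by rewrite le_eqVlt; apply/orP; left; apply/eqP; ring.
have k1 : 0 <= 24 * c2 * r m1 by apply: mulr_ge0 => //; apply: mulr_ge0 => //; exact: ltW.
have [e0|e0] := ltP 0 (En z); last by rewrite (le_trans e0)// mulr_ge0// (lv_ge0 lv).
rewrite -(ler_pM2r e0) -expr2 (le_trans h2)//.
by rewrite (le_trans (ler_wpM2l (lv_ge0 lv x) h6))// le_eqVlt; apply/orP; left; apply/eqP; ring.
Qed.

Hypothesis post_le : forall x, sp (A (post x)) (post x) <= sp (A x) x.

Let iter_post_le m x : sp (A (iter m post x)) (iter m post x) <= sp (A x) x.
Proof. by elim: m => //= m IH; rewrite (le_trans (post_le _)). Qed.

(** The pre-smoother is not a contraction in the energy, but followed by the
    projection it is bounded, by duality with the post-smoother. *)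
Lemma coarse_correction_bound (e : R) (E : W -> W) m1 m2 :
  0 <= e -> (forall y, spw (Aw (E y)) (E y) <= e * spw (Aw y) y) ->
  forall x, let y := iter m2 post (I (E (P (iter m1 pre x)))) in
    sp (A y) y <= 16 * (c2 / c1) ^+ 3 * e * sp (A x) x.
Proof.
move=> e0 hE x /=.
have c10 := lv_c1 lv; have c20 := lv_c2 lv.
have c22 : 0 <= 2 * c2 by rewrite mulr_ge0// ltW.
pose y := P (iter m1 pre x); rewrite -/y.
have h0 := iter_post_le m2 (I (E y)).
have h1 := normal_op_upper lv (I (E y)); rewrite -EI in h1.
have h2 := normal_op_lower lw (E y).
have h3 := hE y.
have h4 := normal_op_upper lw y.
have h5 : c1 * Ew y <= 4 * c2 * En x.
  have := lv_CS lv x (iter m1 post (I (starw y))).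
  rewrite -(pre_post lv) -coarse_form_projE (lv_star lw) -/y => k1.
  have k2 := normal_op_lower lv (iter m1 post (I (starw y))).
  have k3 := iter_post_le m1 (I (starw y)).
  have k4 := normal_op_upper lv (I (starw y)); rewrite -EI (lv_En_star lw) in k4.
  have k5 : c1 * En (iter m1 post (I (starw y))) <= 4 * c2 * Ew y.
    rewrite (le_trans (ler_wpM2l (ltW c10) (le_trans k2 (ler_wpM2l c22 k3))))//.
    rewrite mulrCA (le_trans (ler_wpM2l c22 k4))// le_eqVlt.
    by apply/orP; left; apply/eqP; ring.
  have [y0|y0] := ltP 0 (Ew y); last first.
    rewrite (@le_trans _ _ 0)//; first by rewrite pmulr_rle0.
    by rewrite mulr_ge0 ?(lv_ge0 lv)// mulr_ge0// ltW.
  rewrite -(ler_pM2r y0) -[leLHS]mulrA -expr2 (le_trans (ler_wpM2l (ltW c10) k1))//.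
  rewrite mulrCA (le_trans (ler_wpM2l (lv_ge0 lv x) k5))// le_eqVlt.
  by apply/orP; left; apply/eqP; ring.
have h6 := normal_op_lower lv x.
have a1 := le_trans h1 (le_trans h2 (ler_wpM2l c22 h3)).
have ce : 0 <= 2 * c2 * e by rewrite mulr_ge0.
have a2 := ler_wpM2l ce h4; have a3 := ler_wpM2l ce h5.
have c8 : 0 <= 2 * c2 * e * (4 * c2) by rewrite mulr_ge0// mulr_ge0// ltW.
have a4 := ler_wpM2l c8 h6.
have a0 := ler_wpM2l (ltW c10) h0.
have c13 : 0 < c1 ^+ 3 by rewrite exprn_gt0.
rewrite -(ler_pM2l c13).
have -> : c1 ^+ 3 * (16 * (c2 / c1) ^+ 3 * e * sp (A x) x) = 2 * c2 * e * (4 * c2) * (2 * c2 * sp (A x) x).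
  by field; rewrite gt_eqF.
apply: le_trans a4; rewrite -[leRHS]mulrA; apply: le_trans a3.
rewrite [leRHS]mulrCA (exprS c1 2) -[leLHS]mulrA ler_pM2l//; apply: le_trans a2.
rewrite [leRHS]mulrCA expr2 -[leLHS]mulrA ler_pM2l//.
by apply: (le_trans a0); apply: (le_trans a1); rewrite mulrA.
Qed.

End TwoLevel.

(** * The saddle point form on pairs *)

Section Pairs.
Variables (R : realType) (X : lmodType R) (ip m a : X -> X -> R) (b : R).

Definition bilin_psd (f : X -> X -> R) :=
  [/\ forall z k x y, f (k *: x + y) z = k * f x z + f y z,
      forall x y, f x y = f y x & forall x, 0 <= f x x].

Section Form.
Variable f : X -> X -> R.
Hypothesis bf : bilin_psd f.

Lemma formDl x y z : f (x + y) z = f x z + f y z.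
Proof. by have [l _ _] := bf; rewrite -[x in LHS]scale1r l mul1r. Qed.

Lemma form0l z : f 0 z = 0.
Proof. by apply: (addrI (f 0 z)); rewrite -formDl !addr0. Qed.

Lemma formZl k x z : f (k *: x) z = k * f x z.
Proof. by have [l _ _] := bf; rewrite -[_ *: _]addr0 l form0l addr0. Qed.

Lemma formNl x z : f (- x) z = - f x z.
Proof. by rewrite -scaleN1r formZl mulN1r. Qed.

Lemma formC x y : f x y = f y x. Proof. by case: bf. Qed.

Lemma formDr x y z : f z (x + y) = f z x + f z y.
Proof. by rewrite !(formC z) formDl. Qed.

Lemma formZr k x z : f z (k *: x) = k * f z x.
Proof. by rewrite !(formC z) formZl. Qed.

Lemma formNr x z : f z (- x) = - f z x.
Proof. by rewrite !(formC z) formNl. Qed.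

Definition formE := (formDl, formDr, formNl, formNr, formZl, formZr).

Lemma form_CS x y : f x y ^+ 2 <= f x x * f y y.
Proof.
have [_ _ p] := bf; apply: quad_CS => // t.
by have := p (x - t *: y); rewrite !formE (formC y x); lra.
Qed.

End Form.

Hypotheses (eu : euclidean ip) (bm : bilin_psd m) (ba : bilin_psd a) (b0 : 0 < b).
Hypothesis m0 : forall x, m x x = 0 -> x = 0.

Local Notation X2 := (X * X)%type.

Definition pair_sp (x y : X2) : R := ip x.1 y.1 + ip x.2 y.2.
Definition pair_form (x y : X2) : R :=
  b * a x.1 y.1 - m x.2 y.1 - m x.1 y.2 - b * a x.2 y.2.
Definition pair_energy (x : X2) : R := m x.1 x.1 + b * a x.1 x.1 + (m x.2 x.2 + b * a x.2 x.2).
Definition pair_star (x : X2) : X2 := (x.1 - x.2, - (x.1 + x.2)).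

Lemma pair_euclidean : euclidean pair_sp.
Proof.
have [N [c [c' [k [lc cK cK' k0 h]]]]] := eu.
exists (N + N)%N, (fun x : X2 => row_mx (c x.1) (c x.2)), (fun u => (c' (lsubmx u), c' (rsubmx u))), k.
split => //.
- by move=> r x y /=; rewrite !lc scale_row_mx add_row_mx.
- by move=> [x y] /=; rewrite row_mxKl row_mxKr !cK.
- by move=> u /=; rewrite !cK' hsubmxK.
- move=> x y; rewrite /pair_sp !h -mulrDr; congr (_ * _).
  rewrite /dotp big_split_ord/=; congr (_ + _); apply: eq_bigr => i _.
    by rewrite !row_mxEl.
  by rewrite !row_mxEr.
Qed.

Lemma pair_energy_ge0 x : 0 <= pair_energy x.
Proof.
have [_ _ pm] := bm; have [_ _ pa] := ba.
by rewrite /pair_energy; apply: addr_ge0; apply: addr_ge0 => //; apply: mulr_ge0 => //; exact: ltW.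
Qed.

Lemma pair_energy0 x : pair_energy x = 0 -> x = 0.
Proof.
have [_ _ pm] := bm; have [_ _ pa] := ba; case: x => [x1 x2] /eqP.
rewrite /pair_energy /= paddr_eq0 ?addr_ge0 ?mulr_ge0 ?(ltW b0)//.
by rewrite !paddr_eq0 ?mulr_ge0 ?(ltW b0)// => /andP[/andP[/eqP/m0 -> _] /andP[/eqP/m0 -> _]].
Qed.

Lemma pair_formC x y : pair_form x y = pair_form y x.
Proof.
by rewrite /pair_form (formC ba x.1) (formC ba x.2) (formC bm x.2) (formC bm x.1); ring.
Qed.

Lemma pair_form_star x : pair_form x (pair_star x) = pair_energy x.
Proof.
case: x => x1 x2; rewrite /pair_form /pair_energy /pair_star /= !(formE bm, formE ba).
by rewrite (formC bm x2 x1) (formC ba x2 x1); ring.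
Qed.

Lemma pair_formDl y k x x' : pair_form (k *: x + x') y = k * pair_form x y + pair_form x' y.
Proof.
move: y x x' => [y1 y2] [x1 x2] [u1 u2].
by rewrite /pair_form /= !(formE bm, formE ba); ring.
Qed.

(** The four terms of the form are estimated together, which gives the constant
    one. *)
Lemma pair_CS x y : pair_form x y ^+ 2 <= pair_energy x * pair_energy y.
Proof.
have [_ _ pm] := bm; have [_ _ pa] := ba.
apply: quad_CS => [|t]; first exact: pair_energy_ge0.
move: x y => [x1 x2] [y1 y2].
have k1 := mulr_ge0 (ltW b0) (pa (x1 - t *: y1)); have k2 := pm (x2 + t *: y1).
have k3 := pm (x1 + t *: y2); have k4 := mulr_ge0 (ltW b0) (pa (x2 + t *: y2)).
have := addr_ge0 (addr_ge0 k1 k2) (addr_ge0 k3 k4); congr (0 <= _).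
rewrite /pair_form /pair_energy /= !(formE bm, formE ba).
by rewrite (formC bm y1 x2) (formC bm y2 x1) (formC ba y1 x1) (formC ba y2 x2); ring.
Qed.

Lemma pair_level (L : X -> X) c1 c2 : 0 < c1 -> 0 < c2 -> lin L -> symmetric ip L ->
  (forall x, c1 * (m x x + b * a x x) <= ip (L x) x) ->
  (forall x, ip (L x) x <= c2 * (m x x + b * a x x)) ->
  level pair_sp pair_form pair_energy pair_star (fun x => (L x.1, L x.2)) c1 c2.
Proof.
move=> c10 c20 lL sL h1 h2.
have [_ _ pm] := bm; have [_ _ pa] := ba.
split=> //.
- exact: pair_euclidean.
- exact: pair_formDl.
- exact: pair_formC.
- exact: pair_form_star.
- move=> [x1 x2]; rewrite /pair_form /pair_energy /pair_star /= !(formE bm, formE ba).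
  by rewrite (formC bm x2 x1) (formC ba x2 x1); ring.
- exact: pair_CS.
- exact: pair_energy_ge0.
- exact: pair_energy0.
- move=> x y; have := pair_energy_ge0 (x + y); case: x y => [x1 x2] [y1 y2].
  rewrite /pair_energy /= !(formE bm, formE ba).
  by rewrite (formC bm y1 x1) (formC bm y2 x2) (formC ba y1 x1) (formC ba y2 x2); lra.
- by move=> k x y /=; rewrite !lL.
- by move=> x y; rewrite /pair_sp /= !sL.
- move=> [x1 x2]; rewrite /pair_energy /pair_sp /= mulrDr; exact: lerD.
- move=> [x1 x2]; rewrite /pair_energy /pair_sp /= mulrDr; exact: lerD.
Qed.

End Pairs.

(** * Approximation property of the saddle point form *)

Section PairDuality.
Variables (R : realType) (X Y : lmodType R) (ip m a : X -> X -> R) (ipy : Y -> Y -> R) (b g : R).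
Hypotheses (eu : euclidean ip) (euy : euclidean ipy).
Hypotheses (bm : bilin_psd m) (ba : bilin_psd a) (b0 : 0 < b) (g0 : 0 <= g).
Hypothesis m0 : forall x, m x x = 0 -> x = 0.
Variable J : Y -> X.
Hypotheses (lJ : lin J) (aJ0 : forall y, a (J y) (J y) = 0 -> y = 0).
Hypothesis poisson : forall e, (forall w, a e (J w) = 0) -> m e e <= g * a e e.

Local Notation Bf := (pair_form m a b).
Local Notation En := (pair_energy m a b).

Let energy_projection x : exists w, forall v, a (x - J w) (J v) = 0.
Proof.
have [||||w hw] := @form_solve _ _ _ euy (fun y z => a (J y) (J z)) (fun v => a x (J v)).
- by move=> z k u v; rewrite lJ (formDl ba) (formZl ba).
- by move=> z k u v; rewrite lJ (formDr ba) (formZr ba).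
- by move=> u h; apply: aJ0; rewrite h.
- by move=> k u v; rewrite lJ (formDr ba) (formZr ba).
by exists w => v; rewrite (formDl ba) (formNl ba) hw subrr.
Qed.

(** Duality: [w] solves the fine problem with the error [z] as right-hand side,
    so that the norm of [z] is the form of [z] with the part of [w] that the
    coarse space misses; each component of that part is controlled by the
    Poisson problem it solves. *)
Lemma pair_duality (z : X * X) : (forall v : Y * Y, Bf z (J v.1, J v.2) = 0) ->
  m z.1 z.1 + m z.2 z.2 <= 6 * g * (g + b) / b ^+ 2 * En z.
Proof.
move=> hz.
have [_ _ pm] := bm; have [_ _ pa] := ba.
have idl : lin (fun x : X => x) by [].
have pE x : 0 <= En x by exact: pair_energy_ge0.
have [Z ZE] : exists Z, Z = m z.1 z.1 + m z.2 z.2 by eexists.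
have Z0 : 0 <= Z by rewrite ZE addr_ge0.
have BfC := pair_formC b bm ba; have BfD := pair_formDl b bm ba.
have Bstar := pair_form_star b bm ba.
have [||||w hw] := @form_solve _ _ _ (pair_euclidean eu) Bf (fun v => m v.1 z.1 + m v.2 z.2).
- exact: BfD.
- by move=> y k x u; rewrite !(BfC y) BfD.
- by move=> x h; apply: (pair_energy0 bm ba b0 m0); rewrite -Bstar h.
- by move=> k [x1 x2] [u1 u2] /=; rewrite !(formE bm); ring.
have cs2 u1 u2 v1 v2 : (m u1 v1 + m u2 v2) ^+ 2 <= (m u1 u1 + m u2 u2) * (m v1 v1 + m v2 v2).
  apply: quad_CS => [|t]; first exact: addr_ge0.
  have := addr_ge0 (pm (u1 - t *: v1)) (pm (u2 - t *: v2)); rewrite !(formE bm).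
  by rewrite (formC bm v1 u1) (formC bm v2 u2); lra.
have Ew : En w <= 2 * Z.
  have := cs2 (w.1 - w.2) (- (w.1 + w.2)) z.1 z.2.
  have := hw (pair_star w); rewrite Bstar /pair_star /= => <-.
  have -> : m (w.1 - w.2) (w.1 - w.2) + m (- (w.1 + w.2)) (- (w.1 + w.2)) = 2 * (m w.1 w.1 + m w.2 w.2).
    by rewrite !(formE bm) (formC bm w.2 w.1); ring.
  have le1 : m w.1 w.1 + m w.2 w.2 <= En w.
    rewrite /pair_energy; have := mulr_ge0 (ltW b0) (pa w.1); have := mulr_ge0 (ltW b0) (pa w.2); lra.
  rewrite -ZE => h; have [e0|e0] := ltP 0 (En w); last by rewrite (le_trans e0)// mulr_ge0.
  rewrite -(ler_pM2r e0) -expr2 (le_trans h)// -!mulrA ler_pM2l//.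
  by rewrite mulrC ler_wpM2l.
have [w1 hw1] := energy_projection w.1; have [w2 hw2] := energy_projection w.2.
pose e1 := w.1 - J w1; pose e2 := w.2 - J w2; rewrite -/e1 in hw1; rewrite -/e2 in hw2.
have ZB : Z = Bf z (e1, e2).
  rewrite ZE -(hw z) BfC.
  have := hz (w1, w2) => /= e.
  transitivity (Bf z w - Bf z (J w1, J w2)); first by rewrite e subr0.
  by rewrite /pair_form /e1 /e2 /= !(formE bm, formE ba); ring.
(* each component solves a Poisson problem, tested with the error itself *)
have q1 : b * a e1 e1 = m e1 (z.1 + w.2).
  have := hw (e1, 0); rewrite /pair_form /=.
  rewrite (formC bm w.1 0) (formC ba w.2 0) !(form0l bm) !(form0l ba) (formDr bm).
  have -> : a w.1 e1 = a e1 e1 by rewrite (formC ba) {3}/e1 (formDr ba) (formNr ba) hw1 subr0.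
  by rewrite (formC bm w.2 e1); lra.
have q2 : b * a e2 e2 = - m e2 (z.2 + w.1).
  have := hw (0, e2); rewrite /pair_form /=.
  rewrite (formC ba w.1 0) (formC bm w.2 0) !(form0l bm) !(form0l ba) (formDr bm).
  have -> : a w.2 e2 = a e2 e2 by rewrite (formC ba) {3}/e2 (formDr ba) (formNr ba) hw2 subr0.
  by rewrite (formC bm w.1 e2); lra.
have bound e y : (forall v, a e (J v) = 0) -> (b * a e e) ^+ 2 <= m e e * m y y ->
    b ^+ 2 * a e e <= g * m y y.
  move=> he h; have := poisson he => h2.
  have [a0|a0] := ltP 0 (a e e); last first.
    rewrite (@le_trans _ _ 0)//; last by rewrite mulr_ge0.
    by rewrite pmulr_rle0// exprn_gt0.
  rewrite -(ler_pM2r a0) -mulrA -expr2 -exprMn (le_trans h)//.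
  by rewrite mulrAC ler_wpM2r.
have B1 : b ^+ 2 * a e1 e1 <= g * m (z.1 + w.2) (z.1 + w.2).
  by apply: bound => //; rewrite q1; exact: form_CS bm _ _.
have B2 : b ^+ 2 * a e2 e2 <= g * m (z.2 + w.1) (z.2 + w.1).
  by apply: bound => //; rewrite q2 sqrrN; exact: form_CS bm _ _.
have [S SE] : exists S, S = a e1 e1 + a e2 e2 by eexists.
have S6 : b ^+ 2 * S <= 6 * g * Z.
  have k1 : m (z.1 + w.2) (z.1 + w.2) <= 2 * (m z.1 z.1 + m w.2 w.2).
    have := pm (z.1 - w.2); rewrite !(formE bm) (formC bm w.2 z.1); lra.
  have k2 : m (z.2 + w.1) (z.2 + w.1) <= 2 * (m z.2 z.2 + m w.1 w.1).
    have := pm (z.2 - w.1); rewrite !(formE bm) (formC bm w.1 z.2); lra.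
  have k3 : m w.1 w.1 + m w.2 w.2 <= 2 * Z.
    apply: le_trans Ew; rewrite /pair_energy.
    have := mulr_ge0 (ltW b0) (pa w.1); have := mulr_ge0 (ltW b0) (pa w.2); lra.
  have k4 : m (z.1 + w.2) (z.1 + w.2) + m (z.2 + w.1) (z.2 + w.1) <= 6 * Z by lra.
  have := ler_wpM2l g0 k4; rewrite SE mulrDr => k5; lra.
have Ee : En (e1, e2) <= (g + b) * S.
  have p1 := poisson hw1; have p2 := poisson hw2.
  by rewrite /pair_energy /= SE; lra.
have cs := pair_CS bm ba b0 z (e1, e2); rewrite -ZB in cs.
rewrite -ZE.
have c0 : 0 <= 6 * g * (g + b) / b ^+ 2.
  apply: divr_ge0; last exact: sqr_ge0.
  by apply: mulr_ge0; [exact: mulr_ge0|rewrite addr_ge0// ltW].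
have [Zp|Zn] := ltP 0 Z; last by rewrite (le_trans Zn)// mulr_ge0.
rewrite -(ler_pM2r Zp) -expr2 (le_trans cs)// [X in X * Z]mulrC -[leRHS]mulrA ler_wpM2l//.
rewrite (le_trans Ee)//.
have gb : 0 <= g + b by rewrite addr_ge0// ltW.
have b2 : 0 < b ^+ 2 by rewrite exprn_gt0.
have := ler_wpM2l gb S6 => k.
rewrite -(ler_pM2l b2) (le_trans _ (le_trans k _))//; first by rewrite mulrCA.
by rewrite le_eqVlt; apply/orP; left; apply/eqP; field; rewrite gt_eqF.
Qed.

End PairDuality.

(** * The finite element space as a Euclidean space *)

Section FESpace.
Variables (R : realType) (d : nat).
Hypotheses (d_gt0 : (0 < d)%N) (d_le3 : (d <= 3)%N).
Variables (Hs : seq ('rV[R]_d * R)).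
Hypothesis unitH : forall p, p \in Hs -> dotp p.1 p.1 = 1.
Hypotheses (uniqH : uniq Hs) (Hs_ne : Hs != [::]).
Variable x0 : 'rV[R]_d.
Hypothesis hx0 : polytope Hs x0.
Variable rho : R.
Hypothesis hrho : forall x, polytope Hs x -> enorm x <= rho.
Variables (sigma kappa : R).
Local Notation Om := (polytope Hs).

Let ne : Om !=set0. Proof. by exists x0. Qed.

Let rho_ge0 : 0 <= rho.
Proof. exact: le_trans (enorm_ge0 x0) (hrho hx0). Qed.

Let B_gt0 : 0 < rho + 1. Proof. by rewrite ltr_wpDl. Qed.
Let HB x : Om x -> cube 0 (rho + 1) x. Proof. exact: polytope_cube. Qed.

Section Mesh.
Variable M : seq 'M[R]_(d.+1, d).
Hypothesis triM : triangulation Om M.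
Hypotheses (shM : shape_regular sigma M) (quM : quasi_uniform kappa M).
Local Notation X := (P1 Om M).
Implicit Types u v w : X.

Let pa v : paffine Hs M v.
Proof. exact/(P1_paffine triM)/P1_funP. Qed.

Lemma P1_funD k u v x : P1_fun (k *: u + v) x = k * u x + v x.
Proof. by []. Qed.

Definition nodal_ip v w := mesh_size M ^+ d * \sum_(x <- interior_vertices Om M) v x * w x.

(** On a simplex the values at the vertices determine the function; those on
    the boundary vanish. *)
Lemma P1_ext v w : (forall x, x \in interior_vertices Om M -> v x = w x) -> v = w.
Proof.
move=> h; apply/val_inj/funext => x /=; have [zv av] := pa v; have [zw aw] := pa w.
case: (pselect (Om x)) => hx; last by rewrite zv// zw.
have [T TM Tx] := mesh_cover triM hx; rewrite (av T)// (aw T)//.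
apply: eq_bigr => j _; congr (_ * _).
case: (pselect (Om (row j T))) => hj; last by rewrite zv// zw.
apply: h; rewrite mem_filter; apply/andP; split; first exact/asboolP.
rewrite mem_undup; apply/allpairsP; exists (T, j); split => //=; exact: mem_enum.
Qed.

Lemma nodal_euclidean : euclidean nodal_ip.
Proof.
set s := interior_vertices Om M.
have us : uniq s by rewrite filter_uniq// undup_uniq.
have hm : 0 < mesh_size M ^+ d by rewrite exprn_gt0// (mesh_size_gt0 d_gt0 ne triM shM quM).
have interp (u : 'rV[R]_(size s)) : {v : X | forall i : 'I_(size s), v s`_i = u 0 i}.
  apply: cid.
  have [v [vP hv]] := nodal_interpolant unitH triM
    (fun x => \sum_(i < size s) (x == s`_i)%:R * u 0 i).
  exists (MkP1 vP) => i /=.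
  have [hi [T [j [TM ij]]]] := interior_verticesP (mem_nth 0 (ltn_ord i)).
  rewrite ij hv -?ij// (bigD1 i)//= eqxx mul1r big1 ?addr0// => k ki.
  by rewrite nth_uniq// eq_sym (inj_eq val_inj) (negPf ki) mul0r.
exists (size s), (fun v : X => \row_i v s`_i), (fun u : 'rV_(size s) => sval (interp u)), (mesh_size M ^+ d).
split => //.
- by move=> k u v; apply/rowP => i; rewrite !mxE.
- move=> v; apply: P1_ext => x xs; case: (interp _) => w /= hw.
  have xi : (index x s < size s)%N by rewrite index_mem.
  by have := hw (Ordinal xi); rewrite mxE /= nth_index.
- by move=> u; apply/rowP => i; rewrite mxE; case: (interp u).
- move=> v w; rewrite /nodal_ip /dotp; congr (_ * _).
  by rewrite (big_nth 0) big_mkord; apply: eq_bigr => i _; rewrite !mxE.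
Qed.

Lemma L2_psd : bilin_psd (fun v w => L2ip Om v w).
Proof.
have E v w : L2ip Om v w = J (fun x => v x * w x) by apply: L2ipE; have [z _] := pa v.
have aP v : adm v by exact: (paffine_adm unitH B_gt0 HB triM (pa v)).
split.
- move=> w k u v; rewrite !E.
  have am : adm (fun x => u x * w x) by apply: admM.
  rewrite -JZ// -JD; [|exact: admZ|exact: admM].
  by congr J; apply/funext => x; rewrite P1_funD; ring.
- by move=> v w; rewrite !E; congr J; apply/funext => x; rewrite mulrC.
- by move=> v; rewrite E; apply: J_ge0 => x; rewrite -expr2 sqr_ge0.
Qed.

Lemma pgradD k u v i x : pgrad M (P1_fun (k *: u + v)) i x = k * pgrad M u i x + pgrad M v i x.
Proof.
rewrite /pgrad mulr_sumr -big_split/=; apply: eq_bigr => T _.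
rewrite /slope !summxE (_ : k * _ = \1_(inner T) x * (k * \sum_j (u (row j T) *: bgrad T j) 0 i)); last by ring.
rewrite -mulrDr; congr (_ * _); rewrite mulr_sumr -big_split/=.
by apply: eq_bigr => j _; rewrite [LHS]mxE [X in X * _](_ : _ = k * u (row j T) + v (row j T))// !mxE; ring.
Qed.

Lemma grad_psd : bilin_psd (fun v w => gradL2ip Om v w).
Proof.
have E v w : gradL2ip Om v w = J (fun x => \sum_i pgrad M v i x * pgrad M w i x).
  exact: (gradL2ipE d_gt0 unitH B_gt0 HB triM triM (pa v) (pa w)).
have aP v i : adm (pgrad M v i) by exact: (adm_pgrad unitH HB triM v i).
have aS v w : adm (fun x => \sum_i pgrad M v i x * pgrad M w i x).
  by apply: adm_sum => i _; exact: admM.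
split.
- move=> w k u v; rewrite !E -JZ// -JD//; last exact: admZ.
  congr J; apply/funext => x; rewrite mulr_sumr -big_split/=.
  by apply: eq_bigr => i _; rewrite pgradD; ring.
- by move=> v w; rewrite !E; congr J; apply/funext => x; apply: eq_bigr => i _; rewrite mulrC.
- by move=> v; rewrite E; apply: J_ge0 => x; apply: sumr_ge0 => i _; rewrite -expr2 sqr_ge0.
Qed.

Let L2sq v : L2ip Om v v = J (fun x => v x ^+ 2).
Proof.
by have [z _] := pa v; rewrite L2ipE//; congr J; apply/funext => x; rewrite expr2.
Qed.

Lemma nodal_le_L2 v : nodal_ip v v <= d.+1%:R * nodal_const d sigma kappa * L2ip Om v v.
Proof. by rewrite L2sq; exact: (fe_lower d_gt0 unitH B_gt0 HB ne triM shM quM (pa v)). Qed.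

Lemma L2_le_nodal v : L2ip Om v v <= upper_const d sigma kappa * nodal_ip v v.
Proof. by rewrite L2sq; exact: (fe_upper d_gt0 unitH B_gt0 HB ne triM shM quM (pa v)). Qed.

Lemma grad_le_L2 v :
  gradL2ip Om v v <= inverse_const d sigma kappa * mesh_size M ^- 2 * L2ip Om v v.
Proof.
rewrite L2sq (gradL2ipE d_gt0 unitH B_gt0 HB triM triM (pa v) (pa v)).
exact: (fe_inverse d_gt0 unitH B_gt0 HB ne triM shM quM (pa v)).
Qed.

Lemma L2_def v : L2ip Om v v = 0 -> v = 0.
Proof.
move=> v0; apply: (sp_eq0 nodal_euclidean); apply/eqP; rewrite eq_le (sp_ge0 nodal_euclidean) andbT.
by rewrite (le_trans (nodal_le_L2 v))// v0 mulr0.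
Qed.

Lemma poisson_P1 M' (e : P1 Om M') : triangulation Om M' ->
  (forall w, gradL2ip Om e w = 0) ->
  L2ip Om e e <= interp_const d sigma kappa * mesh_size M ^+ 2 * gradL2ip Om e e.
Proof.
move=> triM' h; have pe : paffine Hs M' e by exact/(P1_paffine triM')/P1_funP.
have [z _] := pe; rewrite L2ipE//.
rewrite (_ : (fun x => _) = fun x => e x ^+ 2); last by apply/funext => x; rewrite expr2.
apply: (poisson_ap d_gt0 d_le3 unitH uniqH Hs_ne hx0 hrho triM shM quM triM' pe) => v vP.
exact: (h (MkP1 vP)).
Qed.

(** An element with vanishing energy is orthogonal to the whole space, so that
    it vanishes by the approximation property. *)
Lemma grad_def v : gradL2ip Om v v = 0 -> v = 0.
Proof.
move=> v0; apply: L2_def; apply/eqP; rewrite eq_le; have [_ _ ->] := L2_psd; rewrite andbT.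
have h : forall w : X, gradL2ip Om v w = 0.
  move=> w; have := form_CS grad_psd v w; rewrite v0 mul0r => h.
  by apply/eqP; rewrite -sqrf_eq0 eq_le h sqr_ge0.
by have := poisson_P1 triM h; rewrite v0 mulr0.
Qed.

End Mesh.

End FESpace.

(** * Smoothing rates on one level *)

Section Rates.
Variables (R : realType) (V : lmodType R) (sp Bf : V -> V -> R) (En : V -> R)
  (star C : V -> V) (c1 c2 : R).
Hypothesis lv : level sp Bf En star C c1 c2.
Let eu := lv_eu lv.
Local Notation A := (normal_op sp Bf C).
Local Notation post := (post sp Bf C).
Let lA : lin A. Proof. exact: normal_op_lin lv. Qed.
Let sA : symmetric sp A. Proof. exact: normal_op_sym lv. Qed.

Let trivial_energy x l m : ~~ `[< exists y : V, y != 0 >] ->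
  sp (A (iter m (post l) x)) (iter m (post l) x) = 0.
Proof.
move=> /asboolPn h; have -> : iter m (post l) x = 0.
  by apply/eqP/negPn/negP => n; apply: h; exists (iter m (post l) x).
by rewrite (lin0 lA) -(scale0r 0) (spZl eu) mul0r.
Qed.

(** With energy and mass comparable, the operator is well conditioned and the
    optimal damping contracts. *)
Lemma well_conditioned_contraction k1 k2 l : 0 < k1 -> 0 < k2 ->
  (forall x, sp x x <= k1 * En x) -> (forall x, En x <= k2 * sp x x) ->
  l = 2 / (lambda_min A + lambda_max A) ->
  forall x, sp (A (post l x)) (post l x) <=
    (k2 / c1 / (k2 / c1 + (c2 * k1)^-1)) ^+ 2 * sp (A x) x.
Proof.
move=> k10 k20 h1 h2 lE x.
have c10 := lv_c1 lv; have c20 := lv_c2 lv.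
have [|nt] := boolP `[< exists y : V, y != 0 >]; last first.
  by rewrite (trivial_energy x l 1 nt) mulr_ge0 ?sqr_ge0// (normal_op_ge0 lv).
move=> /asboolP ne; have [y y0] := ne.
have hM z : sp (A z) z <= (k2 / c1) * sp z z.
  rewrite mulrAC ler_pdivlMr// mulrC (le_trans (normal_op_upper lv z))// h2.
have hm z : (2 * c2 * k1)^-1 * sp z z <= sp (A z) z.
  rewrite ler_pdivrMl ?mulr_gt0// (le_trans (h1 z))// mulrAC [leRHS]mulrC ler_pM2l//.
  exact: normal_op_lower lv z.
have [hb bM] := lambda_maxP eu lA sA ne hM.
have [ha am] := lambda_minP eu lA sA ne hM hm.
move: lE hb bM ha am; move: (lambda_min A) (lambda_max A) => a b lE hb bM ha am.
have m0 : 0 < (2 * c2 * k1)^-1 by rewrite invr_gt0 !mulr_gt0.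
have a0 : 0 < a by exact: lt_le_trans am.
have ab : a <= b by rewrite -(ler_pM2r (sp_gt0 eu y0)) (le_trans (ha y)).
have ab0 : 0 < a + b by rewrite ltr_pwDl// (le_trans _ ab)// ltW.
rewrite (le_trans (relax_energy eu lA sA a0 ab lE ha hb x))//.
rewrite ler_wpM2r ?(normal_op_ge0 lv)//.
have q0 : 0 < k2 / c1 + (c2 * k1)^-1 by rewrite addr_gt0 ?divr_gt0// invr_gt0 mulr_gt0.
rewrite ler_pXn2r ?nnegrE//; last 2 first.
- by rewrite divr_ge0 ?subr_ge0// ltW.
- by rewrite divr_ge0// ?(ltW q0)// divr_ge0// ltW.
have e : (c2 * k1)^-1 = 2 * (2 * c2 * k1)^-1 by field; rewrite !gt_eqF.
rewrite e in q0 *; move: m0 bM am q0; move: (2 * c2 * k1)^-1 (k2 / c1) => m M m0 bM am q0.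
rewrite ler_pdivrMr// mulrAC ler_pdivlMr//.
have := ler_wpM2l (ltW m0) bM; have M0 : 0 <= M by rewrite (le_trans _ bM)// (le_trans _ ab)// ltW.
have := ler_wpM2l M0 am; have := mulr_gt0 a0 m0; lra.
Qed.

(** With this damping the spectrum is scaled into the unit interval only; the
    rate comes from the approximation property, which bounds the mass of the
    initial error by its energy.  The trivial space is allowed for, because a
    spectral bound says nothing about the sign of the damping there. *)
Lemma damped_rate l k : 0 < l^-1 \/ (forall x : V, x = 0) -> 0 <= k ->
  (forall x, sp (A x) x <= l^-1 * sp x x) ->
  (forall x, sp (A (post l x)) (post l x) <= sp (A x) x) /\
  forall m z, sp z z <= k * l * En z ->
    sp (A (iter m (post l) z)) (iter m (post l) z) <= k / m.+1%:R * En z.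
Proof.
move=> hl k0 hA; case: hl => [|z0]; last first.
  have e x m : sp (A (iter m (post l) x)) (iter m (post l) x) = 0.
    by apply: trivial_energy; apply/asboolPn => -[y]; rewrite (z0 y) eqxx.
  split=> [x|m z _]; first by rewrite (e x 1) (normal_op_ge0 lv).
  by rewrite e mulr_ge0 ?(lv_ge0 lv)// divr_ge0.
rewrite invr_gt0 => l0.
have hA' x : l * sp (A x) x <= sp x x by rewrite -ler_pdivlMl.
have pA := normal_op_ge0 lv.
split=> [x|m z hz]; first exact: damped_energy.
have h := smoothing eu lA sA l0 pA hA' m z.
have lm : 0 < l * m.+1%:R by rewrite mulr_gt0.
rewrite -(ler_pM2l lm) (le_trans h)// (le_trans hz)// le_eqVlt; apply/orP; left; apply/eqP.
by field; rewrite addrC natr1 pnatr_eq0.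
Qed.

End Rates.

Section EnergyNorm.
Variables (R : realType) (V : lmodType R) (sp Bf : V -> V -> R) (En : V -> R)
  (star C : V -> V) (c1 c2 : R).
Hypothesis lv : level sp Bf En star C c1 c2.
Let eu := lv_eu lv.
Local Notation A := (normal_op sp Bf C).
Local Notation nrm := (fun x => Num.sqrt (sp (A x) x)).

Lemma energy_norm_triangle x y : nrm (x + y) <= nrm x + nrm y.
Proof.
have pA := normal_op_ge0 lv.
rewrite -(@ler_pXn2r _ 2) ?nnegrE ?addr_ge0 ?sqrtr_ge0// sqr_sqrtr// sqrrD !sqr_sqrtr//.
have cs := psd_CS eu x y (normal_op_lin lv) (normal_op_sym lv) pA.
rewrite (linD _ _ (normal_op_lin lv)) !(spDl eu, spDr eu).
have -> : sp (A y) x = sp (A x) y by rewrite (normal_op_sym lv) (spC eu).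
have : sp (A x) y <= Num.sqrt (sp (A x) x) * Num.sqrt (sp (A y) y).
  rewrite (le_trans (ler_norm _))// -sqrtr_sqr -sqrtrM// ler_wsqrtr//.
lra.
Qed.

Lemma energy_norm_le c x y : 0 <= c -> sp (A y) y <= c ^+ 2 * sp (A x) x -> nrm y <= c * nrm x.
Proof.
move=> c0 h; rewrite (le_trans (ler_wsqrtr h))// sqrtrM ?sqr_ge0// sqrtr_sqr ger0_norm//.
Qed.

Lemma energy_norm_sqr c x y : nrm y <= c * nrm x -> sp (A y) y <= c ^+ 2 * sp (A x) x.
Proof.
have pA := normal_op_ge0 lv; move=> h.
have h0 : 0 <= c * nrm x by apply: le_trans h; exact: sqrtr_ge0.
rewrite -[sp (A y) y]sqr_sqrtr// -[sp (A x) x]sqr_sqrtr// -exprMn.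
by rewrite ler_pXn2r ?nnegrE// sqrtr_ge0.
Qed.

End EnergyNorm.

Lemma opnorm_le (R : realType) (V : lmodType R) (nrm : V -> R) (A : V -> V) c :
  0 <= c -> (forall x, nrm (A x) <= c * nrm x) -> (opnorm nrm A <= c%:E)%E.
Proof.
move=> c0 h; apply: ge_ereal_sup => _ [x /= x1 <-]; rewrite lee_fin (le_trans (h x))//.
by rewrite -[leRHS]mulr1 ler_wpM2l.
Qed.

(** * The W-cycle *)

Section WCycle.
Variables (R : realType) (d : nat) (Om : set 'rV[R]_d) (sigma kappa : R).
Variables (F : mesh_family Om sigma kappa) (beta Cdag c1 c2 : R).
Variable L : forall k, fespace F k -> fespace F k.
Variables (En : forall k, fespace2 F k -> R) (star : forall k, fespace2 F k -> fespace2 F k).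
Hypothesis lv : forall k, level (@ip2 _ _ _ _ _ F k) (@Bform _ _ _ _ _ F beta k) (@En k) (@star k)
  (@Cop _ _ _ _ _ F L k) c1 c2.
Hypothesis EI : forall k (x : fespace2 F k), En x = En (coarse_to_fine x).

Lemma injection_lin k : lin (@injection _ _ _ _ _ F k).
Proof.
move=> a u v; apply: val_inj; apply/funext => z.
rewrite [LHS](_ : _ = a * P1_fun u z + P1_fun v z); last by [].
by rewrite [RHS](_ : _ = a * P1_fun (injection u) z + P1_fun (injection v) z).
Qed.

Lemma coarse_to_fine_lin k : lin (@coarse_to_fine _ _ _ _ _ F k).
Proof.
move=> a [x1 x2] [y1 y2]; apply: injective_projections.
  exact: (injection_lin a x1 y1).
exact: (injection_lin a x2 y2).
Qed.

Variable m : nat.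
Local Notation S k := (@Sop _ _ _ _ _ F beta L Cdag k).
Local Notation Rr k := (@Rop _ _ _ _ _ F beta L Cdag k).

(** The error that the exact coarse solve would leave, plus the error of the two
    successive approximate coarse solves. *)
Fixpoint wcycle_error k : fespace2 F k -> fespace2 F k :=
  match k with
  | 0 => fun=> 0
  | k'.+1 => fun x =>
      let y := iter m (S k'.+1) x in
      iter m (Rr k'.+1)
        (y - coarse_to_fine (ritz beta y) + coarse_to_fine (wcycle_error (wcycle_error (ritz beta y))))
  end.

Let iter_lin k f n : lin f -> lin (iter n f : fespace2 F k -> fespace2 F k).
Proof. by move=> lf; elim: n => // n IH a x y /=; rewrite IH lf. Qed.

Let R_lin k : lin (Rr k). Proof. exact: (post_lin (lv k) (damping beta L Cdag k)). Qed.
Let S_lin k : lin (S k). Proof. exact: (pre_lin (lv k) (damping beta L Cdag k)). Qed.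
Let P_lin k : lin (@ritz _ _ _ _ _ F beta k).
Proof. exact: (coarse_form_proj_lin (lv k.+1) (lv k) (@coarse_to_fine_lin k)). Qed.

Lemma wcycle_error_lin k : lin (@wcycle_error k).
Proof.
elim: k => [|k IH] a x y; first by rewrite /= scaler0 addr0.
rewrite /=; have lS := iter_lin m (S_lin (k := k.+1)); have lR := iter_lin m (R_lin (k := k.+1)).
rewrite (lS a x y); move: (iter m _ x) (iter m _ y) => u v.
rewrite (P_lin a u v) !(coarse_to_fine_lin, IH) -(lR a); congr (iter _ _ _).
rewrite !scalerDr scalerN opprD.
by rewrite (addrACA (a *: u) v) [LHS]addrACA.
Qed.

(** Both smoothing steps act linearly on the error, and the restricted residual
    is the coarse right-hand side of the projected error; the second coarse
    iteration starts from the result of the first. *)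
Lemma wcycle_error_propagation k : is_error_propagation beta L Cdag m m (@wcycle_error k).
Proof.
have BK j (f : fespace2 F j) : Bop beta (op_inv (@Bop _ _ _ _ _ F beta j) f) = f.
  exact: (form_opK (lv j)).
have lB j : lin (@Bop _ _ _ _ _ F beta j) by exact: (form_op_lin (lv j)).
elim: k => [|k IH] f x0; first by rewrite /= subrr.
rewrite /=.
have [x xE] : exists x, x = op_inv (@Bop _ _ _ _ _ F beta k.+1) f by eexists.
rewrite -xE; have fE : f = Bop beta x by rewrite xE BK.
have fB u : f - Bop beta u = Bop beta (x - u) by rewrite fE (linB _ _ (lB k.+1)).
have shift u w : x - (u + w) = (x - u) - w by rewrite opprD addrA.
have pre n u : x - iter n (pre_smooth beta L Cdag f) u = iter n (S k.+1) (x - u).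
  elim: n => [|n IHn]; first by [].
  rewrite !iterS -IHn {1}/pre_smooth shift fB; reflexivity.
have post n u : x - iter n (post_smooth beta L Cdag f) u = iter n (Rr k.+1) (x - u).
  elim: n => [|n IHn]; first by [].
  rewrite !iterS -IHn {1}/post_smooth shift fB; reflexivity.
rewrite post shift fB pre; move: (iter m _ (x - x0)) => e.
congr (iter _ _ _).
have [w wE] : exists w, w = ritz beta e by eexists.
have [f' f'E] : exists f', f' = fine_to_coarse (Bop beta e) by eexists.
have wf : op_inv (@Bop _ _ _ _ _ F beta k) f' = w.
  by rewrite f'E wE; exact: (coarse_residual (lv k.+1) (lv k) (@coarse_to_fine_lin k)).
rewrite -f'E -wE.
have h1 := IH f' 0; have h2 := IH f' (MG_W beta L Cdag m m f' 0).
rewrite /= wf in h1 h2; rewrite subr0 in h1; rewrite -h1 in h2.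
have -> : MG_W beta L Cdag m m f' (MG_W beta L Cdag m m f' 0) = w - wcycle_error (wcycle_error w).
  by rewrite h2 opprB addrC subrK.
by rewrite (linB _ _ (@coarse_to_fine_lin k)) opprB addrA addrAC.
Qed.

Local Notation nrm := (tnorm beta L 1).

Lemma iter_post_split k n (x y : fespace2 F k) :
  iter n (Rr k) (x + y) = iter n (Rr k) x + iter n (Rr k) y.
Proof. exact: (linD _ _ (iter_lin n (R_lin (k := k)))). Qed.

Lemma wcycle_errorS k (x : fespace2 F k.+1) : wcycle_error x = two_grid beta L Cdag m m x +
  iter m (Rr k.+1) (coarse_to_fine (wcycle_error (wcycle_error (ritz beta (iter m (S k.+1) x))))).
Proof. by rewrite -iter_post_split. Qed.

Lemma wcycle_error_bound (T t : nat -> R) :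
  (forall k, 0 <= t k) ->
  (forall k (x : fespace2 F k.+1), nrm (two_grid beta L Cdag m m x) <= T k.+1 * nrm x) ->
  (forall k (x : fespace2 F k.+1), ip2 (BCB beta L (Rop beta L Cdag x)) (Rop beta L Cdag x)
     <= ip2 (BCB beta L x) x) ->
  (forall k, T k.+1 + 4 * (1 + c2 / c1) ^+ 2 * t k ^+ 2 <= t k.+1) ->
  forall k (x : fespace2 F k), nrm (wcycle_error x) <= t k * nrm x.
Proof.
move=> t0 hT hR hrec; elim=> [|k IH] x.
  have -> : nrm (wcycle_error x) = 0.
    apply/eqP; rewrite sqrtr_eq0 le_eqVlt; apply/orP; left; apply/eqP.
    have eu := lv_eu (lv 0).
    by rewrite /= -[X in ip2 _ X](scale0r 0) (spZr eu) mul0r.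
  by rewrite mulr_ge0// sqrtr_ge0.
have c10 := lv_c1 (lv 0); have c20 := lv_c2 (lv 0).
have qE (y : fespace2 F k) : ip2 (BCB beta L (wcycle_error (wcycle_error y))) (wcycle_error (wcycle_error y))
    <= (t k ^+ 2) ^+ 2 * ip2 (BCB beta L y) y.
  apply: (energy_norm_sqr (lv k)).
  have h1 := IH (wcycle_error y); have h2 := ler_wpM2l (t0 k) (IH y).
  by rewrite expr2 -mulrA; exact: le_trans h1 h2.
have cc := coarse_correction_bound (lv k.+1) (lv k) (@coarse_to_fine_lin k) (@EI k) (hR k)
  (E := fun y => wcycle_error (wcycle_error y)) m m (sqr_ge0 (t k ^+ 2)) qE x.
rewrite wcycle_errorS; apply: (le_trans (energy_norm_triangle (lv k.+1) _ _)).
apply: (@le_trans _ _ (T k.+1 * nrm x + 4 * (1 + c2 / c1) ^+ 2 * t k ^+ 2 * nrm x)); last first.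
  by rewrite -mulrDl ler_wpM2r// sqrtr_ge0.
apply: lerD; first exact: hT.
have [q qE'] : exists q, q = c2 / c1 by eexists.
have q0 : 0 <= q by rewrite qE' divr_ge0// ltW.
rewrite -qE' in cc *.
apply: energy_norm_le.
  by apply: mulr_ge0; [apply: mulr_ge0 => //; exact: sqr_ge0|exact: sqr_ge0].
apply: (le_trans cc); rewrite ler_wpM2r//; first exact: (normal_op_ge0 (lv k.+1)).
rewrite [leRHS]exprMn ler_wpM2r ?sqr_ge0//.
have -> : (4 * (1 + q) ^+ 2) ^+ 2 = 16 * q ^+ 3 + 16 * (1 + 4 * q + 6 * q ^+ 2 + 3 * q ^+ 3 + q ^+ 4) by ring.
by rewrite lerDl mulr_ge0// !addr_ge0// ?mulr_ge0// exprn_ge0.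
Qed.

End WCycle.

(** With a and b the two-grid bounds on the fine and on the coarse levels, the
    quadratic recursion is solved by 2 b up to level n; beyond, the square of
    the inherited term gives the doubly exponential factor. *)
Lemma wcycle_recursion (R : realType) (C a b : R) (n : nat) (t : nat -> R) :
  0 <= C -> 0 <= a -> 0 <= b -> 8 * C * a <= 1 -> 16 * C * b <= 1 ->
  t = (fun k => if (k <= n)%N then 2 * b else 2 * a + 4 ^ (1 - (2 ^ (k - n))%N%:Z) * (2 * b)) ->
  forall k, (if (k.+1 <= n)%N then b else a) + C * t k ^+ 2 <= t k.+1.
Proof.
move=> C0 a0 b0 hC hb -> k /=.
have Ca := ler_wpM2r a0 hC; have Cb := ler_wpM2r b0 hb; rewrite !mul1r in Ca Cb.
have XE N : (4 : R) ^ (1 - N%:Z) = 4 / 4 ^+ N.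
  by rewrite expfzDr// expr1z -exprnN.
have [kn|kn] := leqP k.+1 n.
  rewrite (ltnW kn); have := mulr_ge0 C0 (sqr_ge0 b); rewrite !expr2 in Ca Cb *; lra.
have [kn'|kn'] := leqP k n.
  have -> : k = n by apply/eqP; rewrite eqn_leq kn' -ltnS.
  rewrite subSnn expn1 XE.
  have -> : 4 / 4 ^+ 2 * (2 * b) = b / 2 by field.
  rewrite !expr2 in Ca Cb *; lra.
rewrite subSn ?(ltnW kn')// expnS !XE mulnC exprM.
have [X XE'] : exists X : R, X = 4 / 4 ^+ (2 ^ (k - n))%N by eexists.
have -> : 4 / (4 ^+ (2 ^ (k - n))%N) ^+ 2 * (2 * b) = X ^+ 2 * b / 2.
  by rewrite XE'; field; rewrite expf_neq0.
rewrite -XE'; have X2 := sqr_ge0 X; have Cb' := ler_wpM2l X2 Cb.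
have h : 0 <= C * (2 * a - X * (2 * b)) ^+ 2 by rewrite mulr_ge0// sqr_ge0.
have e1 : 2 * (C * (2 * a) ^+ 2) = 8 * C * a * a by ring.
have e2 : 2 * (C * (X * (2 * b)) ^+ 2) = X ^+ 2 * (16 * C * b * b) / 2 by field.
have e3 : C * (2 * a + X * (2 * b)) ^+ 2 + C * (2 * a - X * (2 * b)) ^+ 2 =
  2 * (C * (2 * a) ^+ 2) + 2 * (C * (X * (2 * b)) ^+ 2) by ring.
rewrite e1 e2 in e3; lra.
Qed.

(** * Normal form of a convex polytopal domain *)

(** Conditions with a zero normal are void on a nonempty domain; the others are
    scaled to unit normals. *)
Lemma polytopal_normal_form (R : realType) (d : nat) (Omega : set 'rV[R]_d) : (0 < d)%N ->
  convex_polytopal_domain Omega -> exists Hs x0 rho,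
  [/\ Omega = polytope Hs, forall p, p \in Hs -> dotp p.1 p.1 = 1, uniq Hs,
      Hs != [::] /\ polytope Hs x0 & forall x, polytope Hs x -> enorm x <= rho].
Proof.
move=> d0 [[x0 hx0] bnd [H HE]].
pose nrm (h : 'rV[R]_d * R) := ((enorm h.1)^-1 *: h.1, h.2 / enorm h.1).
pose Hs := undup [seq nrm h | h <- H & h.1 != 0].
have en0 (a : 'rV[R]_d) : a != 0 -> 0 < enorm a.
  by move=> a0; rewrite lt_neqAle enorm_ge0 andbT eq_sym; apply: contra a0 => /eqP/enorm0_eq0 ->.
have gapE h x : gap (nrm h) x = (h.2 - dotp h.1 x) / enorm h.1.
  by rewrite /gap/= dotpZl mulrBl (mulrC (dotp _ _)).
have OE : Omega = polytope Hs.
  rewrite eqEsubset; split=> x.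
    rewrite HE => hx p; rewrite mem_undup => /mapP[h]; rewrite mem_filter => /andP[h0 hH] ->.
    by rewrite gapE divr_gt0 ?en0// subr_gt0; exact: hx.
  move=> hx; rewrite HE => h hH; have [e|h0] := eqVneq h.1 0.
    by move: hx0; rewrite HE => /(_ h hH); rewrite e !dotp0l.
  have : nrm h \in Hs by rewrite mem_undup; apply: map_f; rewrite mem_filter h0.
  by move=> /hx; rewrite gapE pmulr_lgt0 ?invr_gt0 ?en0// subr_gt0.
have [M [_ hM]] := bnd.
pose rho := d%:R * (`|M| + 1).
have hrho x : Omega x -> enorm x <= rho.
  move=> hx; have MM : M < `|M| + 1 by rewrite (le_lt_trans (ler_norm _))// ltrDl.
  have := hM _ MM x hx => /= nx.
  rewrite (le_trans (enorm_le_sum x))// /rho.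
  rewrite (_ : d%:R * _ = \sum_(i < d) (`|M| + 1)); last by rewrite sumr_const card_ord -[RHS]mulr_natl.
  apply: ler_sum => i _; apply: le_trans nx.
  by rewrite /Num.norm/= mx_normrE; apply: (le_bigmax _ (fun ij => `|x ij.1 ij.2|) (0, i)).
exists Hs, x0, rho; split => //.
- move=> p; rewrite mem_undup => /mapP[h]; rewrite mem_filter => /andP[h0 hH] -> /=.
  by rewrite dotpZl dotpZr -enorm_sqr; field; rewrite gt_eqF ?en0.
- exact: undup_uniq.
- split; last by rewrite -OE.
  apply/eqP => e; have := hrho ((rho + 1) *: delta_mx 0 (Ordinal d0)).
  rewrite OE e => /(_ _); rewrite enormZ enorm_delta mulr1 => h.
  have {}h : `|rho + 1| <= rho by apply: h => p.
  have := le_trans (ler_norm _) h; lra.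
- by rewrite -OE.
Qed.

(** * The two-grid bounds *)

Section Family.
Variables (R : realType) (d : nat).
Hypotheses (d_gt0 : (0 < d)%N) (d_le3 : (d <= 3)%N).
Variables (Hs : seq ('rV[R]_d * R)).
Hypothesis unitH : forall p, p \in Hs -> dotp p.1 p.1 = 1.
Hypotheses (uniqH : uniq Hs) (Hs_ne : Hs != [::]).
Variable x0 : 'rV[R]_d.
Hypothesis hx0 : polytope Hs x0.
Variable rho : R.
Hypothesis hrho : forall x, polytope Hs x -> enorm x <= rho.
Variables (sigma kappa c1 c2 Cdag : R).
Hypotheses (c1_gt0 : 0 < c1) (c2_gt0 : 0 < c2).
Local Notation Om := (polytope Hs).

(** Absolute values keep the constants positive even for shape parameters that
    no mesh satisfies. *)
Definition mass_const : R := `|d.+1%:R * nodal_const d sigma kappa| + 1.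
Definition stiff_const : R := (1 + `|inverse_const d sigma kappa|) * (`|upper_const d sigma kappa| + 1).
Definition poisson_const : R := 4 * (`|interp_const d sigma kappa| + 1).
Definition contraction_const : R :=
  stiff_const / c1 / (stiff_const / c1 + (c2 * mass_const)^-1).
Definition approx_const : R :=
  6 * poisson_const * (poisson_const + 1) * mass_const * (2 * (`|Cdag| + 1)).

Lemma mass_const_gt0 : 0 < mass_const. Proof. by rewrite ltr_wpDl. Qed.

Lemma stiff_const_gt0 : 0 < stiff_const.
Proof. by rewrite mulr_gt0// ?ltr_wpDl// ltr_pwDl. Qed.

Lemma poisson_const_gt0 : 0 < poisson_const.
Proof. by rewrite mulr_gt0// ltr_wpDl. Qed.

Lemma approx_const_gt0 : 0 < approx_const.
Proof.
have := poisson_const_gt0 => p0.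
have p1 : 0 < poisson_const + 1 by rewrite ltr_wpDl// ltW.
have q : 0 < 2 * (`|Cdag| + 1) by rewrite mulr_gt0// ltr_wpDl.
by rewrite !(mulr_gt0 _ q, mulr_gt0 _ mass_const_gt0, mulr_gt0 _ p1, mulr_gt0 _ p0).
Qed.

Lemma contraction_const_in : 0 < contraction_const < 1.
Proof.
have a0 : 0 < stiff_const / c1 by rewrite divr_gt0// stiff_const_gt0.
have b0 : 0 < (c2 * mass_const)^-1 by rewrite invr_gt0 mulr_gt0// mass_const_gt0.
by rewrite /contraction_const divr_gt0 ?addr_gt0//= ltr_pdivrMr ?addr_gt0// mul1r ltrDl.
Qed.

Variables (F : mesh_family Om sigma kappa) (beta : R).
Hypothesis beta_gt0 : 0 < beta.
Variable L : forall k, fespace F k -> fespace F k.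
Hypothesis L_lin : forall k, lin (@L k).
Hypothesis L_sym : forall k (v w : fespace F k), ip (L v) w = ip v (L w).
Hypothesis L_bounds : forall k (v : fespace F k),
  c1 * H1beta_sqr Om beta v <= ip (L v) v <= c2 * H1beta_sqr Om beta v.

Local Notation b := (Num.sqrt beta).
Local Notation L2 := (fun v w => L2ip Om v w).
Local Notation grad := (fun v w => gradL2ip Om v w).

Definition energy k (x : fespace2 F k) : R := H1beta_sqr Om beta x.1 + H1beta_sqr Om beta x.2.
Definition flip k (x : fespace2 F k) : fespace2 F k := pair_star x.

Let b_gt0 : 0 < b. Proof. by rewrite sqrtr_gt0. Qed.
Let ne : Om !=set0. Proof. by exists x0. Qed.
Let tri k : triangulation Om (F k). Proof. exact: mesh_triangulation. Qed.
Let sh k : shape_regular sigma (F k). Proof. exact: mesh_shape_regular. Qed.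
Let qu k : quasi_uniform kappa (F k). Proof. exact: mesh_quasi_uniform. Qed.

Lemma hmesh_gt0 k : 0 < hmesh F k.
Proof. exact: (mesh_size_gt0 d_gt0 ne (tri k) (@sh k) (@qu k)). Qed.

Let eu k : euclidean (@ip _ _ _ _ _ F k).
Proof. exact: (nodal_euclidean d_gt0 unitH hx0 (tri k) (@sh k) (@qu k)). Qed.

Let L2P k : bilin_psd (fun v w : fespace F k => L2ip Om v w).
Proof. exact: (L2_psd unitH hx0 hrho (tri k)). Qed.

Let gradP k : bilin_psd (fun v w : fespace F k => gradL2ip Om v w).
Proof. exact: (grad_psd d_gt0 unitH hx0 hrho (tri k)). Qed.

Let L2_0 k (v : fespace F k) : L2ip Om v v = 0 -> v = 0.
Proof. exact: (L2_def d_gt0 unitH hx0 hrho (tri k) (@sh k) (@qu k)). Qed.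

Lemma fe_level k : level (@ip2 _ _ _ _ _ F k) (@Bform _ _ _ _ _ F beta k) (@energy k) (@flip k)
  (@Cop _ _ _ _ _ F L k) c1 c2.
Proof.
apply: (pair_level (eu k) (L2P k) (gradP k) b_gt0 (@L2_0 k) c1_gt0 c2_gt0 (@L_lin k)).
- by move=> v w; rewrite L_sym.
- by move=> v; have /andP[] := L_bounds v.
- by move=> v; have /andP[] := L_bounds v.
Qed.

Let energy_mass k (x : fespace2 F k) : L2ip Om x.1 x.1 + L2ip Om x.2 x.2 <= energy x.
Proof.
have [_ _ p] := gradP k.
have h (v : fespace F k) : L2ip Om v v <= H1beta_sqr Om beta v.
  by rewrite lerDl; apply: mulr_ge0 (p v); exact: ltW.
by apply: lerD; exact: h.
Qed.

Lemma mass_bound k (x : fespace2 F k) :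
  ip2 x x <= mass_const * (L2ip Om x.1 x.1 + L2ip Om x.2 x.2).
Proof.
have [_ _ p] := L2P k.
have h (v : fespace F k) : ip v v <= mass_const * L2ip Om v v.
  rewrite (le_trans (nodal_le_L2 d_gt0 unitH hx0 hrho (tri k) (@sh k) (@qu k) v))//.
  by rewrite ler_wpM2r ?p// (le_trans (ler_norm _))// lerDl.
by rewrite mulrDr; apply: lerD.
Qed.

(** On a level whose mesh size is large compared to the regularization, the
    inverse inequality bounds the energy by the mass. *)
Lemma stiff_bound k (x : fespace2 F k) : b * hmesh F k ^- 2 < 1 ->
  energy x <= stiff_const * ip2 x x.
Proof.
move=> sm; have [_ _ p] := L2P k.
have bh : 0 <= b * hmesh F k ^- 2.
  by apply: mulr_ge0; [exact: ltW|rewrite invr_ge0 sqr_ge0].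
have h (v : fespace F k) : H1beta_sqr Om beta v <= stiff_const * ip v v.
  have h1 := grad_le_L2 d_gt0 unitH hx0 hrho (tri k) (@sh k) (@qu k) v.
  have h2 := L2_le_nodal d_gt0 unitH hx0 hrho (tri k) (@sh k) (@qu k) v.
  have n0 : 0 <= ip v v := sp_ge0 (eu k) v.
  have h2' : L2ip Om v v <= (`|upper_const d sigma kappa| + 1) * ip v v.
    by rewrite (le_trans h2)// ler_wpM2r// (le_trans (ler_norm _))// lerDl.
  rewrite /stiff_const -mulrA.
  have i0 : 0 <= 1 + `|inverse_const d sigma kappa| by rewrite addr_ge0.
  apply: le_trans (ler_wpM2l i0 h2'); rewrite /H1beta_sqr mulrDl mul1r lerD2l.
  apply: le_trans (ler_wpM2l (ltW b_gt0) h1) _.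
  rewrite mulrA ler_wpM2r ?p// mulrCA.
  apply: (@le_trans _ _ (`|inverse_const d sigma kappa| * (b * hmesh F k ^- 2))).
    by rewrite ler_wpM2r// ler_norm.
  by rewrite -[leRHS]mulr1 ler_wpM2l// ltW.
by rewrite mulrDr; apply: lerD.
Qed.

Local Notation nrm := (tnorm beta L 1).

Lemma post_contraction k (x : fespace2 F k) : b * hmesh F k ^- 2 < 1 ->
  ip2 (BCB beta L (Rop beta L Cdag x)) (Rop beta L Cdag x) <=
    contraction_const ^+ 2 * ip2 (BCB beta L x) x.
Proof.
move=> sm.
have h1 y : ip2 y y <= mass_const * energy (k := k) y.
  by rewrite (le_trans (mass_bound y))// ler_wpM2l ?energy_mass// ltW// mass_const_gt0.
apply: (well_conditioned_contraction (fe_level k) mass_const_gt0 stiff_const_gt0 h1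
  (fun y => stiff_bound y sm) (l := damping beta L Cdag k)).
by rewrite /damping sm.
Qed.

Local Notation Bk k := (@Bform _ _ _ _ _ F beta k).
Local Notation TG m1 m2 := (two_grid beta L Cdag m1 m2).

Let two_grid_bound k (r : nat -> R) m1 m2 : (forall m, 0 <= r m) ->
  (forall m (z : fespace2 F k.+1), (forall w : fespace2 F k, Bform beta z (coarse_to_fine w) = 0) ->
     ip2 (BCB beta L (iter m (@Rop _ _ _ _ _ F beta L Cdag k.+1) z))
       (iter m (@Rop _ _ _ _ _ F beta L Cdag k.+1) z) <= r m * energy z) ->
  forall x : fespace2 F k.+1, ip2 (BCB beta L (TG m1 m2 x)) (TG m1 m2 x) <=
    48 * c2 ^+ 2 * (r m1 * r m2) * ip2 (BCB beta L x) x.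
Proof.
exact: (two_level_bound (fe_level k.+1) (fe_level k) (@coarse_to_fine_lin _ _ _ _ _ F k)
  (fun _ _ => erefl) (fun _ => erefl)).
Qed.

Let ge48 : (48 : R) <= 7 ^+ 2. Proof. by rewrite expr2; lra. Qed.

(** The smoothers alone contract at the full rate, and the coarse correction is
    bounded. *)
Lemma two_grid_small k m1 m2 (x : fespace2 F k.+1) : b * hmesh F k.+1 ^- 2 < 1 ->
  nrm (TG m1 m2 x) <= 7 * c2 / c1 * contraction_const ^+ (m1 + m2) * nrm x.
Proof.
move=> sm; have /andP[g0 _] := contraction_const_in.
move: (fun z => post_contraction z sm) g0; move: contraction_const => g hg g0.
have it m (z : fespace2 F k.+1) :
    ip2 (BCB beta L (iter m (@Rop _ _ _ _ _ F beta L Cdag k.+1) z))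
      (iter m (@Rop _ _ _ _ _ F beta L Cdag k.+1) z) <= (g ^+ m) ^+ 2 * ip2 (BCB beta L z) z.
  elim: m => [|m IH]; first by rewrite expr0 expr1n mul1r.
  rewrite iterS; apply: le_trans (hg _) _; rewrite (exprS g m) exprMn -[leRHS]mulrA.
  by rewrite ler_wpM2l// sqr_ge0.
have := @two_grid_bound k (fun m => (g ^+ m) ^+ 2 / c1) m1 m2.
move=> /(_ _ _ x) h; apply: energy_norm_le.
  by rewrite mulr_ge0// ?exprn_ge0 ?(ltW g0)// divr_ge0// ?mulr_ge0// ltW.
apply: le_trans (h _ _) _.
- by move=> m; rewrite divr_ge0 ?sqr_ge0// ltW.
- move=> m z _; apply: le_trans (it m z) _; rewrite -mulrA ler_wpM2l ?sqr_ge0//.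
  by rewrite ler_pdivlMl//; exact: (normal_op_upper (fe_level k.+1)).
rewrite ler_wpM2r//; first exact: (normal_op_ge0 (fe_level k.+1)).
rewrite exprD; move: (g ^+ m1) (g ^+ m2) => u v.
have -> : (7 * c2 / c1 * (u * v)) ^+ 2 = 7 ^+ 2 * (c2 ^+ 2 * (u ^+ 2 / c1 * (v ^+ 2 / c1))).
  by field; rewrite gt_eqF.
rewrite -mulrA ler_wpM2r//; apply: mulr_ge0; first exact: sqr_ge0.
by apply: mulr_ge0; rewrite divr_ge0 ?sqr_ge0// ltW.
Qed.

Hypothesis Cdag_bound : forall k,
  lambda_max (@BCB _ _ _ _ _ F beta L k) <= Cdag * (1 + b * hmesh F k ^- 2).

Let damped_spectrum k (x : fespace2 F k) : 1 <= b * hmesh F k ^- 2 ->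
  ip2 (BCB beta L x) x <= (damping beta L Cdag k)^-1 * ip2 x x.
Proof.
move=> big; rewrite /damping ltNge big/= invrK.
have lv := fe_level k; have eue := lv_eu lv.
have lA : lin (@BCB _ _ _ _ _ F beta L k) by exact: normal_op_lin lv.
have sA : symmetric (@ip2 _ _ _ _ _ F k) (@BCB _ _ _ _ _ F beta L k) by exact: normal_op_sym lv.
have [->|x_n] := eqVneq x 0.
  by rewrite (lin0 lA) -(scale0r 0) (spZl eue) mul0r mulr0.
have [K K0 hK] := lin_bounded eue lA.
have hM (y : fespace2 F k) : ip2 (BCB beta L y) y <= (1 + K) * ip2 y y.
  have := sp_ge0 eue (BCB beta L y - y).
  rewrite !(spDl eue, spDr eue, spNl eue, spNr eue) (spC eue y (BCB beta L y)).
  have := hK y; have := sp_ge0 eue y; have := mulr_ge0 K0 (sp_ge0 eue y).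
  move: (ip2 y y) (ip2 _ y) (ip2 _ _) => u v w; lra.
have [h _] := lambda_maxP eue lA sA (ex_intro _ x x_n) hM.
have h3 : 0 <= ip2 x x := sp_ge0 eue x.
exact: le_trans (h x) (ler_wpM2r h3 (Cdag_bound k)).
Qed.

Let damping_sign k : 1 <= b * hmesh F k ^- 2 ->
  0 < (damping beta L Cdag k)^-1 \/ (forall x : fespace2 F k, x = 0).
Proof.
move=> big; have lv := fe_level k; have eue := lv_eu lv.
have [|d0] := ltP 0 (damping beta L Cdag k)^-1; [by left|right] => x.
have h1 : energy x <= 2 * c2 * ip2 (BCB beta L x) x := normal_op_lower lv x.
have h2 := damped_spectrum x big; have h3 : 0 <= ip2 x x := sp_ge0 eue x.
have h4 : 0 <= energy x := lv_ge0 lv x.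
suff e0 : energy x = 0 by exact: (lv_En0 lv e0).
move: h1 h2 h3 h4 d0.
move: (energy x) (ip2 _ x) (ip2 x x) ((damping _ _ _ _)^-1) => e q n l h1 h2 h3 h4 l0.
have ln : l * n <= 0 by rewrite mulr_le0_ge0.
apply/eqP; rewrite eq_le h4 andbT; apply: le_trans h1 _.
by rewrite pmulr_rle0 ?mulr_gt0// (le_trans h2).
Qed.

Lemma post_nonexpansive k (x : fespace2 F k) :
  ip2 (BCB beta L (Rop beta L Cdag x)) (Rop beta L Cdag x) <= ip2 (BCB beta L x) x.
Proof.
have lv := fe_level k.
have [sm|big] := ltP (b * hmesh F k ^- 2) 1.
  apply: le_trans (post_contraction x sm) _.
  rewrite -[leRHS]mul1r ler_wpM2r//; first exact: (normal_op_ge0 lv).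
  by have /andP[g0 g1] := contraction_const_in; rewrite expr_le1 ?(ltW g1)// ltW.
have [h _] := damped_rate lv (damping_sign big) (lexx 0) (fun y => damped_spectrum y big).
exact: h.
Qed.

(** The Poisson approximation property transferred to the form by duality; where
    the ratio of beta^(1/2) to h^2 is at least one, the remaining factor is the
    inverse of that ratio, the order of the damping factor. *)
Lemma approximation_property k (z : fespace2 F k.+1) : 1 <= b * hmesh F k.+1 ^- 2 ->
  (forall w : fespace2 F k, Bform beta z (coarse_to_fine w) = 0) ->
  ip2 z z <= approx_const * damping beta L Cdag k.+1 * energy z.
Proof.
move=> big hz; have lv := fe_level k.+1.
case: (damping_sign big) => [l0|z0]; last first.
  have eue := lv_eu lv.
  rewrite (z0 z) -[X in ip2 X _](scale0r 0) (spZl eue) mul0r.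
  by rewrite (_ : energy _ = 0) ?mulr0// -(lv_star lv) -(form_opE lv) (z0 (form_op _ _ _)) -(scale0r 0) (spZl eue) mul0r.
have h0 := hmesh_gt0 k.+1; move: (h0); set h := hmesh F k.+1 in big h0 * => h_gt0.
have P0 := poisson_const_gt0; have M0 := mass_const_gt0.
have hk : hmesh F k = 2 * h by rewrite /h /hmesh mesh_halving; field.
have g0 : 0 <= poisson_const * h ^+ 2 by rewrite mulr_ge0 ?sqr_ge0// ltW.
have pois (e : fespace F k.+1) : (forall w : fespace F k, gradL2ip Om e (injection w) = 0) ->
    L2ip Om e e <= poisson_const * h ^+ 2 * gradL2ip Om e e.
  move=> he; have [_ _ p] := gradP k.+1.
  have := poisson_P1 d_gt0 d_le3 unitH uniqH Hs_ne hx0 hrho (tri k) (@sh k) (@qu k) (tri k.+1) he.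
  rewrite -/(hmesh F k) hk => /le_trans; apply; rewrite ler_wpM2r ?p//.
  rewrite exprMn /poisson_const mulrA (mulrC _ (2 ^+ 2)) ler_wpM2r ?sqr_ge0//.
  have := ler_norm (interp_const d sigma kappa).
  move: (interp_const d sigma kappa) => c; rewrite expr2; lra.
have aJ0 (y : fespace F k) : gradL2ip Om (injection y) (injection y) = 0 -> y = 0.
  exact: (grad_def d_gt0 d_le3 unitH uniqH Hs_ne hx0 hrho (tri k) (@sh k) (@qu k)).
have dual : L2ip Om z.1 z.1 + L2ip Om z.2 z.2 <= 6 * (poisson_const * h ^+ 2) *
    (poisson_const * h ^+ 2 + b) / b ^+ 2 * energy z.
  exact: (pair_duality (eu k.+1) (eu k) (L2P k.+1) (gradP k.+1) b_gt0 g0 (@L2_0 k.+1)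
    (@injection_lin _ _ _ _ _ F k) aJ0 pois (z := z) hz).
have e0 : 0 <= energy z := lv_ge0 lv z.
apply: le_trans (mass_bound z) _; apply: le_trans (ler_wpM2l (ltW M0) dual) _.
rewrite [leLHS]mulrA ler_wpM2r//.
have h2 : 0 < h ^+ 2 by rewrite exprn_gt0.
have bh : h ^+ 2 <= b by rewrite -[b](divfK (lt0r_neq0 h2)) ler_peMl// ltW.
have lE : damping beta L Cdag k.+1 = (Cdag * (1 + b * h ^- 2))^-1.
  by rewrite /damping ltNge big.
rewrite lE invrK in l0; rewrite lE /approx_const.
rewrite ler_pdivlMr//.
have [q qE] : exists q, q = h ^+ 2 by eexists.
rewrite -qE in h2 bh l0 big *.
have c1' : Cdag * (1 + b / q) <= (`|Cdag| + 1) * (2 * (b / q)).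
  apply: (@le_trans _ _ ((`|Cdag| + 1) * (1 + b / q))).
    rewrite ler_wpM2r ?addr_ge0 ?divr_ge0 ?(ltW h2) ?(ltW b_gt0)//.
    by rewrite (le_trans (ler_norm _))// lerDl.
  by rewrite ler_wpM2l ?addr_ge0//; lra.
have k0 : 0 <= mass_const * (6 * (poisson_const * q) * (poisson_const * q + b) / b ^+ 2).
  by rewrite !mulr_ge0// ?invr_ge0 ?sqr_ge0 ?addr_ge0 ?mulr_ge0// ltW.
apply: le_trans (ler_wpM2l k0 c1') _.
have D0 : 0 <= `|Cdag| + 1 by rewrite addr_ge0.
move: P0 M0 D0; move: poisson_const mass_const (`|Cdag| + 1) => P M D P0 M0 D0.
have -> : M * (6 * (P * q) * (P * q + b) / b ^+ 2) * (D * (2 * (b / q))) =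
    6 * P * M * (2 * D) * ((P * q + b) / b) by field; rewrite !gt_eqF.
have -> : 6 * P * (P + 1) * M * (2 * D) = 6 * P * M * (2 * D) * (P + 1) by ring.
rewrite ler_wpM2l//; last by rewrite ler_pdivrMr// mulrDl mul1r lerD2r ler_pM2l.
by apply: mulr_ge0; rewrite mulr_ge0// ?mulr_ge0// ltW.
Qed.

Lemma two_grid_large k m1 m2 (x : fespace2 F k.+1) : 1 <= b * hmesh F k.+1 ^- 2 ->
  nrm (TG m1 m2 x) <=
    7 * c2 * approx_const * (Num.sqrt (maxn 1 m1 * maxn 1 m2)%:R)^-1 * nrm x.
Proof.
move=> big; have lv := fe_level k.+1; have a0 := approx_const_gt0.
have [_ rate] := damped_rate lv (damping_sign big) (ltW a0) (fun y => damped_spectrum y big).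
have r0 m : 0 <= approx_const / m.+1%:R by rewrite divr_ge0// ltW.
have h := two_grid_bound m1 m2 r0 (fun m z hz => rate m z (approximation_property big hz)) x.
apply: energy_norm_le.
  by rewrite mulr_ge0 ?invr_ge0 ?sqrtr_ge0// mulr_ge0 ?(ltW a0)// mulr_ge0// ltW.
apply: le_trans h _; rewrite ler_wpM2r//; first exact: (normal_op_ge0 lv).
rewrite exprMn exprVn sqr_sqrtr// natrM.
have mx m : (maxn 1 m)%:R <= m.+1%:R :> R by rewrite ler_nat; clear; lia.
have mp m : 0 < (maxn 1 m)%:R :> R by rewrite ltr0n; clear; lia.
have iv m : m.+1%:R^-1 <= (maxn 1 m)%:R^-1 :> R by rewrite lef_pV2// posrE.
apply: (@le_trans _ _ (7 ^+ 2 * c2 ^+ 2 * (approx_const / m1.+1%:R * (approx_const / m2.+1%:R)))).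
  have k0 : 0 <= c2 ^+ 2 * (approx_const / m1.+1%:R * (approx_const / m2.+1%:R)).
    by apply: mulr_ge0; [exact: sqr_ge0|exact: mulr_ge0].
  by have := ler_wpM2r k0 ge48; rewrite [X in X <= _]mulrA [X in _ <= X]mulrA.
have -> : 7 ^+ 2 * c2 ^+ 2 * (approx_const / m1.+1%:R * (approx_const / m2.+1%:R)) =
  (7 * c2 * approx_const) ^+ 2 * (m1.+1%:R^-1 * m2.+1%:R^-1).
  by move: approx_const (m1.+1%:R^-1 : R) (m2.+1%:R^-1 : R) => A u v; ring.
rewrite ler_wpM2l ?sqr_ge0// invfM.
by apply: ler_pM; rewrite ?invr_ge0//; exact: iv.
Qed.

Lemma hmesh_decr j k : (j <= k)%N -> hmesh F k <= hmesh F j.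
Proof.
move=> /subnKC <-; elim: (k - j)%N => [|n IH]; first by rewrite addn0.
rewrite addnS /hmesh mesh_halving; apply: le_trans IH; rewrite ler_pdivrMr// ler_peMr ?ler1n//.
exact: ltW (hmesh_gt0 _).
Qed.

Lemma ratio_incr j k : (j <= k)%N -> b * hmesh F j ^- 2 <= b * hmesh F k ^- 2.
Proof.
move=> jk; rewrite ler_wpM2l ?(ltW b_gt0)// lef_pV2 ?posrE ?exprn_gt0 ?hmesh_gt0//.
by rewrite ler_pXn2r ?nnegrE ?(ltW (hmesh_gt0 _))//; exact: hmesh_decr.
Qed.

End Family.

Theorem theorem5p5 (R : realType) (d : nat) (hd : d = 2%N \/ d = 3%N)
  (Omega : set 'rV[R]_d) (hOmega : convex_polytopal_domain Omega)
  (sigma kappa c1 c2 Cdag : R) (hc1 : 0 < c1) (hc2 : 0 < c2) :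
  exists gamma Csharp Cflat : R,
  [/\ 0 < gamma < 1, 0 < Csharp, 0 < Cflat &
  forall (F : mesh_family Omega sigma kappa) (beta : R),
  0 < beta ->
  forall L : (forall k : nat, {linear fespace F k -> fespace F k}),
  (forall k (v w : fespace F k), ip (L k v) w = ip v (L k w)) ->
  (forall k (v : fespace F k),
     c1 * H1beta_sqr Omega beta v <= ip (L k v) v
     <= c2 * H1beta_sqr Omega beta v) ->
  (forall k, lambda_max (BCB beta L (k := k))
     <= Cdag * (1 + Num.sqrt beta * hmesh F k ^- 2)) ->
  let small k := Num.sqrt beta * hmesh F k ^- 2 < 1 in
  let opn k (A : fespace2 F k -> fespace2 F k) :=
    opnorm (tnorm beta L 1 (k := k)) A in
  [/\ forall k (x : fespace2 F k), (1 <= k)%N -> small k ->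
        tnorm beta L 1 (Rop beta L Cdag x) <= gamma * tnorm beta L 1 x,
      forall k m1 m2, small k.+1 ->
        (opn k.+1 (two_grid beta L Cdag m1 m2 (k := k))
           <= (Csharp * gamma ^+ (m1 + m2))%:E)%E,
      forall k m1 m2, 1 <= Num.sqrt beta * hmesh F k.+1 ^- 2 ->
        (opn k.+1 (two_grid beta L Cdag m1 m2 (k := k))
           <= (Cflat * (Num.sqrt (maxn 1 m1 * maxn 1 m2)%:R)^-1)%:E)%E &
      forall kstar,
        (0 < kstar)%N -> small kstar ->
        (forall k, (0 < k)%N -> small k -> (k <= kstar)%N) ->
        exists2 mstar, (0 < mstar)%N & forall m, (mstar <= m)%N ->
        exists E : (forall k, {linear fespace2 F k -> fespace2 F k}),
        [/\ forall k, is_error_propagation beta L Cdag m m (E k),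
            forall k, (1 <= k <= kstar)%N ->
              (opn k (E k) <= (2 * Csharp * gamma ^+ (2 * m))%:E)%E &
            forall k, (kstar + 1 <= k)%N ->
              (opn k (E k) <= (2 * Cflat * m%:R^-1
                 + 4 ^ (1 - (2 ^ (k - kstar))%N%:Z)
                   * (2 * Csharp * gamma ^+ (2 * m)))%:E)%E]]].
Proof.
have d0 : (0 < d)%N by case: hd => ->.
have d3 : (d <= 3)%N by case: hd => ->.
have [Hs [x0 [rho [OE uH qH [nH hx0] hr]]]] := polytopal_normal_form d0 hOmega.
subst Omega.
have [g gE] : exists g, g = contraction_const d sigma kappa c1 c2 by eexists.
have [a aE] : exists a, a = approx_const d sigma kappa Cdag by eexists.
have g01 : 0 < g < 1 by rewrite gE; exact: contraction_const_in.
have a0 : 0 < a by rewrite aE; exact: approx_const_gt0.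
exists g, (7 * c2 / c1), (7 * c2 * a); split => //.
- by rewrite divr_gt0// mulr_gt0.
- by rewrite !mulr_gt0.
move=> F beta b0 L Lsym Lb CB small opn.
have L_lin k : lin (L k) by move=> r x y; exact: linearP.
have lv k := fe_level d0 uH hx0 hr hc1 hc2 b0 L_lin Lsym Lb k.
have small_tg k m1 m2 (x : fespace2 F k.+1) : small k.+1 ->
    tnorm beta L 1 (two_grid beta L Cdag m1 m2 x) <= 7 * c2 / c1 * g ^+ (m1 + m2) * tnorm beta L 1 x.
  move=> sm; rewrite gE.
  exact: (two_grid_small d0 uH hx0 hr Cdag hc1 hc2 b0 L_lin Lsym Lb m1 m2 x sm).
have large_tg k m1 m2 (x : fespace2 F k.+1) : 1 <= Num.sqrt beta * hmesh F k.+1 ^- 2 ->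
    tnorm beta L 1 (two_grid beta L Cdag m1 m2 x) <=
    7 * c2 * a * (Num.sqrt (maxn 1 m1 * maxn 1 m2)%:R)^-1 * tnorm beta L 1 x.
  move=> big; rewrite aE.
  exact: (two_grid_large d0 d3 uH qH nH hx0 hr hc1 hc2 b0 L_lin Lsym Lb CB m1 m2 x big).
have /andP[g0 g1] := g01.
have s0 : 0 < 7 * c2 / c1 by rewrite divr_gt0// mulr_gt0.
have f0 : 0 < 7 * c2 * a by rewrite !mulr_gt0.
split.
- move=> k x _ sm; apply: energy_norm_le; first exact: ltW.
  by rewrite gE; exact: (post_contraction d0 uH hx0 hr Cdag hc1 hc2 b0 L_lin Lsym Lb x sm).
- move=> k m1 m2 sm; apply: opnorm_le; last by move=> x; exact: small_tg.
  by rewrite mulr_ge0 ?exprn_ge0// ltW.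
- move=> k m1 m2 big; apply: opnorm_le; last by move=> x; exact: large_tg.
  by rewrite mulr_ge0 ?invr_ge0 ?sqrtr_ge0// ltW.
move=> kstar ks0 sks maxks.
move: s0 f0 small_tg large_tg; move: (7 * c2 / c1) (7 * c2 * a) => Cs Cf s0 f0 small_tg large_tg.
have [K KE] : exists K, K = 4 * (1 + c2 / c1) ^+ 2 by eexists.
have K0 : 0 < K.
  by rewrite KE mulr_gt0// exprn_gt0// ltr_pwDl// divr_ge0// ltW.
have [N hN] : exists N, forall n, (N <= n)%N -> 16 * K * (Cs * g ^+ n) <= 1.
  have e0 : 0 < (16 * K * Cs)^-1 by rewrite invr_gt0 !mulr_gt0.
  have : (fun n => g ^+ n) @ \oo --> (0 : R) by apply: cvg_expr; rewrite ger0_norm// ltW.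
  move=> /cvgrPdist_lt /(_ _ e0)[N _ h]; exists N => n Nn.
  have := h n Nn; rewrite sub0r normrN ger0_norm ?exprn_ge0 ?(ltW g0)// => hn.
  by rewrite mulrA -ler_pdivlMl ?mulr1 ?ltW// !mulr_gt0.
have K8 : 0 <= 8 * K * Cf by rewrite !mulr_ge0// ltW.
exists (maxn 1 (maxn N (Num.bound (8 * K * Cf)))) => [|m]; first by rewrite leq_max.
rewrite !geq_max => /andP[m1 /andP[mN mB]].
have m0 : 0 < m%:R :> R by rewrite ltr0n.
pose bm := Cs * g ^+ (2 * m); pose am := Cf * m%:R^-1.
have hb : 16 * K * bm <= 1 by apply: hN; rewrite (leq_trans mN)// leq_pmull.
have ha : 8 * K * am <= 1.
  rewrite mulrA ler_pdivrMr// mul1r (le_trans (ltW (archi_boundP K8)))// ler_nat.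
  exact: mB.
have bm0 : 0 <= bm by rewrite mulr_ge0 ?exprn_ge0// ltW.
have am0 : 0 <= am by rewrite mulr_ge0 ?invr_ge0// ltW.
pose t k := if (k <= kstar)%N then 2 * bm else 2 * am + 4 ^ (1 - (2 ^ (k - kstar))%N%:Z) * (2 * bm).
have t0 k : 0 <= t k.
  rewrite /t; case: ifP => _; first exact: mulr_ge0.
  by apply: addr_ge0; [exact: mulr_ge0|apply: mulr_ge0; [exact: exprz_ge0|exact: mulr_ge0]].
have hrec := @wcycle_recursion R K am bm kstar t (ltW K0) am0 bm0 ha hb erefl.
pose T k := if (k <= kstar)%N then bm else am.
have hT k (x : fespace2 F k.+1) :
    tnorm beta L 1 (two_grid beta L Cdag m m x) <= T k.+1 * tnorm beta L 1 x.
  rewrite /T; have [hk|hk] := leqP k.+1 kstar.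
    have -> : bm = Cs * g ^+ (m + m) by rewrite /bm addnn -mul2n.
    apply: small_tg; apply: le_lt_trans sks.
    exact: (ratio_incr d0 hx0 F b0).
  have big : 1 <= Num.sqrt beta * hmesh F k.+1 ^- 2.
    rewrite leNgt; apply/negP => /(maxks k.+1 isT); by rewrite leqNgt hk.
  have := large_tg k m m x big; rewrite (maxn_idPr m1) natrM -expr2 sqrtr_sqr ger0_norm ?ler0n//.
have hR k (x : fespace2 F k.+1) : ip2 (BCB beta L (Rop beta L Cdag x)) (Rop beta L Cdag x)
    <= ip2 (BCB beta L x) x.
  exact: (post_nonexpansive d0 uH hx0 hr hc1 hc2 b0 L_lin Lsym Lb CB x).
have EI k (x : fespace2 F k) : energy beta x = energy beta (coarse_to_fine x) by [].
have rec k : T k.+1 + 4 * (1 + c2 / c1) ^+ 2 * t k ^+ 2 <= t k.+1 by rewrite -KE; exact: hrec.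
have err := wcycle_error_bound lv EI t0 hT hR rec.
have El k := wcycle_error_lin Cdag lv m (k := k).
have Ep k := wcycle_error_propagation Cdag lv m (k := k).
pose E k : {linear fespace2 F k -> fespace2 F k} :=
  HB.pack (@wcycle_error _ _ _ _ _ F beta Cdag L m k)
    (GRing.isLinear.Build R (fespace2 F k) (fespace2 F k) *:%R _ (El k)).
have EE k : (opn k (E k) <= (t k)%:E)%E by apply: opnorm_le => // x; exact: err.
exists E; split.
- by move=> k; exact: Ep.
- by move=> k /andP[_ kk]; have := EE k; rewrite /t kk /bm mulrA.
- move=> k kk; have := EE k; rewrite /t leqNgt -addn1 kk /= /bm /am !mulrA.
  by [].
Qed.
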